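(* Let $m\ge 1$. There exist constants $C>0$ and $\beta>1$ such that, with $U_f^*$ denoting the twisted non-tangential maximal function of aperture $\beta$, for all $f\in C_0^\infty(\mathbb{R}^{2m})$ and all $\lambda>0$, $$\left|\{\mathbf{x}\in\mathbb{R}^{2m}: S_{twist}(f)(\mathbf{x})>\lambda\}\right|\le C\left|\{\mathbf{x}\in\mathbb{R}^{2m}: U_f^*(\mathbf{x})>\lambda\}\right|+\frac{C}{\lambda^2}\int_{\{\mathbf{x}\in\mathbb{R}^{2m}:\,U_f^*(\mathbf{x})\le\lambda\}}U_f^*(\mathbf{x})^2\,d\mathbf{x}.$$
   Context: Write $\mathbf{x}=(x_1,x_2)\in\mathbb{R}^m\times\mathbb{R}^m=\mathbb{R}^{2m}$ and $\mathbf{r}=(r_1,r_2,r_3)\in\mathbb{R}^3_+=(0,\infty)^3$; $|E|$ is Lebesgue measure. $C_0^\infty$ denotes smooth compactly supported functions. Tubes. Let $T(\mathbf{0},\mathbf{r})$ be: $\{|x_1|<r_1,\ |x_2|<r_2\}$ if $r_1,r_2\ge r_3$; $\{|x_1-x_2|<r_1,\ |x_2|<r_3\}$ if $r_1,r_3\ge r_2$; $\{|x_2-x_1|<r_2,\ |x_1|<r_3\}$ if $r_2,r_3\ge r_1$ (in case of ties use the first applicable case). Put $T(\mathbf{x},\mathbf{r})=\mathbf{x}+T(\mathbf{0},\mathbf{r})$, $V_{\mathbf{r}}=|T(\mathbf{x},\mathbf{r})|$. For $\beta>0$ the cone of aperture $\beta$ at $\mathbf{x}$ is $\Gamma^\beta(\mathbf{x})=\{(\mathbf{y},\mathbf{r})\in\mathbb{R}^{2m}\times\mathbb{R}^3_+:\mathbf{y}\in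 T(\mathbf{x},\beta\mathbf{r})\}$, and $\Gamma(\mathbf{x})=\Gamma^1(\mathbf{x})$. Twisted Poisson extension. Let $Poi_a(v)=a^{-m}Poi(v/a)$, $Poi(v)=c_m(1+|v|^2)^{-(m+1)/2}$, be the Poisson kernel on $\mathbb{R}^m$ ($\int Poi=1$), and $$(Poi_{twist})_{\mathbf{r}}(\mathbf{x})=\int_{\mathbb{R}^m}Poi_{r_1}(x_1-u)\,Poi_{r_2}(x_2-u)\,Poi_{r_3}(u)\,du,\qquad U_f(\mathbf{x},\mathbf{r})=(Poi_{twist})_{\mathbf{r}}*f(\mathbf{x}).$$ Maximal function (aperture $\beta$): $U_f^*(\mathbf{x})=\sup_{(\mathbf{y},\mathbf{r})\in\Gamma^\beta(\mathbf{x})}|U_f(\mathbf{y},\mathbf{r})|$. Area function: with $\nabla_j=(\nabla_{x_j},\partial_{r_j})$ for $j=1,2$ and $\nabla_3=(\nabla_{x_1}+\nabla_{x_2},\partial_{r_3})$, $$S_{twist}(f)(\mathbf{x})=\left(\iint_{\Gamma(\mathbf{x})}|r_1\nabla_1\,r_2\nabla_2\,r_3\nabla_3U_f(\mathbf{y},\mathbf{r})|^2\frac{d\mathbf{y}\,d\mathbf{r}}{r_1r_2r_3V_{\mathbf{r}}}\right)^{1/2},$$ where $d\mathbf{r}=dr_1dr_2dr_3$, spatial derivatives are taken in $\mathbf{y}$, and the integrand is $r_1^2r_2^2r_3^2|\nabla_1\nabla_2\nabla_3U_f|^2$, i.e. $r_1^2r_2^2r_3^2$ times the sum of squared moduli of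 all components of the $(m+1)^3$-component tensor $\nabla_1\nabla_2\nabla_3U_f$. *)

(* Defs.v *)
From HB Require Import structures.
From mathcomp Require Import all_boot all_order all_algebra.
From mathcomp Require Import all_classical all_reals all_analysis.
From mathcomp Require Import complex.

Set Implicit Arguments.
Unset Strict Implicit.
Unset Printing Implicit Defensive.

Import Order.TTheory GRing.Theory Num.Theory.
Import numFieldNormedType.Exports.

Local Open Scope classical_set_scope.
Local Open Scope ring_scope.

(* The library's sigma-finite instance on m1 \x m2 is shadowed by a later one for
   subprobabilities, hence this lemma and the explicit instances below. *)
Lemma sigma_finite_product_measure1 (d1 d2 : measure_display)
    (T1 : measurableType d1) (T2 : measurableType d2) (R : realType)
    (m1 : {measure set T1 -> \bar R}) (m2 : {sigma_finite_measure set T2 -> \bar R}) :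
  sigma_finite setT m1 -> sigma_finite setT (m1 \x m2)%E.
Proof.
move=> /sigma_finiteP[F [TF ndF Foo]].
have /sigma_finiteP[G [TG ndG Goo]] := sigma_finiteT m2.
exists (fun n => F n `*` G n).
  rewrite -setXTT TF TG predeqE => -[x y]; split.
    move=> [/= [n _ Fnx] [k _ Gky]]; exists (maxn n k) => //; split.
    - by move: x Fnx; exact/subsetPset/ndF/leq_maxl.
    - by move: y Gky; exact/subsetPset/ndG/leq_maxr.
  by move=> [n _ []/= ? ?]; split; exists n.
move=> k; have [? ?] := Foo k; have [? ?] := Goo k.
split; first exact: measurableX.
by rewrite product_measure1E// lte_mul_pinfty// ge0_fin_numE.
Qed.

(* R^m is 'rV[R]_m.  The library gives this type its topology, but neither a
   sigma-algebra nor Lebesgue measure; both are built here, by the same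
   construction as the library's product sigma-algebra on n.-tuple T. *)

Definition measure_rV_display : measure_display.
Proof. exact: default_measure_display. Qed.

Section measurable_rV.
Context {R : realType} {m : nat}.

Definition coord_rV (i : 'I_m) (v : 'rV[R]_m) : R := v ord0 i.

Let rV_set0 : g_sigma_preimage coord_rV set0.
Proof. exact: sigma_algebra0. Qed.

Let rV_setC A : g_sigma_preimage coord_rV A -> g_sigma_preimage coord_rV (~` A).
Proof. exact: sigma_algebraC. Qed.

Let rV_bigcup (F : _^nat) : (forall i, g_sigma_preimage coord_rV (F i)) ->
  g_sigma_preimage coord_rV (\bigcup_i (F i)).
Proof. exact: sigma_algebra_bigcup. Qed.

HB.instance Definition _ := @isMeasurable.Build measure_rV_display
  'rV[R]_m (g_sigma_preimage coord_rV) rV_set0 rV_setC rV_bigcup.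

Lemma measurable_coord_rV (i : 'I_m) : measurable_fun [set: 'rV[R]_m] (coord_rV i).
Proof.
move=> _ Y mY; rewrite setTI; apply: sub_sigma_algebra => /=.
rewrite -bigcup_seq/=; exists i => /=; first by rewrite mem_index_enum.
by exists Y => //; rewrite setTI.
Qed.

Lemma measurable_fun_rV d (T : measurableType d) (f : T -> 'rV[R]_m) :
  (forall i, measurable_fun [set: T] (coord_rV i \o f)) ->
  measurable_fun [set: T] f.
Proof.
move=> mf _ A mA.
have : g_sigma_preimage (fun i => coord_rV i \o f) `<=` measurable.
  apply: smallest_sub; first exact: sigma_algebra_measurable.
  rewrite -bigcup_seq => B [i _ [C mC <-]].
  exact: mf.
by apply; rewrite g_sigma_preimage_comp; exists A.
Qed.

End measurable_rV.

Section cons_rV.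
Context {R : realType} {m : nat}.

Definition cons_rV (p : measurableTypeR R * 'rV[R]_m) : 'rV[R]_m.+1 :=
  \row_i oapp (p.2 ord0) p.1 (unlift ord0 i).

Definition uncons_rV (v : 'rV[R]_m.+1) : measurableTypeR R * 'rV[R]_m :=
  (v ord0 ord0, \row_i v ord0 (lift ord0 i)).

Lemma uncons_rVK : cancel uncons_rV cons_rV.
Proof.
move=> v; apply/rowP => i; rewrite mxE /=.
by case: unliftP => [j ->|->] //=; rewrite mxE.
Qed.

Lemma cons_rVK : cancel cons_rV uncons_rV.
Proof.
move=> [a v]; rewrite /uncons_rV mxE unlift_none /=; congr pair.
by apply/rowP => i; rewrite !mxE liftK.
Qed.

Lemma measurable_cons_rV : measurable_fun [set: measurableTypeR R * 'rV[R]_m] cons_rV.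
Proof.
apply: measurable_fun_rV => i.
case: (unliftP ord0 i) => [j ->|->].
- rewrite (_ : _ \o _ = coord_rV j \o snd).
    by apply: measurableT_comp => //; exact: measurable_coord_rV.
  by apply/funext => p; rewrite /coord_rV /= mxE liftK.
- rewrite (_ : _ \o _ = fst) //.
  by apply/funext => p; rewrite /coord_rV /= mxE unlift_none.
Qed.

Lemma measurable_uncons_rV : measurable_fun [set: 'rV[R]_m.+1] uncons_rV.
Proof.
apply/measurable_fun_pair => /=.
- exact: measurable_coord_rV.
- apply: measurable_fun_rV => i.
  rewrite (_ : _ \o _ = coord_rV (lift ord0 i)); first exact: measurable_coord_rV.
  by apply/funext => v; rewrite /coord_rV /= mxE.
Qed.

Variable mu : {sigma_finite_measure set 'rV[R]_m -> \bar R}.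

Definition cons_measure : set 'rV[R]_m.+1 -> \bar R :=
  pushforward (lebesgue_measure \x mu)%E cons_rV.

Let cons_measure0 : cons_measure set0 = 0%E.
Proof. by rewrite /cons_measure /pushforward preimage_set0 measure0. Qed.

Let cons_measure_ge0 A : (0 <= cons_measure A)%E.
Proof. by rewrite /cons_measure /pushforward measure_ge0. Qed.

Let cons_measure_sigma_additive : semi_sigma_additive cons_measure.
Proof.
move=> F mF tF mUF; rewrite /cons_measure /pushforward preimage_bigcup.
apply: measure_semi_sigma_additive.
- by move=> n; rewrite -[X in measurable X]setTI; exact: measurable_cons_rV.
- apply/trivIsetP => /= i j _ _ ij; rewrite -preimage_setI.
  by move/trivIsetP : tF => /(_ _ _ _ _ ij) ->//; rewrite preimage_set0.
- rewrite -preimage_bigcup -[X in measurable X]setTI.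
  exact: measurable_cons_rV.
Qed.

HB.instance Definition _ := isMeasure.Build _ _ _ cons_measure
  cons_measure0 cons_measure_ge0 cons_measure_sigma_additive.

Let cons_measure_sigma_finite : sigma_finite setT cons_measure.
Proof.
have [F FT Ffin] : sigma_finite setT (lebesgue_measure \x mu)%E.
  by apply: sigma_finite_product_measure1; exact: sigma_finiteT.
exists (fun n => uncons_rV @^-1` F n).
  by rewrite -preimage_bigcup -FT preimage_setT.
move=> n; have [mF Foo] := Ffin n; split.
  by rewrite -[X in measurable X]setTI; exact: measurable_uncons_rV.
rewrite /cons_measure /pushforward -comp_preimage.
by rewrite (_ : uncons_rV \o cons_rV = id) //; apply/funext => p /=; rewrite cons_rVK.
Qed.

HB.instance Definition _ := Measure_isSigmaFinite.Build _ _ _ cons_measure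
  cons_measure_sigma_finite.

End cons_rV.

Fixpoint lebesgue_rV {R : realType} (m : nat) :
    {sigma_finite_measure set 'rV[R]_m -> \bar R} :=
  match m with
  | 0 => dirac (0 : 'rV[R]_0)
  | n.+1 => cons_measure (lebesgue_rV n)
  end.

Lemma lebesgue_rV_box (R : realType) (m : nat) (A : 'I_m -> set R) :
  (forall i, measurable (A i)) ->
  lebesgue_rV m [set v : 'rV[R]_m | forall i, A i (v ord0 i)] =
  (\prod_(i < m) @lebesgue_measure R (A i))%E.
Proof.
elim: m A => [|m IHm] A mA /=.
  by rewrite big_ord0 diracE mem_set // => -[].
rewrite /cons_measure /pushforward.
pose B := [set v : 'rV[R]_m | forall i, A (lift ord0 i) (v ord0 i)].
rewrite (_ : _ @^-1` _ = A ord0 `*` B); last first.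
  apply/seteqP; split => -[a v] /=.
  - move=> Av; split => [|i] /=.
    + by have := Av ord0; rewrite mxE unlift_none.
    + by have := Av (lift ord0 i); rewrite mxE liftK.
  - move=> [Aa Bv] i; rewrite mxE /=.
    by case: unliftP => [j ->|->] //=; exact: Bv.
have mB : measurable B.
  rewrite (_ : B = \bigcap_(i in [set: 'I_m]) (coord_rV i @^-1` A (lift ord0 i))).
    apply: fin_bigcap_measurable => // i _.
    by rewrite -[X in measurable X]setTI; exact: measurable_coord_rV.
  by apply/seteqP; split => v /= Bv i; [move=> _|]; exact: Bv.
rewrite product_measure1E; [|exact: mA|exact: mB].
rewrite big_ord_recl; congr (_ * _)%E.
by apply: IHm => i; exact: mA.
Qed.

Section lebesgue_products.
Context {R : realType} {m : nat}.

Definition lebesgue_R2m : set ('rV[R]_m * 'rV[R]_m) -> \bar R :=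
  (lebesgue_rV m \x lebesgue_rV m)%E.

HB.instance Definition _ := Measure.on lebesgue_R2m.

Let lebesgue_R2m_sigma_finite : sigma_finite setT lebesgue_R2m.
Proof. by apply: sigma_finite_product_measure1; exact: sigma_finiteT. Qed.

HB.instance Definition _ := Measure_isSigmaFinite.Build _ _ _ lebesgue_R2m
  lebesgue_R2m_sigma_finite.

Definition lebesgue_R3 :
    set (measurableTypeR R * measurableTypeR R * measurableTypeR R) -> \bar R :=
  (lebesgue_measure \x lebesgue_measure \x lebesgue_measure)%E.

HB.instance Definition _ := Measure.on lebesgue_R3.

Let lebesgue_R3_sigma_finite : sigma_finite setT lebesgue_R3.
Proof.
apply: sigma_finite_product_measure1; apply: sigma_finite_product_measure1.
exact: sigma_finiteT.
Qed.

HB.instance Definition _ := Measure_isSigmaFinite.Build _ _ _ lebesgue_R3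
  lebesgue_R3_sigma_finite.

Definition lebesgue_R2m3 : 
    set (('rV[R]_m * 'rV[R]_m) *
         (measurableTypeR R * measurableTypeR R * measurableTypeR R)) -> \bar R :=
  (lebesgue_R2m \x lebesgue_R3)%E.

HB.instance Definition _ := Measure.on lebesgue_R2m3.

Let lebesgue_R2m3_sigma_finite : sigma_finite setT lebesgue_R2m3.
Proof. by apply: sigma_finite_product_measure1; exact: sigma_finiteT. Qed.

HB.instance Definition _ := Measure_isSigmaFinite.Build _ _ _ lebesgue_R2m3
  lebesgue_R2m3_sigma_finite.

End lebesgue_products.

Section smooth.
Context {R : realType} {V : normedModType R}.

Fixpoint Ck (k : nat) (g : V -> R) : Prop :=
  match k with
  | 0 => continuous g
  | j.+1 => continuous g /\
      forall v : V, (forall x, derivable g x v) /\ Ck j (fun x => 'D_v g x)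
  end.

Definition smooth (g : V -> R) : Prop := forall k, Ck k g.

(* Complex-valued functions are treated through their real and imaginary
   parts: the library's derivatives along vectors of a real normed space and its
   integrals are not available with values in R[i]. *)
Definition smooth_compact_support (f : V -> R[i]) : Prop :=
  [/\ smooth (fun x => complex.Re (f x)), smooth (fun x => complex.Im (f x)) &
      compact (closure [set x | f x != 0])].

Definition cderive (v : V) (F : V -> R[i]) : V -> R[i] := fun p =>
  Complex ('D_v (fun q => complex.Re (F q)) p) ('D_v (fun q => complex.Im (F q)) p).

End smooth.

Definition cintegral (d : measure_display) (T : measurableType d) (R : realType)
    (mu : {measure set T -> \bar R}) (D : set T) (F : T -> R[i]) : R[i] :=
  Complex (\int[mu]_(z in D) complex.Re (F z)) (\int[mu]_(z in D) complex.Im (F z)).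

Section twisted.
Context {R : realType} {m : nat}.

Local Notation Rm := 'rV[R]_m.
Local Notation R2m := ('rV[R]_m * 'rV[R]_m)%type.
Local Notation R3 := (R * R * R)%type.

(* The norm `|v| of 'rV[R]_m in the library is the maximum norm. *)
Definition enorm (v : Rm) : R := Num.sqrt (\sum_i v ord0 i ^+ 2).

Definition positive3 (r : R3) : Prop := let: (r1, r2, r3) := r in
  [/\ 0 < r1, 0 < r2 & 0 < r3].

Definition scale3 (b : R) (r : R3) : R3 := let: (r1, r2, r3) := r in
  (b * r1, b * r2, b * r3).

(* The last branch is the case r2, r3 >= r1. *)
Definition tube0 (r : R3) : set R2m := let: (r1, r2, r3) := r in
  if (r3 <= r1) && (r3 <= r2) then
    [set x | enorm x.1 < r1 /\ enorm x.2 < r2]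
  else if (r2 <= r1) && (r2 <= r3) then
    [set x | enorm (x.1 - x.2) < r1 /\ enorm x.2 < r3]
  else
    [set x | enorm (x.2 - x.1) < r2 /\ enorm x.1 < r3].

Definition tube (x : R2m) (r : R3) : set R2m := [set x + z | z in tube0 r].

Definition tube_volume (r : R3) : R := fine (lebesgue_R2m (tube0 r)).

Definition cone (beta : R) (x : R2m) : set (R2m * R3) :=
  [set p | positive3 p.2 /\ tube x (scale3 beta p.2) p.1].

Definition poisson_profile (v : Rm) : R :=
  (1 + enorm v ^+ 2) `^ (- (m.+1%:R / 2)).

Definition poisson_const : R := (\int[lebesgue_rV m]_v poisson_profile v)^-1.

Definition poisson (a : R) (v : Rm) : R :=
  a ^- m * (poisson_const * poisson_profile (a^-1 *: v)).

Definition poisson_twist (r : R3) (x : R2m) : R := let: (r1, r2, r3) := r in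
  \int[lebesgue_rV m]_u
    (poisson r1 (x.1 - u) * poisson r2 (x.2 - u) * poisson r3 u).

Definition twisted_extension (f : R2m -> R[i]) (p : R2m * R3) : R[i] :=
  cintegral lebesgue_R2m setT (fun z => (poisson_twist p.2 (p.1 - z))%:C%C * f z).

Definition twisted_maximal (beta : R) (f : R2m -> R[i]) (x : R2m) : \bar R :=
  ereal_sup [set (Normc.normc (twisted_extension f p))%:E | p in cone beta x].

(* Components of nabla_1, nabla_2, nabla_3: Some i is the i-th spatial one, None is
   the derivative in the radius. *)
Definition dir1 (a : option 'I_m) : R2m * R3 :=
  if a is Some i then (delta_mx ord0 i, 0, (0, 0, 0)) else (0, 0, (1, 0, 0)).

Definition dir2 (a : option 'I_m) : R2m * R3 :=
  if a is Some i then (0, delta_mx ord0 i, (0, 0, 0)) else (0, 0, (0, 1, 0)).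

Definition dir_r3 : R2m * R3 := (0, 0, (0, 0, 1)).

Definition nabla1 (a : option 'I_m) (F : R2m * R3 -> R[i]) : R2m * R3 -> R[i] :=
  cderive (dir1 a) F.

Definition nabla2 (a : option 'I_m) (F : R2m * R3 -> R[i]) : R2m * R3 -> R[i] :=
  cderive (dir2 a) F.

Definition nabla3 (a : option 'I_m) (F : R2m * R3 -> R[i]) : R2m * R3 -> R[i] :=
  if a is Some i then fun p => nabla1 (Some i) F p + nabla2 (Some i) F p
  else cderive dir_r3 F.

Definition nabla123_sqnorm (F : R2m * R3 -> R[i]) (p : R2m * R3) : R :=
  \sum_(a : option 'I_m) \sum_(b : option 'I_m) \sum_(c : option 'I_m)
    Normc.normc (nabla1 a (nabla2 b (nabla3 c F)) p) ^+ 2.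

Definition area_integrand (f : R2m -> R[i]) (p : R2m * R3) : R :=
  let: (r1, r2, r3) := p.2 in
  r1 ^+ 2 * r2 ^+ 2 * r3 ^+ 2 * nabla123_sqnorm (twisted_extension f) p /
  (r1 * r2 * r3 * tube_volume p.2).

Definition twisted_area (f : R2m -> R[i]) (x : R2m) : \bar R :=
  poweR (\int[lebesgue_R2m3]_(p in cone 1 x) (area_integrand f p)%:E)%E 2^-1.

End twisted.

(* Main.v *)
(* The twisted Poisson kernel is the push-forward, under (w1, w2, w3) |-> (w1 - w3, w2 - w3),
   of a tensor product of three Poisson kernels.  Hence U_f(y, r) is harmonic in the
   variables attached to each radius r_j separately, nabla_3 being the gradient along the
   diagonal, and one can argue as for a product of three half-spaces, in the style of
   Merryfield.

   Let M be the maximal function of U_f and A = {M > lambda}, let v be the extension of the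
   indicator function of A, again harmonic in each group of variables, and let
   p = max(0, 1/2 - v).  Where v < 1/2, the point lies in a cone of aperture beta with
   vertex outside A, so |U_f| <= lambda there.  If X is harmonic for the j-th group and w is
   a weight with |nabla_j w|^2 <= c w W and Delta_j w >= - c W, expanding Delta_j (X^2 w)
   and integrating it against (t - a) (b - t) / (b - a) in t = r_j on [a, b] bounds the
   energy of |nabla_j X|^2 w by boundary terms and the energy of X^2 W.  Such pairs (w, W)
   are stable under sums and products and contain (h^2, |nabla_j h|^2), h harmonic for the
   j-th group, and (p^n, p^(n-2) |nabla_j v|^2), n >= 3.
   Three steps, one per radius, starting from powers of v and from U_f^2 p, bound
   the integral of r_1 r_2 r_3 |nabla_1 nabla_2 nabla_3 U_f|^2 p^7 by
   lambda^2 |A| plus the integral of M^2 off A.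

   Finally v <= 1/4 on all the cones with vertex outside a set A' with |A'| <= C |A|, given
   by the maximal functions in 3 m directions; there p >= 1/4, and Chebyshev's inequality
   concludes. *)

From HB Require Import structures.
Require Import Defs.
From mathcomp Require Import all_boot all_order all_algebra.
From mathcomp Require Import all_classical all_reals all_analysis.
From mathcomp Require Import complex.
From mathcomp Require Import measurable_realfun ring lra.

Set Implicit Arguments.
Unset Strict Implicit.
Unset Printing Implicit Defensive.

Import Order.TTheory GRing.Theory Num.Theory.
Import numFieldNormedType.Exports.

Local Open Scope classical_set_scope.
Local Open Scope ring_scope.

(** * Lebesgue measure on R^m, R^2m and R^3m *)

(** The cut-off is a power of a truncated harmonic function rather than an indicator function: the
    errors that it causes are then energies of v, which the same Green argument, run with v in place
    of U_f and using v <= 1, bounds by multiples of |A|. Each use of the pair (p^n, p^(n-2) |nabla_j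
    v|^2) costs two powers of p. Three steps can thus lead from p^n to p^(n-6), and one power of p
    must survive, because |U_f| <= lambda is known only where p > 0: hence the exponent 7. The
    parabola (t - a) (b - t) / (b - a) vanishes at both ends, so that the boundary terms involve
    values and no radial derivatives, and no decay at 0 or at infinity enters. The price is that
    these terms freeze r_j at a or b. The errors of one step are themselves weighted energies, with
    products of gradients of v as weights; they are treated by further steps in the remaining radii
    until U_f carries no derivative and can be replaced by lambda. *)

Section affine_invariance.
Context {R : realType}.
Local Open Scope ereal_scope.

Lemma measurable_affine (a b : R) :
  measurable_fun [set: measurableTypeR R]
    ((fun x : R => a * x + b)%R : measurableTypeR R -> measurableTypeR R).
Proof. by apply: measurable_funD => //; apply: measurable_funM. Qed.

(** The image of [a] times Lebesgue measure under x |-> a x + b gives half-open intervals their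
    length, so it is Lebesgue measure. *)
Lemma lebesgue_measure_affine (a b : R) (A : set R) : (0 < a)%R -> measurable A ->
  lebesgue_measure ((fun x : R => a * x + b)%R @^-1` A) =
  (a^-1)%:E * (lebesgue_measure A : \bar R).
Proof.
move=> a0 mA; have a0' : (0 <= a)%R by apply: ltW.
pose g : measurableTypeR R -> measurableTypeR R := (fun x : R => a * x + b)%R.
suff -> : (lebesgue_measure A : \bar R) =
    pushforward (mscale (NngNum a0') (@lebesgue_measure R)) g A.
  by rewrite /pushforward /mscale /= muleA -EFinM mulVf ?gt_eqF// mul1e.
have mg : measurable_fun setT g by exact: measurable_affine.
apply: lebesgue_measure_unique => //.
move=> /= _ [[x y]] _ <-.
rewrite /mscale /= /pushforward /=.
rewrite (_ : _ @^-1` _ = `]((x - b) / a)%R, ((y - b) / a)%R]%classic); last first.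
  apply/seteqP; split=> t /=; rewrite /g !in_itv /= => /andP[] u v;
    apply/andP; split.
  - by rewrite ltr_pdivrMr// mulrC ltrBlDr.
  - by rewrite ler_pdivlMr// mulrC lerBrDr.
  - by rewrite -ltrBlDr mulrC -ltr_pdivrMr.
  - by rewrite -lerBrDr mulrC -ler_pdivlMr.
rewrite !lebesgue_measure_itv /= !lte_fin ltr_pM2r ?invr_gt0// ltrBDr subrK.
case: ifPn => _; rewrite ?mule0// -!EFinB -EFinM; congr EFin; field.
by rewrite gt_eqF.
Qed.

Lemma ge0_integral_lebesgue_affine (a b : R) (f : R -> \bar R) : (0 < a)%R ->
  measurable_fun setT f -> (forall x, 0 <= f x) ->
  \int[lebesgue_measure]_x f (a * x + b)%R =
  (a^-1)%:E * \int[lebesgue_measure]_x f x.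
Proof.
move=> a0 mf f0; have a0' : (0 <= a^-1)%R by rewrite invr_ge0 ltW.
pose g : measurableTypeR R -> measurableTypeR R := (fun x : R => a * x + b)%R.
have mg : measurable_fun setT g by exact: measurable_affine.
transitivity (\int[pushforward lebesgue_measure g]_x f x).
  by rewrite ge0_integral_pushforward.
rewrite (eq_measure_integral (mscale (NngNum a0') (@lebesgue_measure R))).
  by rewrite ge0_integral_mscale.
by move=> A mA _; exact: lebesgue_measure_affine.
Qed.
End affine_invariance.

Section rV_affine_invariance.
Context {R : realType}.

Lemma measurable_fun_coord_rV d (T : measurableType d) m (f : T -> 'rV[R]_m) i :
  measurable_fun setT f -> measurable_fun setT (fun x => f x ord0 i).
Proof.
by move=> mf; apply: (measurableT_comp (measurable_coord_rV i)).
Qed.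

Lemma measurable_funD_rV d (T : measurableType d) m (f g : T -> 'rV[R]_m) :
  measurable_fun setT f -> measurable_fun setT g ->
  measurable_fun setT (fun x => f x + g x).
Proof.
move=> mf mg; apply: measurable_fun_rV => i.
rewrite (_ : _ \o _ = fun x => f x ord0 i + g x ord0 i).
  by apply: measurable_funD; exact: measurable_fun_coord_rV.
by apply/funext => x; rewrite /coord_rV /= mxE.
Qed.

Lemma measurable_funZ_rV d (T : measurableType d) m (k : T -> R) (f : T -> 'rV[R]_m) :
  measurable_fun setT k -> measurable_fun setT f ->
  measurable_fun setT (fun x => k x *: f x).
Proof.
move=> mk mf; apply: measurable_fun_rV => i.
rewrite (_ : _ \o _ = fun x => k x * f x ord0 i).
  by apply: measurable_funM => //; exact: measurable_fun_coord_rV.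
by apply/funext => x; rewrite /coord_rV /= mxE.
Qed.

Lemma measurable_funN_rV d (T : measurableType d) m (f : T -> 'rV[R]_m) :
  measurable_fun setT f -> measurable_fun setT (fun x => - f x).
Proof.
move=> mf; under eq_fun do rewrite -scaleN1r.
exact: measurable_funZ_rV.
Qed.

Lemma measurable_funB_rV d (T : measurableType d) m (f g : T -> 'rV[R]_m) :
  measurable_fun setT f -> measurable_fun setT g ->
  measurable_fun setT (fun x => f x - g x).
Proof. by move=> mf mg; apply: measurable_funD_rV => //; exact: measurable_funN_rV. Qed.

Local Open Scope ereal_scope.

Lemma ge0_integral_rVS m (f : 'rV[R]_m.+1 -> \bar R) :
  measurable_fun setT f -> (forall v, 0 <= f v) ->
  \int[lebesgue_rV m.+1]_v f v =
  \int[lebesgue_measure]_s \int[lebesgue_rV m]_v f (cons_rV (s, v)).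
Proof.
move=> mf f0 /=.
have mc : measurable_fun setT (@cons_rV R m) by exact: measurable_cons_rV.
transitivity (\int[pushforward (lebesgue_measure \x lebesgue_rV m) (@cons_rV R m)]_v f v).
  exact: eq_measure_integral.
rewrite ge0_integral_pushforward// preimage_setT fubini_tonelli1//.
  exact: measurableT_comp.
by move=> x; exact: f0.
Qed.

(** Induction on the dimension: [cons_rV] splits off the first coordinate, and each coordinate
    contributes one factor 1/a. *)
Lemma ge0_integral_rV_affine m (a : R) (c : 'rV[R]_m) (f : 'rV[R]_m -> \bar R) :
  (0 < a)%R -> measurable_fun setT f -> (forall v, 0 <= f v) ->
  \int[lebesgue_rV m]_v f (a *: v + c)%R =
  (a ^- m)%:E * \int[lebesgue_rV m]_v f v.
Proof.
move=> a0; elim: m => [|m IHm] in c f *; move=> mf f0.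
  rewrite expr0 invr1 mul1e; apply: eq_integral => v _; congr f.
  by apply/rowP => -[].
have mg : measurable_fun setT (fun v : 'rV[R]_m.+1 => f (a *: v + c)%R).
  apply: (measurableT_comp mf); apply: measurable_funD_rV => //.
  exact: measurable_funZ_rV.
rewrite !ge0_integral_rVS//.
pose c' : 'rV[R]_m := (\row_i c ord0 (lift ord0 i))%R.
pose F s := \int[lebesgue_rV m]_v f (cons_rV (s, v)).
have E s v : (a *: cons_rV (s, v) + c = cons_rV (a * s + c ord0 ord0, a *: v + c'))%R.
  apply/rowP => i; rewrite !mxE; case: unliftP => [j ->|->] /=.
    by rewrite !mxE.
  by [].
transitivity (\int[lebesgue_measure]_s ((a ^- m)%:E * F (a * s + c ord0 ord0)%R)).
  apply: eq_integral => s _; rewrite /F -(IHm c' (fun v => f (cons_rV ((a * s + c ord0 ord0)%R,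
    v)))).
  - by apply: eq_integral => v _; rewrite E.
  - apply: (measurableT_comp mf); apply: (measurableT_comp measurable_cons_rV).
    exact: pair1_measurable.
  - by [].
have mF : measurable_fun setT F.
  apply: (@measurable_fun_fubini_tonelli_F _ _ _ _ _ _ (fun p => f (cons_rV p))) => //.
  exact: (measurableT_comp mf measurable_cons_rV).
have F0 s : 0 <= F s by apply: integral_ge0.
have am : (0 <= a ^- m)%R by rewrite invr_ge0 exprn_ge0// ltW.
have mFa : measurable_fun setT (fun s => F (a * s + c ord0 ord0)%R).
  exact: (measurableT_comp mF (measurable_affine _ _)).
rewrite ge0_integralZl_EFin; [|exact: measurableT|by move=> *; exact: F0|exact: mFa|exact: am].
by rewrite (ge0_integral_lebesgue_affine _ a0)// muleA -EFinM -invfM exprSr mulrC.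
Qed.

End rV_affine_invariance.

Section lebesgue_R3m.
Context {R : realType} {m : nat}.

Definition lebesgue_R3m : set ('rV[R]_m * 'rV[R]_m * 'rV[R]_m) -> \bar R :=
  (lebesgue_R2m \x lebesgue_rV m)%E.

HB.instance Definition _ := Measure.on lebesgue_R3m.

Let lebesgue_R3m_sigma_finite : sigma_finite setT lebesgue_R3m.
Proof. by apply: sigma_finite_product_measure1; exact: sigma_finiteT. Qed.

HB.instance Definition _ := Measure_isSigmaFinite.Build _ _ _ lebesgue_R3m
  lebesgue_R3m_sigma_finite.

End lebesgue_R3m.

Section translation_invariance.
Context {R : realType} {m : nat}.
Local Notation Rm := 'rV[R]_m.
Local Open Scope ereal_scope.

Lemma measurable_funD_pair d (T : measurableType d) (f g : T -> Rm * Rm) :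
  measurable_fun setT f -> measurable_fun setT g ->
  measurable_fun setT (fun x => (f x + g x)%R).
Proof.
move=> mf mg; apply: measurable_fun_pair => /=; apply: measurable_funD_rV;
  (exact: (measurableT_comp measurable_fst) || exact: (measurableT_comp measurable_snd)).
Qed.

Lemma measurable_funN_pair d (T : measurableType d) (f : T -> Rm * Rm) :
  measurable_fun setT f -> measurable_fun setT (fun x => (- f x)%R).
Proof.
move=> mf; apply: measurable_fun_pair => /=; apply: measurable_funN_rV;
  (exact: (measurableT_comp measurable_fst) || exact: (measurableT_comp measurable_snd)).
Qed.

Lemma measurable_funB_pair d (T : measurableType d) (f g : T -> Rm * Rm) :
  measurable_fun setT f -> measurable_fun setT g ->
  measurable_fun setT (fun x => (f x - g x)%R).
Proof.
by move=> mf mg; apply: measurable_funD_pair => //; exact: measurable_funN_pair.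
Qed.

Lemma ge0_integral_rV_translation (c : Rm) (f : Rm -> \bar R) :
  measurable_fun setT f -> (forall v, 0 <= f v) ->
  \int[lebesgue_rV m]_v f (v + c)%R = \int[lebesgue_rV m]_v f v.
Proof.
move=> mf f0; rewrite -[RHS]mul1e -[1%:E]/(1%R)%:E -[X in X%:E](invr1) -(expr1n _ m).
rewrite -(ge0_integral_rV_affine c ltr01 mf f0).
by apply: eq_integral => v _; rewrite scale1r.
Qed.

Lemma ge0_integral_R2m_translation (c : Rm * Rm) (f : Rm * Rm -> \bar R) :
  measurable_fun setT f -> (forall v, 0 <= f v) ->
  \int[lebesgue_R2m]_x f (x + c)%R = \int[lebesgue_R2m]_x f x.
Proof.
move=> mf f0; have mg : measurable_fun setT (fun x : Rm * Rm => f (x + c)%R).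
  by apply: (measurableT_comp mf); apply: measurable_funD_pair.
have g0 x : 0 <= f (x + c)%R by exact: f0.
rewrite [LHS](fubini_tonelli1 _ mg g0) [RHS](fubini_tonelli1 _ mf f0).
transitivity (\int[lebesgue_rV m]_u \int[lebesgue_rV m]_v f ((u + c.1)%R, v)).
  apply: eq_integral => u _; rewrite /fubini_F.
  rewrite -(ge0_integral_rV_translation c.2 (f := fun v => f ((u + c.1)%R, v)))//.
  by apply: (measurableT_comp mf); exact: pair1_measurable.
rewrite (ge0_integral_rV_translation c.1
  (f := fun u => \int[lebesgue_rV m]_v f (u, v)))//.
  exact: measurable_fun_fubini_tonelli_F.
by move=> u; exact: integral_ge0.
Qed.

Lemma ge0_integral_R3m (f : Rm * Rm * Rm -> \bar R) :
  measurable_fun setT f -> (forall v, 0 <= f v) ->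
  \int[lebesgue_R3m]_w f w =
  \int[lebesgue_R2m]_u \int[lebesgue_rV m]_v f (u, v).
Proof. by move=> mf f0; exact: fubini_tonelli1. Qed.

Lemma ge0_integral_R3m_translation (c : Rm * Rm * Rm) (f : Rm * Rm * Rm -> \bar R) :
  measurable_fun setT f -> (forall v, 0 <= f v) ->
  \int[lebesgue_R3m]_x f (x + c)%R = \int[lebesgue_R3m]_x f x.
Proof.
move=> mf f0; have mg : measurable_fun setT (fun x : Rm * Rm * Rm => f (x + c)%R).
  apply: (measurableT_comp mf); apply: measurable_fun_pair => /=.
    by apply: measurable_funD_pair => //; exact: measurable_fst.
  by apply: measurable_funD_rV => //; exact: measurable_snd.
have g0 x : 0 <= f (x + c)%R by exact: f0.
rewrite [LHS](ge0_integral_R3m mg g0) [RHS](ge0_integral_R3m mf f0).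
transitivity (\int[lebesgue_R2m]_u \int[lebesgue_rV m]_v f ((u + c.1)%R, v)).
  apply: eq_integral => u _.
  rewrite -(ge0_integral_rV_translation c.2 (f := fun v => f ((u + c.1)%R, v)))//.
  by apply: (measurableT_comp mf); exact: pair1_measurable.
rewrite (ge0_integral_R2m_translation c.1
  (f := fun u => \int[lebesgue_rV m]_v f (u, v)))//.
  exact: measurable_fun_fubini_tonelli_F.
by move=> u; exact: integral_ge0.
Qed.

(** Both sides are differences of integrals of positive and negative parts, and these agree term by
    term; integrability never enters. *)
Lemma integral_invariant d (T : measurableType d) (mu : {measure set T -> \bar R})
    (phi : T -> T) (f : T -> \bar R) :
  (forall g : T -> \bar R, measurable_fun setT g -> (forall x, 0 <= g x) ->
    \int[mu]_x g (phi x) = \int[mu]_x g x) ->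
  measurable_fun setT f -> \int[mu]_x f (phi x) = \int[mu]_x f x.
Proof.
move=> inv mf; rewrite [LHS]integralE [RHS]integralE; congr (_ - _).
  rewrite -(inv _ (measurable_funepos mf) (funepos_ge0 f)).
  by apply: eq_integral => x _; rewrite !funeposE.
rewrite -(inv _ (measurable_funeneg mf) (funeneg_ge0 f)).
by apply: eq_integral => x _; rewrite !funenegE.
Qed.

Lemma integral_R3m_translation (c : Rm * Rm * Rm) (f : Rm * Rm * Rm -> \bar R) :
  measurable_fun setT f ->
  \int[lebesgue_R3m]_x f (x + c)%R = \int[lebesgue_R3m]_x f x.
Proof.
move=> mf; pose phi (x : Rm * Rm * Rm) := (x + c)%R.
apply: (integral_invariant (mu := lebesgue_R3m) (phi := phi)) mf => g.
exact: ge0_integral_R3m_translation.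
Qed.

Lemma integral_R2m_translation (c : Rm * Rm) (f : Rm * Rm -> \bar R) :
  measurable_fun setT f ->
  \int[lebesgue_R2m]_x f (x + c)%R = \int[lebesgue_R2m]_x f x.
Proof.
move=> mf; pose phi (x : Rm * Rm) := (x + c)%R.
apply: (integral_invariant (mu := lebesgue_R2m) (phi := phi)) mf => g.
exact: ge0_integral_R2m_translation.
Qed.

Lemma lebesgue_R2m_translation (c : Rm * Rm) (A : set (Rm * Rm)) : measurable A ->
  lebesgue_R2m [set x | A (x + c)%R] = lebesgue_R2m A.
Proof.
move=> mA.
have mB : measurable [set x | A (x + c)%R].
  have mT : measurable_fun setT (fun x : Rm * Rm => (x + c)%R).
    by apply: measurable_funD_pair.
  by rewrite -[X in measurable X]setTI; exact: (mT measurableT _ mA).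
rewrite -[in RHS](setIT A) -[in LHS](setIT [set x | A (x + c)%R]).
rewrite -!integral_indic//.
rewrite -(integral_R2m_translation c (f := fun x => (\1_A x)%:E)).
  by apply: eq_integral => x _; rewrite !indicE.
by apply/measurable_EFinP; exact: measurable_indic.
Qed.

End translation_invariance.

(** * The Poisson kernel *)

Section euclidean_norm.
Context {R : realType} {m : nat}.
Implicit Types v w : 'rV[R]_m.

Lemma enorm_sqE v : enorm v ^+ 2 = \sum_i v ord0 i ^+ 2.
Proof. by rewrite sqr_sqrtr// sumr_ge0// => i _; rewrite sqr_ge0. Qed.

Lemma enorm_ge0 v : 0 <= enorm v.
Proof. exact: sqrtr_ge0. Qed.

Lemma enormN v : enorm (- v) = enorm v.
Proof. by rewrite /enorm; under eq_bigr do rewrite mxE sqrrN. Qed.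

Lemma enormZ (a : R) v : enorm (a *: v) = `|a| * enorm v.
Proof.
rewrite /enorm; under eq_bigr do rewrite mxE exprMn.
by rewrite -mulr_sumr sqrtrM ?sqr_ge0// sqrtr_sqr.
Qed.

Lemma coord_le_enorm v i : `|v ord0 i| <= enorm v.
Proof.
rewrite -(ler_pXn2r (n:=2))// ?nnegrE ?enorm_ge0// enorm_sqE real_normK ?num_real//.
by rewrite (bigD1 i)//= lerDl sumr_ge0// => j _; rewrite sqr_ge0.
Qed.

Lemma measurable_enorm : measurable_fun [set: 'rV[R]_m] enorm.
Proof.
apply: (measurableT_comp (continuous_measurable_fun (@sqrt_continuous R))).
apply: measurable_sum => i; apply: measurable_funX; exact: measurable_coord_rV.
Qed.

Lemma enorm_sqD_le v w : enorm (v + w) ^+ 2 <= 2 * enorm v ^+ 2 + 2 * enorm w ^+ 2.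
Proof.
rewrite !enorm_sqE !mulr_sumr -big_split /=; apply: ler_sum => i _.
rewrite mxE; have := sqr_ge0 (v ord0 i - w ord0 i); nra.
Qed.

Definition cube (rho : R) : set 'rV[R]_m := [set v | forall i, `|v ord0 i| < rho].

Lemma measurable_cube rho : measurable (cube rho).
Proof.
rewrite (_ : cube rho = \bigcap_(i in [set: 'I_m]) (coord_rV i @^-1` [set x : R | `|x| < rho])).
  apply: fin_bigcap_measurable => // i _.
  rewrite -[X in measurable X]setTI; apply: measurable_coord_rV => //.
  rewrite (_ : [set _ | _] = ball (0:R) rho); first exact: measurable_ball.
  by apply/seteqP; split => x /=; rewrite /ball /= sub0r normrN.
by apply/seteqP; split => v /= cv i; [move=> _|]; exact: cv.
Qed.

Lemma lebesgue_cube rho : 0 <= rho ->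
  lebesgue_rV m (cube rho) = ((2 * rho) ^+ m)%:E.
Proof.
move=> r0; rewrite (_ : cube rho = [set v | forall i : 'I_m, ball (0:R) rho (v ord0 i)]).
  rewrite (lebesgue_rV_box (A := fun=> ball (0:R) rho)); last first.
    by move=> i; exact: measurable_ball.
  under eq_bigr do rewrite lebesgue_measure_ball//.
  by rewrite prodEFin prodr_const card_ord mulr_natl.
by apply/seteqP; split => v /= cv i; move: (cv i); rewrite /ball /= sub0r normrN.
Qed.

End euclidean_norm.

Lemma powR_sqr_half {R : realType} (x : R) n : 0 <= x ->
  (x ^+ 2) `^ (n%:R / 2) = x ^+ n.
Proof.
move=> x0; rewrite -powR_mulrn// -powRrM mulrCA divff ?mulr1 ?pnatr_eq0//.
by rewrite powR_mulrn.
Qed.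

Section poisson_profile.
Context {R : realType} {m : nat}.
Implicit Types v w : 'rV[R]_m.

Definition base v : R := 1 + enorm v ^+ 2.

Lemma base_ge1 v : 1 <= base v.
Proof. by rewrite lerDl sqr_ge0. Qed.

Lemma base_gt0 v : 0 < base v.
Proof. exact: lt_le_trans (base_ge1 v). Qed.

Lemma profileE v : poisson_profile v = (base v `^ (m.+1%:R / 2))^-1.
Proof. by rewrite /poisson_profile powRN. Qed.

Lemma profile_gt0 v : 0 < poisson_profile v.
Proof. by rewrite powR_gt0 ?base_gt0. Qed.

Lemma profile_le1 v : poisson_profile v <= 1.
Proof.
rewrite profileE invf_le1 ?powR_gt0 ?base_gt0// -[X in X <= _](powRr0 (base v)).
by rewrite ler_powR ?base_ge1// divr_ge0.
Qed.

(** The profile is a negative power of [base], so comparing two values of [base] is enough. Both the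
    domination under the integral sign and the shifts inside a cone rest on this. *)
Lemma le_profile (k : R) v w : 0 < k -> base w <= k * base v ->
  poisson_profile v <= k `^ (m.+1%:R / 2) * poisson_profile w.
Proof.
move=> k0 h; rewrite !profileE ler_pdivlMr ?powR_gt0 ?base_gt0//.
rewrite ler_pdivrMl ?powR_gt0 ?base_gt0// -powRM ?(ltW k0) ?(ltW (base_gt0 _))//.
rewrite ge0_ler_powR ?nnegrE ?mulr_ge0 ?(ltW k0) ?(ltW (base_gt0 _)) ?divr_ge0//.
by rewrite mulrC.
Qed.

Lemma measurable_base : measurable_fun [set: 'rV[R]_m] base.
Proof. by apply: measurable_funD => //; apply: measurable_funX; exact: measurable_enorm. Qed.

Lemma measurable_profile : measurable_fun [set: 'rV[R]_m] poisson_profile.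
Proof. exact: (measurableT_comp (measurable_powR _) measurable_base). Qed.

Definition dyad (k : nat) : R := 2 ^+ k.

(** The least dyadic cube containing v is used: v lies outside the cube of half that side, so |v| is
    at least half of [dyad k], which produces the factor 2^(m+1). For k = 0 the trivial bound by 1
    suffices. *)
Lemma profile_le_dyadic v : exists k,
  cube (dyad k) v /\ poisson_profile v <= 2 ^+ m.+1 / dyad k ^+ m.+1.
Proof.
have [k0 hk0] : exists k, cube (dyad k) v.
  exists (Num.truncn (enorm v)).+1 => i.
  apply: le_lt_trans (coord_le_enorm v i) _.
  have h := truncnS_gt (enorm v).
  apply: lt_le_trans h _.
  by rewrite /dyad -natrX ler_nat; exact/ltnW/ltn_expl.
have [k hk kmin] := ex_minnP (P := fun k => `[< cube (dyad k) v >]) (ex_intro _ k0 (asboolT hk0)).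
exists k; split; first exact/asboolP.
case: k => [|k] in hk kmin *.
  rewrite /dyad expr0 expr1n divr1 (le_trans (profile_le1 v))//.
  by rewrite exprn_ege1// ler1n.
have [i hi] : exists i, dyad k <= `|v ord0 i|.
  apply: contrapT => /forallNP h.
  have : (k.+1 <= k)%N by apply: kmin; apply/asboolP => i; rewrite ltNge; apply/negP/h.
  by rewrite ltnn.
have d0 j : 0 <= dyad j by rewrite exprn_ge0.
have h2 : dyad k <= enorm v by apply: le_trans hi (coord_le_enorm v i).
have -> : 2 ^+ m.+1 / dyad k.+1 ^+ m.+1 = (dyad k ^+ m.+1)^-1.
  rewrite /dyad [2 ^+ k.+1]exprS exprMn invfM mulrA divff ?mul1r//.
rewrite profileE.
rewrite lef_pV2 ?posrE ?powR_gt0 ?base_gt0 ?exprn_gt0//.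
rewrite -(powR_sqr_half m.+1 (d0 k)) ge0_ler_powR ?nnegrE ?sqr_ge0 ?(ltW (base_gt0 _)) ?divr_ge0//.
apply: (@le_trans _ _ (enorm v ^+ 2)); last by rewrite lerDr.
by rewrite ler_pXn2r ?nnegrE ?enorm_ge0.
Qed.

Local Open Scope ereal_scope.

(** Pointwise, [q] is at most one term of the series of the functions [c k] times the indicator of
    [B k]. Since all terms are nonnegative, the sets may overlap. *)
Lemma ge0_integral_dominated_series d (T : measurableType d)
    (mu : {measure set T -> \bar R}) (q : T -> R) (h : T -> \bar R)
    (c : nat -> R) (B : nat -> set T) :
  measurable_fun setT q -> measurable_fun setT h -> (forall x, 0 <= q x)%R ->
  (forall x, 0 <= h x) -> (forall k, 0 <= c k)%R -> (forall k, measurable (B k)) ->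
  (forall x, exists k, B k x /\ (q x <= c k)%R) ->
  \int[mu]_x ((q x)%:E * h x) <= \sum_(k <oo) (c k)%:E * \int[mu]_(x in B k) h x.
Proof.
move=> mq mh q0 h0 c0 mB qB.
pose F k x := (c k)%:E * ((\1_(B k) x)%:E * h x).
have mF k : measurable_fun setT (F k).
  apply: emeasurable_funM => //; apply: emeasurable_funM => //.
  by apply/measurable_EFinP; exact: measurable_indic.
have F0 k x : 0 <= F k x by rewrite !mule_ge0// lee_fin.
have mg : measurable_fun setT (fun x => \sum_(k <oo) F k x).
  by apply: ge0_emeasurable_sum => // k x _ _; exact: F0.
apply: (@le_trans _ _ (\int[mu]_x (\sum_(k <oo) F k x))).
  apply: ge0_le_integral => //.
  - by move=> x _; rewrite mule_ge0// lee_fin.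
  - by apply: emeasurable_funM => //; exact/measurable_EFinP.
  move=> x _; have [k [Bx qc]] := qB x.
  apply: (@le_trans _ _ (F k x)).
    by rewrite /F indicE mem_set// mul1e; apply: lee_wpmul2r; rewrite ?lee_fin.
  rewrite (nneseriesD1 (n := k)) //.
  by rewrite leeDl// nneseries_ge0.
rewrite integral_nneseries//.
apply: lee_nneseries => k _.
  by move=> _; apply: integral_ge0 => x _; exact: F0.
rewrite ge0_integralZl_EFin//; last 2 first.
  by move=> x _; rewrite mule_ge0// lee_fin.
  by apply: emeasurable_funM => //; apply/measurable_EFinP; exact: measurable_indic.
rewrite lee_wpmul2l ?lee_fin// [leRHS]integral_mkcond le_eqVlt; apply/orP; left.
apply/eqP; apply: eq_integral => x _; rewrite patchE indicE.
by case: ifP => _; rewrite ?mul1e ?mul0e.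
Qed.

End poisson_profile.

Section poisson_mass.
Context {R : realType} {m : nat}.
Implicit Types v w : 'rV[R]_m.
Local Notation prof := (@poisson_profile R m).
Local Open Scope ereal_scope.

Lemma nneseries_half (c : R) : (0 <= c)%R ->
  \sum_(k <oo) (c / 2 ^+ k)%:E <= (2 * c)%:E.
Proof.
move=> c0.
have := @cvg_geometric_eseries_half R (2 * c)%R 0.
rewrite expr0 divr1 => /cvg_lim <- //.
apply: lee_nneseries => k _; first by rewrite lee_fin divr_ge0 ?exprn_ge0.
rewrite lee_fin addn1 natrX exprS -mulf_div divff// mul1r.
exact: lexx.
Qed.

(** The volume 2^(km) of a dyadic cube against the decay 2^(-k(m+1)) leaves a geometric series in
    2^(-k). *)
Lemma integral_profile_lty : \int[lebesgue_rV m]_v (prof v)%:E < +oo.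
Proof.
have -> : \int[lebesgue_rV m]_v (prof v)%:E =
    \int[lebesgue_rV m]_v ((prof v)%:E * cst 1 v).
  by apply: eq_integral => v _; rewrite mule1.
apply: (@le_lt_trans _ _ (\sum_(k <oo) ((2 ^+ m.+1 / dyad k ^+ m.+1)%:E *
    \int[lebesgue_rV m]_(v in cube (dyad k)) cst 1 v))).
  apply: ge0_integral_dominated_series => //.
  - exact: measurable_profile.
  - by move=> v; rewrite ltW// profile_gt0.
  - by move=> k; rewrite divr_ge0 ?exprn_ge0.
  - by move=> k; exact: measurable_cube.
  - exact: profile_le_dyadic.
apply: (@le_lt_trans _ _ (\sum_(k <oo) (2 ^+ (m.+1 + m) / 2 ^+ k)%:E)).
  apply: lee_nneseries => k _.
    by rewrite mule_ge0 ?lee_fin ?divr_ge0 ?exprn_ge0// integral_ge0.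
  rewrite integral_cst; last exact: measurable_cube.
  rewrite mul1e [X in _ * X](_ : _ = ((2 * dyad k) ^+ m)%:E); last first.
    by apply: lebesgue_cube; rewrite exprn_ge0.
  rewrite -EFinM lee_fin le_eqVlt; apply/orP; left; apply/eqP.
  rewrite -/(dyad k); set D := dyad k; have D0 : (D != 0)%R by rewrite expf_neq0.
  by rewrite exprMn (exprS D) exprD; field; rewrite D0 expf_neq0.
by apply: le_lt_trans (nneseries_half _) (ltry _); rewrite exprn_ge0.
Qed.

Lemma integrable_profile :
  (lebesgue_rV m).-integrable setT (EFin \o prof).
Proof.
apply/integrableP; split; first by apply/measurable_EFinP; exact: measurable_profile.
under eq_integral do rewrite /= ger0_norm ?(ltW (profile_gt0 _))//.
exact: integral_profile_lty.
Qed.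

Lemma Rintegral_profile_gt0 : (0 < \int[lebesgue_rV m]_v (prof v))%R.
Proof.
(* [c] is a lower bound of the profile on the unit cube, where |v|^2 <= m. *)
pose c : R := ((1 + m%:R) `^ (m.+1%:R / 2))^-1%R.
have c0 : (0 < c)%R by rewrite invr_gt0 powR_gt0// ltr_pwDl.
rewrite -lte_fin fineK; last exact: integrable_fin_num integrable_profile.
apply: (@lt_le_trans _ _ (\int[lebesgue_rV m]_(v in cube 1) (cst c%:E v))).
  rewrite integral_cst; last exact: measurable_cube.
  rewrite [X in _ * X](_ : _ = ((2 * 1) ^+ m)%:E); last exact: lebesgue_cube.
  by rewrite -EFinM lte_fin mulr_gt0// exprn_gt0// mulr1.
have mc : measurable (cube 1 : set 'rV[R]_m) by exact: measurable_cube.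
have mp : measurable_fun setT (EFin \o prof).
  by apply/measurable_EFinP; exact: measurable_profile.
apply: (@le_trans _ _ (\int[lebesgue_rV m]_(v in cube 1) (prof v)%:E)).
  apply: ge0_le_integral => //.
  - by move=> v _; rewrite lee_fin ltW.
  - exact: measurable_funTS.
  move=> v cv; rewrite lee_fin /c profileE lef_pV2 ?posrE ?powR_gt0 ?base_gt0 ?ltr_pwDl//.
  rewrite ge0_ler_powR ?nnegrE ?divr_ge0 ?(ltW (base_gt0 _)) ?addr_ge0//.
  rewrite lerD2l enorm_sqE -[leRHS]/(m%:R)%R.
  have -> : (m%:R = \sum_(i < m) (1:R))%R by rewrite sumr_const card_ord.
  apply: ler_sum => i _; rewrite -real_normK ?num_real// expr_le1// ltW//.
apply: ge0_subset_integral => // v _.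
by rewrite lee_fin ltW// profile_gt0.
Qed.

Lemma poisson_const_gt0 : (0 < @poisson_const R m)%R.
Proof. by rewrite invr_gt0 Rintegral_profile_gt0. Qed.

Lemma poisson_gt0 (a : R) v : (0 < a)%R -> (0 < poisson a v)%R.
Proof.
move=> a0; rewrite /poisson mulr_gt0 ?invr_gt0 ?exprn_gt0// mulr_gt0//.
  exact: poisson_const_gt0.
exact: profile_gt0.
Qed.

Lemma measurable_poisson (a : R) : measurable_fun [set: 'rV[R]_m] (poisson a).
Proof.
apply: measurable_funM => //; apply: measurable_funM => //.
apply: (measurableT_comp measurable_profile).
exact: measurable_funZ_rV.
Qed.

(** Scaling v = a w removes [a] from the right-hand side. The total mass and the concentration of
    the kernel are thereby uniform in the radius. *)
Lemma integral_poisson_indic (a : R) (B : set 'rV[R]_m) : (0 < a)%R -> measurable B ->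
  \int[lebesgue_rV m]_v ((poisson a v)%:E * (\1_B (a^-1 *: v))%:E) =
  (@poisson_const R m)%:E * \int[lebesgue_rV m]_(v in B) (prof v)%:E.
Proof.
move=> a0 mB.
pose F (v : 'rV[R]_m) := (@poisson_const R m * prof v)%:E * (\1_B v)%:E.
have mF : measurable_fun setT F.
  apply: emeasurable_funM; apply/measurable_EFinP; last exact: measurable_indic.
  by apply: measurable_funM => //; exact: measurable_profile.
have F0 v : 0 <= F v.
  rewrite mule_ge0// lee_fin mulr_ge0 ?(ltW poisson_const_gt0)// ltW//.
  exact: profile_gt0.
have a10 : (0 < a^-1)%R by rewrite invr_gt0.
have := ge0_integral_rV_affine 0%R a10 mF F0.
rewrite exprVn invrK => E.
transitivity ((a ^- m)%:E * \int[lebesgue_rV m]_v F (a^-1 *: v + 0)%R).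
  have mFa : measurable_fun setT (fun v : 'rV[R]_m => F (a^-1 *: v + 0)%R).
    apply: (measurableT_comp mF); apply: measurable_funD_rV => //.
    exact: measurable_funZ_rV.
  have am0 : (0 <= a ^- m)%R by rewrite invr_ge0 exprn_ge0// ltW.
  rewrite -(ge0_integralZl_EFin _ _ _ mFa am0)//.
  by apply: eq_integral => v _; rewrite addr0 /F /poisson !EFinM !muleA.
rewrite E muleA -EFinM mulVf ?expf_neq0 ?gt_eqF// mul1e.
have c0 := ltW poisson_const_gt0.
rewrite [in RHS]integral_mkcond -ge0_integralZl_EFin//; last 2 first.
- by move=> v _; rewrite patchE; case: ifP => // _; rewrite lee_fin ltW// profile_gt0.
- apply/(measurable_restrictT (fun v => (prof v)%:E)) => //.
  by apply: measurable_funTS; apply/measurable_EFinP; exact: measurable_profile.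
apply: eq_integral => v _; rewrite /F EFinM patchE indicE.
by case: ifP => _; rewrite ?mule1// !mule0.
Qed.

Lemma integral_poisson1 (a : R) : (0 < a)%R ->
  \int[lebesgue_rV m]_v (poisson a v)%:E = 1.
Proof.
move=> a0; have := integral_poisson_indic a0 (@measurableT _ 'rV[R]_m).
rewrite [X in _ = _ * X](_ : _ = (\int[lebesgue_rV m]_v (prof v))%:E); last first.
  by rewrite fineK//; exact: integrable_fin_num integrable_profile.
rewrite -EFinM /poisson_const mulVf ?gt_eqF ?Rintegral_profile_gt0// => <-.
by apply: eq_integral => v _; rewrite indicT mule1.
Qed.

(** By scaling, one radius [rho] serves all [a]; it exists because the balls of integer radius
    exhaust the space. *)
Lemma poisson_concentration : exists2 rho : R, (0 < rho)%R &
  forall a : R, (0 < a)%R ->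
  ((9 / 10)%:E <= \int[lebesgue_rV m]_v
     ((poisson a v)%:E * (\1_[set w | (enorm w < rho)%R] (a^-1 *: v))%:E)).
Proof.
pose B (n : nat) := [set w : 'rV[R]_m | (enorm w < n%:R)%R].
have mB n : measurable (B n).
  rewrite -[X in measurable X]setTI (_ : B n = enorm @^-1` `]-oo, n%:R[%classic).
    exact: measurable_enorm.
  by apply/seteqP; split => w /=; rewrite in_itv.
have mp D : measurable_fun D (EFin \o prof).
  by apply: measurable_funTS; apply/measurable_EFinP; exact: measurable_profile.
have p0 v : 0 <= (prof v)%:E by rewrite lee_fin ltW// profile_gt0.
have ndB : nondecreasing_seq B.
  move=> i j ij; apply/subsetPset => w /= h; apply: lt_le_trans h _.
  by rewrite ler_nat.
have := @ge0_nondecreasing_set_cvg_integral _ _ R B _ (lebesgue_rV m) ndB mB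
  (fun i => mp _) (fun i v _ => p0 v).
have -> : \bigcup_i B i = setT.
  rewrite -subTset => w _; exists (Num.truncn (enorm w)).+1 => //=.
  exact: truncnS_gt.
pose I : R := (\int[lebesgue_rV m]_v (prof v))%R.
have I0 : (0 < I)%R by exact: Rintegral_profile_gt0.
rewrite (_ : \int[lebesgue_rV m]_x (EFin \o prof) x = I%:E); last first.
  by rewrite fineK//; exact: integrable_fin_num integrable_profile.
move=> cvB.
have [n hn] : exists n, (9 / 10 * I)%:E < \int[lebesgue_rV m]_(v in B n) (prof v)%:E.
  apply: contrapT => /forallNP h.
  have : I%:E <= (9 / 10 * I)%:E.
    rewrite -(cvg_lim _ cvB)//; apply: lime_le; first by apply/cvg_ex; eexists; exact: cvB.
    by apply: nearW => n; rewrite leNgt; apply/negP; exact: h.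
  rewrite lee_fin; nra.
exists n%:R => [|a a0].
  (* n = 0 is excluded: the ball of radius 0 is empty and cannot carry 9/10 of a positive mass. *)
  rewrite ltr0n lt0n; apply/negP => /eqP n0; move: hn.
  rewrite n0 (_ : B 0%N = set0) ?integral_set0 ?lte_fin; first by nra.
  apply/seteqP; split => // w h; have := enorm_ge0 w.
  by rewrite leNgt => /negP; apply; exact: h.
rewrite (integral_poisson_indic a0 (mB n)) /poisson_const -/I.
apply: (@le_trans _ _ (I^-1%:E * (9 / 10 * I)%:E)).
  by rewrite -EFinM lee_fin mulrCA mulVf ?gt_eqF// mulr1.
by rewrite lee_wpmul2l ?lee_fin ?invr_ge0 ?ltW.
Qed.

End poisson_mass.

(** * Derivatives of the Poisson kernel *)

Section derivative_rules.
Context {R : realType} {V : normedModType R}.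
Implicit Types (f g : V -> R) (x v : V).

Lemma is_derive_const x v (c : R) : is_derive x v (fun _ : V => c) 0.
Proof. exact: is_derive_cst. Qed.

Lemma is_derive_add f g x v (df dg : R) : is_derive x v f df -> is_derive x v g dg ->
  is_derive x v (fun z => f z + g z) (df + dg).
Proof. exact: is_deriveD. Qed.

Lemma is_derive_opp f x v (df : R) : is_derive x v f df ->
  is_derive x v (fun z => - f z) (- df).
Proof. exact: is_deriveN. Qed.

Lemma is_derive_mul f g x v (df dg : R) : is_derive x v f df -> is_derive x v g dg ->
  is_derive x v (fun z => f z * g z) (df * g x + f x * dg).
Proof.
move=> hf hg; refine (is_derive_eq (is_deriveM hf hg) _).
by rewrite /GRing.scale /=; ring.
Qed.

Lemma is_derive_exp f n x v (df : R) : is_derive x v f df ->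
  is_derive x v (fun z => f z ^+ n) (n%:R * f x ^+ n.-1 * df).
Proof.
move=> hf; have -> : (fun z => f z ^+ n) = f ^+ n by apply/funext => z; rewrite exprfctE.
exact: is_deriveX.
Qed.

Lemma eq_is_derive f g x v (d : R) : f =1 g -> is_derive x v f d -> is_derive x v g d.
Proof. by move=> /funext ->. Qed.

End derivative_rules.

Lemma is_derive_var {R : realType} (x : R) : is_derive x 1 (fun z : R => z) 1.
Proof. exact: is_derive_id. Qed.

(** The derivative is assembled from the shape of the function, which is why the rules above are
    restated for explicit abstractions; [derive_eq] leaves the comparison with the expected value as
    a goal. *)
Ltac derive_rule := lazymatch goal with
  | |- is_derive _ _ (fun _ => ?c) _ => exact: is_derive_const
  | |- is_derive _ _ (fun z => z) _ => exact: is_derive_var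
  | |- is_derive _ _ (fun z => (@?f z) * (@?g z)) _ =>
      refine (@is_derive_mul _ _ f g _ _ _ _ _ _); derive_rule
  | |- is_derive _ _ (fun z => (@?f z) + (@?g z)) _ =>
      refine (@is_derive_add _ _ f g _ _ _ _ _ _); derive_rule
  | |- is_derive _ _ (fun z => - (@?f z)) _ =>
      refine (@is_derive_opp _ _ f _ _ _ _); derive_rule
  | |- is_derive _ _ (fun z => (@?f z) ^+ ?n) _ =>
      refine (@is_derive_exp _ _ f n _ _ _ _); derive_rule
  | |- _ => eassumption
  end.

Ltac derive_eq := eapply is_derive_eq; [derive_rule | ].

Section jet_bounds.
Context {R : realType}.
Variables (al b r x sg D : R).
Hypotheses (al0 : 0 < al) (r0 : 0 < r) (rb : r <= b) (sg0 : 0 < sg) (sgD : sg <= D)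
  (D1 : 1 <= D) (xD : `|x| * sg <= D) (x2D : x ^+ 2 * sg <= D).

Let D0 : 0 <= D. Proof. exact: le_trans D1. Qed.
Let D2 : D <= D ^+ 2. Proof. by rewrite expr2 ler_peMl. Qed.
Let D3 : 1 <= D ^+ 2. Proof. exact: le_trans D1 D2. Qed.
Let b0 : 0 <= b. Proof. exact: le_trans (ltW r0) rb. Qed.

(** In the application [sg] is 1/(r^2 + |w|^2), [x] a coordinate of w and [D] a bound for [sg] times
    1 + |w|^2. The factors of all jets are polynomials in r, x and [sg] of degree at most two in
    [sg], whence a constant times D^2. *)
Lemma jet_bound0 : `|r| <= b * D ^+ 2.
Proof. by rewrite gtr0_norm//; apply: le_trans rb _; rewrite ler_peMr. Qed.

Lemma jet_bound1 : `|- (2 * al) * r * x * sg| <= 2 * al * b * D ^+ 2.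
Proof.
have -> : `|- (2 * al) * r * x * sg| = 2 * al * r * (`|x| * sg).
  by rewrite !normrM normrN normrM (ger0_norm (ler0n _ 2)) (gtr0_norm al0) (gtr0_norm r0)
    (gtr0_norm sg0); ring.
apply: ler_pM; first by rewrite !mulr_ge0// ltW.
- by rewrite mulr_ge0// ltW.
- by rewrite ler_wpM2l// mulr_ge0// ltW.
- exact: le_trans xD D2.
Qed.

Lemma jet_bound2 : `|1 - 2 * al * r ^+ 2 * sg| <= (1 + 2 * al * b ^+ 2) * D ^+ 2.
Proof.
apply: le_trans (ler_normB _ _) _; rewrite normr1 [leRHS]mulrDl mul1r; apply: lerD => //.
rewrite ger0_norm; last by rewrite !mulr_ge0 ?sqr_ge0// ltW.
apply: ler_pM; first by rewrite !mulr_ge0 ?sqr_ge0// ltW.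
- exact: ltW.
- rewrite ler_wpM2l//; first by rewrite mulr_ge0// ltW.
  by rewrite ler_pXn2r ?nnegrE// ltW.
- exact: le_trans sgD D2.
Qed.

Let sg2 : sg ^+ 2 <= D ^+ 2.
Proof. by rewrite ler_pXn2r ?nnegrE// ltW. Qed.

Lemma jet_bound3 : `|r * (- (2 * al) * sg + 4 * al * (al + 1) * x ^+ 2 * sg ^+ 2)| <=
  (2 * al * b + 4 * al * (al + 1) * b) * D ^+ 2.
Proof.
have c2 : 0 <= 2 * al by rewrite mulr_ge0// ltW.
have c4 : 0 <= 4 * al * (al + 1) by rewrite !mulr_ge0 ?addr_ge0// ltW.
have -> : (2 * al * b + 4 * al * (al + 1) * b) * D ^+ 2 =
  b * (2 * al * D ^+ 2 + 4 * al * (al + 1) * D ^+ 2) by ring.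
rewrite normrM gtr0_norm//; apply: ler_pM => //; first exact: ltW.
apply: le_trans (ler_normD _ _) _; apply: lerD.
  rewrite normrM normrN (ger0_norm c2) (gtr0_norm sg0) ler_wpM2l//.
  exact: le_trans sgD D2.
have -> : 4 * al * (al + 1) * x ^+ 2 * sg ^+ 2 =
  4 * al * (al + 1) * ((x ^+ 2 * sg) * sg) by ring.
have sg00 := ltW sg0.
have y0 : 0 <= x ^+ 2 * sg by rewrite mulr_ge0 ?sqr_ge0.
by rewrite (ger0_norm (mulr_ge0 c4 (mulr_ge0 y0 sg00))) ler_wpM2l// [leRHS]expr2 ler_pM.
Qed.

Lemma jet_bound4 : `|- (6 * al) * r * sg + 4 * al * (al + 1) * r ^+ 3 * sg ^+ 2| <=
  (6 * al * b + 4 * al * (al + 1) * b ^+ 3) * D ^+ 2.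
Proof.
have c6 : 0 <= 6 * al by rewrite mulr_ge0// ltW.
have c4 : 0 <= 4 * al * (al + 1) by rewrite !mulr_ge0 ?addr_ge0// ltW.
have r00 := ltW r0; have sg00 := ltW sg0.
rewrite [leRHS]mulrDl; apply: le_trans (ler_normD _ _) _; apply: lerD.
  have -> : - (6 * al) * r * sg = - (6 * al * r * sg) by ring.
  rewrite normrN ger0_norm; last by rewrite !mulr_ge0// ltW.
  apply: ler_pM => //; [by rewrite mulr_ge0|by rewrite ler_wpM2l|exact: le_trans sgD D2].
have r30 : 0 <= r ^+ 3 by rewrite exprn_ge0.
have s20 : 0 <= sg ^+ 2 by rewrite exprn_ge0.
rewrite (ger0_norm (mulr_ge0 (mulr_ge0 c4 r30) s20)).
apply: ler_pM => //; first by rewrite (mulr_ge0 c4 r30).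
by rewrite ler_wpM2l// ler_pXn2r ?nnegrE.
Qed.

End jet_bounds.

Section poisson_jet.
Context {R : realType} {m : nat}.
Local Notation Rm := 'rV[R]_m.

(* [K0], [K1 a], [K2 a] index the Poisson kernel and its first and second derivatives
   in the direction [a]; as in Defs, [None] is the radius. *)
Inductive jet := K0 | K1 of option 'I_m | K2 of option 'I_m.

Definition alpha : R := m.+1%:R / 2.

(** With s = r^2 + |w|^2 the Poisson kernel is a constant times r s^(-alpha). This is what remains
    of each derivative after s^(-alpha) has been taken out, [sigma] standing for 1/s. *)
Definition jet_factor (k : jet) (r : R) (w : Rm) (sigma : R) : R :=
  match k with
  | K0 => r
  | K1 (Some i) => - (2 * alpha) * r * w ord0 i * sigma
  | K1 None => 1 - 2 * alpha * r ^+ 2 * sigma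
  | K2 (Some i) => r * (- (2 * alpha) * sigma +
      4 * alpha * (alpha + 1) * w ord0 i ^+ 2 * sigma ^+ 2)
  | K2 None => - (6 * alpha) * r * sigma +
      4 * alpha * (alpha + 1) * r ^+ 3 * sigma ^+ 2
  end.

Definition kern (k : jet) (r : R) (w : Rm) : R :=
  let s := r ^+ 2 + enorm w ^+ 2 in
  @poisson_const R m * (s `^ (- alpha) * jet_factor k r w s^-1).

Lemma alpha_gt0 : 0 < alpha.
Proof. by rewrite divr_gt0. Qed.

Lemma kern0E (r : R) (w : Rm) : 0 < r -> kern K0 r w = poisson r w.
Proof.
move=> r0; rewrite /kern /poisson /=.
have -> : r ^+ 2 + enorm w ^+ 2 = r ^+ 2 * base (r^-1 *: w).
  rewrite /base enormZ exprMn mulrDr mulr1 mulrA; congr (_ + _).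
  by rewrite ger0_norm ?invr_ge0 ?ltW// -exprMn mulfV ?gt_eqF// expr1n mul1r.
rewrite powRM ?sqr_ge0 ?(ltW (base_gt0 _))//.
rewrite -[poisson_profile _]/(base (r^-1 *: w) `^ (- alpha)).
rewrite [X in X * _ * _]powRN powR_sqr_half ?(ltW r0)// exprS.
field; rewrite expf_neq0 ?gt_eqF//.
Qed.

Lemma kern0_gt0 (r : R) (w : Rm) : 0 < r -> 0 < kern K0 r w.
Proof. by move=> r0; rewrite kern0E// poisson_gt0. Qed.

Lemma enorm_delta (w : Rm) i (t : R) :
  enorm (w + t *: delta_mx ord0 i) ^+ 2 =
  (enorm w ^+ 2 - w ord0 i ^+ 2) + (w ord0 i + t) ^+ 2.
Proof.
rewrite !enorm_sqE (bigD1 i)//= [in RHS](bigD1 i)//= !mxE !eqxx mulr1.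
under eq_bigr => j ji do rewrite !mxE (negbTE ji) andbF mulr0 addr0.
by ring.
Qed.

Lemma is_derive_powN (A : R) (x : R) : 0 < A + x ^+ 2 ->
  is_derive x 1 (fun x : R => (A + x ^+ 2) `^ (- alpha))
    (- (2 * alpha) * x * (A + x ^+ 2) `^ (- alpha) * (A + x ^+ 2)^-1).
Proof.
move=> s0.
have h : is_derive x 1 (fun x : R => A + x ^+ 2) (2 * x).
  apply: is_derive_eq; rewrite /GRing.scale /=; ring.
have H := @is_derive1_comp R (fun s => s `^ (- alpha)) (fun x : R => A + x ^+ 2) x _ _
  (is_derive1_powR _ s0) h.
refine (is_derive_eq H _).
rewrite powRB ?powRr1 ?(ltW s0)//; first by rewrite /GRing.scale /=; ring.
by rewrite (gt_eqF s0) implybT.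
Qed.

Lemma is_derive_inv2 (A : R) (x : R) : 0 < A + x ^+ 2 ->
  is_derive x 1 (fun x : R => (A + x ^+ 2)^-1)
    (- 2 * x * (A + x ^+ 2)^-1 ^+ 2).
Proof.
move=> s0.
have h : is_derive x 1 (fun x : R => A + x ^+ 2) (2 * x).
  apply: is_derive_eq; rewrite /GRing.scale /=; ring.
have sn0 : A + x ^+ 2 != 0 by rewrite gt_eqF.
refine (is_derive_eq (@is_deriveV R (fun x : R => A + x ^+ 2) x _ _ sn0 h) _).
by rewrite /GRing.scale /= exprVn; ring.
Qed.

Section one_variable.
Variables (P S : R -> R) (x : R).
Hypothesis dP : is_derive x 1 P (- (2 * alpha) * x * P x * S x).
Hypothesis dS : is_derive x 1 S (- 2 * x * S x ^+ 2).
Local Notation c := (@poisson_const R m).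

(** [P] and [S] stand for s^(-alpha) and 1/s as functions of one variable. Knowing only their
    derivatives reduces every rule between jets to a polynomial identity. *)
Lemma jet_space01 (r : R) : is_derive x 1 (fun x => c * (P x * r))
  (c * (P x * (- (2 * alpha) * r * x * S x))).
Proof. by derive_eq; rewrite /GRing.scale /=; ring. Qed.

Lemma jet_space12 (r : R) : is_derive x 1 (fun x => c * (P x * (- (2 * alpha) * r * x * S x)))
  (c * (P x * (r * (- (2 * alpha) * S x + 4 * alpha * (alpha + 1) * x ^+ 2 * S x ^+ 2)))).
Proof. by derive_eq; rewrite /GRing.scale /=; ring. Qed.

Lemma jet_space2 (r : R) : exists d, is_derive x 1 (fun x => c * (P x * (r * (- (2 * alpha) * S x
  + 4 * alpha * (alpha + 1) * x ^+ 2 * S x ^+ 2)))) d.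
Proof. by eexists; derive_rule. Qed.

Lemma jet_radius01 : is_derive x 1 (fun x => c * (P x * x))
  (c * (P x * (1 - 2 * alpha * x ^+ 2 * S x))).
Proof. by derive_eq; rewrite /GRing.scale /=; ring. Qed.

Lemma jet_radius12 : is_derive x 1 (fun x => c * (P x * (1 - 2 * alpha * x ^+ 2 * S x)))
  (c * (P x * (- (6 * alpha) * x * S x + 4 * alpha * (alpha + 1) * x ^+ 3 * S x ^+ 2))).
Proof. by derive_eq; rewrite /GRing.scale /=; ring. Qed.

Lemma jet_radius2 : exists d, is_derive x 1 (fun x => c * (P x * (- (6 * alpha) * x * S x + 4 *
  alpha * (alpha + 1) * x ^+ 3 * S x ^+ 2))) d.
Proof. by eexists; derive_rule. Qed.

End one_variable.

Definition moved (a : option 'I_m) (t : R) (q : R * Rm) : R * Rm :=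
  if a is Some i then (q.1, q.2 + t *: delta_mx ord0 i) else (q.1 + t, q.2).

(* Locked: unfolding the explicit formula during unification is prohibitively slow. *)
Fact kernp_key : unit. Proof. exact: tt. Qed.
Definition kernp : jet -> R * Rm -> R := locked_with kernp_key (fun k q => kern k q.1 q.2).

Lemma kernpE k q : kernp k q = kern k q.1 q.2.
Proof. by rewrite /kernp unlock. Qed.

Lemma is_derive_translate (g : R -> R) (x0 t d : R) :
  is_derive (x0 + t) 1 g d -> is_derive t 1 (fun t => g (x0 + t)) d.
Proof.
move=> gd; have h := is_derive_add (is_derive_const t 1 x0) (is_derive_var t).
have := is_derive1_comp gd h.
by rewrite add0r mulr1.
Qed.

Lemma kern_space (k : jet) (i : 'I_m) (t : R) q :
  let A := q.1 ^+ 2 + (enorm q.2 ^+ 2 - q.2 ord0 i ^+ 2) in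
  let x := q.2 ord0 i + t in
  (kernp k (moved (Some i) t q) = @poisson_const R m * ((A + x ^+ 2) `^ (- alpha) *
     jet_factor k q.1 (q.2 + t *: delta_mx ord0 i) (A + x ^+ 2)^-1)) *
  ((q.2 + t *: delta_mx ord0 i) ord0 i = x).
Proof.
move=> A x; split.
  by rewrite kernpE /kern /= enorm_delta addrA.
by rewrite !mxE !eqxx mulr1.
Qed.

Lemma kern_radius (k : jet) (t : R) q :
  let x := q.1 + t in
  kernp k (moved None t q) = @poisson_const R m *
    ((enorm q.2 ^+ 2 + x ^+ 2) `^ (- alpha) *
     jet_factor k x q.2 (enorm q.2 ^+ 2 + x ^+ 2)^-1).
Proof. by move=> x; rewrite kernpE /kern /= [in RHS]addrC. Qed.

Lemma moved_base_gt0 a t q : 0 < (moved a t q).1 ->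
  if a is Some i then
    0 < q.1 ^+ 2 + (enorm q.2 ^+ 2 - q.2 ord0 i ^+ 2) + (q.2 ord0 i + t) ^+ 2
  else 0 < enorm q.2 ^+ 2 + (q.1 + t) ^+ 2.
Proof.
case: a => [i|] /= q0; last by rewrite ltr_wpDl ?sqr_ge0// exprn_gt0.
by rewrite -addrA -enorm_delta ltr_pwDl ?exprn_gt0// sqr_ge0.
Qed.

Lemma is_derive_kern01 a t q : 0 < (moved a t q).1 ->
  is_derive t 1 (fun t => kernp K0 (moved a t q)) (kernp (K1 a) (moved a t q)).
Proof.
move/moved_base_gt0; case: a => [i|] s0.
  rewrite (kern_space (K1 (Some i)) i t q).1 /= (kern_space K0 i t q).2.
  apply: eq_is_derive (is_derive_translate (jet_space01 (S := fun x => (_ + x ^+ 2)^-1)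
    (is_derive_powN s0) q.1)) => u.
  by rewrite (kern_space K0 i u q).1.
rewrite kern_radius /=.
have H := is_derive_translate (jet_radius01 (S := fun x => (_ + x ^+ 2)^-1) (is_derive_powN s0)).
apply: (eq_is_derive _ H) => u.
by rewrite kern_radius.
Qed.

Lemma is_derive_kern12 a t q : 0 < (moved a t q).1 ->
  is_derive t 1 (fun t => kernp (K1 a) (moved a t q)) (kernp (K2 a) (moved a t q)).
Proof.
move/moved_base_gt0; case: a => [i|] s0.
  rewrite (kern_space (K2 (Some i)) i t q).1 /= (kern_space K0 i t q).2.
  apply: eq_is_derive (is_derive_translate (jet_space12 (is_derive_powN s0) (is_derive_inv2 s0)
    q.1)) => u.
  by rewrite (kern_space (K1 (Some i)) i u q).1 /= (kern_space K0 i u q).2.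
rewrite kern_radius /=.
have H := is_derive_translate (jet_radius12 (is_derive_powN s0) (is_derive_inv2 s0)).
apply: (eq_is_derive _ H) => u.
by rewrite kern_radius.
Qed.

Lemma is_derive_kern2 a t q : 0 < (moved a t q).1 ->
  exists d, is_derive t 1 (fun t => kernp (K2 a) (moved a t q)) d.
Proof.
move/moved_base_gt0; case: a => [i|] s0.
  have [d hd] := jet_space2 (is_derive_powN s0) (is_derive_inv2 s0) q.1; exists d.
  apply: eq_is_derive (is_derive_translate hd) => u.
  by rewrite (kern_space (K2 (Some i)) i u q).1 /= (kern_space K0 i u q).2.
have [d hd] := jet_radius2 (is_derive_powN s0) (is_derive_inv2 s0); exists d.
apply: eq_is_derive (is_derive_translate hd) => u.
by rewrite kern_radius.
Qed.

Lemma sum_option (F : option 'I_m -> R) :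
  \sum_a F a = F None + \sum_i F (Some i).
Proof.
rewrite (bigD1 None)//=; congr (_ + _).
rewrite (reindex_omap Some id) /=; last by case.
by apply: eq_bigl => i; rewrite eqxx.
Qed.

(** After substituting |w|^2 = s - r^2 the sum is a multiple of 2 alpha - 1 - m, and alpha = (m +
    1)/2. *)
Lemma kern_harmonic q : 0 < q.1 -> \sum_(a : option 'I_m) kernp (K2 a) q = 0.
Proof.
move=> q0; rewrite sum_option /= kernpE; under eq_bigr do rewrite kernpE.
rewrite /kern /=.
set s := q.1 ^+ 2 + enorm q.2 ^+ 2; set p := s `^ _.
have s0 : s != 0 by rewrite gt_eqF// ltr_pwDl ?exprn_gt0// sqr_ge0.
rewrite -!mulr_sumr big_split /= sumr_const card_ord.
under eq_bigr do rewrite -mulrA [_ * s^-1 ^+ 2]mulrC mulrA.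
rewrite -mulr_sumr -enorm_sqE.
have -> : enorm q.2 ^+ 2 = s - q.1 ^+ 2 by rewrite /s; ring.
rewrite -[_ *+ m]mulr_natr.
have -> : m%:R = 2 * alpha - 1 :> R.
  by rewrite /alpha -natr1; field.
by field.
Qed.

Lemma measurable_kernp k : measurable_fun setT (kernp k : measurableTypeR R * Rm -> R).
Proof.
have m1 : measurable_fun setT (fun q : measurableTypeR R * Rm => q.1 : R).
  exact: measurable_fst.
have m2 : measurable_fun setT (fun q : measurableTypeR R * Rm => q.2).
  exact: measurable_snd.
have ms : measurable_fun setT (fun q : measurableTypeR R * Rm => q.1 ^+ 2 + enorm q.2 ^+ 2 : R).
  apply: measurable_funD; apply: measurable_funX => //.
  exact: (measurableT_comp measurable_enorm).
have mi : measurable_fun setT (fun q : measurableTypeR R * Rm => (q.1 ^+ 2 + enorm q.2 ^+ 2)^-1 :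
  R).
  rewrite (_ : (fun _ => _) = (fun q : measurableTypeR R * Rm => (q.1 ^+ 2 + enorm q.2 ^+ 2) `^
    (-1))).
    exact: (measurableT_comp (measurable_powR _) ms).
  by apply/funext => q; rewrite powR_inv1// addr_ge0// sqr_ge0.
have mw i : measurable_fun setT (fun q : measurableTypeR R * Rm => q.2 ord0 i : R).
  exact: measurable_fun_coord_rV.
rewrite (_ : kernp k = fun q => kern k q.1 q.2); last by apply/funext => q; rewrite kernpE.
apply: measurable_funM => //; apply: measurable_funM.
  exact: (measurableT_comp (measurable_powR _) ms).
case: k => [|[i|]|[i|]] //=; repeat (done || apply: measurable_funM || apply: measurable_funD ||
  apply: measurable_funX || apply: measurable_funN || apply: measurable_funB || exact: mw).
Qed.

(** For a <= r the quantity r^2 + |w|^2 is at least min(1, a^2) times 1 + |w|^2. This turns its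
    power into the profile and bounds the remaining factor, so all jets decay like the profile
    itself. *)
Lemma kern_bound (k : jet) (a b : R) : 0 < a -> a <= b -> exists2 C : R, 0 < C &
  forall r w, a <= r -> r <= b -> `|kern k r w| <= C * poisson_profile w.
Proof.
move=> a0 ab.
pose d : R := Num.min 1 (a ^+ 2).
have d0 : 0 < d by rewrite lt_min ltr01 exprn_gt0.
have d1 : d <= 1 by rewrite ge_min lexx.
have b0 : 0 < b by apply: lt_le_trans ab.
pose c := @poisson_const R m.
have c0 : 0 < c by exact: poisson_const_gt0.
have al := alpha_gt0.
(* One constant that dominates the constants of the five jet bounds. *)
pose M : R := 1 + b + 6 * alpha * b + (4 * alpha * (alpha + 1)) * b + 2 * alpha * b ^+ 2
   + 4 * alpha * (alpha + 1) * b ^+ 3.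
have M1 : 0 <= 6 * alpha * b by rewrite !mulr_ge0 ?ltW.
have M2 : 0 <= 4 * alpha * (alpha + 1) * b by rewrite !mulr_ge0 ?addr_ge0 ?ltW.
have M3 : 0 <= 2 * alpha * b ^+ 2 by rewrite !mulr_ge0 ?exprn_ge0 ?ltW.
have M4 : 0 <= 4 * alpha * (alpha + 1) * b ^+ 3.
  by rewrite !mulr_ge0 ?addr_ge0 ?exprn_ge0 ?ltW.
have M5 : 0 <= 2 * alpha * b by rewrite !mulr_ge0 ?ltW.
have M0 : 0 < M by rewrite /M; lra.
exists (c * (d^-1 `^ alpha * (M * d^-1 ^+ 2))).
  by rewrite mulr_gt0// mulr_gt0 ?powR_gt0 ?invr_gt0// mulr_gt0// exprn_gt0// invr_gt0.
move=> r w ar rb; rewrite /kern -/c.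
have r0 : 0 < r by apply: lt_le_trans ar.
set s := r ^+ 2 + enorm w ^+ 2.
have sd : d * base w <= s.
  rewrite /base /s mulrDr mulr1 lerD//.
    by rewrite /d ge_min; apply/orP; right; rewrite ler_pXn2r ?nnegrE ?(ltW a0) ?(ltW r0).
  by rewrite ler_piMl ?sqr_ge0.
have s0 : 0 < s by apply: lt_le_trans sd; rewrite mulr_gt0 ?base_gt0.
rewrite !normrM (gtr0_norm c0) -!mulrA ler_pM2l// (ger0_norm (powR_ge0 _ _)).
rewrite [X in _ <= X](_ : _ = (d^-1 `^ alpha * poisson_profile w) * (M * d^-1 ^+ 2)); last by ring.
rewrite ler_pM ?powR_ge0//.
  have -> : d^-1 `^ alpha = (d `^ alpha)^-1.
    by rewrite -[d^-1](powR_inv1 (ltW d0)) -powRrM mulN1r powRN.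
  rewrite powRN profileE -invfM.
  rewrite -powRM ?(ltW d0) ?(ltW (base_gt0 _))// lef_pV2 ?posrE ?powR_gt0 ?mulr_gt0 ?base_gt0//.
  by rewrite ge0_ler_powR ?nnegrE ?mulr_ge0 ?(ltW d0) ?(ltW s0) ?(ltW (base_gt0 _)) ?(ltW al).
pose D := d^-1; have D1 : 1 <= D by rewrite invf_ge1.
have sD : s^-1 * base w <= D.
  by rewrite mulrC ler_pdivrMr// /D -ler_pdivrMl ?invr_gt0// invrK.
have B1 := base_ge1 w.
pose sg := s^-1; have sg0 : 0 < sg by rewrite invr_gt0.
rewrite -/sg -/D.
have sg1 : sg <= D by apply: le_trans sD; rewrite -/sg ler_peMr// ltW.
have E0 := sqr_ge0 (enorm w).
have wi i : w ord0 i ^+ 2 <= base w.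
  apply: (@le_trans _ _ (enorm w ^+ 2)); last by rewrite /base lerDr.
  by rewrite enorm_sqE (bigD1 i)//= lerDl sumr_ge0// => j _; rewrite sqr_ge0.
have wsg i : `|w ord0 i| * sg <= D.
  apply: le_trans sD; rewrite mulrC ler_pM2l//.
  have := wi i; rewrite -[w ord0 i ^+ 2]real_normK ?num_real//.
  have := normr_ge0 (w ord0 i); nra.
have w2sg i : w ord0 i ^+ 2 * sg <= D.
  by apply: le_trans sD; rewrite mulrC ler_pM2l.
have D2 : D <= D ^+ 2 by rewrite expr2 ler_peMr// (le_trans _ D1).
have D0 : 0 < D by apply: lt_le_trans D1.
have D3 : 1 <= D ^+ 2 by apply: le_trans D1 D2.
have MD (x y : R) : x <= y * D ^+ 2 -> y <= M -> x <= M * D ^+ 2.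
  by move=> h1 h2; apply: le_trans h1 _; rewrite ler_wpM2r// exprn_ge0// ltW.
case: k => [|[i|]|[i|]] /=; [apply: (MD _ b) | apply: (MD _ (2 * alpha * b))
  | apply: (MD _ (1 + 2 * alpha * b ^+ 2))
  | apply: (MD _ (2 * alpha * b + 4 * alpha * (alpha + 1) * b))
  | apply: (MD _ (6 * alpha * b + 4 * alpha * (alpha + 1) * b ^+ 3))];
  try by rewrite /M; lra.
- exact: jet_bound0.
- by have wsgi := wsg i; apply: jet_bound1.
- exact: jet_bound2.
- by have wsgi := w2sg i; apply: jet_bound3.
- exact: jet_bound4.
Qed.

End poisson_jet.

(** * The twisted Poisson extension as a product extension *)

Inductive idx3 := J1 | J2 | J3.

Definition upd {T : Type} (f : idx3 -> T) (j : idx3) (x : T) : idx3 -> T := fun i =>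
  match j, i with J1, J1 | J2, J2 | J3, J3 => x | _, _ => f i end.

Lemma ler_pM3 {R : realType} (x y z X Y Z A B D : R) :
  0 <= x -> 0 <= y -> 0 <= z -> 0 <= X -> 0 <= Y -> 0 <= Z ->
  0 <= A -> 0 <= B -> 0 <= D -> x <= A * X -> y <= B * Y -> z <= D * Z ->
  x * y * z <= A * B * D * (X * Y * Z).
Proof.
move=> x0 y0 z0 X0 Y0 Z0 A0 B0 D0 xX yY zZ.
rewrite [leRHS](_ : _ = (A * X) * (B * Y) * (D * Z)); last by ring.
by apply: ler_pM; rewrite ?mulr_ge0//; apply: ler_pM.
Qed.

Section lifted_extension.
Context {R : realType} {m : nat}.
Local Notation Rm := 'rV[R]_m.
Local Notation R2m := (Rm * Rm)%type.
Local Notation mR := (measurableTypeR R).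
Local Notation jet := (@jet m).
Implicit Types (kap : idx3 -> jet) (j : idx3) (a : option 'I_m).

Definition dir j a : R2m * (R * R * R) :=
  match j with
  | J1 => dir1 a
  | J2 => dir2 a
  | J3 => if a is Some i then (delta_mx ord0 i, delta_mx ord0 i, (0, 0, 0)) else dir_r3
  end.

Definition radius (r : R * R * R) j : R :=
  match j with J1 => r.1.1 | J2 => r.1.2 | J3 => r.2 end.

Definition positive (p : R2m * (R * R * R)) : Prop := forall j, 0 < radius p.2 j.

(* The twisted Poisson kernel is the push-forward of a tensor product of three Poisson
   kernels under [twist]; the signs in [point] avoid any reflection of the variables. *)
Definition twist (w : Rm * Rm * Rm) : R2m := (w.1.1 - w.2, w.1.2 - w.2).

Definition point (r : R * R * R) (w : Rm * Rm * Rm) j : R * Rm :=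
  match j with J1 => (r.1.1, - w.1.1) | J2 => (r.1.2, - w.1.2) | J3 => (r.2, w.2) end.

Definition kprod kap (q : idx3 -> R * Rm) : R :=
  kernp (kap J1) (q J1) * kernp (kap J2) (q J2) * kernp (kap J3) (q J3).

Definition krest kap (q : idx3 -> R * Rm) j : R :=
  match j with
  | J1 => kernp (kap J2) (q J2) * kernp (kap J3) (q J3)
  | J2 => kernp (kap J1) (q J1) * kernp (kap J3) (q J3)
  | J3 => kernp (kap J1) (q J1) * kernp (kap J2) (q J2)
  end.

Lemma kprodE kap q j : kprod kap q = kernp (kap j) (q j) * krest kap q j.
Proof. by rewrite /kprod; case: j => /=; ring. Qed.

Lemma krest_upd kap q j k : krest (upd kap j k) q j = krest kap q j.
Proof. by case: j. Qed.

Lemma upd_same {T : Type} (f : idx3 -> T) j x : upd f j x j = x.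
Proof. by case: j. Qed.

(** With [kap] constantly [K0] this is the twisted Poisson extension of [g]. All derivatives fall on
    the kernels, so that [g] may be any bounded measurable function, in particular an indicator. *)
Definition ext kap (g : R2m -> R) (p : R2m * (R * R * R)) : R :=
  \int[lebesgue_R3m]_w (kprod kap (point p.2 w) * g (p.1 + twist w)).

Definition prof3 (w : Rm * Rm * Rm) : R :=
  poisson_profile w.1.1 * poisson_profile w.1.2 * poisson_profile w.2.

Lemma profileN (w : Rm) : poisson_profile (- w) = poisson_profile w.
Proof. by rewrite /poisson_profile enormN. Qed.

Lemma prof3_ge0 w : 0 <= prof3 w.
Proof. by rewrite /prof3 !mulr_ge0 ?(ltW (profile_gt0 _)). Qed.

Lemma measurable_twist : measurable_fun setT twist.
Proof.
by apply: measurable_fun_pair => /=; apply: measurable_funB_rV;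
  (exact: measurable_snd || (apply: measurableT_comp; exact: measurable_fst)
  || (apply: (measurableT_comp measurable_fst); exact: measurable_fst)
  || (apply: (measurableT_comp measurable_snd); exact: measurable_fst)).
Qed.

Lemma measurable_prof3 : measurable_fun setT prof3.
Proof.
apply: measurable_funM; first apply: measurable_funM.
- apply: (measurableT_comp measurable_profile).
  by apply: (measurableT_comp measurable_fst); exact: measurable_fst.
- apply: (measurableT_comp measurable_profile).
  by apply: (measurableT_comp measurable_snd); exact: measurable_fst.
- by apply: (measurableT_comp measurable_profile); exact: measurable_snd.
Qed.

Lemma ge0_integral_tensor (f1 f2 f3 : Rm -> R) :
  measurable_fun setT f1 -> measurable_fun setT f2 -> measurable_fun setT f3 ->
  (forall w, 0 <= f1 w) -> (forall w, 0 <= f2 w) -> (forall w, 0 <= f3 w) ->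
  (\int[lebesgue_R3m]_w (f1 w.1.1 * f2 w.1.2 * f3 w.2)%:E =
   (\int[lebesgue_rV m]_w (f1 w)%:E) * (\int[lebesgue_rV m]_w (f2 w)%:E) *
   (\int[lebesgue_rV m]_w (f3 w)%:E))%E.
Proof.
move=> m1 m2 m3 p1 p2 p3.
have m11 : measurable_fun setT (fun w : Rm * Rm * Rm => f1 w.1.1).
  apply: (measurableT_comp m1).
  by apply: (measurableT_comp measurable_fst); exact: measurable_fst.
have m12 : measurable_fun setT (fun w : Rm * Rm * Rm => f2 w.1.2).
  apply: (measurableT_comp m2).
  by apply: (measurableT_comp measurable_snd); exact: measurable_fst.
have m13 : measurable_fun setT (fun w : Rm * Rm * Rm => f3 w.2).
  by apply: (measurableT_comp m3); exact: measurable_snd.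
rewrite ge0_integral_R3m; last 2 first.
- by apply/measurable_EFinP; apply: measurable_funM => //; exact: measurable_funM.
- by move=> w; rewrite lee_fin !mulr_ge0.
have e1 : measurable_fun setT (EFin \o f1) by exact/measurable_EFinP.
have e2 : measurable_fun setT (EFin \o f2) by exact/measurable_EFinP.
have e3 : measurable_fun setT (EFin \o f3) by exact/measurable_EFinP.
pose I3 := (\int[lebesgue_rV m]_w (f3 w)%:E)%E.
pose I2 := (\int[lebesgue_rV m]_w (f2 w)%:E)%E.
have I30 : (0 <= I3)%E by apply: integral_ge0 => w _; rewrite lee_fin.
have I20 : (0 <= I2)%E by apply: integral_ge0 => w _; rewrite lee_fin.
have mu1 : measurable_fun setT (fun u : Rm * Rm => f1 u.1).
  by apply: (measurableT_comp m1); exact: measurable_fst.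
have mu2 : measurable_fun setT (fun u : Rm * Rm => f2 u.2).
  by apply: (measurableT_comp m2); exact: measurable_snd.
transitivity (\int[lebesgue_R2m]_u ((f1 u.1 * f2 u.2)%:E * I3))%E.
  apply: eq_integral => u _ /=.
  have h12 : 0 <= f1 u.1 * f2 u.2 by rewrite mulr_ge0.
  rewrite -(ge0_integralZl_EFin _ _ _ e3 h12)//.
  by move=> w _; rewrite lee_fin.
have mu12 : measurable_fun setT (fun u : Rm * Rm => (f1 u.1 * f2 u.2)%:E).
  by apply/measurable_EFinP; exact: measurable_funM.
rewrite (ge0_integralZr _ _ mu12)//; last by move=> u _; rewrite lee_fin mulr_ge0.
congr (_ * _)%E.
rewrite [LHS](fubini_tonelli1 _ mu12); last by move=> u; rewrite lee_fin mulr_ge0.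
transitivity (\int[lebesgue_rV m]_u ((f1 u)%:E * I2))%E.
  apply: eq_integral => u _; rewrite /fubini_F /=.
  rewrite -(ge0_integralZl_EFin _ _ _ e2 (p1 u))//.
  by move=> w _; rewrite lee_fin.
by rewrite (ge0_integralZr _ _ e1)// => u _; rewrite lee_fin.
Qed.

Lemma integral_prof3_lty : (\int[lebesgue_R3m]_w (prof3 w)%:E < +oo)%E.
Proof.
have m0 := @measurable_profile R m.
have p0 (w : Rm) := ltW (profile_gt0 w).
rewrite (ge0_integral_tensor m0 m0 m0 p0 p0 p0).
have I0 : (0 <= \int[lebesgue_rV m]_w (@poisson_profile R m w)%:E)%E.
  by apply: integral_ge0 => w _; rewrite lee_fin.
have := @integral_profile_lty R m.
by move: I0; case: integral => // x _ _; rewrite -!EFinM ltry.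
Qed.

Lemma integrable_prof3 : lebesgue_R3m.-integrable setT (EFin \o prof3).
Proof.
apply/integrableP; split; first by apply/measurable_EFinP; exact: measurable_prof3.
under eq_integral do rewrite /= ger0_norm ?prof3_ge0//.
exact: integral_prof3_lty.
Qed.

(** For |t| < min(1, r0/2) the radius stays in [r0/2, 2 r0], and a spatial shift of length at most 1
    multiplies [base] by at most 3. The bound is uniform in [t], as differentiation under the
    integral sign requires. *)
Lemma moved_bound (k : jet) a (r0 : R) : 0 < r0 -> exists2 C : R, 0 < C &
  forall t w, `|t| < Num.min 1 (r0 / 2) ->
    `|kernp k (moved a t (r0, w))| <= C * poisson_profile w.
Proof.
move=> r00.
have h0 : 0 < r0 / 2 by rewrite divr_gt0.
have h1 : r0 / 2 <= 2 * r0 by lra.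
have [C C0 hC] := kern_bound k h0 h1.
exists (C * 3 `^ (m.+1%:R / 2)); first by rewrite mulr_gt0// powR_gt0.
move=> t w; rewrite lt_min => /andP[t1 tr].
have [/andP[t1l t1r] /andP[trl trr]] : (-1 < t < 1) /\ (- (r0 / 2) < t < r0 / 2).
  by rewrite -!ltr_norml.
rewrite kernpE; case: a => [i|] /=.
  apply: le_trans (hC _ _ _ _) _; [lra|lra|].
  rewrite -mulrA ler_pM2l//; apply: le_profile => //.
  have := enorm_sqD_le (w + t *: delta_mx ord0 i) (- (t *: delta_mx ord0 i)).
  rewrite addrK enormN enormZ exprMn real_normK ?num_real//.
  have -> : enorm (delta_mx ord0 i : Rm) ^+ 2 = 1.
    have := enorm_delta (0 : Rm) i 1; rewrite add0r scale1r mxE => ->.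
    rewrite enorm_sqE big1; first by ring.
    by move=> l _; rewrite mxE expr0n.
  rewrite /base; nra.
apply: le_trans (hC _ _ _ _) _; [lra|lra|].
rewrite -mulrA ler_pM2l// ler_peMl ?(ltW (profile_gt0 _))//.
by rewrite -[X in X <= _](powRr0 3) ler_powR ?divr_ge0// ler1n.
Qed.

Lemma kernp_bound (k : jet) (a b : R) : 0 < a -> a <= b -> exists2 C : R, 0 < C &
  forall q, a <= q.1 <= b -> `|kernp k q| <= C * poisson_profile q.2.
Proof.
move=> a0 ab; have [C C0 hC] := kern_bound k a0 ab; exists C => // q /andP[? ?].
by rewrite kernpE; exact: hC.
Qed.

Lemma kprod_bound kap (a b : R) : 0 < a -> a <= b -> exists2 C : R, 0 < C &
  forall r w, (forall j, a <= radius r j <= b) ->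
    `|kprod kap (point r w)| <= C * prof3 w.
Proof.
move=> a0 ab.
have [C1 C10 h1] := kernp_bound (kap J1) a0 ab.
have [C2 C20 h2] := kernp_bound (kap J2) a0 ab.
have [C3 C30 h3] := kernp_bound (kap J3) a0 ab.
exists (C1 * C2 * C3); first by rewrite !mulr_gt0.
move=> r w hr.
have := h1 (point r w J1) (hr J1); have := h2 (point r w J2) (hr J2).
have := h3 (point r w J3) (hr J3); rewrite /= !profileN => k3 k2 k1.
rewrite /kprod (normrM (_ * _)) (normrM (kernp _ _)).
exact: (ler_pM3 (normr_ge0 _) (normr_ge0 _) (normr_ge0 _) (ltW (profile_gt0 _))
  (ltW (profile_gt0 _)) (ltW (profile_gt0 _)) (ltW C10) (ltW C20) (ltW C30) k1 k2 k3).
Qed.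

Lemma measurable_point j :
  measurable_fun setT (fun z : (mR * mR * mR) * (Rm * Rm * Rm) =>
    point z.1 z.2 j : mR * Rm).
Proof.
case: j; apply: measurable_fun_pair => /=; try apply: measurable_funN_rV;
  by repeat (exact: measurable_fst || exact: measurable_snd ||
     apply: (measurableT_comp measurable_fst) || apply: (measurableT_comp measurable_snd)).
Qed.

Lemma measurable_kprod kap :
  measurable_fun setT (fun z : (mR * mR * mR) * (Rm * Rm * Rm) => kprod kap (point z.1 z.2)).
Proof.
by apply: measurable_funM; first apply: measurable_funM;
  apply: (measurableT_comp (measurable_kernp _)); exact: measurable_point.
Qed.

Lemma measurable_ext_integrand kap (g : R2m -> R) : measurable_fun setT g ->
  measurable_fun setT (fun z : (R2m * (mR * mR * mR)) * (Rm * Rm * Rm) =>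
    kprod kap (point z.1.2 z.2) * g (z.1.1 + twist z.2)).
Proof.
move=> mg; apply: measurable_funM.
  have mz : measurable_fun setT
      (fun z : (R2m * (mR * mR * mR)) * (Rm * Rm * Rm) => (z.1.2, z.2)).
    apply: measurable_fun_pair => /=; last exact: measurable_snd.
    by apply: (measurableT_comp measurable_snd); exact: measurable_fst.
  exact: (measurableT_comp (measurable_kprod kap) mz).
apply: (measurableT_comp mg); apply: measurable_funD_pair.
  by apply: (measurableT_comp measurable_fst); exact: measurable_fst.
by apply: (measurableT_comp measurable_twist); exact: measurable_snd.
Qed.

Lemma le_integrable_prof3 (F : Rm * Rm * Rm -> R) (C : R) : measurable_fun setT F ->
  (forall w, `|F w| <= C * prof3 w) -> lebesgue_R3m.-integrable setT (EFin \o F).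
Proof.
move=> mF hF; have := integrableZl measurableT C integrable_prof3.
apply: le_integrable => //; first exact/measurable_EFinP.
move=> w _ /=; rewrite lee_fin; apply: le_trans (hF w) _.
by rewrite ler_norm.
Qed.

Lemma measurable_kern_moved (k : jet) a t (r : R * R * R) j :
  measurable_fun setT (fun w : Rm * Rm * Rm => kernp k (moved a t (point r w j))).
Proof.
apply: (measurableT_comp (measurable_kernp k)).
have mw : measurable_fun setT (fun w : Rm * Rm * Rm => (point r w j).2).
  case: j => /=; try apply: measurable_funN_rV;
  by repeat (exact: measurable_fst || exact: measurable_snd ||
     apply: (measurableT_comp measurable_fst) || apply: (measurableT_comp measurable_snd)).
have -> : (fun w => moved a t (point r w j)) = (fun w : Rm * Rm * Rm =>
    if a is Some i then (radius r j, (point r w j).2 + t *: delta_mx ord0 i)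
    else (radius r j + t, (point r w j).2)).
  by apply/funext => w; case: a => [i|]; case: j {mw}.
case: a => [i|]; apply: measurable_fun_pair => //.
by apply: measurable_funD_rV.
Qed.

Lemma moved0 a (q : R * Rm) : moved a 0 q = q.
Proof. by case: a q => [i|] [r w]; rewrite /= ?scale0r addr0. Qed.

Lemma measurable_krest kap (r : R * R * R) j :
  measurable_fun setT (fun w : Rm * Rm * Rm => krest kap (point r w) j).
Proof.
have h k i : measurable_fun setT (fun w : Rm * Rm * Rm => kernp k (point r w i)).
  have := measurable_kern_moved k None 0 r i.
  by under eq_fun do rewrite moved0.
by case: j; apply: measurable_funM; exact: h.
Qed.

Definition line_integrand kap (g : R2m -> R) (p : R2m * (R * R * R)) j a (t : R)
    (w : Rm * Rm * Rm) : R :=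
  kernp (kap j) (moved a t (point p.2 w j)) * krest kap (point p.2 w) j *
  g (p.1 + twist w).

Lemma measurable_line_integrand kap g p j a t : measurable_fun setT g ->
  measurable_fun setT (line_integrand kap g p j a t).
Proof.
move=> mg; apply: measurable_funM; first apply: measurable_funM.
- exact: measurable_kern_moved.
- exact: measurable_krest.
- apply: (measurableT_comp mg); apply: measurable_funD_pair => //.
  exact: measurable_twist.
Qed.

(** Translating the integration variable by [c] moves a displacement along [dir j] from the argument
    of [g] to the j-th kernel alone. For a radial displacement [c] is 0. *)
Lemma ext_line kap g p j a (t : R) : measurable_fun setT g ->
  ext kap g (p + t *: dir j a) = \int[lebesgue_R3m]_w line_integrand kap g p j a t w.
Proof.
move=> mg; have mF := measurable_line_integrand kap p j a t mg.
pose c : Rm * Rm * Rm := if a is Some i then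
  match j with
  | J1 => (t *: delta_mx ord0 i, 0, 0) | J2 => (0, t *: delta_mx ord0 i, 0)
  | J3 => (0, 0, - (t *: delta_mx ord0 i)) end else 0.
have mE : measurable_fun setT (EFin \o line_integrand kap g p j a t) by exact/measurable_EFinP.
rewrite /Rintegral -(integral_R3m_translation c mE); congr fine.
apply: eq_integral => -[[w1 w2] w3] _; congr EFin.
rewrite /line_integrand (kprodE kap _ j).
have rowring (u v : Rm) : (forall l, u ord0 l = v ord0 l) -> u = v by move=> h; apply/rowP.
move: p {mF mE} => [[y1 y2] [[r1 r2] r3]].
congr (_ * _ * _).
- by case: a @c => [i|]; case: j => /=; congr (kernp _ (_, _)) => /=;
    try (apply: rowring => l; rewrite !mxE); rewrite /GRing.scale /=; ring.
- by rewrite /krest; case: a @c => [i|]; case: j => /=;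
    (congr (_ * _); congr (kernp _ _); congr (_, _)) => /=;
    try (apply: rowring => l; rewrite !mxE); rewrite /GRing.scale /=; ring.
- by case: a @c => [i|]; case: j => /=; congr (g (_, _)) => /=;
    apply: rowring => l; rewrite !mxE; ring.
Qed.

Lemma is_derive_cvg (V : normedModType R) (f : V -> R) (p v : V) (d : R) :
  (h^-1 *: (f (h *: v + p) - f p)) @[h --> 0^'] --> d -> is_derive p v f d.
Proof.
move=> h; apply: DeriveDef; last exact: cvg_lim.
by apply/cvg_ex; exists d.
Qed.

Lemma line_integrand_bound kap (g : R2m -> R) p j a (M : R) : positive p -> (forall y, `|g y| <=
  M) ->
  exists C, forall t w, `|t| < Num.min 1 (radius p.2 j / 2) ->
    `|line_integrand kap g p j a t w| <= C * prof3 w.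
Proof.
move=> pos gM.
have M0 : 0 <= M by apply: le_trans (gM 0).
have [C C0 hC] := moved_bound (kap j) a (pos j).
have hb i : exists2 C : R, 0 < C & forall w,
    `|kernp (kap i) (point p.2 w i)| <= C * poisson_profile (point p.2 w i).2.
  have [D D0 hD] := kernp_bound (kap i) (pos i) (lexx _).
  by exists D => // w; apply: hD; case: (i) => /=; rewrite lexx.
have [C1 C10 h1] := hb J1; have [C2 C20 h2] := hb J2; have [C3 C30 h3] := hb J3.
have p0 w i := ltW (profile_gt0 (point p.2 w i).2).
have E w : prof3 w = poisson_profile (point p.2 w J1).2 * poisson_profile (point p.2 w J2).2 *
    poisson_profile (point p.2 w J3).2 by rewrite /prof3 /= !profileN.
have c0 := ltW C0; have c1 := ltW C10; have c2 := ltW C20; have c3 := ltW C30.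
suff [D hD] : exists D, forall t w, `|t| < Num.min 1 (radius p.2 j / 2) ->
    `|kernp (kap j) (moved a t (point p.2 w j)) * krest kap (point p.2 w) j| <= D * prof3 w.
  exists (D * M) => t w ht; rewrite /line_integrand (normrM (_ * krest _ _ _)) [leRHS]mulrAC.
  exact: (ler_pM (normr_ge0 _) (normr_ge0 _) (hD t w ht) (gM _)).
case: j hC => hC.
- exists (C * C2 * C3) => t w ht; have kb := hC t (point p.2 w J1).2 ht.
  rewrite (normrM (kernp _ _)) /krest (normrM (kernp _ _) (kernp _ _)) mulrA E.
  exact: (ler_pM3 (normr_ge0 _) (normr_ge0 _) (normr_ge0 _) (p0 w J1) (p0 w J2) (p0 w J3)
      c0 c2 c3 kb (h2 w) (h3 w)).
- exists (C * C1 * C3) => t w ht; have kb := hC t (point p.2 w J2).2 ht.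
  rewrite (normrM (kernp _ _)) /krest (normrM (kernp _ _) (kernp _ _)) mulrA E.
  rewrite [poisson_profile _ * poisson_profile _]mulrC.
  exact: (ler_pM3 (normr_ge0 _) (normr_ge0 _) (normr_ge0 _) (p0 w J2) (p0 w J1) (p0 w J3)
      c0 c1 c3 kb (h1 w) (h3 w)).
- exists (C * C1 * C2) => t w ht; have kb := hC t (point p.2 w J3).2 ht.
  rewrite (normrM (kernp _ _)) /krest (normrM (kernp _ _) (kernp _ _)) mulrA E.
  rewrite [X in _ <= _ * X]mulrC [X in _ <= _ * X]mulrA.
  exact: (ler_pM3 (normr_ge0 _) (normr_ge0 _) (normr_ge0 _) (p0 w J3) (p0 w J1) (p0 w J2)
      c0 c1 c2 kb (h1 w) (h2 w)).
Qed.

Lemma integrable_line_integrand kap (g : R2m -> R) p j a t (M : R) : measurable_fun setT g ->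
  positive p -> (forall y, `|g y| <= M) -> `|t| < Num.min 1 (radius p.2 j / 2) ->
  lebesgue_R3m.-integrable setT (EFin \o line_integrand kap g p j a t).
Proof.
move=> mg pos gM ht; have [C hC] := line_integrand_bound kap j a pos gM.
apply: (@le_integrable_prof3 _ C); first exact: measurable_line_integrand.
by move=> w; exact: hC.
Qed.

Lemma moved_gt0 a t (r : R) (w : Rm) : 0 < r -> `|t| < Num.min 1 (r / 2) ->
  0 < (moved a t (r, w)).1.
Proof.
move=> r0; rewrite lt_min => /andP[_]; rewrite ltr_norml => /andP[h _].
by case: a => [i|] //=; lra.
Qed.

Lemma pointE r w j : point r w j = (radius r j, (point r w j).2).
Proof. by case: j. Qed.

(** After [ext_line] only the j-th kernel depends on the parameter; the derivative passes under the
    integral, dominated by a multiple of the integrable [prof3]. *)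
Lemma is_derive_ext kap (g : R2m -> R) p j a k' (M : R) : measurable_fun setT g -> positive p ->
  (forall y, `|g y| <= M) ->
  (kap j = K0 /\ k' = K1 a) \/ (kap j = K1 a /\ k' = K2 a) ->
  is_derive p (dir j a) (ext kap g) (ext (upd kap j k') g p).
Proof.
move=> mg pos gM hk; apply: is_derive_cvg.
pose f := line_integrand kap g p j a.
pose d := Num.min 1 (radius p.2 j / 2).
have d0 : 0 < d by rewrite lt_min ltr01 divr_gt0//; exact: pos.
have inI (t : R) : t \in `]-d, d[ -> `|t| < d by rewrite in_itv ltr_norml.
have derf (t : R) (w : Rm * Rm * Rm) : `|t| < d -> is_derive t 1 (f ^~ w) (line_integrand (upd kap
  j k') g p j a t w).
  move=> td; rewrite /f /line_integrand upd_same krest_upd.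
  have tp : 0 < (moved a t (point p.2 w j)).1 by rewrite pointE; apply: moved_gt0 => //; exact: pos.
  have dk : is_derive t 1 (fun t => kernp (kap j) (moved a t (point p.2 w j)))
      (kernp k' (moved a t (point p.2 w j))).
    by case: hk => -[-> ->]; [exact: is_derive_kern01|exact: is_derive_kern12].
  have := is_derive_mul dk (is_derive_const t 1 (krest kap (point p.2 w) j * g (p.1 + twist w))).
  rewrite mulr0 addr0 !mulrA; apply: eq_is_derive => u; exact: mulrA.
have [C hC] := line_integrand_bound (upd kap j k') j a pos gM.
have G0 w : 0 <= `|C * prof3 w| by [].
have iG : lebesgue_R3m.-integrable setT (EFin \o (fun w => `|C * prof3 w|)).
  apply: (@le_integrable_prof3 _ `|C|).
    by apply: measurableT_comp => //; apply: measurable_funM => //; exact: measurable_prof3.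
  by move=> w; rewrite normr_id normrM (ger0_norm (prof3_ge0 w)).
have I0 : `](- d), d[%classic 0 by rewrite /= in_itv /= oppr_lt0 d0.
have intf (t : R) : `](- d), d[%classic t -> lebesgue_R3m.-integrable setT (EFin \o f t).
  by move=> /inI td; exact: integrable_line_integrand mg pos gM td.
have derf1 (t : R) w : `](- d), d[%classic t -> setT w -> derivable (f ^~ w) t 1.
  by move=> /inI td _; have [] := derf t w td.
have Gub (t : R) w : `](- d), d[%classic t -> setT w -> `|partial1of2 f t w| <= `|C * prof3 w|.
  move=> /inI td _; rewrite partial1of2E; have [_ ->] := derf t w td.
  exact: le_trans (hC _ _ td) (ler_norm _).
have := cvg_differentiation_under_integral measurableT I0 intf derf1 G0 iG Gub.
have -> : \int[lebesgue_R3m]_w (partial1of2 f 0 w) = ext (upd kap j k') g p.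
  have := ext_line (upd kap j k') p j a 0 mg; rewrite scale0r addr0 => ->.
  apply: eq_Rintegral => w _; rewrite partial1of2E.
  by have [_ ->] := derf 0 w (inI _ I0).
have -> : (fun h : R => h^-1 *: (ext kap g (h *: dir j a + p) - ext kap g p)) =
    (fun h : R => h^-1 *: (\int[lebesgue_R3m]_w f (h + 0) w - \int[lebesgue_R3m]_w f 0 w)).
  apply/funext => h; congr (_ *: (_ - _)); first by rewrite addr0 addrC ext_line.
  by have := ext_line kap p j a 0 mg; rewrite scale0r addr0.
by [].
Qed.

End lifted_extension.

Section lifted_extension_estimates.
Context {R : realType} {m : nat}.
Local Notation Rm := 'rV[R]_m.
Local Notation R2m := (Rm * Rm)%type.
Local Notation mR := (measurableTypeR R).
Local Notation jet := (@jet m).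
Local Notation prof3 := (@prof3 R m).
Local Notation kap0 := (fun _ : idx3 => @K0 m).
Implicit Types (kap : idx3 -> jet) (j : idx3) (a : option 'I_m) (g : R2m -> R).

Lemma radius_dir (p : R2m * (R * R * R)) j a t j' :
  radius (p + t *: dir j a).2 j' =
  radius p.2 j' + (if a is None then (match j, j' with J1, J1 | J2, J2 | J3, J3 => t | _, _ => 0
    end) else 0).
Proof.
by move: p => [[y1 y2] [[r1 r2] r3]]; case: a => [i|]; case: j; case: j' => /=;
  rewrite /GRing.scale /= ?mulr0 ?mulr1 ?addr0.
Qed.

(** Continuity of a second derivative along its own direction is exactly what the fundamental
    theorem of calculus consumes later. The kernel [K2] is still differentiable, and domination
    transfers the continuity to the integral. *)
Lemma ext_line_continuous kap g p j a (M : R) : measurable_fun setT g -> positive p ->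
  (forall y, `|g y| <= M) -> kap j = K2 a ->
  {for 0, continuous (fun t : R => ext kap g (p + t *: dir j a))}.
Proof.
move=> mg pos gM hk.
pose d := Num.min 1 (radius p.2 j / 2).
have d0 : 0 < d by rewrite lt_min ltr01 divr_gt0//; exact: pos.
have inI (t : R) : t \in `]-d, d[ -> `|t| < d by rewrite in_itv ltr_norml.
have I0 : 0 \in (`](- d), d[%classic : set R).
  by rewrite inE /= in_itv /= oppr_lt0 d0.
have [C hC] := line_integrand_bound kap j a pos gM.
have iG := integrableZl measurableT C (@integrable_prof3 R m).
have intf (t : R) : `](- d), d[%classic t -> lebesgue_R3m.-integrable setT (EFin \o line_integrand
  kap g p j a t).
  by move=> /inI td; exact: integrable_line_integrand mg pos gM td.
have cf : {ae lebesgue_R3m, forall w, setT w ->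
    {in `](- d), d[%classic, continuous ((line_integrand kap g p j a) ^~ w)}}.
  apply: aeW => w _ t; rewrite inE => /inI td.
  have tp : 0 < (moved a t (point p.2 w j)).1 by rewrite pointE; apply: moved_gt0 => //; exact: pos.
  have [e he] := is_derive_kern2 tp; rewrite -hk in he.
  have := is_derive_mul he (is_derive_const t 1 (krest kap (point p.2 w) j * g (p.1 + twist w))).
  move=> [h _]; move: h => /derivable1_diffP/differentiable_continuous.
  rewrite /continuous_at /line_integrand; under [in X in _ -> X]eq_fun do rewrite -mulrA.
  by rewrite -mulrA.
have gub (t : R) : `](- d), d[%classic t -> {ae lebesgue_R3m, forall w, setT w ->
    `|line_integrand kap g p j a t w| <= C * prof3 w}.
  by move=> /inI td; apply: aeW => w _; exact: hC.
have := continuity_under_integral measurableT intf cf iG gub I0.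
have -> : (fun t : R => ext kap g (p + t *: dir j a)) =
    (fun t => \int[lebesgue_R3m]_w line_integrand kap g p j a t w).
  by apply/funext => t; rewrite ext_line.
by [].
Qed.

(** A signed integral is the difference of two nonnegative ones, each jointly measurable in (y, r)
    by Tonelli. *)
Lemma measurable_ext kap g : measurable_fun setT g ->
  measurable_fun setT (ext kap g : R2m * (mR * mR * mR) -> R).
Proof.
move=> mg; have mF := measurable_ext_integrand kap mg.
have mE : measurable_fun setT (fun z : (R2m * (mR * mR * mR)) * (Rm * Rm * Rm) =>
  (kprod kap (point z.1.2 z.2) * g (z.1.1 + twist z.2))%:E) by exact/measurable_EFinP.
apply: (measurableT_comp (fine_measurable measurableT)
  (g := fun p : R2m * (mR * mR * mR) => (\int[lebesgue_R3m]_w (kprod kap (point p.2 w) * g (p.1 +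
    twist w))%:E)%E)).
under eq_fun do rewrite integralE.
apply: emeasurable_funB.
  apply: (@measurable_fun_fubini_tonelli_F _ _ _ _ _ lebesgue_R3m (fun z : (R2m * (mR * mR * mR))
    * (Rm * Rm * Rm) => (fun w => (kprod kap (point z.1.2 w) * g (z.1.1 + twist w))%:E)^\+%E z.2)).
    under eq_fun do rewrite funeposE.
    exact: measurable_maxe.
  by move=> z; exact: funepos_ge0.
apply: (@measurable_fun_fubini_tonelli_F _ _ _ _ _ lebesgue_R3m (fun z : (R2m * (mR * mR * mR)) *
  (Rm * Rm * Rm) => (fun w => (kprod kap (point z.1.2 w) * g (z.1.1 + twist w))%:E)^\-%E z.2)).
  under eq_fun do rewrite funenegE.
  by apply: measurable_maxe => //; exact: measurableT_comp.
by move=> z; exact: funeneg_ge0.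
Qed.

Lemma measurable_ext_integrand_w kap g (p : R2m * (R * R * R)) : measurable_fun setT g ->
  measurable_fun setT (fun w => kprod kap (point p.2 w) * g (p.1 + twist w)).
Proof.
move=> mg; have := measurable_line_integrand kap p J1 None 0 mg.
apply: eq_measurable_fun => w _.
by rewrite /line_integrand moved0 (kprodE _ _ J1).
Qed.

Lemma integrable_ext_integrand kap g (p : R2m * (R * R * R)) (M : R) : measurable_fun setT g ->
  positive p -> (forall y, `|g y| <= M) ->
  lebesgue_R3m.-integrable setT (EFin \o (fun w => kprod kap (point p.2 w) * g (p.1 + twist w))).
Proof.
move=> mg pos gM.
have h0 : `|0 : R| < Num.min 1 (radius p.2 J1 / 2).
  by rewrite normr0 lt_min ltr01 divr_gt0//; exact: pos.
have := integrable_line_integrand kap None mg pos gM h0.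
apply: eq_integrable => // w _; congr EFin.
by rewrite /line_integrand moved0 (kprodE _ _ J1).
Qed.

Lemma ext_harmonic kap g p j (M : R) : measurable_fun setT g -> positive p ->
  (forall y, `|g y| <= M) -> \sum_(a : option 'I_m) ext (upd kap j (K2 a)) g p = 0.
Proof.
move=> mg pos gM.
have int1 a := integrable_ext_integrand (upd kap j (K2 a)) mg pos gM.
suff : ((\sum_(a : option 'I_m) ext (upd kap j (K2 a)) g p)%:E = 0)%E by case.
rewrite -sumEFin.
transitivity (\sum_(a : option 'I_m) \int[lebesgue_R3m]_w (kprod (upd kap j (K2 a)) (point p.2 w)
  * g (p.1 + twist w))%:E)%E.
  by apply: eq_bigr => a _; rewrite fineK//; exact: integrable_fin_num (int1 a).
rewrite -integral_sum//.
apply: integral0_eq => w _; rewrite sumEFin; congr EFin.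
under eq_bigr do rewrite (kprodE _ _ j) upd_same krest_upd -mulrA.
rewrite -mulr_suml kern_harmonic ?mul0r//.
by rewrite pointE; exact: pos.
Qed.

Lemma ext_bound kap (a b : R) : 0 < a -> a <= b -> exists2 C : R, 0 <= C &
  forall g (M : R) p, measurable_fun setT g -> (forall y, `|g y| <= M) ->
    (forall j, a <= radius p.2 j <= b) -> `|ext kap g p| <= C * M.
Proof.
move=> a0 ab; have [C C0 hC] := kprod_bound kap a0 ab.
pose I := \int[lebesgue_R3m]_w (prof3 w).
have I0 : 0 <= I by apply: Rintegral_ge0 => w _; exact: prof3_ge0.
exists (C * I); first by rewrite mulr_ge0// ltW.
move=> g M p mg gM hp.
have pos : positive p by move=> j; have /andP[h _] := hp j; exact: lt_le_trans h.
have M0 : 0 <= M by apply: le_trans (gM 0).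
have int1 := integrable_ext_integrand kap mg pos gM.
apply: le_trans (le_normr_Rintegral measurableT int1) _.
have iG := integrableZl measurableT (C * M) (@integrable_prof3 R m).
have -> : C * I * M = \int[lebesgue_R3m]_w (C * M * prof3 w).
  by rewrite (RintegralZl _ measurableT (@integrable_prof3 R m)) mulrAC.
apply: le_Rintegral => //.
  by have := integrable_norm int1; apply: eq_integrable.
move=> w _; rewrite normrM mulrAC.
by apply: ler_pM => //; exact: hC.
Qed.

(** Young's inequality: integrating in y first, translation invariance produces the norm of [g], and
    the kernel is dominated by an integrable function uniformly over the radii in [a, b]. *)
Lemma ext_L1 kap (a b : R) : 0 < a -> a <= b -> exists2 C : R, 0 <= C &
  forall g (M : R) r, measurable_fun setT g -> (forall y, `|g y| <= M) ->
    (forall j, a <= radius r j <= b) ->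
    (\int[lebesgue_R2m]_y `|ext kap g (y, r)|%:E <= C%:E * \int[lebesgue_R2m]_y `|g y|%:E)%E.
Proof.
move=> a0 ab; have [C C0 hC] := kprod_bound kap a0 ab.
pose I := \int[lebesgue_R3m]_w (prof3 w).
have I0 : 0 <= I by apply: Rintegral_ge0 => w _; exact: prof3_ge0.
exists (C * I); first by rewrite mulr_ge0// ltW.
move=> g M r mg gM hr.
have ngm : measurable_fun setT (fun y => `|g y|%:E : \bar R).
  by apply/measurable_EFinP; exact: measurableT_comp.
pose H (y : R2m) (w : Rm * Rm * Rm) : \bar R := ((C * prof3 w) * `|g (y + twist w)|)%:E.
have H0 y w : (0 <= H y w)%E by rewrite lee_fin mulr_ge0// (mulr_ge0 (ltW C0) (prof3_ge0 w)).
have mH : measurable_fun setT (fun z : R2m * (Rm * Rm * Rm) => H z.1 z.2).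
  apply/measurable_EFinP; apply: measurable_funM.
    apply: measurable_funM => //.
    by apply: (measurableT_comp measurable_prof3); exact: measurable_snd.
  apply: measurableT_comp => //; apply: (measurableT_comp mg).
  apply: measurable_funD_pair; first exact: measurable_fst.
  by apply: (measurableT_comp measurable_twist); exact: measurable_snd.
have mHy y : measurable_fun setT (H y).
  apply/measurable_EFinP; apply: measurable_funM.
    by apply: measurable_funM => //; exact: measurable_prof3.
  apply: measurableT_comp => //; apply: (measurableT_comp mg).
  by apply: measurable_funD_pair => //; exact: measurable_twist.
apply: (@le_trans _ _ (\int[lebesgue_R2m]_y \int[lebesgue_R3m]_w H y w)%E).
  apply: ge0_le_integral => //.
  - apply/measurable_EFinP; apply: measurableT_comp => //.
    by apply: (measurableT_comp (measurable_ext kap mg)); exact: pair2_measurable.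
  - exact: (@measurable_fun_fubini_tonelli_F _ _ _ _ _ lebesgue_R3m (fun z : R2m * (Rm * Rm * Rm)
    => H z.1 z.2)).
  move=> y _.
  have pos : positive (y, r) by move=> j; have /andP[h _] := hr j; exact: lt_le_trans h.
  have int1 := integrable_ext_integrand kap mg pos gM.
  rewrite /ext (EFin_normr_Rintegral measurableT int1).
  apply: le_trans (le_abse_integral _ _ _) _ => //; first exact: measurable_int int1.
  apply: ge0_le_integral => //.
  - by apply: measurableT_comp => //; exact: measurable_int int1.
  move=> w _ /=; rewrite lee_fin normrM.
  by apply: ler_pM => //; exact: hC.
rewrite [leLHS](@fubini_tonelli _ _ _ _ _ lebesgue_R2m lebesgue_R3m (fun z : R2m * (Rm * Rm * Rm)
  => H z.1 z.2))//.
pose N := (\int[lebesgue_R2m]_y `|g y|%:E)%E.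
have N0 : (0 <= N)%E by apply: integral_ge0.
have mC : measurable_fun setT (fun w => (C * prof3 w)%:E).
  by apply/measurable_EFinP; apply: measurable_funM => //; exact: measurable_prof3.
have C0w w : 0 <= C * prof3 w by rewrite mulr_ge0 ?prof3_ge0// ltW.
apply: (@le_trans _ _ (\int[lebesgue_R3m]_w ((C * prof3 w)%:E * N))%E).
  rewrite le_eqVlt; apply/orP; left; apply/eqP; apply: eq_integral => w _ /=.
  rewrite /N -(ge0_integral_R2m_translation (twist w) ngm)//.
  have mt : measurable_fun setT (fun y : R2m => `|g (y + twist w)|%:E : \bar R).
    by apply: (measurableT_comp ngm); apply: measurable_funD_pair.
  by rewrite -(ge0_integralZl_EFin _ _ _ mt (C0w w)).
rewrite [leLHS](_ : _ = (\int[lebesgue_R3m]_w (C * prof3 w)%:E) * N)%E; last first.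
  by apply: ge0_integralZr => // w _; rewrite lee_fin.
have -> : (\int[lebesgue_R3m]_w (C * prof3 w)%:E = (C * I)%:E)%E; last by [].
rewrite /I -(RintegralZl C measurableT (@integrable_prof3 R m)) fineK//.
have := integrableZl measurableT C (@integrable_prof3 R m).
exact: integrable_fin_num.
Qed.

Lemma ext_ge0 g (p : R2m * (R * R * R)) : positive p -> (forall y, 0 <= g y) ->
  0 <= ext kap0 g p.
Proof.
move=> pos g0; apply: Rintegral_ge0 => w _; rewrite mulr_ge0//.
by rewrite /kprod !mulr_ge0// kernpE ltW// kern0_gt0// (pointE _ _ J1, pointE _ _ J2, pointE _ _
  J3); exact: pos.
Qed.

Lemma kprod0_gt0 (r : R * R * R) w : (forall j, 0 < radius r j) ->
  0 < kprod kap0 (point r w) :> R.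
Proof.
move=> pos; have h j : 0 < kernp (@K0 m) (point r w j).
  by rewrite kernpE pointE kern0_gt0//; exact: pos.
by rewrite /kprod !mulr_gt0.
Qed.

Lemma integral_kprod0 (r : R * R * R) : (forall j, 0 < radius r j) ->
  (\int[lebesgue_R3m]_w (kprod kap0 (point r w))%:E = 1)%E.
Proof.
move=> pos.
have E w : kprod kap0 (point r w) = poisson r.1.1 w.1.1 * poisson r.1.2 w.1.2 * poisson r.2 w.2.
  rewrite /kprod !kernpE !kern0E /=; [|exact: (pos J3)|exact: (pos J2)|exact: (pos J1)].
  by rewrite /poisson !scalerN !profileN.
under eq_integral do rewrite E.
have p1 : 0 < r.1.1 := pos J1; have p2 : 0 < r.1.2 := pos J2; have p3 : 0 < r.2 := pos J3.
rewrite (ge0_integral_tensor (measurable_poisson _) (measurable_poisson _)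
  (measurable_poisson _) (fun w => ltW (poisson_gt0 w p1)) (fun w => ltW (poisson_gt0 w p2))
  (fun w => ltW (poisson_gt0 w p3))).
by rewrite (integral_poisson1 p1) (integral_poisson1 p2) (integral_poisson1 p3) !mul1e.
Qed.

Lemma ext_indic_le1 (A : set R2m) (p : R2m * (R * R * R)) : positive p -> measurable A ->
  ext kap0 (\1_A : R2m -> R) p <= 1.
Proof.
move=> pos mA; have mg : measurable_fun setT (\1_A : R2m -> R) by exact: measurable_indic.
have gM y : `|\1_A y : R| <= 1 by rewrite indicE; case: (y \in A); rewrite ?normr1 ?normr0.
have int1 := integrable_ext_integrand kap0 mg pos gM.
rewrite -lee_fin fineK; last exact: integrable_fin_num int1.
rewrite -(integral_kprod0 pos); apply: ge0_le_integral => //.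
- by move=> w _; rewrite lee_fin mulr_ge0// ltW// kprod0_gt0.
- exact: measurable_int int1.
- apply/measurable_EFinP.
  have := measurable_ext_integrand_w kap0 p (measurable_cst (1 : R)).
  by apply: eq_measurable_fun => w _; rewrite mulr1.
by move=> w _; rewrite lee_fin ler_piMr ?(ltW (kprod0_gt0 _ _)).
Qed.

End lifted_extension_estimates.

Lemma mvt_bound {R : realType} (phi phi' : R -> R) (L t : R) :
  (forall s : R, `|s| <= `|t| -> is_derive s 1 phi (phi' s)) ->
  (forall s : R, `|s| <= `|t| -> `|phi' s| <= L) -> `|phi t - phi 0| <= L * `|t|.
Proof.
move=> dphi bphi.
have cont (a b : R) : (forall s : R, s \in `[a, b] -> `|s| <= `|t|) -> {within `[a, b], continuous
  phi}.
  move=> h; apply: derivable_within_continuous => s sab.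
  by have [] := dphi s (h s sab).
have [t0|t0] := leP 0 t.
  have h (s : R) : s \in `[0, t] -> `|s| <= `|t|.
    by rewrite in_itv /= => /andP[s0 st]; rewrite !ger0_norm.
  have [|c hc ->] := @MVT_segment R phi phi' 0 t t0 _ (cont _ _ h).
    move=> s s0t; apply: dphi; apply: h; exact: subset_itv_oo_cc s0t.
  by rewrite subr0 normrM ler_wpM2r// bphi// h.
have h (s : R) : s \in `[t, 0] -> `|s| <= `|t|.
  by rewrite in_itv /= => /andP[ts s0]; rewrite (ler0_norm s0) (ler0_norm (ltW t0)) lerN2.
have [|c hc E] := @MVT_segment R phi phi' t 0 (ltW t0) _ (cont _ _ h).
  move=> s s0t; apply: dphi; apply: h; exact: subset_itv_oo_cc s0t.
rewrite distrC E sub0r normrM normrN ler_wpM2r// bphi// h//.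
Qed.

Lemma is_derive_line {R : realType} {V : normedModType R} (f : V -> R) (p v : V) (t d : R) :
  is_derive (p + t *: v) v f d -> is_derive t 1 (fun s : R => f (p + s *: v)) d.
Proof.
move=> [df <-]; apply: is_derive_cvg.
have := df; rewrite /derivable => /cvg_ex [l hl].
have -> : 'D_v f (p + t *: v) = l by apply: cvg_lim.
have -> : (fun h : R => h^-1 *: (f (p + (h *: 1 + t) *: v) - f (p + t *: v))) =
    (fun h : R => h^-1 *: (f (h *: v + (p + t *: v)) - f (p + t *: v))).
  apply/funext => h; congr (_ *: (f _ - _)).
  by rewrite [h *: 1]mulr1 scalerDl addrCA.
by [].
Qed.

(** * The derivative along the diagonal as the sum of the two partial derivatives *)

Section mixed_derivative.
Context {R : realType} {m : nat}.
Local Notation Rm := 'rV[R]_m.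
Local Notation R2m := (Rm * Rm)%type.
Local Notation jet := (@jet m).
Local Notation kap0 := (fun _ : idx3 => @K0 m).
Variables (g : R2m -> R) (M : R).
Hypotheses (mg : measurable_fun setT g) (gM : forall y, `|g y| <= M).
Implicit Types (p : R2m * (R * R * R)).

Lemma positive_bounds p : positive p -> exists a b : R,
  [/\ 0 < a, a <= b & forall j, a <= radius p.2 j <= b].
Proof.
move=> pos; pose x := radius p.2 J1; pose y := radius p.2 J2; pose z := radius p.2 J3.
exists (Num.min x (Num.min y z)), (Num.max x (Num.max y z)).
have x0 := pos J1; have y0 := pos J2; have z0 := pos J3.
split.
- by rewrite !lt_min x0 y0 z0.
- by apply: (@le_trans _ _ x); rewrite ?ge_min ?le_max lexx.
- by case; rewrite !ge_min !le_max !lexx ?orbT.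
Qed.

(** A spatial displacement leaves the radii unchanged, and the bound on the derivative depends on
    them only; hence [L] is uniform in [y]. *)
Lemma ext_lipschitz (kap : idx3 -> jet) p j i k' : positive p ->
  (kap j = K0 /\ k' = K1 (Some i)) \/ (kap j = K1 (Some i) /\ k' = K2 (Some i)) ->
  exists2 L : R, 0 <= L & forall y (t : R),
    `|ext kap g ((y, p.2) + t *: dir j (Some i)) - ext kap g (y, p.2)| <= L * `|t|.
Proof.
move=> pos hk; have [a [b [a0 ab hab]]] := positive_bounds pos.
have [C C0 hC] := ext_bound (upd kap j k') a0 ab.
have M0 : 0 <= M by apply: le_trans (gM 0).
exists (C * M); first by rewrite mulr_ge0.
move=> y t; pose q s := (y, p.2) + s *: dir j (Some i) : R2m * (R * R * R).
have rq s j' : radius (q s).2 j' = radius p.2 j' by rewrite radius_dir /= addr0.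
have pq s : positive (q s) by move=> j'; rewrite rq; exact: pos.
have q0E : q 0 = (y, p.2) by rewrite /q scale0r addr0.
have := @mvt_bound R (fun s => ext kap g (q s)) (fun s => ext (upd kap j k') g (q s)) (C * M) t.
rewrite q0E; apply.
  move=> s _; apply: is_derive_line; exact: (is_derive_ext mg (pq s) gM hk).
by move=> s _; apply: hC => // j'; rewrite rq.
Qed.

Lemma ext_taylor (kap : idx3 -> jet) p j i : positive p -> kap j = K0 ->
  exists2 L : R, 0 <= L & forall y (t : R),
    `|ext kap g ((y, p.2) + t *: dir j (Some i)) - ext kap g (y, p.2)
      - t * ext (upd kap j (K1 (Some i))) g (y, p.2)| <= L * t ^+ 2.
Proof.
move=> pos hk.
have hk1 : ((upd kap j (K1 (Some i))) j = K0 /\ K2 (Some i) = K1 (Some i)) \/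
   ((upd kap j (K1 (Some i))) j = K1 (Some i) /\ K2 (Some i) = K2 (Some i)).
  by right; rewrite upd_same.
have [L L0 hL] := ext_lipschitz pos hk1.
exists L => // y t; pose q s := (y, p.2) + s *: dir j (Some i) : R2m * (R * R * R).
pose D := ext (upd kap j (K1 (Some i))) g.
have rq s j' : radius (q s).2 j' = radius p.2 j' by rewrite radius_dir /= addr0.
have pq s : positive (q s) by move=> j'; rewrite rq; exact: pos.
have := @mvt_bound R (fun s => ext kap g (q s) - s * D (y, p.2))
  (fun s => D (q s) - D (y, p.2)) (L * `|t|) t.
have q0E : q 0 = (y, p.2) by rewrite /q scale0r addr0.
have -> : L * `|t| * `|t| = L * t ^+ 2 by rewrite -mulrA -expr2 real_normK ?num_real.
rewrite -/D; set G := L * t ^+ 2.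
have -> : ext kap g (q t) - ext kap g (y, p.2) - t * D (y, p.2) =
    ext kap g (q t) - t * D (y, p.2) - (ext kap g (q 0) - 0 * D (y, p.2)).
  by rewrite q0E mul0r subr0 addrAC.
apply.
  move=> s _.
  have d1 : is_derive s 1 (fun s => ext kap g (q s)) (D (q s)).
    by apply: is_derive_line; apply: (is_derive_ext mg (pq s) gM); left.
  have d2 := is_derive_mul (is_derive_var s) (is_derive_const s 1 (D (y, p.2))).
  have := is_derive_add d1 (is_derive_opp d2).
  by rewrite mul1r mulr0 addr0.
move=> s st; apply: le_trans (hL y s) _.
by rewrite ler_wpM2l.
Qed.

(** Directional derivatives alone need not be additive in the direction. The diagonal step is split
    into a step along [J2] to the point [q] and one along [J1]; Taylor's bound controls each up to
    h^2, and the Lipschitz bound brings the [J1] derivative from [q] back to [p]. *)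
Lemma ext_sum_rule p i : positive p ->
  ext (upd kap0 J3 (K1 (Some i))) g p =
  ext (upd kap0 J1 (K1 (Some i))) g p + ext (upd kap0 J2 (K1 (Some i))) g p.
Proof.
move=> pos; set d1 := ext (upd kap0 J1 _) g; set d2 := ext (upd kap0 J2 _) g.
have [_ D3] := is_derive_ext (kap := kap0) (j := J3) (a := Some i) (k' := K1 (Some i))
  mg pos gM (or_introl (conj erefl erefl)).
rewrite -D3; apply: derive_val.
have [L1 L10 h1] := ext_taylor i pos (erefl (kap0 J1)).
have [L2 L20 h2] := ext_taylor i pos (erefl (kap0 J2)).
have hk12 : ((upd kap0 J1 (K1 (Some i))) J2 = K0 /\ K1 (Some i) = K1 (Some i)) \/
   ((upd kap0 J1 (K1 (Some i))) J2 = K1 (Some i) /\ K1 (Some i) = K2 (Some i)) by left.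
have [L3 L30 h3] := ext_lipschitz pos hk12.
apply: is_derive_cvg; apply/cvgrPdist_le => e e0.
pose L := L1 + L2 + L3; have L1_0 : 0 < L + 1 by rewrite ltr_wpDl// !addr_ge0.
near=> h.
have h0 : h != 0 by near: h; exact: nbhs_dnbhs_neq.
pose F := ext kap0 g; pose q := p + h *: dir J2 (Some i).
have qE : q = (q.1, p.2).
  rewrite {1}[q]surjective_pairing; congr (_, _).
  have -> : q.2 = p.2 + h *: (0 : R * R * R) by [].
  by rewrite scaler0 addr0.
have pE : p = (p.1, p.2) by case: (p).
have E3 : h *: dir J3 (Some i) + p = (q.1, p.2) + h *: dir J1 (Some i).
  rewrite -qE /q addrC -addrA -scalerDr; congr (_ + _ *: _).
  by congr ((_, _), ((_, _), _)); rewrite ?addr0 ?add0r.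
have := h1 q.1 h; have := h2 p.1 h; have := h3 p.1 h.
rewrite -/d1 -/d2 -E3 -pE -qE -/q -/F => k3 k2 k1.
rewrite -[_ - _](mulKf h0) normrM normfV.
rewrite ler_pdivrMl ?normr_gt0//.
have -> : h * (d1 p + d2 p - h^-1 *: (F (h *: dir J3 (Some i) + p) - F p)) =
  - ((F (h *: dir J3 (Some i) + p) - F q - h * d1 q) + (F q - F p - h * d2 p) + h * (d1 q - d1 p)).
  by rewrite /GRing.scale /=; field.
rewrite normrN; apply: (@le_trans _ _ ((L1 + L2 + L3) * h ^+ 2)).
  apply: le_trans (ler_normD _ _) _; rewrite [leRHS]mulrDl; apply: lerD.
    by apply: le_trans (ler_normD _ _) _; rewrite [leRHS]mulrDl; apply: lerD.
  have -> : L3 * h ^+ 2 = `|h| * (L3 * `|h|).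
    by rewrite -[h ^+ 2]real_normK ?num_real// expr2 mulrCA mulrA.
  by rewrite [`|h * _|]normrM ler_wpM2l.
have -> : (L1 + L2 + L3) * h ^+ 2 = `|h| * ((L1 + L2 + L3) * `|h|).
  by rewrite -[h ^+ 2]real_normK ?num_real// expr2 mulrCA mulrA.
rewrite ler_wpM2l//.
have he : `|h| <= e / (L + 1) by near: h; apply: dnbhs0_le; exact: divr_gt0.
apply: (@le_trans _ _ ((L + 1) * `|h|)); first by rewrite ler_wpM2r// lerDl.
by rewrite -ler_pdivlMl// mulrC.
Unshelve. all: end_near.
Qed.

End mixed_derivative.

(** * Jets, harmonic functions and admissible weights *)

Section slab_bounds.
Context {R : realType} {m : nat}.
Local Notation Rm := 'rV[R]_m.
Local Notation R2m := (Rm * Rm)%type.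
Local Notation mR := (measurableTypeR R).
Local Notation P := (R2m * (R * R * R))%type.
Local Notation mP := (R2m * (mR * mR * mR))%type.
Implicit Types (F G : P -> R).

Definition slab (a b : R) (r : R * R * R) : Prop := forall j, a <= radius r j <= b.

Lemma slab_positive a b (p : P) : 0 < a -> slab a b p.2 -> positive p.
Proof. by move=> a0 h j; have /andP[h1 _] := h j; exact: lt_le_trans h1. Qed.

Definition slab_bounded F : Prop := measurable_fun setT (F : mP -> R) /\
  forall a b : R, 0 < a -> a <= b ->
    exists C : R, forall p, slab a b p.2 -> `|F p| <= C.

(** Only spatial slices are required to be integrable, with a norm uniform over the slab; Fubini
    over a bounded interval of radii then follows. *)
Definition slab_integrable F : Prop := forall a b : R, 0 < a -> a <= b ->
  exists C : R, forall r, slab a b r -> (\int[lebesgue_R2m]_y `|F (y, r)|%:E <= C%:E)%E.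

Lemma slab_bounded_cst (c : R) : slab_bounded (fun=> c).
Proof. by split=> // a b _ _; exists `|c|. Qed.

Lemma slab_boundedD F G : slab_bounded F -> slab_bounded G ->
  slab_bounded (fun p => F p + G p).
Proof.
move=> [mF bF] [mG bG]; split; first exact: measurable_funD.
move=> a b a0 ab; have [C hC] := bF a b a0 ab; have [D hD] := bG a b a0 ab.
exists (C + D) => p hp; apply: le_trans (ler_normD _ _) _.
by apply: lerD; [exact: hC|exact: hD].
Qed.

Lemma slab_boundedM F G : slab_bounded F -> slab_bounded G ->
  slab_bounded (fun p => F p * G p).
Proof.
move=> [mF bF] [mG bG]; split; first exact: measurable_funM.
move=> a b a0 ab; have [C hC] := bF a b a0 ab; have [D hD] := bG a b a0 ab.
exists (C * D) => p hp; rewrite normrM.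
by apply: ler_pM => //; [exact: hC|exact: hD].
Qed.

Lemma slab_bounded_sum (I : Type) (s : seq I) (F : I -> P -> R) :
  (forall i, slab_bounded (F i)) -> slab_bounded (fun p => \sum_(i <- s) F i p).
Proof.
move=> h; elim: s => [|i s IH].
  by have := slab_bounded_cst 0; congr slab_bounded; apply/funext => p; rewrite big_nil.
have := slab_boundedD (h i) IH.
by congr slab_bounded; apply/funext => p; rewrite big_cons.
Qed.

Lemma measurable_section F r : slab_bounded F -> measurable_fun setT (fun y : R2m => F (y, r)).
Proof. by move=> [mF _]; apply: (measurableT_comp mF); exact: pair2_measurable. Qed.

Lemma slab_integrable0 : slab_integrable (fun=> 0).
Proof.
by move=> a b a0 ab; exists 0 => r _; under eq_integral do rewrite normr0; rewrite integral0.
Qed.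

Lemma slab_integrableD F G : slab_bounded F -> slab_bounded G ->
  slab_integrable F -> slab_integrable G -> slab_integrable (fun p => F p + G p).
Proof.
move=> bF bG iF iG a b a0 ab; have [C hC] := iF a b a0 ab; have [D hD] := iG a b a0 ab.
exists (C + D) => r hr.
have mF := measurable_section r bF; have mG := measurable_section r bG.
have mnF : measurable_fun setT (fun y : R2m => `|F (y, r)|%:E : \bar R).
  by apply/measurable_EFinP; exact: measurableT_comp.
have mnG : measurable_fun setT (fun y : R2m => `|G (y, r)|%:E : \bar R).
  by apply/measurable_EFinP; exact: measurableT_comp.
apply: (@le_trans _ _ (\int[lebesgue_R2m]_y (`|F (y, r)|%:E + `|G (y, r)|%:E))%E).
  apply: ge0_le_integral => //.
  - by apply/measurable_EFinP; apply: measurableT_comp => //; exact: measurable_funD.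
  - exact: emeasurable_funD.
  - by move=> y _; rewrite -EFinD lee_fin ler_normD.
by rewrite ge0_integralD// EFinD leeD// ?hC// hD.
Qed.

Lemma slab_integrableM F G : slab_bounded F -> slab_bounded G ->
  slab_integrable F -> slab_integrable (fun p => F p * G p).
Proof.
move=> bF bG iF a b a0 ab; have [C hC] := iF a b a0 ab.
have [D hD] := bG.2 a b a0 ab; exists (`|D| * C) => r hr.
have mF := measurable_section r bF; have mG := measurable_section r bG.
have mnF : measurable_fun setT (fun y : R2m => `|F (y, r)|%:E : \bar R).
  by apply/measurable_EFinP; exact: measurableT_comp.
apply: (@le_trans _ _ (\int[lebesgue_R2m]_y (`|D|%:E * `|F (y, r)|%:E))%E).
  apply: ge0_le_integral => //.
  - by apply/measurable_EFinP; apply: measurableT_comp => //; exact: measurable_funM.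
  - exact: measurable_funeM.
  - move=> y _; rewrite -EFinM lee_fin normrM mulrC ler_wpM2r//.
    by apply: le_trans (ler_norm D); exact: (hD (y, r)).
by rewrite (ge0_integralZl_EFin _ _ _ mnF (normr_ge0 D))// EFinM lee_wpmul2l// hC.
Qed.

End slab_bounds.

Lemma line_continuous {R : realType} {V : normedModType R} (f : V -> R) (p v : V) (d : R) :
  is_derive p v f d -> {for 0, continuous (fun t : R => f (p + t *: v))}.
Proof.
move=> h; have h0 : is_derive (p + 0 *: v) v f d by rewrite scale0r addr0.
have [h1 _] := is_derive_line h0.
by move: h1 => /derivable1_diffP/differentiable_continuous.
Qed.

Section second_order.
Context {R : realType} {m : nat}.
Local Notation Rm := 'rV[R]_m.
Local Notation R2m := (Rm * Rm)%type.
Local Notation P := (R2m * (R * R * R))%type.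
Local Notation I := (option 'I_m).
Implicit Types (j : idx3).

(** Functions carry their first and pure second derivatives as data, so that the derivatives of sums
    and products are given by formulas. A Laplacian in one group of variables calls for no mixed
    derivatives. *)
Record jfun := Jfun { jval :> P -> R; jd1 : I -> P -> R; jd2 : I -> P -> R }.

Record jet2 j (F : jfun) : Prop := Jet2 {
  jet2_d1 : forall p a, positive p -> is_derive p (dir j a) (jval F) (jd1 F a p);
  jet2_d2 : forall p a, positive p -> is_derive p (dir j a) (jd1 F a) (jd2 F a p);
  jet2_cont : forall p a, positive p ->
    {for 0, continuous (fun t : R => jd2 F a (p + t *: dir j a))};
  jet2_b0 : slab_bounded F;
  jet2_b1 : forall a, slab_bounded (jd1 F a);
  jet2_b2 : forall a, slab_bounded (jd2 F a) }.

Record jint (F : jfun) : Prop := Jint {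
  jint0 : slab_integrable F;
  jint1 : forall a, slab_integrable (jd1 F a);
  jint2 : forall a, slab_integrable (jd2 F a) }.

Definition jcst (c : R) := Jfun (fun=> c) (fun _ _ => 0) (fun _ _ => 0).

Definition jadd (F G : jfun) := Jfun (fun p => F p + G p)
  (fun a p => jd1 F a p + jd1 G a p) (fun a p => jd2 F a p + jd2 G a p).

Definition jmul (F G : jfun) := Jfun (fun p => F p * G p)
  (fun a p => jd1 F a p * G p + F p * jd1 G a p)
  (fun a p => (jd2 F a p * G p + jd1 F a p * jd1 G a p) +
              (jd1 F a p * jd1 G a p + F p * jd2 G a p)).

Lemma jet2_cst j c : jet2 j (jcst c).
Proof.
split=> /=; try by move=> *; exact: slab_bounded_cst.
- by move=> p a _; exact: is_derive_const.
- by move=> p a _; exact: is_derive_const.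
- by move=> p a _; exact: cst_continuous.
Qed.

Lemma jet2_add j F G : jet2 j F -> jet2 j G -> jet2 j (jadd F G).
Proof.
move=> hF hG; split=> /=.
- by move=> p a pos; apply: is_derive_add; apply: jet2_d1.
- by move=> p a pos; apply: is_derive_add; apply: jet2_d2.
- by move=> p a pos; apply: cvgD; [exact: (jet2_cont hF)|exact: (jet2_cont hG)].
- exact: slab_boundedD (jet2_b0 hF) (jet2_b0 hG).
- by move=> a; exact: slab_boundedD (jet2_b1 hF a) (jet2_b1 hG a).
- by move=> a; exact: slab_boundedD (jet2_b2 hF a) (jet2_b2 hG a).
Qed.

Lemma jet2_mul j F G : jet2 j F -> jet2 j G -> jet2 j (jmul F G).
Proof.
move=> hF hG; split=> /=.
- by move=> p a pos; apply: is_derive_mul; apply: jet2_d1.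
- move=> p a pos; apply: is_derive_add; apply: is_derive_mul;
    by (apply: jet2_d1 || apply: jet2_d2).
- move=> p a pos.
  have cF := line_continuous (jet2_d1 hF a pos).
  have cG := line_continuous (jet2_d1 hG a pos).
  have cF1 := line_continuous (jet2_d2 hF a pos).
  have cG1 := line_continuous (jet2_d2 hG a pos).
  apply: cvgD; apply: cvgD; apply: cvgM;
    by [exact: cF|exact: cG|exact: cF1|exact: cG1|exact: (jet2_cont hF)|exact: (jet2_cont hG)].
- exact: slab_boundedM (jet2_b0 hF) (jet2_b0 hG).
- move=> a; exact: (slab_boundedD (slab_boundedM (jet2_b1 hF a) (jet2_b0 hG))
    (slab_boundedM (jet2_b0 hF) (jet2_b1 hG a))).
- have h11 a := slab_boundedM (jet2_b1 hF a) (jet2_b1 hG a).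
  move=> a; exact: (slab_boundedD
    (slab_boundedD (slab_boundedM (jet2_b2 hF a) (jet2_b0 hG)) (h11 a))
    (slab_boundedD (h11 a) (slab_boundedM (jet2_b0 hF) (jet2_b2 hG a)))).
Qed.

Lemma jint_cst0 : jint (jcst 0).
Proof. by split=> /= *; exact: slab_integrable0. Qed.

Lemma jint_add j F G : jet2 j F -> jet2 j G -> jint F -> jint G -> jint (jadd F G).
Proof.
move=> hF hG iF iG; split=> /= [|a|a].
- exact: slab_integrableD (jet2_b0 hF) (jet2_b0 hG) (jint0 iF) (jint0 iG).
- exact: slab_integrableD (jet2_b1 hF a) (jet2_b1 hG a) (jint1 iF a) (jint1 iG a).
- exact: slab_integrableD (jet2_b2 hF a) (jet2_b2 hG a) (jint2 iF a) (jint2 iG a).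
Qed.

(** One integrable factor is enough, since the derivatives of the other are bounded on slabs. This
    allows weights that do not tend to zero, such as the cut-off. *)
Lemma jint_mul j F G : jet2 j F -> jet2 j G -> jint F -> jint (jmul F G).
Proof.
move=> hF hG iF.
have h0 := jet2_b0 hF; have h1 := jet2_b1 hF; have h2 := jet2_b2 hF.
have g0 := jet2_b0 hG; have g1 := jet2_b1 hG; have g2 := jet2_b2 hG.
have b11 a := slab_boundedM (h1 a) (g1 a).
have i0 := slab_integrableM h0 g0 (jint0 iF).
have i11 a := slab_integrableM (h1 a) (g1 a) (jint1 iF a).
have i10 a := slab_integrableM (h1 a) g0 (jint1 iF a).
have i01 a := slab_integrableM h0 (g1 a) (jint0 iF).
have i20 a := slab_integrableM (h2 a) g0 (jint2 iF a).
have i02 a := slab_integrableM h0 (g2 a) (jint0 iF).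
have b10 a := slab_boundedM (h1 a) g0; have b01 a := slab_boundedM h0 (g1 a).
have b20 a := slab_boundedM (h2 a) g0; have b02 a := slab_boundedM h0 (g2 a).
split=> /= [|a|a].
- exact: i0.
- exact: slab_integrableD (b10 a) (b01 a) (i10 a) (i01 a).
- exact: (slab_integrableD (slab_boundedD (b20 a) (b11 a)) (slab_boundedD (b11 a) (b02 a))
    (slab_integrableD (b20 a) (b11 a) (i20 a) (i11 a))
    (slab_integrableD (b11 a) (b02 a) (i11 a) (i02 a))).
Qed.

Definition jext j (g : R2m -> R) (kap : idx3 -> @jet m) : jfun :=
  Jfun (ext kap g) (fun a => ext (upd kap j (K1 a)) g) (fun a => ext (upd kap j (K2 a)) g).

Lemma upd_upd {T : Type} (f : idx3 -> T) j x y : upd (upd f j x) j y = upd f j y.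
Proof. by apply/funext => i; case: j; case: i. Qed.

Section jext_properties.
Variables (g : R2m -> R) (M : R).
Hypotheses (mg : measurable_fun setT g) (gM : forall y, `|g y| <= M).

Lemma slab_bounded_ext kap : slab_bounded (ext kap g).
Proof.
split; first exact: measurable_ext.
move=> a b a0 ab; have [C _ hC] := ext_bound kap a0 ab.
by exists (C * M) => p hp; exact: hC.
Qed.

Lemma jet2_ext j kap : kap j = K0 -> jet2 j (jext j g kap).
Proof.
move=> k0; split=> /=; try by move=> *; exact: slab_bounded_ext.
- by move=> p a pos; apply: (is_derive_ext mg pos gM); left.
- move=> p a pos.
  have := @is_derive_ext R m (upd kap j (K1 a)) g p j a (K2 a) M mg pos gM.
  by rewrite upd_upd; apply; right; rewrite upd_same.
- by move=> p a pos; apply: (ext_line_continuous mg pos gM); rewrite upd_same.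
Qed.

Lemma slab_integrable_ext kap : (\int[lebesgue_R2m]_y `|g y|%:E < +oo)%E ->
  slab_integrable (ext kap g).
Proof.
move=> ig a b a0 ab; have [C C0 hC] := ext_L1 kap a0 ab.
exists (C * fine (\int[lebesgue_R2m]_y `|g y|%:E)) => r hr.
apply: le_trans (hC g M r mg gM hr) _.
by rewrite EFinM fineK// ge0_fin_numE// integral_ge0.
Qed.

End jext_properties.

End second_order.

(** * Powers of the positive part and their derivatives *)

Section ramp.
Context {R : realType}.

Definition ramp (x : R) : R := Num.max 0 x.

Lemma ramp_ge0 x : 0 <= ramp x. Proof. by rewrite /ramp le_max lexx. Qed.

Lemma ramp_le_norm x : ramp x <= `|x|.
Proof. by rewrite /ramp ge_max normr_ge0 ler_norm. Qed.

(** Trading one factor [ramp x] for [x] lets the derivatives of all powers be computed by the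
    product rule, starting from the square. *)
Lemma ramp_mulE x n : ramp x ^+ n.+2 = x * ramp x ^+ n.+1.
Proof.
rewrite exprS /ramp; have [x0|x0] := leP x 0; last by [].
by rewrite expr0n /= !mulr0.
Qed.

(** The error of the first-order expansion of the squared positive part is at most h^2 in absolute
    value, whatever the signs of x and x + h. *)
Lemma is_derive_ramp_sqr (x : R) : is_derive x 1 (fun z => ramp z ^+ 2) (2 * ramp x).
Proof.
apply: is_derive_cvg; apply/cvgrPdist_le => e e0; near=> h.
have h0 : h != 0 by near: h; exact: nbhs_dnbhs_neq.
have he : `|h| <= e by near: h; exact: dnbhs0_le.
rewrite -[_ - _](mulKf h0) [`|_ * _|]normrM normfV ler_pdivrMl ?normr_gt0//.
apply: (@le_trans _ _ (`|h| * `|h|)); last by rewrite ler_wpM2l.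
rewrite [h *: 1]mulr1 {1}/GRing.scale /= mulrBr mulVKf// -normrM ger0_norm -?expr2 ?sqr_ge0//.
rewrite ler_norml /ramp.
by case: (leP 0 x) => x0; case: (leP 0 (h + x)) => hx0; apply/andP; split; nra.
Unshelve. all: end_near.
Qed.

Lemma is_derive_ramp n (x : R) :
  is_derive x 1 (fun z => ramp z ^+ n.+2) (n.+2%:R * ramp x ^+ n.+1).
Proof.
elim: n => [|n IH]; first exact: is_derive_ramp_sqr.
have := is_derive_mul (is_derive_var x) IH.
have -> : 1 * ramp x ^+ n.+2 + x * (n.+2%:R * ramp x ^+ n.+1) = n.+3%:R * ramp x ^+ n.+2.
  have -> : n.+3%:R = 1 + n.+2%:R :> R by rewrite -natr1 addrC.
  rewrite ramp_mulE; move: (n.+2%:R : R) (ramp x ^+ n.+1) => N Q; ring.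
by apply: eq_is_derive => z; rewrite -ramp_mulE.
Qed.

End ramp.

Lemma is_derive_comp {R : realType} {V : normedModType R} (f : V -> R) (phi : R -> R)
    (p v : V) (d e : R) : is_derive p v f d -> is_derive (f p) 1 phi e ->
  is_derive p v (fun z => phi (f z)) (e * d).
Proof.
move=> hf hphi.
have h0 : is_derive (p + 0 *: v) v f d by rewrite scale0r addr0.
have h1 := is_derive_line h0.
have hphi0 : is_derive (f (p + 0 *: v)) 1 phi e by rewrite scale0r addr0.
have [D E] := @is_derive1_comp _ _ _ _ _ _ hphi0 h1.
apply: is_derive_cvg; rewrite -E.
have := D; rewrite /derivable => /cvg_ex[l hl].
have -> : 'D_1 (phi \o (fun s : R => f (p + s *: v))) 0 = l by apply: cvg_lim.
move: hl; rewrite /= scale0r addr0.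
have -> : (fun h : R => h^-1 *: ((phi \o (fun s : R => f (p + s *: v))) (h *: 1 + 0) - phi (f p))) =
    (fun h : R => h^-1 *: (phi (f (h *: v + p)) - phi (f p))).
  by apply/funext => h /=; rewrite [h *: 1]mulr1 addr0 [p + _]addrC.
by [].
Qed.

(** For w > 0 the choice x = w gives the claim. For w = 0 it says S <= 0, and a positive S is
    refuted by x = S / (c W + 1). *)
Lemma quadratic_optimum {R : realType} (c w W S : R) : 0 <= c -> 0 <= w -> 0 <= W ->
  (forall x : R, 2 * x * S <= w * S + c * x ^+ 2 * W) -> S <= c * w * W.
Proof.
move=> c0 w0 W0 h.
have cW : 0 <= c * W by rewrite mulr_ge0.
have [w1|w1] := ltP 0 w.
  have := h w; have -> : w * S + c * w ^+ 2 * W = w * S + w * (c * w * W) by ring.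
  by move=> h1; rewrite -(ler_pM2l w1); lra.
have w00 : w = 0 by apply/eqP; rewrite eq_le w1 w0.
rewrite w00 mulr0 mul0r leNgt; apply/negP => S0.
pose x := S / (c * W + 1); have cW1 : 0 < c * W + 1 by rewrite ltr_wpDl.
have x0 : 0 < x by rewrite divr_gt0.
have := h x; rewrite w00 mul0r add0r.
have -> : c * x ^+ 2 * W = x * (x * (c * W)) by ring.
have -> : 2 * x * S = x * (2 * S) by ring.
rewrite ler_pM2l// => h1.
have : x * (c * W + 1) = S by rewrite /x divfK// gt_eqF.
nra.
Qed.

Section admissible_weights.
Context {R : realType} {m : nat}.
Local Notation Rm := 'rV[R]_m.
Local Notation R2m := (Rm * Rm)%type.
Local Notation mR := (measurableTypeR R).
Local Notation P := (R2m * (R * R * R))%type.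
Local Notation mP := (R2m * (mR * mR * mR))%type.
Local Notation I := (option 'I_m).
Local Notation jet := (@jet m).
Local Notation kap0 := (fun _ : idx3 => @K0 m).
Implicit Types (j : idx3) (w W : P -> R) (s : seq (idx3 -> jet)).

(* The first inequality amounts to [\sum_a w_a ^+ 2 <= c * w * W]; in this form, linear
   in [(w, W)], it is stable under sums without recourse to Cauchy-Schwarz. *)
Definition admissible (c : R) j w W : Prop := exists F : jfun,
  [/\ jval F = w, jet2 j F, measurable_fun setT (W : mP -> R),
    forall p, 0 <= w p /\ 0 <= W p &
    forall p, positive p ->
      (forall (x : R) (xi : I -> R), 2 * x * (\sum_a xi a * jd1 F a p) <=
        w p * (\sum_a xi a ^+ 2) + c * x ^+ 2 * W p) /\
      - (c * W p) <= \sum_a jd2 F a p ].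

Lemma admissible_le c c' j w W : c <= c' -> admissible c j w W -> admissible c' j w W.
Proof.
move=> cc' [F [Fw hF mW hp h]]; exists F; split=> // p pos.
have [w0 W0] := hp p; have [h1 h2] := h p pos; split=> //.
- move=> x xi; apply: le_trans (h1 x xi) _.
  by rewrite lerD2l ler_wpM2r// ler_wpM2r// sqr_ge0.
- by apply: le_trans h2; rewrite lerN2 ler_wpM2r.
Qed.

Lemma admissible1 c j : admissible c j (fun=> 1) (fun=> 0).
Proof.
exists (jcst 1); split=> //; first exact: jet2_cst.
move=> p _ /=; split=> //; last by rewrite mulr0 oppr0 sumr_ge0.
move=> x xi; under eq_bigr do rewrite mulr0.
by rewrite big1// !mulr0 addr0 mul1r sumr_ge0// => a _; exact: sqr_ge0.
Qed.

Lemma admissible0 c j : admissible c j (fun=> 0) (fun=> 0).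
Proof.
exists (jcst 0); split=> //; first exact: jet2_cst.
move=> p _ /=; split=> //; last by rewrite mulr0 oppr0 sumr_ge0.
by move=> x xi; under eq_bigr do rewrite mulr0; rewrite big1// !mulr0 addr0 mul0r.
Qed.

Lemma admissible_add c j w W w' W' : admissible c j w W -> admissible c j w' W' ->
  admissible c j (fun p => w p + w' p) (fun p => W p + W' p).
Proof.
move=> [F [<- hF mW hp h]] [G [<- hG mW' hp' h']]; exists (jadd F G); split=> //.
- exact: jet2_add.
- exact: measurable_funD.
- by move=> p /=; have [w0 W0] := hp p; have [w0' W0'] := hp' p; rewrite !addr_ge0.
move=> p pos; have [h1 h2] := h p pos; have [h1' h2'] := h' p pos; split=> /=.
- move=> x xi; under eq_bigr do rewrite mulrDr.
  have := lerD (h1 x xi) (h1' x xi); rewrite big_split /= => H.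
  rewrite mulrDr; apply: le_trans H _; rewrite le_eqVlt; apply/orP; left; apply/eqP; ring.
- by rewrite big_split /= mulrDr opprD lerD.
Qed.

(** The Laplacian of w w' contains twice the scalar product of the two gradients. Testing the
    inequality for w against the gradient of w', then the one for w' against itself, bounds this
    cross term by c (W w' + w W'); the constant therefore doubles. *)
Lemma admissible_mul c j w W w' W' : 0 <= c -> admissible c j w W -> admissible c j w' W' ->
  admissible (2 * c) j (fun p => w p * w' p) (fun p => W p * w' p + w p * W' p).
Proof.
move=> c0 [F [<- hF mW hp h]] [G [<- hG mW' hp' h']]; exists (jmul F G); split=> //.
- exact: jet2_mul.
- apply: measurable_funD; apply: measurable_funM => //.
  + by have [] := jet2_b0 hG.
  + by have [] := jet2_b0 hF.
- by move=> p /=; have [w0 W0] := hp p; have [w0' W0'] := hp' p; rewrite addr_ge0 ?mulr_ge0.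
move=> p pos; have [h1 h2] := h p pos; have [h1' h2'] := h' p pos.
have [w0 W0] := hp p; have [w0' W0'] := hp' p; split=> /=.
- move=> x xi.
  have -> : \sum_a xi a * (jd1 F a p * G p + F p * jd1 G a p) =
      (\sum_a xi a * jd1 F a p) * G p + F p * (\sum_a xi a * jd1 G a p).
    rewrite mulr_suml mulr_sumr -big_split /=; apply: eq_bigr => a _; ring.
  (* At 2x both sides acquire a factor 2, which cancels: 4 c becomes 2 * (2 c). *)
  have k1 := ler_wpM2r w0' (h1 (2 * x) xi); have k2 := ler_wpM2l w0 (h1' (2 * x) xi).
  have := lerD k1 k2; set S1 := \sum_a xi a * jd1 F a p; set S2 := \sum_a xi a * jd1 G a p.
  set X := \sum_a xi a ^+ 2; move: (F p) (G p) (W p) (W' p) => f g1 V V' K.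
  have E1 : (2 * (2 * x) * S1) * g1 + f * (2 * (2 * x) * S2) =
    2 * (2 * x * (S1 * g1 + f * S2)) by ring.
  have E2 : (f * X + c * (2 * x) ^+ 2 * V) * g1 + f * (g1 * X + c * (2 * x) ^+ 2 * V') =
    2 * (f * g1 * X + 2 * c * x ^+ 2 * (V * g1 + f * V')) by ring.
  by move: K; rewrite E1 E2 ler_pM2l.
- pose T := \sum_a jd1 F a p * jd1 G a p.
  pose S := \sum_a jd1 G a p ^+ 2.
  have S0 : 0 <= S by apply: sumr_ge0 => a _; exact: sqr_ge0.
  have hS : S <= c * G p * W' p.
    apply: quadratic_optimum => // x; have := h1' x (fun a => jd1 G a p).
    by under eq_bigr do rewrite -expr2.
  have hT : - (2 * T) <= c * (W p * G p + F p * W' p).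
    (* The test x = - G p yields the bound after division by G p. If G p = 0, then S <= 0, so the
       gradient of G vanishes and the cross term with it. *)
    have [G0|G0] := ltP 0 (G p).
      have := h1 (- G p) (fun a => jd1 G a p).
      under eq_bigr do rewrite mulrC; rewrite -/T -/S => k.
      have k' := ler_wpM2l w0 hS.
      rewrite -(ler_pM2l G0).
      have -> : G p * - (2 * T) = 2 * - G p * T by ring.
      apply: le_trans k _.
      have -> : G p * (c * (W p * G p + F p * W' p)) =
        F p * (c * G p * W' p) + c * (- G p) ^+ 2 * W p by ring.
      by rewrite lerD2r.
    have G00 : G p = 0 by apply/eqP; rewrite eq_le G0 w0'.
    have S00 : S = 0.
      by apply/eqP; rewrite eq_le S0 andbT; move: hS; rewrite G00 mulr0 mul0r.
    have T0 : T = 0.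
      apply: big1 => a _; suff -> : jd1 G a p = 0 by rewrite mulr0.
      apply/eqP; rewrite -sqrf_eq0; apply/eqP.
      by move: S00 => /psumr_eq0P; apply => // i _; exact: sqr_ge0.
    by rewrite T0 mulr0 oppr0 !mulr_ge0// addr_ge0// mulr_ge0.
  have -> : \sum_a (jd2 F a p * G p + jd1 F a p * jd1 G a p +
      (jd1 F a p * jd1 G a p + F p * jd2 G a p)) =
      (\sum_a jd2 F a p) * G p + 2 * T + F p * (\sum_a jd2 G a p).
    rewrite mulr_suml mulr_sumr mulr_sumr -!big_split /=; apply: eq_bigr => a _; ring.
  have k1 := ler_wpM2r w0' h2; have k2 := ler_wpM2l w0 h2'.
  have := lerD k1 k2; move: hT.
  set A := (\sum_a jd2 F a p) * G p; set B := F p * (\sum_a jd2 G a p).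
  set V := W p * G p; set V' := F p * W' p.
  have -> : - (c * W p) * G p = - (c * V) by rewrite mulNr mulrA.
  have -> : F p * - (c * W' p) = - (c * V') by rewrite mulrN mulrCA.
  have -> : - (2 * c * (V + V')) = - (c * (V + V')) + (- (c * V) + - (c * V')) by ring.
  move: T A B => T A B k k'.
  have -> : A + 2 * T + B = 2 * T + (A + B) by ring.
  by apply: lerD => //; rewrite lerNl.
Qed.

Definition nsq (g : R2m -> R) s (p : P) : R := \sum_(k <- s) ext k g p ^+ 2.

(** A list of jets stands for a vector-valued function and [nsq] for its squared length; [nabla j]
    replaces each component by its gradient in the j-th group. *)
Definition nabla j s : seq (idx3 -> jet) :=
  [seq upd k j (K1 a) | k <- s, a <- index_enum I].

Lemma nsq_ge0 g s p : 0 <= nsq g s p.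
Proof. by apply: sumr_ge0 => k _; exact: sqr_ge0. Qed.

Lemma nsq_nabla g j s p :
  nsq g (nabla j s) p = \sum_(k <- s) \sum_a ext (upd k j (K1 a)) g p ^+ 2.
Proof. by rewrite /nsq /nabla big_allpairs_dep. Qed.

(** A component still at [K0] in the group j can be differentiated twice there and is harmonic
    there. Each group is differentiated at most once along the chain, so this can be maintained. *)
Fixpoint clean j s : Prop := if s is k :: s' then k j = K0 /\ clean j s' else True.

Lemma clean_cat j s s' : clean j s -> clean j s' -> clean j (s ++ s').
Proof. by elim: s => //= k s IH [-> /IH h] /h. Qed.

Lemma clean_nabla j j' s : j <> j' -> clean j s -> clean j (nabla j' s).
Proof.
move=> jj'; elim: s => //= k s IH [kj hs]; rewrite /nabla /=; apply: clean_cat; last exact: IH.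
elim: (index_enum I) => //= a l IHl; split=> //.
by case: j jj' kj {IH hs IHl}; case: j'.
Qed.

Section square_functions.
Variables (g : R2m -> R) (M : R).
Hypotheses (mg : measurable_fun setT g) (gM : forall y, `|g y| <= M).

Lemma slab_bounded_nsq s : slab_bounded (nsq g s).
Proof.
apply: slab_bounded_sum => k; have h := slab_bounded_ext mg gM k.
by have := slab_boundedM h h; congr slab_bounded; apply/funext => p; rewrite expr2.
Qed.

(** For X harmonic in the j-th group the gradient of X^2 has square 4 X^2 |nabla_j X|^2, whence the
    4, and its Laplacian 2 |nabla_j X|^2 is nonnegative. *)
Lemma admissible_sqr c j k : 4 <= c -> k j = K0 ->
  admissible c j (fun p => ext k g p ^+ 2) (fun p => \sum_a ext (upd k j (K1 a)) g p ^+ 2).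
Proof.
move=> c4 kj; apply: (admissible_le c4); have hY := jet2_ext mg gM kj.
exists (jmul (jext j g k) (jext j g k)); split=> //.
- exact: jet2_mul.
- have -> : (fun p : P => \sum_a ext (upd k j (K1 a)) g p ^+ 2) = nsq g (nabla j [:: k]).
    by apply/funext => p; rewrite nsq_nabla big_seq1.
  by have [] := slab_bounded_nsq (nabla j [:: k]).
- by move=> p; split; [exact: sqr_ge0|apply: sumr_ge0 => a _; exact: sqr_ge0].
move=> p pos; split=> [x xi|] /=.
- rewrite !mulr_sumr -big_split /=; apply: ler_sum => a _.
  set Y := ext k g p; set Z := ext _ g p; rewrite -subr_ge0.
  have -> : Y ^+ 2 * xi a ^+ 2 + 4 * x ^+ 2 * Z ^+ 2 - 2 * x * (xi a * (Z * Y + Y * Z)) =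
    (Y * xi a - 2 * x * Z) ^+ 2 by ring.
  exact: sqr_ge0.
- have -> : \sum_a (ext (upd k j (K2 a)) g p * ext k g p +
      ext (upd k j (K1 a)) g p * ext (upd k j (K1 a)) g p +
      (ext (upd k j (K1 a)) g p * ext (upd k j (K1 a)) g p +
       ext k g p * ext (upd k j (K2 a)) g p)) =
      2 * (\sum_a ext (upd k j (K1 a)) g p ^+ 2) +
      2 * ext k g p * (\sum_a ext (upd k j (K2 a)) g p).
    rewrite !mulr_sumr -big_split /=; apply: eq_bigr => a _; ring.
  rewrite (ext_harmonic _ _ mg pos gM) mulr0 addr0.
  have : 0 <= \sum_a ext (upd k j (K1 a)) g p ^+ 2 by apply: sumr_ge0 => a _; exact: sqr_ge0.
  by move=> h; lra.
Qed.

Lemma admissible_nsq c j s : 4 <= c -> clean j s -> admissible c j (nsq g s) (nsq g (nabla j s)).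
Proof.
move=> c4; elim: s => [_|k s IH [kj /IH h]].
  have := admissible0 c j; congr admissible; apply/funext => p; first by rewrite /nsq big_nil.
  by rewrite nsq_nabla big_nil.
have := admissible_add (admissible_sqr c4 kj) h; congr admissible; apply/funext => p.
  by rewrite /nsq big_cons.
by rewrite !nsq_nabla big_cons.
Qed.

Definition cutoff n (p : P) : R := ramp (2^-1 - ext kap0 g p) ^+ n.

Lemma cutoff_ge0 n p : 0 <= cutoff n p.
Proof. by rewrite exprn_ge0// ramp_ge0. Qed.

Lemma slab_bounded_cutoff n : slab_bounded (cutoff n).
Proof.
have h1 : slab_bounded (fun p : P => ramp (2^-1 - ext kap0 g p)).
  have h0 := slab_boundedD (slab_bounded_cst 2^-1)
    (slab_boundedM (slab_bounded_cst (-1)) (slab_bounded_ext mg gM kap0)).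
  have -> : (fun p : P => ramp (2^-1 - ext kap0 g p)) = (fun p => ramp (2^-1 + -1 * ext kap0 g p)).
    by apply/funext => p; rewrite mulN1r.
  split; first by apply: measurable_maxr => //; have [] := h0.
  move=> a b a0 ab; have [C hC] := h0.2 a b a0 ab; exists C => p hp.
  by rewrite ger0_norm ?ramp_ge0//; apply: le_trans (ramp_le_norm _) (hC p hp).
elim: n => [|n IH].
  have -> : cutoff 0 = fun=> 1 by apply/funext => p; rewrite /cutoff expr0.
  exact: slab_bounded_cst.
by have := slab_boundedM h1 IH; congr slab_bounded; apply/funext => p; rewrite /cutoff exprS.
Qed.

(** With q the truncated function, |nabla_j q^N|^2 = N^2 q^N (q^(N-2) |nabla_j v|^2) for N = n + 3,
    and harmonicity of v makes the Laplacian of q^N nonnegative. The exponent is at least 3 for the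
    second derivative to be continuous. *)
Lemma admissible_cutoff c j n : n.+3%:R ^+ 2 <= c ->
  admissible c j (cutoff n.+3) (fun p => nsq g (nabla j [:: kap0]) p * cutoff n.+1 p).
Proof.
move=> hc; apply: (admissible_le hc); set k3 : R := n.+3%:R; set k2 : R := n.+2%:R.
have k30 : 0 <= k3 by rewrite ler0n.
have k20 : 0 <= k2 by rewrite ler0n.
pose d1 a : P -> R := ext (upd kap0 j (K1 a)) g; pose d2 a : P -> R := ext (upd kap0 j (K2 a)) g.
have hY := @jet2_ext _ _ g M mg gM j kap0 erefl.
pose F := Jfun (cutoff n.+3) (fun a p => k3 * cutoff n.+2 p * - d1 a p)
  (fun a p => k3 * (k2 * cutoff n.+1 p * - d1 a p) * - d1 a p +
     k3 * cutoff n.+2 p * - d2 a p).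
have dcut l p a : positive p ->
    is_derive p (dir j a) (cutoff l.+2) (l.+2%:R * cutoff l.+1 p * - d1 a p).
  move=> pos; have h := jet2_d1 hY a pos.
  have h' : is_derive p (dir j a) (fun q => 2^-1 - ext kap0 g q) (- d1 a p).
    by have := is_derive_add (is_derive_const p (dir j a) 2^-1) (is_derive_opp h); rewrite add0r.
  exact: is_derive_comp h' (is_derive_ramp l _).
exists F; split=> //.
- have nd1 a : slab_bounded (fun p => - d1 a p).
    have := slab_boundedM (slab_bounded_cst (-1)) (jet2_b1 hY a).
    by congr slab_bounded; apply/funext => p; rewrite mulN1r.
  have nd2 a : slab_bounded (fun p => - d2 a p).
    have := slab_boundedM (slab_bounded_cst (-1)) (jet2_b2 hY a).
    by congr slab_bounded; apply/funext => p; rewrite mulN1r.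
  have bc l (x : R) : slab_bounded (fun p => x * cutoff l p).
    exact: slab_boundedM (slab_bounded_cst x) (slab_bounded_cutoff l).
  split=> [p a pos|p a pos|p a pos||a|a] /=.
  + exact: dcut.
  + have h1 := is_derive_mul (is_derive_const p (dir j a) k3) (dcut n p a pos).
    have h2 := is_derive_opp (jet2_d2 hY a pos).
    by have := is_derive_mul h1 h2; rewrite mul0r add0r.
  + have c1 l : {for 0, continuous (fun t : R => cutoff l.+1 (p + t *: dir j a))}.
      have hd := is_derive_add (is_derive_const p (dir j a) 2^-1) (is_derive_opp (jet2_d1 hY a
        pos)).
      have := line_continuous hd; rewrite /cutoff.
      set u := (fun t : R => _); move=> cu.
      have cr : {for 0, continuous (fun t : R => ramp (u t))}.
        by apply: continuous_max => //; exact: cst_continuous.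
      elim: l => [|l IH]; first exact: cr.
      exact: (cvgM cr IH).
    have cd := line_continuous (jet2_d2 hY a pos).
    have cd2 := jet2_cont hY (a := a) pos.
    apply: cvgD; apply: cvgM; first last.
    * by apply: cvgN; exact: cd2.
    * by apply: cvgM; [exact: cvg_cst|exact: c1].
    * by apply: cvgN; exact: cd.
    * apply: cvgM; first exact: cvg_cst.
      apply: cvgM; last by apply: cvgN; exact: cd.
      by apply: cvgM; [exact: cvg_cst|exact: c1].
  + exact: slab_bounded_cutoff.
  + exact: slab_boundedM (bc _ _) (nd1 a).
  + apply: (@slab_boundedD _ _ (fun p => k3 * (k2 * cutoff n.+1 p * - d1 a p) * - d1 a p)
       (fun p => k3 * cutoff n.+2 p * - d2 a p)).
      exact: slab_boundedM (slab_boundedM (slab_bounded_cst k3) (slab_boundedM (bc n.+1 k2) (nd1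
        a))) (nd1 a).
    exact: slab_boundedM (bc _ _) (nd2 a).
- apply: measurable_funM; first by have [] := slab_bounded_nsq (nabla j [:: kap0]).
  by have [] := slab_bounded_cutoff n.+1.
- move=> p; split; first exact: cutoff_ge0.
  exact: mulr_ge0 (nsq_ge0 _ _ _) (cutoff_ge0 _ _).
move=> p pos.
have NE : nsq g (nabla j [:: kap0]) p = \sum_a d1 a p ^+ 2 by rewrite nsq_nabla big_seq1.
have c0 := cutoff_ge0 n.+1 p.
set q := ramp (2^-1 - ext kap0 g p).
have E3 : cutoff n.+3 p = q ^+ 2 * cutoff n.+1 p by rewrite /cutoff -/q -exprD.
have E2 : cutoff n.+2 p = q * cutoff n.+1 p by rewrite /cutoff -/q -exprS.
split=> [x xi|].
- rewrite /= NE E3 E2; set T := cutoff n.+1 p.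
  have -> : k3 ^+ 2 * x ^+ 2 * ((\sum_a d1 a p ^+ 2) * T) =
    (k3 ^+ 2 * x ^+ 2 * T) * \sum_a d1 a p ^+ 2 by ring.
  rewrite !mulr_sumr -big_split /=; apply: ler_sum => a _.
  rewrite -subr_ge0.
  have -> : q ^+ 2 * T * xi a ^+ 2 + k3 ^+ 2 * x ^+ 2 * T * d1 a p ^+ 2 -
      2 * x * (xi a * (k3 * (q * T) * - d1 a p)) = T * (q * xi a + k3 * x * d1 a p) ^+ 2 by ring.
  by rewrite mulr_ge0// sqr_ge0.
- have -> : \sum_a jd2 F a p = k3 * k2 * cutoff n.+1 p * (\sum_a d1 a p ^+ 2) -
      k3 * cutoff n.+2 p * (\sum_a d2 a p).
    rewrite !mulr_sumr -sumrB; apply: eq_bigr => a _ /=; ring.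
  rewrite (ext_harmonic _ _ mg pos gM) mulr0 subr0 -NE.
  apply: (@le_trans _ _ 0); first by rewrite oppr_le0 mulr_ge0 ?mulr_ge0 ?sqr_ge0 ?nsq_ge0.
  by rewrite !mulr_ge0 ?nsq_ge0.
Qed.

End square_functions.

End admissible_weights.

(** * Green's inequality *)

Section fundamental_theorem.
Context {R : realType}.
Local Notation mR := (measurableTypeR R).
Local Notation mu := (@lebesgue_measure R).

Lemma integral_is_derive (F f : R -> R) (a b : R) : a < b ->
  (forall t, a <= t <= b -> is_derive t 1 F (f t)) ->
  (forall t, a <= t <= b -> {for t, continuous f}) ->
  (\int[mu]_(t in `[a, b]) (f t)%:E = (F b)%:E - (F a)%:E)%E.
Proof.
move=> ab dF cf.
have inab t : t \in `]a, b[ -> a <= t <= b.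
  by rewrite in_itv /= => /andP[/ltW -> /ltW ->].
have cF t : a <= t <= b -> {for t, continuous F}.
  by move=> /dF [h _]; move: h => /derivable1_diffP/differentiable_continuous.
apply: continuous_FTC2 => //.
- by apply: continuous_in_subspaceT => t; rewrite inE /= in_itv /=; exact: cf.
- split.
  + by move=> t /inab/dF [].
  + by apply: cvg_at_right_filter; apply: cF; rewrite lexx ltW.
  + by apply: cvg_at_left_filter; apply: cF; rewrite lexx ltW.
- by move=> t /inab /dF [_]; rewrite derive1E.
Qed.

Definition hat (a b t : R) : R := (t - a) * (b - t) / (b - a).

(** A frozen radius gets the indicator function of [a, b], so that only frozen values inside the
    slab contribute; an integrated one gets the parabola [hat]. *)
Definition wt (a b : R) (o : option R) (t : R) : R :=
  if a <= t <= b then if o is Some _ then 1 else hat a b t else 0.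

Lemma hat_ge0 a b t : a <= t <= b -> 0 <= hat a b t.
Proof.
move=> /andP[at_ tb].
by rewrite /hat divr_ge0 ?mulr_ge0 ?subr_ge0//; exact: le_trans tb.
Qed.

Lemma wt_ge0 a b o t : 0 <= wt a b o t.
Proof. by rewrite /wt; case: ifP => // h; case: o => [_|]//; exact: hat_ge0 h. Qed.

Lemma measurable_wt a b o : measurable_fun setT (wt a b o : mR -> R).
Proof.
apply: measurable_fun_ifT => //.
- by apply: measurable_and; exact: measurable_fun_ler.
- case: o => [_|]; first exact: measurable_cst.
  apply: measurable_funM => //; apply: measurable_funM; exact: measurable_funB.
Qed.

Lemma wt_restrict a b o (F : R -> R) :
  (\int[mu]_t (wt a b o t * F t)%:E =
   \int[mu]_(t in `[a, b]) ((if o is Some _ then 1 else hat a b t) * F t)%:E)%E.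
Proof.
rewrite [RHS]integral_mkcond; apply: eq_integral => t _; rewrite patchE /wt.
rewrite (_ : (t \in `[a, b]%classic) = (a <= t <= b)).
  by case: ifP => //; rewrite mul0r.
by apply/idP/idP; rewrite inE /= in_itv.
Qed.

Lemma wt_bounded a b o : a < b -> exists2 C : R, 0 <= C & forall t, wt a b o t <= C * \1_(`[a,
  b]%classic) t.
Proof.
move=> ab; exists (1 + (b - a)); first by rewrite addr_ge0// subr_ge0 ltW.
move=> t; rewrite /wt indicE (_ : (t \in `[a, b]%classic) = (a <= t <= b)); last first.
  by apply/idP/idP; rewrite inE /= in_itv.
case: ifP => [/andP[at_ tb]|_]; last by rewrite mulr0.
rewrite mulr1; case: o => [_|]; first by rewrite lerDl subr_ge0 ltW.
rewrite /hat ler_pdivrMr ?subr_gt0//; nra.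
Qed.

(* [hat] is concave with slopes [1] and [-1] at the end points. *)
Lemma integral_hat_le (h h1 h2 : R -> R) (a b : R) : a < b ->
  (forall t, a <= t <= b -> is_derive t 1 h (h1 t)) ->
  (forall t, a <= t <= b -> is_derive t 1 h1 (h2 t)) ->
  (forall t, a <= t <= b -> {for t, continuous h2}) ->
  (forall t, a <= t <= b -> 0 <= h t) ->
  (\int[mu]_t (wt a b None t * h2 t)%:E <= (h a + h b)%:E)%E.
Proof.
move=> ab d1 d2 c2 h0; rewrite wt_restrict.
have ba0 : b - a != 0 by rewrite subr_eq0 gt_eqF.
have bap : 0 < b - a by rewrite subr_gt0.
(* [F] is hat * h' - hat' * h. Its derivative hat * h'' - hat'' * h exceeds the integrand by 2 h /
   (b - a) >= 0, and F b - F a = h a + h b. *)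
pose F (t : R) := hat a b t * h1 t + - (((b - t) + - (t - a)) / (b - a)) * h t.
pose f (t : R) := hat a b t * h2 t + 2 / (b - a) * h t.
have dF t : a <= t <= b -> is_derive t 1 F (f t).
  move=> hab; have D1 := d1 t hab; have D2 := d2 t hab.
  rewrite /F /f /hat; derive_eq; rewrite /GRing.scale /=; field; exact: ba0.
have ch t : a <= t <= b -> {for t, continuous h}.
  by move=> /d1 [k _]; move: k => /derivable1_diffP/differentiable_continuous.
have chat t : {for t, continuous (hat a b)}.
  have [k _] : is_derive t 1 (hat a b) (1 * (b - t) / (b - a) + (t - a) * -1 / (b - a)).
    rewrite /hat; derive_eq; rewrite /GRing.scale /=; field; exact: ba0.
  by move: k => /derivable1_diffP/differentiable_continuous.
have ch2 t : a <= t <= b -> {for t, continuous (fun t => hat a b t * h2 t)}.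
  by move=> hab; apply: cvgM; [exact: chat|exact: c2].
have cf t : a <= t <= b -> {for t, continuous f}.
  move=> hab; apply: cvgD; first exact: ch2.
  by apply: cvgM; [exact: cvg_cst|exact: ch].
have I1 (u : R -> R) : (forall t, a <= t <= b -> {for t, continuous u}) ->
    mu.-integrable `[a, b] (EFin \o u).
  move=> cu; apply: continuous_compact_integrable; first exact: segment_compact.
  by apply: continuous_in_subspaceT => t; rewrite inE /= in_itv /=; exact: cu.
have E := integral_is_derive ab dF cf.
have -> : h a + h b = F b - F a.
  by rewrite /F /hat; field.
rewrite EFinB -E; apply: le_integral => //; [exact: (I1 _ ch2)|exact: (I1 _ cf)|].
move=> t; rewrite inE /= in_itv /= => hab.
by rewrite lee_fin lerDl mulr_ge0 ?h0// divr_ge0// ltW.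
Qed.

Lemma continuous_shift (f : R -> R) (t : R) :
  {for 0, continuous (fun u : R => f (t + u))} -> {for t, continuous f}.
Proof.
move=> c; have -> : f = (fun u : R => f (t + u)) \o (fun s => s - t).
  by apply/funext => s /=; rewrite addrC subrK.
apply: continuous_comp; last by rewrite subrr.
by apply: cvgB; [exact: cvg_id|exact: cvg_cst].
Qed.

End fundamental_theorem.

Lemma pair_ext {A B : Type} (x y : A * B) : x.1 = y.1 -> x.2 = y.2 -> x = y.
Proof. by case: x y => [x1 x2] [y1 y2] /= -> ->. Qed.

Section green.
Context {R : realType} {m : nat}.
Local Notation Rm := 'rV[R]_m.
Local Notation R2m := (Rm * Rm)%type.
Local Notation mR := (measurableTypeR R).
Local Notation P := (R2m * (R * R * R))%type.
Implicit Types (j : idx3).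

Definition setr (r : R * R * R) j (t : R) : R * R * R :=
  match j with J1 => (t, r.1.2, r.2) | J2 => (r.1.1, t, r.2) | J3 => (r.1.1, r.1.2, t) end.

Lemma radius_setr r j t i : radius (setr r j t) i = upd (radius r) j t i.
Proof. by case: j; case: i. Qed.

Lemma setr_dir y r j t s : (y, setr r j t) + s *: dir j None = (y, setr r j (t + s)) :> P.
Proof.
case: r => [[r1 r2] r3]; apply: pair_ext.
  transitivity (y + s *: (0 : R2m)); first by case: j.
  by rewrite scaler0 addr0.
have E : s *: (1 : R) = s := mulr1 s.
by case: j => /=; apply: pair_ext => /=; try apply: pair_ext => /=; rewrite ?E ?scaler0 ?addr0.
Qed.

Lemma space_dir y r j i s :
  (y, r) + s *: dir j (Some i) = (y + s *: (dir j (Some i)).1, r) :> P.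
Proof.
apply: pair_ext => //=.
transitivity (r + s *: (0 : R * R * R)); first by case: j.
by rewrite scaler0 addr0.
Qed.

Lemma measurable_setr j r : measurable_fun setT (setr r j : mR -> mR * mR * mR).
Proof. by case: j; apply: measurable_fun_pair => //; apply: measurable_fun_pair. Qed.

Lemma slab_setr a b r j t : slab a b r -> a <= t <= b -> slab a b (setr r j t).
Proof. by move=> h ht i; rewrite radius_setr; case: j => /=; case: i => //=; by [exact: (h
  J1)|exact: (h J2)|exact: (h J3)]. Qed.

(** Integrating f1 over unit segments in the given direction and over y gives the integral of f1 by
    translation invariance, and also that of f (y + E) - f y, which is zero. Integrability replaces
    compact support, and the diagonal direction is treated like the others. *)
Lemma integral_space_derivative (f f1 : P -> R) j i r :
  measurable_fun setT (fun y : R2m => f (y, r)) -> measurable_fun setT (fun y : R2m => f1 (y, r)) ->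
  (forall y, is_derive (y, r) (dir j (Some i)) f (f1 (y, r))) ->
  (forall y, {for 0, continuous (fun s : R => f1 ((y, r) + s *: dir j (Some i)))}) ->
  (\int[lebesgue_R2m]_y `|f (y, r)|%:E < +oo)%E ->
  (\int[lebesgue_R2m]_y `|f1 (y, r)|%:E < +oo)%E ->
  (\int[lebesgue_R2m]_y (f1 (y, r))%:E = 0)%E.
Proof.
move=> mf mf1 df cf1 If If1.
pose E : R2m := (dir j (Some i)).1.
pose H (z : R2m * mR) : R := f1 (z.1 + z.2 *: E, r).
have mshift : measurable_fun setT (fun z : R2m * mR => z.1 + z.2 *: E).
  apply: measurable_funD_pair; first exact: measurable_fst.
  apply: measurable_fun_pair => /=; apply: measurable_fun_rV => l.
    have -> : coord_rV l \o (fun z : R2m * mR => z.2 *: E.1) = (fun z => z.2 * E.1 ord0 l).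
      by apply/funext => z; rewrite /coord_rV /= mxE.
    by apply: measurable_funM => //; exact: measurable_snd.
  have -> : coord_rV l \o (fun z : R2m * mR => z.2 *: E.2) = (fun z => z.2 * E.2 ord0 l).
    by apply/funext => z; rewrite /coord_rV /= mxE.
  by apply: measurable_funM => //; exact: measurable_snd.
have mH : measurable_fun setT H by apply: (measurableT_comp mf1).
pose U : set mR := `[0, 1]%classic.
have mU : measurable U by exact: measurable_itv.
pose G (z : R2m * mR) : \bar R := (\1_U z.2 * H z)%:E.
have m1U : measurable_fun setT (\1_U : mR -> R) by exact: measurable_indic.
have mG : measurable_fun setT G.
  apply/measurable_EFinP; apply: measurable_funM => //.
  by apply: (measurableT_comp m1U); exact: measurable_snd.
have i1 : lebesgue_R2m.-integrable setT (fun y : R2m => (f1 (y, r))%:E).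
  by apply/integrableP; split; [exact/measurable_EFinP|].
have i0 : lebesgue_R2m.-integrable setT (fun y : R2m => (f (y, r))%:E).
  by apply/integrableP; split; [exact/measurable_EFinP|].
pose T := (\int[lebesgue_R2m]_y (f1 (y, r))%:E)%E.
have ef1 : measurable_fun setT (fun y : R2m => (f1 (y, r))%:E) by exact/measurable_EFinP.
have nf1 : measurable_fun setT (fun y : R2m => `|f1 (y, r)|%:E).
  by apply/measurable_EFinP; exact: measurableT_comp.
have intU : (\int[lebesgue_measure]_s ((\1_U : mR -> R) s)%:E = 1)%E.
  transitivity (lebesgue_measure (`[0%R, 1%R]%classic : set R)).
    by rewrite integral_indic// setIT.
  by rewrite lebesgue_measure_itv /= lte_fin ltr01 sube0.
have iG : (lebesgue_R2m \x lebesgue_measure)%E.-integrable setT G.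
  apply: (proj2 (@integrable21ltyP _ _ _ _ R lebesgue_R2m lebesgue_measure G mG)).
  pose N := (\int[lebesgue_R2m]_y `|f1 (y, r)|%:E)%E.
  have N0 : (0 <= N)%E by apply: integral_ge0 => y _; rewrite lee_fin.
  have -> : (\int[lebesgue_measure]_s \int[lebesgue_R2m]_y `|G (y, s)| =
      \int[lebesgue_measure]_s (((\1_U : mR -> R) s)%:E * N))%E.
    apply: eq_integral => s _; rewrite /N -(ge0_integral_R2m_translation (s *: E) nf1)//.
    have U0 : 0 <= (\1_U s : R) by rewrite indicE.
    have mt : measurable_fun setT (fun y : R2m => `|f1 (y + s *: E, r)|%:E).
      by apply: (measurableT_comp nf1); apply: measurable_funD_pair.
    rewrite -(ge0_integralZl_EFin _ _ _ mt U0)//.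
    by apply: eq_integral => y _; rewrite /G /H abse_EFin normrM ger0_norm// EFinM.
  have me : measurable_fun setT (fun s : mR => (\1_U s : R)%:E) by exact/measurable_EFinP.
  by rewrite (ge0_integralZr _ _ me)// ?intU ?mul1e// => s _; rewrite lee_fin indicE.
have := Fubini iG.
have -> : (\int[lebesgue_measure]_s \int[lebesgue_R2m]_y G (y, s) = T)%E.
  have -> : (\int[lebesgue_measure]_s \int[lebesgue_R2m]_y G (y, s) =
      \int[lebesgue_measure]_s (T * ((\1_U : mR -> R) s)%:E))%E.
    apply: eq_integral => s _; rewrite /T -(integral_R2m_translation (s *: E) ef1) muleC.
    rewrite -integralZl//.
    apply/integrableP; split.
      by apply: (measurableT_comp ef1); apply: measurable_funD_pair.
    by rewrite (ge0_integral_R2m_translation (s *: E) nf1).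
  have Tf : T \is a fin_num by exact: integrable_fin_num i1.
  have iU : lebesgue_measure.-integrable setT (fun s : mR => (\1_U s : R)%:E).
    apply/integrableP; split; first exact/measurable_EFinP.
    rewrite [ltLHS](_ : _ = 1)%E ?ltry// -intU; apply: eq_integral => s _.
    by rewrite abse_EFin ger0_norm// indicE.
  rewrite -(fineK Tf) integralZl// intU mule1//.
rewrite -/T => <-.
have -> : (\int[lebesgue_R2m]_y \int[lebesgue_measure]_s G (y, s) =
    \int[lebesgue_R2m]_y ((f (y + E, r))%:E - (f (y, r))%:E))%E.
  apply: eq_integral => y _.
  have -> : (f (y + E, r))%:E = (f ((y, r) + 1 *: dir j (Some i)))%:E by rewrite space_dir scale1r.
  have -> : (f (y, r))%:E = (f ((y, r) + 0 *: dir j (Some i)))%:E by rewrite scale0r addr0.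
  have D (s : R) : 0 <= s <= 1 ->
      is_derive s 1 (fun s => f ((y, r) + s *: dir j (Some i))) (f1 ((y, r) + s *: dir j (Some i))).
    move=> _; apply: is_derive_line.
    by have := df (y + s *: E); rewrite space_dir.
  have C (s : R) : 0 <= s <= 1 ->
      {for s, continuous (fun s : R => f1 ((y, r) + s *: dir j (Some i)))}.
    move=> _; apply: continuous_shift.
    have := cf1 (y + s *: E).
    have -> : (fun t : R => f1 ((y + s *: E, r) + t *: dir j (Some i))) =
        (fun u => f1 ((y, r) + (s + u) *: dir j (Some i))).
      by apply/funext => u; rewrite !space_dir -/E -addrA -scalerDl.
    by [].
  have := integral_is_derive ltr01 D C => /= <-.
  rewrite [RHS]integral_mkcond; apply: eq_integral => s _; rewrite patchE /G indicE /H /=.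
  by case: ifP => sU; rewrite ?mul1r ?mul0r// space_dir.
rewrite integralB_EFin//.
  have mff : measurable_fun setT (fun y : R2m => (f (y, r))%:E) by exact/measurable_EFinP.
  rewrite (integral_R2m_translation E mff) subee//.
  exact: integrable_fin_num i0.
apply/integrableP; split.
  by apply/measurable_EFinP; apply: (measurableT_comp mf); apply: measurable_funD_pair.
have nf : measurable_fun setT (fun y : R2m => `|f (y, r)|%:E).
  by apply/measurable_EFinP; exact: measurableT_comp.
by rewrite (ge0_integral_R2m_translation E nf).
Qed.

End green.

Section one_variable_estimate.
Context {R : realType} {m : nat}.
Local Notation Rm := 'rV[R]_m.
Local Notation R2m := (Rm * Rm)%type.
Local Notation mR := (measurableTypeR R).
Local Notation P := (R2m * (R * R * R))%type.
Local Notation mP := (R2m * (mR * mR * mR))%type.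
Local Notation jet := (@jet m).
Local Notation mu := (@lebesgue_measure R).
Variables (a b : R) (j : idx3) (r : R * R * R).
Hypotheses (a0 : 0 < a) (ab : a < b) (hr : slab a b r).

Local Notation rho := (setr r j).
Local Notation nu := (lebesgue_R2m \x lebesgue_measure)%E.

Lemma setr_positive (y : R2m) t : a <= t <= b -> positive ((y, rho t) : P).
Proof. by move=> ht; apply: (slab_positive a0); exact: slab_setr. Qed.

Lemma measurable_line (F : P -> R) : measurable_fun setT (F : mP -> R) ->
  measurable_fun setT (fun z : R2m * mR => F (z.1, rho z.2)).
Proof.
move=> mF; apply: (measurableT_comp mF); apply: measurable_fun_pair; first exact: measurable_fst.
by apply: (measurableT_comp (measurable_setr j r)); exact: measurable_snd.
Qed.

Lemma measurable_weighted (F : P -> R) : measurable_fun setT (F : mP -> R) ->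
  measurable_fun setT (fun z : R2m * mR => (wt a b None z.2 * F (z.1, rho z.2))%:E).
Proof.
move=> mF; apply/measurable_EFinP; apply: measurable_funM; last exact: measurable_line.
by apply: (measurableT_comp (measurable_wt a b None)); exact: measurable_snd.
Qed.

Lemma integrable_weighted (F : P -> R) : slab_bounded F -> slab_integrable F ->
  nu.-integrable setT (fun z : R2m * mR => (wt a b None z.2 * F (z.1, rho z.2))%:E).
Proof.
move=> bF iF; have mG := measurable_weighted bF.1.
apply: (proj2 (@integrable21ltyP _ _ _ _ R lebesgue_R2m lebesgue_measure _ mG)).
have [C hC] := iF a b a0 (ltW ab); have [D D0 hD] := wt_bounded None ab.
pose U : set mR := `[a, b]%classic.
have mU : measurable U by exact: measurable_itv.
have C0 : (0 <= C%:E)%E by apply: le_trans (hC r hr); apply: integral_ge0 => y _; rewrite lee_fin.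
apply: (@le_lt_trans _ _ (\int[mu]_t ((D * C)%:E * (\1_U (t : mR))%:E))%E).
  apply: ge0_le_integral => //.
  - by move=> t _; apply: integral_ge0.
  - apply: (@measurable_fun_fubini_tonelli_G _ _ _ _ _ lebesgue_R2m (fun z : R2m * mR => `|(wt a b
    None z.2 * F (z.1, rho z.2))%:E|%E)) => //.
    exact: measurableT_comp.
  - by apply: measurable_funeM; apply/measurable_EFinP; exact: measurable_indic.
  move=> t _ /=.
  have w0 := wt_ge0 a b None t.
  have mt : measurable_fun setT (fun y : R2m => `|F (y, rho t)|%:E : \bar R).
    by apply/measurable_EFinP; apply: measurableT_comp => //; exact: measurable_section.
  have -> : (\int[lebesgue_R2m]_y `|wt a b None t * F (y, rho t)|%:E =
      (wt a b None t)%:E * \int[lebesgue_R2m]_y `|F (y, rho t)|%:E)%E.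
    rewrite -(ge0_integralZl_EFin _ _ _ mt w0)//.
    by apply: eq_integral => y _; rewrite normrM ger0_norm// EFinM.
  have hw := hD t; rewrite -/U in hw.
  case: (boolP (t \in U)) => tU.
    have tab : a <= t <= b by move: tU; rewrite inE /U /= in_itv.
    rewrite indicE tU mule1 EFinM; apply: lee_pmul => //.
    - by apply: integral_ge0 => y _; rewrite lee_fin.
    - by rewrite lee_fin; move: hw; rewrite indicE tU mulr1.
    - exact: hC (slab_setr j hr tab).
  rewrite indicE (negbTE tU) mule0.
  have -> : wt a b None t = 0.
    by apply/eqP; rewrite eq_le w0 andbT; move: hw; rewrite indicE (negbTE tU) mulr0.
  by rewrite mul0e.
have DC0 : 0 <= D * C by rewrite mulr_ge0.
have m1 : measurable_fun setT (fun t : mR => (\1_U t : R)%:E).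
  by apply/measurable_EFinP; exact: measurable_indic.
rewrite (ge0_integralZl_EFin _ _ _ m1 DC0)//.
rewrite integral_indic// setIT.
rewrite [X in (_ * X < _)%E](_ : _ = (b - a)%:E); last first.
  by transitivity (lebesgue_measure (`[a, b]%classic : set R)) => //; rewrite lebesgue_measure_itv
    /= lte_fin ab.
by rewrite -EFinM ltry.
Qed.

Lemma jd2_space_integral0 (h : @jfun R m) i t : a <= t <= b -> jet2 j h -> jint h ->
  (\int[lebesgue_R2m]_y (jd2 h (Some i) (y, rho t))%:E = 0)%E.
Proof.
move=> ht hj hi; have hs := slab_setr j hr ht.
apply: (@integral_space_derivative R m (jd1 h (Some i)) (jd2 h (Some i)) j i (rho t)).
- exact: measurable_section (jet2_b1 hj _).
- exact: measurable_section (jet2_b2 hj _).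
- by move=> y; apply: jet2_d2 => //; exact: setr_positive.
- by move=> y; apply: (jet2_cont hj); exact: setr_positive.
- have [C hC] := jint1 hi (Some i) a0 (ltW ab).
  exact: le_lt_trans (hC _ hs) (ltry _).
- have [C hC] := jint2 hi (Some i) a0 (ltW ab).
  exact: le_lt_trans (hC _ hs) (ltry _).
Qed.

Lemma integrable_slice (F : P -> R) t : a <= t <= b -> slab_bounded F -> slab_integrable F ->
  lebesgue_R2m.-integrable setT (fun y => (F (y, rho t))%:E).
Proof.
move=> ht bF iF; apply/integrableP; split; first by apply/measurable_EFinP; exact:
  measurable_section.
have [C hC] := iF a b a0 (ltW ab).
exact: le_lt_trans (hC _ (slab_setr j hr ht)) (ltry _).
Qed.

(** The second derivatives in space integrate to zero on each slice, so only the radial one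
    survives, and [integral_hat_le] bounds it by boundary values. *)
Lemma green_le (h : @jfun R m) : jet2 j h -> jint h -> (forall p, positive p -> 0 <= h p) ->
  (\int[nu]_z (wt a b None z.2 * \sum_i jd2 h i (z.1, rho z.2))%:E <=
   \int[lebesgue_R2m]_y (h (y, rho a))%:E + \int[lebesgue_R2m]_y (h (y, rho b))%:E)%E.
Proof.
move=> hj hi h0.
have ha : a <= a <= b by rewrite lexx ltW.
have hb : a <= b <= b by rewrite lexx ltW.
have iw i := integrable_weighted (jet2_b2 hj i) (jint2 hi i).
under eq_integral do rewrite mulr_sumr -sumEFin.
rewrite integral_sum// (bigD1 None) //= big1 ?addr0; last first.
  case=> // i _; rewrite -(integral21_prod_meas1 (iw (Some i))) /=.
  apply: integral0_eq => t _; rewrite /fubini_G /=.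
  have [tab|tab] := boolP (a <= t <= b); last first.
    by apply: integral0_eq => y _; rewrite /wt (negbTE tab) mul0r.
  under eq_integral do rewrite EFinM.
  rewrite integralZl//; first by rewrite jd2_space_integral0// mule0.
  exact: integrable_slice (jet2_b2 hj _) (jint2 hi _).
have ia := integrable_slice ha (jet2_b0 hj) (jint0 hi).
have ib := integrable_slice hb (jet2_b0 hj) (jint0 hi).
rewrite -integralD// -(integral12_prod_meas1 (iw None)) /=.
apply: le_integral => //.
- exact: integrable_fubini_F (iw None).
- exact: integrableD.
move=> y _; rewrite -EFinD /fubini_F /=.
apply: (@integral_hat_le R (fun t => h (y, rho t)) (fun t => jd1 h None (y, rho t))
  (fun t => jd2 h None (y, rho t)) a b ab).
- move=> t tab.
  have := @is_derive_line R _ (jval h) (y, rho 0) (dir j None) t (jd1 h None (y, rho t)).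
  rewrite setr_dir add0r => /(_ (jet2_d1 hj None (setr_positive y tab))).
  by apply: eq_is_derive => s; rewrite setr_dir add0r.
- move=> t tab.
  have := @is_derive_line R _ (jd1 h None) (y, rho 0) (dir j None) t (jd2 h None (y, rho t)).
  rewrite setr_dir add0r => /(_ (jet2_d2 hj None (setr_positive y tab))).
  by apply: eq_is_derive => s; rewrite setr_dir add0r.
- move=> t tab; apply: continuous_shift.
  have := jet2_cont hj (a := None) (setr_positive y tab).
  have -> : (fun s : R => jd2 h None ((y, rho t) + s *: dir j None)) =
      (fun s : R => jd2 h None (y, rho (t + s))) by apply/funext => s; rewrite setr_dir.
  by [].
- by move=> t tab; apply: h0; exact: setr_positive.
Qed.

Fixpoint jnsq (g : R2m -> R) (s : seq (idx3 -> jet)) : jfun :=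
  if s is k :: s' then jadd (jmul (jext j g k) (jext j g k)) (jnsq g s') else jcst 0.

Section harmonic_family.
Variables (u : R2m -> R) (M : R).
Hypotheses (mu : measurable_fun setT u) (uM : forall y, `|u y| <= M)
  (u1 : (\int[lebesgue_R2m]_y `|u y|%:E < +oo)%E).

Lemma jval_jnsq s : jval (jnsq u s) = nsq u s.
Proof.
elim: s => [|k s IH]; apply/funext => p; first by rewrite /nsq big_nil.
by rewrite /= IH /nsq big_cons expr2.
Qed.

Lemma jet2_jnsq s : clean j s -> jet2 j (jnsq u s) /\ jint (jnsq u s).
Proof.
elim: s => [_|k s IH [kj /IH[h1 h2]]]; first by split; [exact: jet2_cst|exact: jint_cst0].
have hk := jet2_ext mu uM kj.
have ik : jint (jext j u k) by split=> [|i|i]; exact: slab_integrable_ext mu uM _ u1.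
have hkk := jet2_mul hk hk; have ikk := jint_mul hk hk ik.
by split; [exact: jet2_add|exact: jint_add hkk h1 ikk h2].
Qed.

(** The Laplacian of X^2 w is 2 w |nabla X|^2 + 4 X nabla X . nabla w + X^2 Delta w. The middle term
    absorbs one copy of w |nabla X|^2 and costs 4 c X^2 W, the last costs c X^2 W: this is the
    origin of 5 c. *)
Lemma jd2_jnsq_ge c w W (F : jfun) s p : jval F = w -> positive p -> 0 <= W p ->
  (forall (x : R) (xi : option 'I_m -> R), 2 * x * (\sum_a xi a * jd1 F a p) <=
     w p * (\sum_a xi a ^+ 2) + c * x ^+ 2 * W p) ->
  - (c * W p) <= \sum_a jd2 F a p -> clean j s ->
  nsq u (nabla j s) p * w p - 5 * c * (nsq u s p * W p) <=
    \sum_a jd2 (jmul (jnsq u s) F) a p.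
Proof.
move=> <- pos W0 h1 h2; elim: s => [_|k s IH [kj /IH h]].
  rewrite nsq_nabla /nsq !big_nil mul0r mul0r mulr0 subr0.
  by rewrite sumr_ge0// => i _ /=; rewrite !mul0r !addr0.
have -> : nsq u (nabla j (k :: s)) p =
    \sum_i ext (upd k j (K1 i)) u p ^+ 2 + nsq u (nabla j s) p by rewrite !nsq_nabla big_cons.
have -> : nsq u (k :: s) p = ext k u p ^+ 2 + nsq u s p by rewrite /nsq big_cons.
pose Y := jext j u k.
have -> : \sum_i jd2 (jmul (jnsq u (k :: s)) F) i p =
    \sum_i jd2 (jmul (jmul Y Y) F) i p + \sum_i jd2 (jmul (jnsq u s) F) i p.
  rewrite -big_split /=; apply: eq_bigr => i _; ring.
rewrite [_ * jval F p]mulrDl [_ * W p]mulrDl mulrDr opprD addrACA; apply: lerD => //.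
pose A := \sum_i ext (upd k j (K1 i)) u p ^+ 2.
pose B := \sum_i ext (upd k j (K1 i)) u p * jd1 F i p.
pose C := \sum_i jd2 F i p.
have -> : \sum_i jd2 (jmul (jmul Y Y) F) i p =
   2 * (jval F p * A) + 4 * ext k u p * B + ext k u p ^+ 2 * C
   + 2 * ext k u p * jval F p * (\sum_i ext (upd k j (K2 i)) u p).
  rewrite /A /B /C !mulr_sumr -!big_split /=; apply: eq_bigr => i _; ring.
rewrite (ext_harmonic _ _ mu pos uM) mulr0 addr0 -/A.
(* The free parameter is set to -2 X, tested against the gradient of X. *)
have k1 := h1 (- 2 * ext k u p) (fun i => ext (upd k j (K1 i)) u p).
rewrite -/A -/B in k1.
have k2 := ler_wpM2l (sqr_ge0 (ext k u p)) h2; rewrite -/C in k2.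
move: k1 k2; move: (jval F p) (ext k u p) (W p) A B C => f y V A' B' C' k1 k2.
have e1 : 2 * (- 2 * y) * B' = - (4 * y * B') by ring.
have e2 : c * (- 2 * y) ^+ 2 * V = 4 * (c * (y ^+ 2 * V)) by ring.
have e3 : y ^+ 2 * - (c * V) = - (c * (y ^+ 2 * V)) by ring.
rewrite e1 e2 in k1; rewrite e3 in k2; rewrite -mulrA [A' * f]mulrC; lra.
Qed.

(** The inequality of [jd2_jnsq_ge], integrated: [green_le] turns the integral of the Laplacian of
    X^2 w into the two boundary terms. *)
Lemma one_step_line c (w W : P -> R) s : 0 < c -> admissible c j w W -> clean j s ->
  (\int[nu]_z (wt a b None z.2 * (nsq u (nabla j s) (z.1, rho z.2) * w (z.1, rho z.2)))%:E <=
   \int[lebesgue_R2m]_y (nsq u s (y, rho a) * w (y, rho a))%:E +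
   \int[lebesgue_R2m]_y (nsq u s (y, rho b) * w (y, rho b))%:E +
   (5 * c)%:E *
   \int[nu]_z (wt a b None z.2 * (nsq u s (z.1, rho z.2) * W (z.1, rho z.2)))%:E)%E.
Proof.
move=> c0 [F [Fw hF mW hpos hadm]] hs.
have [hj hi] := jet2_jnsq hs.
pose h := jmul (jnsq u s) F.
have hh : jet2 j h by exact: jet2_mul.
have ih : jint h by exact: jint_mul hj hF hi.
have c5 : 0 < 5 * c by rewrite mulr_gt0.
have hval p : h p = nsq u s p * w p by rewrite /h /= jval_jnsq -Fw.
have h0 p : positive p -> 0 <= h p.
  by move=> pos; have [w0 _] := hpos p; rewrite hval mulr_ge0 ?nsq_ge0.
have G := green_le hh ih h0.
pose T (z : R2m * mR) := (wt a b None z.2 * (nsq u s (z.1, rho z.2) * W (z.1, rho z.2)))%:E.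
have mnW : measurable_fun setT ((fun p => nsq u s p * W p) : mP -> R).
  by apply: measurable_funM => //; have [] := slab_bounded_nsq mu uM s.
have mT : measurable_fun setT T := measurable_weighted mnW.
have slabP (z : R2m * mR) : a <= z.2 <= b -> positive ((z.1, rho z.2) : P).
  by move=> hz; exact: setr_positive.
have T0 z : (0 <= T z)%E.
  rewrite /T /wt; case: ifP => hz; last by rewrite mul0r.
  have [_ W0] := hpos (z.1, rho z.2).
  by rewrite lee_fin mulr_ge0 ?hat_ge0// mulr_ge0// nsq_ge0.
have B0 t : a <= t <= b -> (0 <= \int[lebesgue_R2m]_y (nsq u s (y, rho t) * w (y, rho t))%:E)%E.
  move=> ht; apply: integral_ge0 => y _; have [w0 _] := hpos (y, rho t).
  by rewrite lee_fin mulr_ge0 ?nsq_ge0.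
have ha : a <= a <= b by rewrite lexx ltW.
have hb : a <= b <= b by rewrite lexx ltW.
(* An infinite error integral makes the bound trivial; a finite one allows the integral of a sum to
   be split. *)
have [Tfin|Tinf] := ltP (\int[nu]_z T z)%E +oo%E; last first.
  move: Tinf; rewrite leye_eq => /eqP ->.
  rewrite gt0_muley ?lte_fin// addey ?leey//.
  by apply/eqP => E; have := adde_ge0 (B0 a ha) (B0 b hb); rewrite E.
have iT : nu.-integrable setT T.
  apply/integrableP; split=> //; apply: le_lt_trans Tfin.
  by rewrite le_eqVlt; apply/orP; left; apply/eqP; apply: eq_integral => z _; rewrite gee0_abs.
pose S (z : R2m * mR) := (wt a b None z.2 * \sum_i jd2 h i (z.1, rho z.2))%:E.
have iS : nu.-integrable setT S.
  have iw i := integrable_weighted (jet2_b2 hh i) (jint2 ih i).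
  have -> : S = fun z => (\sum_i (wt a b None z.2 * jd2 h i (z.1, rho z.2))%:E)%E.
    by apply/funext => z; rewrite /S mulr_sumr -sumEFin.
  by apply: integrable_sum => // i _; exact: iw.
apply: (@le_trans _ _ (\int[nu]_z (S z + (5 * c)%:E * T z))%E); last first.
  rewrite integralD//; last exact: integrableZl.
  rewrite integralZl//; apply: leeD => //.
  apply: le_trans G _.
  by under eq_integral do rewrite hval; under [X in (_ + X <= _)%E]eq_integral do rewrite hval.
apply: ge0_le_integral => //.
- move=> z _; rewrite /wt; case: ifP => hz; last by rewrite mul0r.
  have [w0 _] := hpos (z.1, rho z.2).
  by rewrite lee_fin mulr_ge0 ?hat_ge0// mulr_ge0// nsq_ge0.
- have bn : slab_bounded (fun p => nsq u (nabla j s) p * w p).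
    by apply: slab_boundedM; [exact: slab_bounded_nsq mu uM _|rewrite -Fw; exact: jet2_b0 hF].
  exact: measurable_weighted bn.1.
- have [mS _] := integrableP _ _ _ iS.
  by apply: emeasurable_funD => //; exact: measurable_funeM.
move=> z _; rewrite /S /T -EFinM -EFinD lee_fin /wt; case: ifP => hz; last by rewrite !mul0r mulr0
  addr0.
have [w0 W0] := hpos (z.1, rho z.2); have [h1 h2] := hadm _ (slabP z hz).
have k := jd2_jnsq_ge Fw (slabP z hz) W0 h1 h2 hs.
rewrite [5 * c * _]mulrCA -mulrDr ler_wpM2l ?hat_ge0//.
by rewrite -lerBlDr.
Qed.

End harmonic_family.
End one_variable_estimate.

(** * Energy estimates *)

Section triple_integral.
Context {R : realType} {m : nat}.
Local Notation Rm := 'rV[R]_m.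
Local Notation R2m := (Rm * Rm)%type.
Local Notation mR := (measurableTypeR R).
Local Notation P := (R2m * (R * R * R))%type.
Local Notation mP := (R2m * (mR * mR * mR))%type.
Variables (a b : R).
Hypotheses (a0 : 0 < a) (ab : a < b).
Implicit Types (tau : idx3 -> option R) (j : idx3) (F G : P -> R).

(* For each radius, [Some c] freezes its value and [None] integrates it against [hat]. *)
Definition radial_measure (o : option R) : {sigma_finite_measure set mR -> \bar R} :=
  if o is Some c then (dirac (c : mR) : {sigma_finite_measure set mR -> \bar R})
  else (lebesgue_measure : {sigma_finite_measure set mR -> \bar R}).

Definition slice F (r : R * R * R) : \bar R := (\int[lebesgue_R2m]_y (F (y, r))%:E)%E.

Definition weight tau (r : R * R * R) : R :=
  wt a b (tau J1) r.1.1 * wt a b (tau J2) r.1.2 * wt a b (tau J3) r.2.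

Definition Int tau F : \bar R :=
  (\int[radial_measure (tau J1)]_t1 \int[radial_measure (tau J2)]_t2
   \int[radial_measure (tau J3)]_t3 ((weight tau (t1, t2, t3))%:E * slice F (t1, t2, t3)))%E.

Definition tri j (s : R * R) (t : R) : R * R * R :=
  match j with J1 => (t, s.1, s.2) | J2 => (s.1, t, s.2) | J3 => (s.1, s.2, t) end.

Definition fst_other j := match j with J1 => J2 | _ => J1 end.
Definition snd_other j := match j with J3 => J2 | _ => J3 end.

Definition inner j (o : option R) F (s : R * R) : \bar R :=
  (\int[radial_measure o]_t ((wt a b o t)%:E * slice F (tri j s t)))%E.

Definition outer_weight j tau (s : R * R) : R :=
  wt a b (tau (fst_other j)) s.1 * wt a b (tau (snd_other j)) s.2.

Lemma weight_ge0 tau r : 0 <= weight tau r.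
Proof. by rewrite /weight !mulr_ge0 ?wt_ge0. Qed.

Lemma outer_weight_ge0 j tau s : 0 <= outer_weight j tau s.
Proof. by rewrite /outer_weight mulr_ge0 ?wt_ge0. Qed.

Lemma measurable_weight tau : measurable_fun setT (weight tau : mR * mR * mR -> R).
Proof.
apply: measurable_funM; first apply: measurable_funM;
  apply: (measurableT_comp (measurable_wt a b _)).
- by apply: (measurableT_comp measurable_fst); exact: measurable_fst.
- by apply: (measurableT_comp measurable_snd); exact: measurable_fst.
- exact: measurable_snd.
Qed.

Lemma measurable_outer_weight j tau : measurable_fun setT (outer_weight j tau : mR * mR -> R).
Proof.
by apply: measurable_funM; apply: (measurableT_comp (measurable_wt a b _));
  [exact: measurable_fst|exact: measurable_snd].
Qed.

Lemma slice_ge0 F r : (forall p, 0 <= F p) -> (0 <= slice F r)%E.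
Proof. by move=> F0; apply: integral_ge0 => y _; rewrite lee_fin. Qed.

Lemma measurable_slice F : measurable_fun setT (F : mP -> R) -> (forall p, 0 <= F p) ->
  measurable_fun setT (slice F : mR * mR * mR -> \bar R).
Proof.
move=> mF F0; apply: (@measurable_fun_fubini_tonelli_G _ _ _ _ _ lebesgue_R2m
  (fun z : R2m * (mR * mR * mR) => (F z)%:E)) => //.
  exact/measurable_EFinP.
Qed.

Lemma measurable_tri j : measurable_fun setT (fun z : (mR * mR) * mR => tri j z.1 z.2 : mR * mR *
  mR).
Proof.
by case: j; apply: measurable_fun_pair => /=; try apply: measurable_fun_pair => /=;
  repeat (exact: measurable_fst || exact: measurable_snd ||
     apply: (measurableT_comp measurable_fst) || apply: (measurableT_comp measurable_snd)).
Qed.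

Lemma measurable_inner_integrand j (o : option R) F : measurable_fun setT (F : mP -> R) ->
  (forall p, 0 <= F p) ->
  measurable_fun setT (fun z : (mR * mR) * mR => ((wt a b o z.2)%:E * slice F (tri j z.1 z.2))%E).
Proof.
move=> mF F0; apply: emeasurable_funM.
  apply/measurable_EFinP; apply: (measurableT_comp (measurable_wt a b _)); exact: measurable_snd.
exact: (measurableT_comp (measurable_slice mF F0) (measurable_tri j)).
Qed.

Lemma inner_ge0 j o F s : (forall p, 0 <= F p) -> (0 <= inner j o F s)%E.
Proof.
by move=> F0; apply: integral_ge0 => t _; rewrite mule_ge0 ?slice_ge0// lee_fin wt_ge0.
Qed.

Lemma measurable_inner j o F : measurable_fun setT (F : mP -> R) -> (forall p, 0 <= F p) ->
  measurable_fun setT (inner j o F : mR * mR -> \bar R).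
Proof.
move=> mF F0; apply: (@measurable_fun_fubini_tonelli_F _ _ _ _ _ (radial_measure o)
  (fun z : (mR * mR) * mR => ((wt a b o z.2)%:E * slice F (tri j z.1 z.2))%E)).
  exact: measurable_inner_integrand.
by move=> z; rewrite mule_ge0 ?slice_ge0// lee_fin wt_ge0.
Qed.

(** Tonelli brings any chosen radius innermost; the estimate in that radius can then be applied with
    the two others fixed. *)
Lemma Int_inner j tau F : measurable_fun setT (F : mP -> R) -> (forall p, 0 <= F p) ->
  (Int tau F = \int[radial_measure (tau (fst_other j)) \x radial_measure (tau (snd_other j))]_s
    ((outer_weight j tau s)%:E * inner j (tau j) F s))%E.
Proof.
move=> mF F0.
pose H (z : mR * mR * mR) := ((weight tau z)%:E * slice F z)%E.
have mH : measurable_fun setT H.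
  apply: emeasurable_funM; last exact: measurable_slice.
  by apply/measurable_EFinP; exact: measurable_weight.
have H0 z : (0 <= H z)%E by rewrite mule_ge0 ?slice_ge0// lee_fin weight_ge0.
have mHtri i : measurable_fun setT (fun z : (mR * mR) * mR => H (tri i z.1 z.2)).
  exact: (measurableT_comp mH (measurable_tri i)).
pose K i (s : mR * mR) := (\int[radial_measure (tau i)]_t H (tri i s t))%E.
have mK i : measurable_fun setT (K i : mR * mR -> \bar R).
  by apply: (@measurable_fun_fubini_tonelli_F _ _ _ _ _ (radial_measure (tau i))
    (fun z : (mR * mR) * mR => H (tri i z.1 z.2))).
have K0 i s : (0 <= K i s)%E by apply: integral_ge0 => t _.
have KE i s : K i s = ((outer_weight i tau s)%:E * inner i (tau i) F s)%E.
  rewrite /K /inner -(ge0_integralZl_EFin _ _ _ _ (outer_weight_ge0 i tau s))//.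
  - apply: eq_integral => t _; rewrite muleA -EFinM /H; congr (_%:E * _)%E.
    by rewrite /weight /outer_weight; case: i => /=; ring.
  - by move=> t _; rewrite mule_ge0 ?slice_ge0// lee_fin wt_ge0.
  - have := measurable_inner_integrand i (tau i) mF F0.
    by move=> h; exact: (measurableT_comp h (pair1_measurable (s : mR * mR))).
under eq_integral do rewrite -KE.
rewrite (fubini_tonelli1 _ (mK j))// /fubini_F /=.
have swap23 t1 : (\int[radial_measure (tau J2)]_t2 \int[radial_measure (tau J3)]_t3 H (t1, t2, t3) =
    \int[radial_measure (tau J3)]_t3 \int[radial_measure (tau J2)]_t2 H (t1, t2, t3))%E.
  apply: (@fubini_tonelli _ _ _ _ _ (radial_measure (tau J2)) (radial_measure (tau J3))
    (fun z : mR * mR => H (t1, z.1, z.2))) => //.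
  apply: (measurableT_comp mH); apply: measurable_fun_pair => /=; last exact: measurable_snd.
  by apply: measurable_fun_pair => //; exact: measurable_fst.
case: j => /=; first last.
- by [].
- by apply: eq_integral => t1 _; exact: swap23.
rewrite /Int.
rewrite [LHS](@fubini_tonelli _ _ _ _ _ (radial_measure (tau J1)) (radial_measure (tau J2)) (K J3)
  (mK J3) (K0 J3)).
apply: eq_integral => t2 _.
apply: (@fubini_tonelli _ _ _ _ _ (radial_measure (tau J1)) (radial_measure (tau J3))
  (fun z : mR * mR => H (z.1, t2, z.2))) => //.
apply: (measurableT_comp mH); apply: measurable_fun_pair => /=; last exact: measurable_snd.
by apply: measurable_fun_pair => //; exact: measurable_fst.
Qed.

(** Where the outer weight does not vanish, the two other radii lie in [a, b]; this is the
    hypothesis of the estimate in one radius. *)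
Lemma outer_slab j tau (s : R * R) t : outer_weight j tau s != 0 -> a <= t <= b ->
  slab a b (tri j s t).
Proof.
rewrite /outer_weight /wt; case: ifP => h1; last by rewrite mul0r eqxx.
case: ifP => h2; last by rewrite mulr0 eqxx.
by move=> _ ht; case: j h1 h2 => h1 h2; case.
Qed.

Lemma slice_le F G r : measurable_fun setT (F : mP -> R) -> measurable_fun setT (G : mP -> R) ->
  (forall p, 0 <= F p) -> (forall y, F (y, r) <= G (y, r)) -> (slice F r <= slice G r)%E.
Proof.
move=> mF mG F0 FG; apply: ge0_le_integral => //.
- by move=> y _; rewrite lee_fin.
- by apply/measurable_EFinP; apply: (measurableT_comp mF); exact: pair2_measurable.
- by apply/measurable_EFinP; apply: (measurableT_comp mG); exact: pair2_measurable.
- by move=> y _; rewrite lee_fin.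
Qed.

Lemma sliceD F G r : measurable_fun setT (F : mP -> R) -> measurable_fun setT (G : mP -> R) ->
  (forall p, 0 <= F p) -> (forall p, 0 <= G p) ->
  slice (fun p => F p + G p) r = (slice F r + slice G r)%E.
Proof.
move=> mF mG F0 G0; rewrite /slice; under eq_integral do rewrite EFinD.
apply: ge0_integralD => //; try by move=> y _; rewrite lee_fin.
- by apply/measurable_EFinP; apply: (measurableT_comp mF); exact: pair2_measurable.
- by apply/measurable_EFinP; apply: (measurableT_comp mG); exact: pair2_measurable.
Qed.

Lemma sliceZ (c : R) F r : 0 <= c -> measurable_fun setT (F : mP -> R) -> (forall p, 0 <= F p) ->
  slice (fun p => c * F p) r = (c%:E * slice F r)%E.
Proof.
move=> c0 mF F0; rewrite /slice; under eq_integral do rewrite EFinM.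
have mf : measurable_fun setT (fun y : R2m => (F (y, r))%:E).
  by apply/measurable_EFinP; apply: (measurableT_comp mF); exact: pair2_measurable.
by rewrite (ge0_integralZl_EFin _ _ _ mf c0)// => y _; rewrite lee_fin.
Qed.

Lemma Int_outer tau F : measurable_fun setT (F : mP -> R) -> (forall p, 0 <= F p) ->
  (Int tau F = \int[radial_measure (tau J1) \x radial_measure (tau J2)]_s
     \int[radial_measure (tau J3)]_t ((weight tau (s, t))%:E * slice F (s, t)))%E.
Proof.
move=> mF F0.
rewrite (fubini_tonelli1 (fun s : mR * mR => \int[radial_measure (tau J3)]_t ((weight tau (s,
  t))%:E * slice F (s, t)))%E)//.
- apply: (@measurable_fun_fubini_tonelli_F _ _ _ _ _ (radial_measure (tau J3))
    (fun z : mR * mR * mR => ((weight tau z)%:E * slice F z)%E)).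
    apply: emeasurable_funM; last exact: measurable_slice.
    by apply/measurable_EFinP; exact: measurable_weight.
  by move=> z; rewrite mule_ge0 ?slice_ge0// lee_fin weight_ge0.
- by move=> s; apply: integral_ge0 => t _; rewrite mule_ge0 ?slice_ge0// lee_fin weight_ge0.
Qed.

Lemma weight_slab tau r : weight tau r != 0 -> slab a b r.
Proof.
rewrite /weight => h j; have := h; apply: contraR => hj.
suff -> : wt a b (tau j) (radius r j) = 0 -> wt a b (tau J1) r.1.1 * wt a b (tau J2) r.1.2 * wt a
  b (tau J3) r.2 == 0.
  by [].
  by rewrite /wt (negbTE hj).
by case: (j) => /= ->; rewrite ?(mul0r, mulr0).
Qed.

Section pointwise.
Variables (tau : idx3 -> option R) (F G : P -> R).
Hypotheses (mF : measurable_fun setT (F : mP -> R)) (mG : measurable_fun setT (G : mP -> R))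
  (F0 : forall p, 0 <= F p) (G0 : forall p, 0 <= G p).

Let term (H : P -> R) (z : mR * mR * mR) := ((weight tau z)%:E * slice H z)%E.

Let mterm H : measurable_fun setT (H : mP -> R) -> (forall p, 0 <= H p) ->
  measurable_fun setT (term H).
Proof.
move=> mH H0; apply: emeasurable_funM; last exact: measurable_slice.
by apply/measurable_EFinP; exact: measurable_weight.
Qed.

Let term0 H z : (forall p, 0 <= H p) -> (0 <= term H z)%E.
Proof. by move=> H0; rewrite mule_ge0 ?slice_ge0// lee_fin weight_ge0. Qed.

Let mterm1 H s : measurable_fun setT (H : mP -> R) -> (forall p, 0 <= H p) ->
  measurable_fun setT (fun t : mR => term H ((s : mR * mR), t)).
Proof. by move=> mH H0; exact: (measurableT_comp (mterm mH H0) (pair1_measurable s)). Qed.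

Let mterm3 H : measurable_fun setT (H : mP -> R) -> (forall p, 0 <= H p) ->
  measurable_fun setT (fun s : mR * mR => \int[radial_measure (tau J3)]_t term H (s, t))%E.
Proof.
move=> mH H0; apply: (@measurable_fun_fubini_tonelli_F _ _ _ _ _ (radial_measure (tau J3)) (term
  H)).
  exact: mterm.
by move=> z; exact: term0.
Qed.

Lemma Int_le : (forall p, slab a b p.2 -> F p <= G p) -> (Int tau F <= Int tau G)%E.
Proof.
move=> FG; rewrite (Int_outer tau mF F0) (Int_outer tau mG G0).
apply: ge0_le_integral; first exact: measurableT.
- by move=> s _; apply: integral_ge0 => t _; exact: term0.
- exact: mterm3 mF F0.
- exact: mterm3 mG G0.
move=> s _; apply: ge0_le_integral; first exact: measurableT.
- by move=> t _; exact: term0.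
- exact: mterm1 mF F0.
- exact: mterm1 mG G0.
move=> t _; have [->|w0] := eqVneq (weight tau (s, t)) 0; first by rewrite !mul0e.
apply: lee_wpmul2l; first by rewrite lee_fin weight_ge0.
by apply: slice_le => // y; apply: FG; exact: weight_slab w0.
Qed.

Lemma IntD : Int tau (fun p => F p + G p) = (Int tau F + Int tau G)%E.
Proof.
rewrite !Int_outer//; [|exact: measurable_funD|by move=> p; rewrite addr_ge0].
rewrite -ge0_integralD//; first last.
- exact: mterm3.
- by move=> s _; apply: integral_ge0 => t _; exact: term0.
- exact: mterm3.
- by move=> s _; apply: integral_ge0 => t _; exact: term0.
apply: eq_integral => s _; rewrite -ge0_integralD//; first last.
- exact: mterm1.
- by move=> t _; exact: term0.
- exact: mterm1.
- by move=> t _; exact: term0.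
apply: eq_integral => t _; rewrite /term sliceD// ge0_muleDr//; exact: slice_ge0.
Qed.

Lemma IntZ (c : R) : 0 <= c -> Int tau (fun p => c * F p) = (c%:E * Int tau F)%E.
Proof.
move=> c0; rewrite !Int_outer//; [|exact: measurable_funM|by move=> p; rewrite mulr_ge0].
rewrite -(ge0_integralZl_EFin _ _ _ (mterm3 mF F0) c0)//; last first.
  by move=> s _; apply: integral_ge0 => t _; exact: term0.
apply: eq_integral => s _.
rewrite -(ge0_integralZl_EFin _ _ _ (mterm1 s mF F0) c0)//; last by move=> t _; exact: term0.
by apply: eq_integral => t _; rewrite /term sliceZ// muleCA.
Qed.

Lemma Int_frozen (c : idx3 -> R) : (forall j, tau j = Some (c j)) ->
  (forall j, a <= c j <= b) -> Int tau F = slice F (c J1, c J2, c J3).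
Proof.
move=> tc hc; rewrite Int_outer//.
rewrite (fubini_tonelli1 _ (mterm3 mF F0)) /fubini_F; last first.
  by move=> s; apply: integral_ge0 => t _; exact: term0.
rewrite !tc /=.
have m2 : measurable_fun setT (fun s1 : mR => \int[\d_(c J2 : mR)]_s2 \int[\d_(c J3 : mR)]_t term
  F ((s1, s2), t))%E.
  have := @measurable_fun_fubini_tonelli_F _ _ _ _ _ (radial_measure (tau J2)) _ (mterm3 mF F0).
  rewrite !tc /=; apply => s; apply: integral_ge0 => t _; exact: term0.
rewrite integral_dirac// diracT mul1e.
have m3 : measurable_fun setT (fun s2 : mR => \int[\d_(c J3 : mR)]_t term F ((c J1, s2), t))%E.
  have := measurableT_comp (mterm3 mF F0) (pair1_measurable (c J1 : mR)).
  by rewrite tc.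
rewrite integral_dirac// diracT mul1e.
rewrite integral_dirac//; last exact: mterm1.
rewrite diracT mul1e /term /weight !tc /= /wt !hc !mulr1 mul1e//.
Qed.

End pointwise.

End triple_integral.

Section integrated_step.
Context {R : realType} {m : nat}.
Local Notation Rm := 'rV[R]_m.
Local Notation R2m := (Rm * Rm)%type.
Local Notation mR := (measurableTypeR R).
Local Notation P := (R2m * (R * R * R))%type.
Local Notation mP := (R2m * (mR * mR * mR))%type.
Variables (a b : R).
Hypotheses (a0 : 0 < a) (ab : a < b).

Lemma inner_frozen j (c : R) (F : P -> R) s : a <= c <= b -> measurable_fun setT (F : mP -> R) ->
  (forall p, 0 <= F p) -> inner a b j (Some c) F s = slice F (tri j s c).
Proof.
move=> hc mF F0; rewrite /inner /= integral_dirac//; last first.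
  have h := measurable_inner_integrand a b j (Some c) mF F0.
  exact: (measurableT_comp h (pair1_measurable (s : mR * mR))).
by rewrite diracT mul1e /wt hc mul1e.
Qed.

Lemma setr_tri j (s : R * R) (t t' : R) : setr (tri j s t) j t' = tri j s t'.
Proof. by case: j. Qed.

Lemma inner_integrated j (F : P -> R) (s : R * R) (t0 : R) : measurable_fun setT (F : mP -> R) ->
  (forall p, 0 <= F p) -> inner a b j None F s =
  (\int[lebesgue_R2m \x lebesgue_measure]_z
     (wt a b None z.2 * F (z.1, setr (tri j s t0) j z.2))%:E)%E.
Proof.
move=> mF F0; have mW := measurable_weighted a b j (tri j s t0) mF.
rewrite (fubini_tonelli2 _ mW) /fubini_G /inner; last first.
  by move=> z; rewrite lee_fin mulr_ge0 ?wt_ge0.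
apply: eq_integral => t _ /=; rewrite /slice setr_tri.
under [RHS]eq_integral do rewrite EFinM.
rewrite (ge0_integralZl_EFin _ _ _ _ (wt_ge0 a b None t))//; first by move=> y _; rewrite lee_fin.
by apply/measurable_EFinP; apply: (measurableT_comp mF); exact: pair2_measurable.
Qed.

Variables (u : R2m -> R) (M : R).
Hypotheses (mu : measurable_fun setT u) (uM : forall y, `|u y| <= M)
  (u1 : (\int[lebesgue_R2m]_y `|u y|%:E < +oo)%E).

(** [one_step_line] integrated against the weights of the two other radii. Its boundary terms become
    the same triple integral with the j-th radius frozen at a or at b. *)
Lemma Int_step tau j c (w W : P -> R) s : 0 < c -> admissible c j w W -> clean j s ->
  (Int a b (upd tau j None) (fun p => nsq u (nabla j s) p * w p)%R <=
   Int a b (upd tau j (Some a)) (fun p => nsq u s p * w p)%R +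
   Int a b (upd tau j (Some b)) (fun p => nsq u s p * w p)%R +
   (5 * c)%:E * Int a b (upd tau j None) (fun p => nsq u s p * W p)%R)%E.
Proof.
move=> c0 hadm hs; have [F [Fw hF mW hp _]] := hadm.
have w0 p : 0 <= w p by have [] := hp p.
have W0 p : 0 <= W p by have [] := hp p.
have mw : measurable_fun setT (w : mP -> R) by rewrite -Fw; have [] := jet2_b0 hF.
have mn s' : measurable_fun setT (nsq u s' : mP -> R) by have [] := slab_bounded_nsq mu uM s'.
have n0 s' p : 0 <= nsq u s' p by exact: nsq_ge0.
have mH1 := measurable_funM (mn (nabla j s)) mw; have mH2 := measurable_funM (mn s) mw.
have mH3 := measurable_funM (mn s) mW.
have H10 p : 0 <= nsq u (nabla j s) p * w p by rewrite mulr_ge0.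
have H20 p : 0 <= nsq u s p * w p by rewrite mulr_ge0.
have H30 p : 0 <= nsq u s p * W p by rewrite mulr_ge0.
have c5 : 0 <= 5 * c by rewrite mulr_ge0// ltW.
have distr (x : R) (A B C : \bar R) : (0 <= A -> 0 <= B -> 0 <= C ->
    x%:E * A + x%:E * B + (5 * c)%:E * (x%:E * C) = x%:E * (A + B + (5 * c)%:E * C))%E.
  move=> A0 B0 C0; rewrite muleCA ge0_muleDr ?adde_ge0//; last by rewrite mule_ge0// lee_fin.
  by rewrite (ge0_muleDr _ A0 B0).
have ha : a <= a <= b by rewrite lexx ltW.
have hb : a <= b <= b by rewrite lexx ltW.
rewrite !(Int_inner a b j _ _)//.
have E1 o : upd tau j o (fst_other j) = tau (fst_other j) by case: (j).
have E2 o : upd tau j o (snd_other j) = tau (snd_other j) by case: (j).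
have E3 o z : outer_weight a b j (upd tau j o) z = outer_weight a b j tau z.
  by rewrite /outer_weight E1 E2.
rewrite !upd_same !E1 !E2; set mo := (X in integral X).
have mow : measurable_fun setT (fun z : mR * mR => (outer_weight a b j tau z)%:E).
  by apply/measurable_EFinP; exact: measurable_outer_weight.
have ow0 z := outer_weight_ge0 a b j tau z.
pose T o (H : P -> R) (z : mR * mR) := ((outer_weight a b j tau z)%:E * inner a b j o H z)%E.
have mT o H : measurable_fun setT (H : mP -> R) -> (forall p, 0 <= H p) -> measurable_fun setT (T
  o H).
  by move=> mH H0; apply: emeasurable_funM => //; exact: measurable_inner.
have T0 o H z : (forall p, 0 <= H p) -> (0 <= T o H z)%E.
  by move=> H0; rewrite mule_ge0 ?inner_ge0// lee_fin.
have ET o o' (H : P -> R) : (\int[mo]_z ((outer_weight a b j (upd tau j o) z)%:E * inner a b j o'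
  H z) =
    \int[mo]_z T o' H z)%E by apply: eq_integral => z _; rewrite E3.
rewrite !ET -(ge0_integralZl_EFin _ _ (fun z _ => T0 _ _ z H30) (mT _ _ mH3 H30) c5); last exact:
  measurableT.
have mS := mT (Some a) _ mH2 H20; have mS' := mT (Some b) _ mH2 H20.
have S0 z := T0 (Some a) _ z H20; have S0' z := T0 (Some b) _ z H20.
rewrite -(ge0_integralD _ _ (fun z _ => S0 z) mS (fun z _ => S0' z) mS')//.
have mU := mT None _ mH3 H30; have U0 z := T0 None _ z H30.
rewrite -(ge0_integralD _ _ _ (emeasurable_funD mS mS') _ (measurable_funeM _ mU))//; first last.
- by move=> z _; rewrite mule_ge0 ?lee_fin.
- by move=> z _; rewrite adde_ge0.
apply: ge0_le_integral; first exact: measurableT.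
- by move=> z _; exact: T0.
- exact: mT.
- by apply: emeasurable_funD; [exact: emeasurable_funD|exact: measurable_funeM].
move=> z _; rewrite /T.
have [->|oz] := eqVneq (outer_weight a b j tau z) 0; first by rewrite !mul0e mule0 !adde0.
rewrite (distr _ _ _ _ (inner_ge0 _ _ _ _ _ H20) (inner_ge0 _ _ _ _ _ H20) (inner_ge0 _ _ _ _ _
  H30)).
apply: lee_wpmul2l; first by rewrite lee_fin.
rewrite !(inner_integrated j z a)// !inner_frozen//.
have hr := outer_slab oz ha.
have := one_step_line a0 ab hr mu uM u1 c0 hadm hs.
by rewrite !setr_tri.
Qed.

End integrated_step.

Section extension_of_indicator.
Context {R : realType} {m : nat}.
Local Notation Rm := 'rV[R]_m.
Local Notation R2m := (Rm * Rm)%type.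
Local Notation P := (R2m * (R * R * R))%type.
Local Notation kap0 := (fun _ : idx3 => @K0 m).
Variable A : set R2m.
Hypothesis mA : measurable A.

Local Notation v := (ext kap0 (\1_A : R2m -> R)).

Lemma indic_norm_le1 (y : R2m) : `|\1_A y : R| <= 1.
Proof. by rewrite indicE; case: (y \in A); rewrite ?normr1 ?normr0. Qed.

Lemma measurable_indicR : measurable_fun setT (\1_A : R2m -> R).
Proof. exact: measurable_indic. Qed.

Lemma integral_norm_indic : (\int[lebesgue_R2m]_y `|\1_A y : R|%:E = lebesgue_R2m A)%E.
Proof.
transitivity (\int[lebesgue_R2m]_y (\1_A y : R)%:E)%E; last by rewrite integral_indic// setIT.
by apply: eq_integral => y _; rewrite ger0_norm// indicE.
Qed.

Lemma ext_indic_ge0 (p : P) : positive p -> 0 <= v p.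
Proof. by move=> pos; apply: ext_ge0 => // y; rewrite indicE. Qed.

(** The kernel has mass one, so the extension preserves the measure of [A] on every slice; all
    energies of v are ultimately measured by this. *)
Lemma integral_ext_indic r : (forall j, 0 < radius r j) ->
  (\int[lebesgue_R2m]_y (v (y, r))%:E = lebesgue_R2m A)%E.
Proof.
move=> pos.
pose H (z : R2m * (Rm * Rm * Rm)) : \bar R :=
  (kprod kap0 (point r z.2) * \1_A (z.1 + twist z.2))%:E.
have mk : measurable_fun setT (fun w : Rm * Rm * Rm => kprod kap0 (point r w)).
  have := measurable_ext_integrand_w kap0 ((0 : R2m), r) (measurable_cst (1 : R)).
  by apply: eq_measurable_fun => w _ /=; rewrite mulr1.
have mH : measurable_fun setT H.
  apply/measurable_EFinP; apply: measurable_funM.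
    by apply: (measurableT_comp mk); exact: measurable_snd.
  apply: (measurableT_comp measurable_indicR); apply: measurable_funD_pair; first exact:
    measurable_fst.
  by apply: (measurableT_comp measurable_twist); exact: measurable_snd.
have H0 z : (0 <= H z)%E by rewrite lee_fin mulr_ge0 ?indicE// ltW// kprod0_gt0.
transitivity (\int[lebesgue_R2m]_y \int[lebesgue_R3m]_w H (y, w))%E.
  apply: eq_integral => y _; rewrite fineK//.
  have posp : positive (y, r) by [].
  exact: integrable_fin_num (integrable_ext_integrand kap0 measurable_indicR posp indic_norm_le1).
rewrite (@fubini_tonelli _ _ _ _ _ lebesgue_R2m lebesgue_R3m H mH H0).
transitivity (\int[lebesgue_R3m]_w ((kprod kap0 (point r w))%:E * lebesgue_R2m A))%E.
  apply: eq_integral => w _.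
  have mt : measurable_fun setT (fun y : R2m => (\1_A y : R)%:E) by apply/measurable_EFinP.
  have mtw : measurable_fun setT (fun y : R2m => (\1_A (y + twist w) : R)%:E).
    by apply: (measurableT_comp mt); apply: measurable_funD_pair.
  rewrite /H /=; under eq_integral do rewrite EFinM.
  rewrite (ge0_integralZl_EFin _ _ _ mtw (ltW (kprod0_gt0 w pos)))//.
  rewrite (ge0_integral_R2m_translation (twist w) mt)//.
  by rewrite integral_indic// setIT.
have ek : measurable_fun setT (fun w : Rm * Rm * Rm => (kprod kap0 (point r w))%:E) by
  exact/measurable_EFinP.
rewrite (ge0_integralZr _ _ ek)//; last by move=> w _; rewrite lee_fin ltW// kprod0_gt0.
by rewrite integral_kprod0// mul1e.
Qed.

Lemma cutoff_le1 n (p : P) : positive p -> cutoff (\1_A : R2m -> R) n p <= 1.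
Proof.
move=> pos; rewrite /cutoff exprn_ile1 ?ramp_ge0// /ramp ge_max ler01 /=.
have := ext_indic_ge0 pos; lra.
Qed.

Lemma cutoff_gt0 n (p : P) : 0 < cutoff (\1_A : R2m -> R) n.+1 p -> v p < 2^-1.
Proof.
rewrite /cutoff /ramp => h; rewrite ltNge; apply/negP => v2; move: h.
by rewrite (_ : Num.max _ _ = 0) ?expr0n ?ltxx//; apply: max_l; lra.
Qed.

End extension_of_indicator.

Section energy.
Context {R : realType} {m : nat}.
Local Notation Rm := 'rV[R]_m.
Local Notation R2m := (Rm * Rm)%type.
Local Notation mR := (measurableTypeR R).
Local Notation P := (R2m * (R * R * R))%type.
Local Notation mP := (R2m * (mR * mR * mR))%type.
Variables (a b : R).
Hypotheses (a0 : 0 < a) (ab : a < b).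
Implicit Types (F G w W : P -> R) (B : idx3 -> bool) (j k : idx3).

Definition good F : Prop := measurable_fun setT (F : mP -> R) /\ forall p, 0 <= F p.

Lemma good_mul F G : good F -> good G -> good (fun p => F p * G p).
Proof. by move=> [mF F0] [mG G0]; split=> [|p]; [exact: measurable_funM|rewrite mulr_ge0]. Qed.

Lemma good_add F G : good F -> good G -> good (fun p => F p + G p).
Proof. by move=> [mF F0] [mG G0]; split=> [|p]; [exact: measurable_funD|rewrite addr_ge0]. Qed.

Lemma admissible_good c j w W : admissible c j w W -> good w /\ good W.
Proof.
move=> [F [<- hF mW h _]]; split.
  by split=> [|p]; [have [] := jet2_b0 hF|have [] := h p].
by split=> // p; have [] := h p.
Qed.

Definition freeze B (c : idx3 -> R) j : option R := if B j then None else Some (c j).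

(* [B] is the set of radii that are integrated; the others are arbitrary in [a, b]. *)
Definition energy_bound (L : R) B F (C : R) : Prop := good F /\
  forall c : idx3 -> R, (forall j, a <= c j <= b) -> (Int a b (freeze B c) F <= (C * L)%:E)%E.

Section fixed_bound.
Variable L : R.

Lemma energy_bound_le B F G C : good G -> (forall p, slab a b p.2 -> G p <= F p) ->
  energy_bound L B F C -> energy_bound L B G C.
Proof.
move=> [mG G0] GF [[mF F0] h]; split; first by split.
move=> c hc; apply: le_trans (h c hc).
exact: Int_le mG mF G0 F0 GF.
Qed.

Lemma energy_bound_add B F G C C' : energy_bound L B F C -> energy_bound L B G C' ->
  energy_bound L B (fun p => F p + G p) (C + C').
Proof.
move=> [gF h] [gG h']; split=> [|c hc]; first exact: good_add.
rewrite (IntD _ _ _ gF.1 gG.1 gF.2 gG.2) mulrDl EFinD.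
by apply: leeD; [exact: h|exact: h'].
Qed.

Lemma energy_bound0 B : energy_bound L B (fun=> 0) 0.
Proof.
split=> [|c hc]; first by split.
rewrite mul0r /Int [leLHS](_ : _ = 0)%E//.
do 3!(apply: integral0_eq => ? _).
by rewrite /slice integral0 mule0.
Qed.

Section step.
Variables (u : R2m -> R) (M : R).
Hypotheses (mu : measurable_fun setT u) (uM : forall y, `|u y| <= M)
  (u1 : (\int[lebesgue_R2m]_y `|u y|%:E < +oo)%E).

Lemma good_nsq s : good (nsq u s).
Proof. by split=> [|p]; [have [] := slab_bounded_nsq mu uM s|exact: nsq_ge0]. Qed.

Lemma good_cutoff n : good (cutoff u n).
Proof. by split=> [|p]; [have [] := slab_bounded_cutoff mu uM n|exact: cutoff_ge0]. Qed.

(** The two copies of [C] are the boundary terms, with r_j frozen at a and at b; [C'] is the error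
    left by the weight. *)
Lemma energy_bound_step c B j w W s C C' : 0 < c -> B j -> admissible c j w W -> clean j s ->
  energy_bound L (upd B j false) (fun p => nsq u s p * w p) C ->
  energy_bound L B (fun p => nsq u s p * W p) C' ->
  energy_bound L B (fun p => nsq u (nabla j s) p * w p) (C + C + 5 * c * C').
Proof.
move=> c0 Bj hadm hs [_ h] [gW h'].
have [gw _] := admissible_good hadm; split=> [|d hd].
  exact: good_mul (good_nsq _) gw.
have E x : upd (freeze B d) j (Some x) = freeze (upd B j false) (upd d j x).
  by apply/funext => i; rewrite /freeze; case: (j) (i) => -[].
have E0 : upd (freeze B d) j None = freeze B d.
  by apply/funext => i; rewrite /freeze; move: Bj; case: (j) (i) => -[] //= ->.
have hupd x : a <= x <= b -> forall i, a <= upd d j x i <= b.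
  by move=> hx i; move: hx (hd i); case: (j) (i) => -[].
have := Int_step a0 ab mu uM u1 (freeze B d) c0 hadm hs; rewrite E0 !E => k.
apply: le_trans k _.
have c5 : 0 <= 5 * c by rewrite mulr_ge0// ltW.
have -> : (C + C + 5 * c * C') * L = C * L + C * L + 5 * c * (C' * L) by ring.
rewrite !EFinD (EFinM (5 * c) (C' * L)).
apply: leeD; first apply: leeD.
- by apply: h; apply: hupd; rewrite lexx ltW.
- by apply: h; apply: hupd; rewrite lexx ltW.
- by apply: lee_wpmul2l; rewrite ?lee_fin//; exact: h'.
Qed.

Lemma energy_bound_step1 B j s C : B j -> clean j s ->
  energy_bound L (upd B j false) (nsq u s) C -> energy_bound L B (nsq u (nabla j s)) (C + C).
Proof.
move=> Bj hs h.
have E1 s' : (fun p => nsq u s' p * 1) = nsq u s' by apply/funext => p; rewrite mulr1.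
have E0 : (fun p => nsq u s p * 0) = fun=> 0 by apply/funext => p; rewrite mulr0.
have := @energy_bound_step 1 B j (fun=> 1) (fun=> 0) s C 0 ltr01 Bj (admissible1 1 j) hs.
by rewrite !E1 E0 mulr0 addr0; apply => //; exact: energy_bound0.
Qed.

End step.
End fixed_bound.
End energy.

(** * The chain of weighted energy bounds for v and for U_f *)

Section energy_chain.
Context {R : realType} {m : nat}.
Local Notation Rm := 'rV[R]_m.
Local Notation R2m := (Rm * Rm)%type.
Local Notation P := (R2m * (R * R * R))%type.
Local Notation jet := (@jet m).
Local Notation kap0 := (fun _ : idx3 => @K0 m).
Local Notation s0 := [:: kap0].
Variables (a b : R).
Hypotheses (a0 : 0 < a) (ab : a < b).
Implicit Types (F G w W : P -> R) (B : idx3 -> bool) (j k : idx3).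

Variables (A : set R2m) (LA : R).
Hypotheses (mA : measurable A) (hA : lebesgue_R2m A = LA%:E).

Local Notation g := (\1_A : R2m -> R).
Local Notation v := (ext kap0 g).
Local Notation energy_bound := (energy_bound a b).
Local Notation N s := (nsq g s).
Local Notation none := (fun _ : idx3 => false).
Local Notation on1 j := (upd none j true).
Local Notation on2 j k := (upd (upd none k true) j true).
Local Notation all3 := (fun _ : idx3 => true).

Let mg : measurable_fun setT g := measurable_indicR mA.
Let gM := @indic_norm_le1 R m A.
Let g1 : (\int[lebesgue_R2m]_y `|g y|%:E < +oo)%E.
Proof. by rewrite integral_norm_indic// hA ltry. Qed.
Let LA0 : 0 <= LA. Proof. by rewrite -lee_fin -hA measure_ge0. Qed.

Lemma on1_off j : upd (on1 j) j false = none.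
Proof. by apply/funext => i; case: j; case: i. Qed.

Lemma on2_off j k : j <> k -> upd (on2 j k) j false = on1 k.
Proof. by move=> jk; apply/funext => i; case: j jk; case: k; case: i. Qed.

Lemma on2C j k : on2 j k = on2 k j.
Proof. by apply/funext => i; case: j; case: k; case: i. Qed.

Lemma all3_off l j k : l <> j -> l <> k -> j <> k -> upd all3 l false = on2 j k.
Proof. by move=> lj lk jk; apply/funext => i; case: l lj lk; case: j jk; case: k; case: i. Qed.

Lemma slab_pos (p : P) : slab a b p.2 -> positive p.
Proof. exact: slab_positive. Qed.

Lemma nsq_s0 (u : R2m -> R) p : nsq u s0 p = ext kap0 u p ^+ 2.
Proof. by rewrite /nsq big_seq1. Qed.

Lemma v2_le1 (p : P) : slab a b p.2 -> N s0 p <= 1.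
Proof.
move=> hp; have pos := slab_pos hp; rewrite nsq_s0.
have v0 := ext_indic_ge0 A pos; have v1 := ext_indic_le1 pos mA.
by rewrite exprn_ile1.
Qed.

Let clean0 j : clean j s0. Proof. by []. Qed.
Let clean1 j k : j <> k -> clean j (nabla k s0). Proof. by move=> jk; exact: clean_nabla. Qed.
Let clean2 j k l : j <> k -> j <> l -> clean j (nabla k (nabla l s0)).
Proof. by move=> jk jl; apply: clean_nabla => //; exact: clean1. Qed.

Let goodN s : good (N s) := good_nsq mg gM s.

Lemma absorb_v B F C : good F -> energy_bound LA B F C -> energy_bound LA B (fun p => N s0 p * F
  p) C.
Proof.
move=> gF; apply: energy_bound_le; first exact: good_mul.
by move=> p hp; rewrite -[leRHS]mul1r ler_wpM2r ?v2_le1//; exact: gF.2.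
Qed.

(** v^2 <= v, and the integral of v over a slice is |A|. *)
Lemma indic_energy0 : energy_bound LA none (N s0) 1.
Proof.
split=> [|c hc]; first exact: goodN.
have [mN N0] := goodN s0.
rewrite (Int_frozen mN N0 (c := c))//.
have hs : slab a b (c J1, c J2, c J3) by case; exact: hc.
have pos j : 0 < radius (c J1, c J2, c J3) j by have /andP[h _] := hs j; exact: lt_le_trans h.
rewrite mul1r -hA -(integral_ext_indic mA pos); apply: ge0_le_integral => //.
- by move=> y _; rewrite lee_fin.
- by apply/measurable_EFinP; apply: (measurableT_comp mN); exact: pair2_measurable.
- apply/measurable_EFinP; have h := measurable_ext kap0 mg.
  by apply: (measurableT_comp h); exact: pair2_measurable.
move=> y _; rewrite lee_fin nsq_s0 expr2.
have posp : positive (y, (c J1, c J2, c J3)) by [].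
by rewrite ler_piMl ?ext_indic_ge0// ext_indic_le1.
Qed.

(** Each constant has the form C + C + 5 * 200 * C' dictated by [energy_bound_step]: boundary terms,
    then error. *)
Definition c_indic_product2 : R := 2 + 2 + 5 * 200 * 4.
Definition c_indic_product3 : R := 4 + 4 + 5 * 200 * 8.
Definition c_indic_triple : R := c_indic_product2 + c_indic_product2 + 5 * 200 * (c_indic_product3
  + c_indic_product3).

(** 200 is a common admissibility constant for the chain: 50 covers the powers of the cut-off, and
    each of at most two products of weights doubles it. *)
Let c200 : 0 < (200 : R). Proof. by rewrite ltr0n. Qed.
Let c4 : 4 <= (200 : R). Proof. by rewrite ler_nat. Qed.

Let admN s j : clean j s -> admissible 200 j (N s) (N (nabla j s)).
Proof. by move=> h; exact: (admissible_nsq mg gM c4 h). Qed.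

Lemma indic_energy1 j : energy_bound LA (on1 j) (N (nabla j s0)) 2.
Proof.
have -> : 2 = 1 + 1 :> R by ring.
by apply: (energy_bound_step1 a0 ab mg gM g1) => //; [rewrite upd_same|rewrite on1_off; exact:
  indic_energy0].
Qed.

Lemma indic_energy2 j k : j <> k -> energy_bound LA (on2 j k) (N (nabla j (nabla k s0))) 4.
Proof.
move=> jk; have -> : 4 = 2 + 2 :> R by ring.
apply: (energy_bound_step1 a0 ab mg gM g1); [by rewrite upd_same|exact: clean1|].
by rewrite on2_off//; exact: indic_energy1.
Qed.

(** The step in r_j starts from v^2 with weight |nabla_k v|^2, whose companion is |nabla_j nabla_k
    v|^2; once v^2 is dropped, only pure energies of v remain. *)
Lemma indic_product2 j k : j <> k ->
  energy_bound LA (on2 j k) (fun p => N (nabla j s0) p * N (nabla k s0) p) c_indic_product2.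
Proof.
move=> jk; apply: (energy_bound_step a0 ab mg gM g1 c200 _ (admN (clean1 jk))) => //.
- by rewrite upd_same.
- by rewrite on2_off//; apply: absorb_v => //; exact: indic_energy1.
- by apply: absorb_v => //; exact: indic_energy2.
Qed.

Lemma indic_energy3 l j k : l <> j -> l <> k -> j <> k ->
  energy_bound LA all3 (N (nabla l (nabla j (nabla k s0)))) 8.
Proof.
move=> lj lk jk; have -> : 8 = 4 + 4 :> R by ring.
apply: (energy_bound_step1 a0 ab mg gM g1) => //; first exact: clean2.
by rewrite (all3_off lj lk jk); exact: indic_energy2.
Qed.

Lemma indic_product3 l j k : l <> j -> l <> k -> j <> k ->
  energy_bound LA all3 (fun p => N (nabla l s0) p * N (nabla j (nabla k s0)) p) c_indic_product3.
Proof.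
move=> lj lk jk; apply: (energy_bound_step a0 ab mg gM g1 c200 _ (admN (clean2 lj lk))) => //.
- by rewrite (all3_off lj lk jk); apply: absorb_v => //; exact: indic_energy2.
- by apply: absorb_v => //; exact: indic_energy3.
Qed.

(** The weight |nabla_j v|^2 |nabla_k v|^2 leaves two errors, one for each factor that receives the
    gradient in the l-th group; both are products of two squared gradients, bounded by
    [indic_product3]. *)
Lemma indic_triple_product l j k : l <> j -> l <> k -> j <> k ->
  energy_bound LA all3 (fun p => N (nabla l s0) p * (N (nabla j s0) p * N (nabla k s0) p))
    c_indic_triple.
Proof.
move=> lj lk jk.
have h4 : 4 <= (100 : R) by rewrite ler_nat.
have h0 : 0 <= (100 : R) by rewrite ler0n.
have := admissible_mul h0 (admissible_nsq mg gM h4 (clean1 lj)) (admissible_nsq mg gM h4 (clean1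
  lk)).
have -> : 2 * 100 = 200 :> R by ring.
move=> hadm; have [_ gW] := admissible_good hadm.
apply: (energy_bound_step a0 ab mg gM g1 c200 _ hadm) => //.
  rewrite (all3_off lj lk jk); apply: absorb_v; first exact: good_mul.
  exact: indic_product2.
apply: absorb_v => //; apply: energy_bound_add.
  have kl : k <> l by move=> E; exact: lk.
  have kj : k <> j by move=> E; exact: jk.
  have := indic_product3 kl kj lj.
  by have -> : (fun p => N (nabla k s0) p * N (nabla l (nabla j s0)) p) = (fun p => N (nabla l
    (nabla j s0)) p * N (nabla k s0) p) by apply/funext => p; rewrite mulrC.
by have := indic_product3 (l := j) (j := l) (k := k); apply=> // E; exact: lj.
Qed.

Variables (u : R2m -> R) (M lam Q : R).
Hypotheses (mu : measurable_fun setT u) (uM : forall y, `|u y| <= M)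
  (u1 : (\int[lebesgue_R2m]_y `|u y|%:E < +oo)%E) (Q0 : 0 <= Q)
  (ulam : forall p, positive p -> v p < 2^-1 -> `|ext kap0 u p| <= lam)
  (uQ : forall r, (forall j, 0 < radius r j) ->
    (slice (fun p => (nsq u s0 p * cutoff g 1 p)%R) r <= Q%:E)%E).

Local Notation cut := (cutoff g).
Local Notation L := (Q + lam ^+ 2 * LA).

Let cut0 n p : 0 <= cut n p. Proof. exact: cutoff_ge0. Qed.
Let goodcut n : good (cut n) := good_cutoff mg gM n.
Let goodu s : good (nsq u s) := good_nsq mu uM s.

Lemma u2_cutoff n p : slab a b p.2 -> nsq u s0 p * cut n.+1 p <= lam ^+ 2.
Proof.
move=> hp; have pos := slab_pos hp; rewrite nsq_s0.
have := cut0 n.+1 p; rewrite le_eqVlt => /predU1P[<-|c0]; first by rewrite mulr0 sqr_ge0.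
have h := ulam pos (cutoff_gt0 c0).
apply: (@le_trans _ _ (ext kap0 u p ^+ 2)).
  by rewrite ler_piMr ?sqr_ge0// cutoff_le1.
by rewrite -[leLHS]real_normK ?num_real// ler_pXn2r// nnegrE (le_trans _ h).
Qed.

(** Where the cut-off is positive, |u| <= lam. An undifferentiated u^2 thus becomes lam^2, and a
    bound in terms of v alone remains; every branch of the chain that reaches an undifferentiated u
    in an error term ends here. *)
Lemma lift_energy_bound n B F C : 0 <= C -> energy_bound LA B F C ->
  energy_bound L B (fun p => nsq u s0 p * (F p * cut n.+1 p)) C.
Proof.
move=> C0 [[mF F0] h]; have gF : good F by split.
have gG : good (fun p => nsq u s0 p * (F p * cut n.+1 p)).
  by apply: good_mul => //; exact: good_mul.
split=> // c hc; apply: (@le_trans _ _ (Int a b (freeze B c) (fun p => lam ^+ 2 * F p))).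
  apply: (Int_le _ gG.1 _ gG.2) => //.
  - exact: measurable_funM.
  - by move=> p; rewrite mulr_ge0 ?sqr_ge0.
  - move=> p hp; rewrite mulrCA mulrC ler_wpM2r//; exact: u2_cutoff.
rewrite (IntZ _ _ _ mF F0 (sqr_ge0 lam)); apply: le_trans.
  by apply: lee_wpmul2l; [rewrite lee_fin sqr_ge0|exact: h].
by rewrite -EFinM lee_fin mulrCA ler_wpM2l// lerDr.
Qed.

(** All higher powers of the cut-off are at most the first one, for which the bound on slices is
    assumed. *)
Lemma cutoff_energy0 n : energy_bound L none (fun p => nsq u s0 p * cut n.+1 p) 1.
Proof.
have gG (k : nat) : good (fun p => nsq u s0 p * cut k p) by exact: good_mul.
have [mG G0] := gG n.+1; have [mH H0] := gG 1%N.
split=> // c hc; rewrite (Int_frozen mG G0 (c := c))// mul1r.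
have hs : slab a b (c J1, c J2, c J3) by case; exact: hc.
have pos j : 0 < radius (c J1, c J2, c J3) j by have /andP[h _] := hs j; exact: lt_le_trans h.
apply: le_trans (le_trans (uQ pos) _); last by rewrite lee_fin lerDl mulr_ge0 ?sqr_ge0.
apply: slice_le => // y; rewrite ler_wpM2l ?(goodu _).2//.
have posp : positive (y, (c J1, c J2, c J3)) by [].
rewrite /cutoff expr1 exprS ler_piMr ?ramp_ge0//; exact: cutoff_le1.
Qed.

Definition c_energy1 : R := 1 + 1 + 5 * 200 * 2.
Definition c_product2 : R := 2 + 2 + 5 * 200 * (4 + c_indic_product2).
Definition c_energy2 : R := c_energy1 + c_energy1 + 5 * 200 * c_product2.
Definition c_product3 : R := 4 + 4 + 5 * 200 * (8 + c_indic_product3).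
Definition c_triple_product : R := c_indic_product2 + c_indic_product2 + 5 * 200 *
  (c_indic_product3 + (c_indic_product3 + c_indic_triple)).
Definition c_remainder3 : R := c_product2 + c_product2 + 5 * 200 * (c_product3 + c_triple_product).
Definition c_energy3 : R := c_energy2 + c_energy2 + 5 * 200 * c_remainder3.

(** The exponents go up to 7, and 7^2 = 49 is below 50. *)
Let adm_cut j n : (n <= 4)%N -> admissible 50 j (cut n.+3) (fun p => N (nabla j s0) p * cut n.+1 p).
Proof.
move=> n4; apply: (admissible_cutoff mg gM); rewrite -natrX ler_nat.
by case: n n4 => [|[|[|[|[|n]]]]].
Qed.

Let admN50 s j : clean j s -> admissible 50 j (N s) (N (nabla j s)).
Proof. by apply: (admissible_nsq mg gM); rewrite ler_nat. Qed.

Let adm_Ncut s j n : (n <= 4)%N -> clean j s -> admissible 100 j (fun p => N s p * cut n.+3 p)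
  (fun p => N (nabla j s) p * cut n.+3 p + N s p * (N (nabla j s0) p * cut n.+1 p)).
Proof.
move=> n4 hs; have -> : 100 = 2 * 50 :> R by ring.
by apply: admissible_mul; [rewrite ler0n|exact: admN50|exact: adm_cut].
Qed.

Let le100 : 100 <= 200 :> R. Proof. by rewrite ler_nat. Qed.
Let le50 : 50 <= 200 :> R. Proof. by rewrite ler_nat. Qed.
Let c_indic_product2_ge0 : 0 <= c_indic_product2. Proof. by rewrite /c_indic_product2; lra. Qed.
Let c_indic_product3_ge0 : 0 <= c_indic_product3. Proof. by rewrite /c_indic_product3; lra. Qed.
Let c_indic_triple_ge0 : 0 <= c_indic_triple. Proof. by rewrite /c_indic_triple; have :=
  c_indic_product2_ge0; have := c_indic_product3_ge0; lra. Qed.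

Lemma split_energy_bound B (w : seq (idx3 -> jet)) W W' (C C' : R) : energy_bound L B (fun p =>
  nsq u w p * W p) C ->
  energy_bound L B (fun p => nsq u w p * W' p) C' -> energy_bound L B (fun p => nsq u w p * (W p +
    W' p)) (C + C').
Proof.
move=> h h'; have := energy_bound_add h h'.
by have -> : (fun p => nsq u w p * W p + nsq u w p * W' p) =
  (fun p => nsq u w p * (W p + W' p)) by apply/funext => p; rewrite mulrDr.
Qed.

Lemma eq_energy_bound B F G C : F =1 G -> energy_bound L B F C -> energy_bound L B G C.
Proof. by move=> /funext ->. Qed.

Lemma cutoff_energy1 j n : (n <= 4)%N -> energy_bound L (on1 j) (fun p => nsq u (nabla j s0) p *
  cut n.+3 p) c_energy1.
Proof.
move=> n4; apply: (energy_bound_step a0 ab mu uM u1 c200 _ (admissible_le le50 (adm_cut j n4))) =>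
  //.
- by rewrite upd_same.
- by rewrite on1_off; exact: cutoff_energy0.
- exact: lift_energy_bound (indic_energy1 j).
Qed.

(** This is the error of the second-order energy. The step in r_k integrates its gradient of u away,
    at the cost of terms u^2 times energies of v. *)
Lemma cutoff_product2 k j n : (n <= 4)%N -> k <> j ->
  energy_bound L (on2 k j) (fun p => nsq u (nabla k s0) p * (N (nabla j s0) p * cut n.+3 p))
    c_product2.
Proof.
move=> n4 kj.
apply: (energy_bound_step a0 ab mu uM u1 c200 _ (admissible_le le100 (adm_Ncut n4 (clean1 kj))))
  => //.
- by rewrite upd_same.
- by rewrite on2_off//; exact: lift_energy_bound (indic_energy1 j).
- apply: split_energy_bound; first exact: lift_energy_bound (indic_energy2 kj).
  apply: eq_energy_bound (lift_energy_bound n c_indic_product2_ge0 (indic_product2 kj)) => p.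
  by congr (_ * _); rewrite mulrA [N (nabla j s0) p * _]mulrC.
Qed.

(** The exponent n + 5 leaves n + 3 in the error |nabla_k u|^2 |nabla_j v|^2, and n + 1 once its own
    gradient of u has been integrated away. *)
Lemma cutoff_energy2 j k n : (n <= 2)%N -> j <> k ->
  energy_bound L (on2 j k) (fun p => nsq u (nabla j (nabla k s0)) p * cut n.+4.+1 p) c_energy2.
Proof.
move=> n2 jk; have n4 : (n.+2 <= 4)%N by rewrite !ltnS.
apply: (energy_bound_step a0 ab mu uM u1 c200 _ (admissible_le le50 (adm_cut j n4))) => //.
- by rewrite upd_same.
- exact: clean1.
- by rewrite on2_off//; exact: cutoff_energy1.
- rewrite on2C; have kj : k <> j by move=> E; exact: jk.
  by apply: cutoff_product2 => //; exact: leq_trans n2 _.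
Qed.

Lemma cutoff_product3 l j k : l <> j -> l <> k -> j <> k -> energy_bound L all3
  (fun p => nsq u (nabla l s0) p * (N (nabla j (nabla k s0)) p * cut 5 p)) c_product3.
Proof.
move=> lj lk jk.
apply: (energy_bound_step a0 ab mu uM u1 c200 _ (admissible_le le100 (adm_Ncut (n := 2) _ (clean2
  lj lk)))) => //.
- by rewrite (all3_off lj lk jk); exact: lift_energy_bound (indic_energy2 jk).
- apply: split_energy_bound; first exact: lift_energy_bound (indic_energy3 lj lk jk).
  apply: eq_energy_bound (lift_energy_bound 2 c_indic_product3_ge0 (indic_product3 lj lk jk)) => p.
  by congr (_ * _); rewrite mulrA [N (nabla l s0) p * _]mulrC.
Qed.

(** The deepest error: the step in r_l leaves u^2 times energies of v with at least one power of the
    cut-off, so the exponent 3 is just enough. *)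
Lemma cutoff_triple_product l j k : l <> j -> l <> k -> j <> k -> energy_bound L all3
  (fun p => nsq u (nabla l s0) p * (N (nabla j s0) p * (N (nabla k s0) p * cut 3 p)))
    c_triple_product.
Proof.
move=> lj lk jk.
have kl : k <> l by move=> E; exact: lk.
have kj : k <> j by move=> E; exact: jk.
have jl : j <> l by move=> E; exact: lj.
have h4 : 4 <= (100 : R) by rewrite ler_nat.
have h0 : 0 <= (100 : R) by rewrite ler0n.
have := admissible_mul h0 (admissible_nsq mg gM h4 (clean1 lj)) (adm_Ncut (n := 0) isT (clean1 lk)).
have -> : 2 * 100 = 200 :> R by ring.
move=> hadm.
apply: (energy_bound_step a0 ab mu uM u1 c200 _ hadm) => //.
- rewrite (all3_off lj lk jk); apply: eq_energy_bound (lift_energy_bound 2 c_indic_product2_ge0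
  (indic_product2 jk)) => p.
  by rewrite !mulrA.
- apply: split_energy_bound.
    apply: eq_energy_bound (lift_energy_bound 2 c_indic_product3_ge0 (indic_product3 kl kj lj)) =>
      p.
    by congr (_ * _); rewrite mulrA [N (nabla k s0) p * _]mulrC.
  have -> : (fun p => nsq u s0 p * (N (nabla j s0) p * (N (nabla l (nabla k s0)) p * cut 3 p +
      N (nabla k s0) p * (N (nabla l s0) p * cut 1 p)))) = (fun p => nsq u s0 p *
      (N (nabla j s0) p * N (nabla l (nabla k s0)) p * cut 3 p +
       N (nabla l s0) p * (N (nabla j s0) p * N (nabla k s0) p) * cut 1 p)).
    by apply/funext => p; ring.
  apply: split_energy_bound; first exact: lift_energy_bound (indic_product3 jl jk lk).
  exact: lift_energy_bound (indic_triple_product lj lk jk).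
Qed.

(** The step in r_1 lowers the exponent from 7 to 5 and leaves |nabla_2 nabla_3 u|^2 |nabla_1 v|^2.
    The step in r_2 applied to this leaves [cutoff_product3] with exponent 5 and
    [cutoff_triple_product] with exponent 3. *)
Lemma cutoff_energy3 : energy_bound L all3
  (fun p => nsq u (nabla J1 (nabla J2 (nabla J3 s0))) p * cut 7 p) c_energy3.
Proof.
have d12 : J1 <> J2 by []; have d13 : J1 <> J3 by []; have d23 : J2 <> J3 by [].
have d31 : J3 <> J1 by []; have d32 : J3 <> J2 by []; have d21 : J2 <> J1 by [].
apply: (energy_bound_step a0 ab mu uM u1 c200 _ (admissible_le le50 (adm_cut J1 (n := 4) _))) => //.
- exact: clean2.
- by rewrite (all3_off d12 d13 d23); exact: cutoff_energy2.
apply: (energy_bound_step a0 ab mu uM u1 c200 _ (admissible_le le100 (adm_Ncut (n := 2) _ (clean1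
  d21)))) => //.
- exact: clean1.
- by rewrite (all3_off d21 d23 d13) on2C; exact: cutoff_product2.
apply: split_energy_bound; first exact: cutoff_product3.
exact: cutoff_triple_product.
Qed.

End energy_chain.

(** * Maximal exceptional sets *)

Section line_maximal.
Context {R : realType} {m : nat}.
Local Notation Rm := 'rV[R]_m.
Local Notation R2m := (Rm * Rm)%type.
Local Notation mR := (measurableTypeR R).
Local Notation lam := (@lebesgue_measure R).
Local Notation B0 := (ball (0%R : R)).
Variable d : R2m.
Implicit Types (A B : set R2m) (x y : R2m) (t s : R).

Definition trace A x : set mR := [set t | A (x + (t : R) *: d)].

Lemma measurable_line_map : measurable_fun setT (fun z : R2m * mR => z.1 + (z.2 : R) *: d).
Proof.
apply: measurable_funD_pair; first exact: measurable_fst.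
by apply: measurable_fun_pair => /=; apply: measurable_funZ_rV => //; exact: measurable_snd.
Qed.

Definition strip A (rho : R) : set (R2m * mR) :=
  [set z | A (z.1 + (z.2 : R) *: d) /\ B0 rho z.2].

Lemma measurable_strip A rho : measurable A -> measurable (strip A rho).
Proof.
move=> mA; apply: measurableI.
  by rewrite -[X in measurable X]setTI; exact: measurable_line_map.
rewrite -[X in measurable X]setTI; apply: (measurable_snd measurableT).
exact: measurable_ball.
Qed.

Lemma strip_section A rho x : xsection (strip A rho) x = trace A x `&` B0 rho.
Proof. by apply/seteqP; split => t; rewrite /xsection /= inE. Qed.

Lemma measurable_trace A x : measurable A -> measurable (trace A x).
Proof.
move=> mA; rewrite -[X in measurable X]setTI.
have : measurable_fun setT (fun t : mR => x + (t : R) *: d).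
  exact: (measurableT_comp measurable_line_map (pair1_measurable x)).
exact.
Qed.

Lemma trace_shift A x t : trace A (x + t *: d) = (fun s : R => 1 * s + t) @^-1` trace A x.
Proof.
by apply/seteqP; split => s; rewrite /trace /= mul1r scalerDl -!addrA [t *: d + _]addrC.
Qed.

(** Tonelli and translation invariance: averaging over all base points the length of [A] on a
    segment of length 2 rho recovers |A|. This carries one-dimensional estimates to R^2m. *)
Lemma integral_strip A (rho : R) : 0 <= rho -> measurable A ->
  (\int[lebesgue_R2m]_x lam (trace A x `&` B0 rho) =
   (2 * rho)%:E * lebesgue_R2m A)%E.
Proof.
move=> r0 mA; have mS := measurable_strip rho mA.
have mi : measurable_fun setT (fun z : R2m * mR => (\1_(strip A rho) z : R)%:E).
  by apply/measurable_EFinP; exact: measurable_indic.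
have i0 z : (0 <= (\1_(strip A rho) z : R)%:E)%E by rewrite lee_fin indicE.
transitivity (\int[lebesgue_R2m]_x \int[lam]_t (\1_(strip A rho) (x, t) : R)%:E)%E.
  apply: eq_integral => x _; rewrite -strip_section.
  transitivity (\int[lam]_t (\1_(xsection (strip A rho) x) t : R)%:E)%E.
    by rewrite integral_indic ?setIT//; exact: measurable_xsection.
  by apply: eq_integral => t _; rewrite !indicE mem_xsection.
rewrite (@fubini_tonelli _ _ _ _ _ lebesgue_R2m lam _ mi i0).
have mb : measurable_fun setT (fun t : mR => (\1_(B0 rho) t : R)%:E).
  by apply/measurable_EFinP; apply: measurable_indic; exact: measurable_ball.
transitivity (\int[lam]_t ((\1_(B0 rho) (t : mR) : R)%:E * lebesgue_R2m A))%E.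
  apply: eq_integral => t _ /=.
  have mA1 : measurable_fun setT (fun x : R2m => (\1_A x : R)%:E).
    by apply/measurable_EFinP; exact: measurable_indic.
  have mAt : measurable_fun setT (fun x : R2m => (\1_A (x + (t : R) *: d) : R)%:E).
    by apply: (measurableT_comp mA1); exact: measurable_funD_pair.
  have b0 : 0 <= (\1_(B0 rho) (t : mR) : R) by rewrite indicE.
  have <- : (\int[lebesgue_R2m]_x (\1_A (x + (t : R) *: d) : R)%:E = lebesgue_R2m A)%E.
    rewrite (ge0_integral_R2m_translation ((t : R) *: d) mA1); last by move=> x; rewrite lee_fin
      indicE.
    by rewrite integral_indic// setIT.
  rewrite -(ge0_integralZl_EFin _ _ _ mAt b0)//.
  apply: eq_integral => x _; rewrite -EFinM; congr EFin; rewrite !indicE.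
  rewrite (_ : ((x, t) \in strip A rho) =
    (t \in (B0 rho : set mR)) && (x + (t : R) *: d \in A)).
    by rewrite -mulnb natrM.
  apply/idP/andP; first by rewrite inE => -[h1 h2]; rewrite !inE.
  by rewrite !inE => -[h1 h2]; split.
rewrite (ge0_integralZr _ _ mb)//.
congr (_ * _)%E; rewrite integral_indic ?setIT//; last exact: measurable_ball.
by transitivity (lam (B0 rho)) => //; rewrite lebesgue_measure_ball// mulr_natl.
Qed.

Lemma measurable_trace_measure A (rho : R) : measurable A ->
  measurable_fun setT (fun x : R2m => lam (trace A x `&` B0 rho)).
Proof.
move=> mA; have := measurable_fun_xsection lam (measurable_strip rho mA).
by apply: eq_measurable_fun => x _ /=; rewrite strip_section.
Qed.

Section exceptional.
Variables (A : set R2m) (c : R).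
Hypotheses (mA : measurable A) (c0 : 0 < c).

Definition large_trace (q : rat) : set R2m :=
  [set x | (c * ratr q)%:E < lam (trace A x `&` B0 (ratr q))]%E.

(** Rational radii make the union countable, hence measurable. The cap [N] confines the argument to
    bounded pieces of the lines; the resulting bound does not depend on it. *)
Definition exceptional (N : nat) : set R2m :=
  \bigcup_q (if 0 < (ratr q : R) <= N%:R then large_trace q else set0).

Lemma measurable_exceptional N : measurable (exceptional N).
Proof.
apply: bigcupT_measurable_rat => q; case: ifP => // _.
rewrite /large_trace -[X in measurable X]setTI.
by apply: emeasurable_fun_o_infty => //; exact: measurable_trace_measure.
Qed.

(** The Hardy-Littlewood inequality on the line through y. For |t| < N and radii at most N the
    intervals around t stay in the ball of radius 2N, so the trace of [A] may be cut off there. *)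
Lemma exceptional_trace N y : (lam (trace (exceptional N) y `&` B0 N%:R) <=
  (6 / c)%:E * lam (trace A y `&` B0 (2 * N%:R)))%E.
Proof.
pose D : set R := trace A y `&` B0 (2 * N%:R).
have mD : measurable D.
  by apply: measurableI; [exact: measurable_trace|exact: measurable_ball].
have mB : measurable (trace (exceptional N) y `&` B0 N%:R : set R).
  apply: measurableI; last exact: measurable_ball.
  by apply: measurable_trace; exact: measurable_exceptional.
have lD : locally_integrable setT (\1_D : R -> R).
  by apply: locally_integrable_indic => //; exact: openT.
(* A trace longer than c q in an interval of length 2 q means an average above c/2; the weak type
   constant 3 then gives 3 / (c/2) = 6/c. *)
have c2 : 0 < c / 2 by rewrite divr_gt0.
have := maximal_inequality lD c2.
have -> : (3 / (c / 2) = 6 / c) by field; rewrite gt_eqF.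
have -> : (\int[lam]_(t in setT) `|(\1_D t : R)%:E| = lam D)%E.
  transitivity (\int[lam]_t (\1_D t : R)%:E)%E; last by rewrite integral_indic// setIT.
  by apply: eq_integral => t _; rewrite gee0_abs// lee_fin indicE.
apply: le_trans; apply: le_measure; rewrite ?inE//.
  rewrite -[X in measurable X]setTI; apply: emeasurable_fun_o_infty => //.
  exact: measurable_HL_maximal.
move=> t /= [[q _]]; case: ifP => // /andP[q0 qN] + tN.
rewrite /large_trace /= trace_shift => hq.
have E : lam ((fun s : R => 1 * s + t) @^-1` trace A y `&` B0 (ratr q)) =
    lam (trace A y `&` ball t (ratr q)).
  have mtb : measurable (trace A y `&` ball t (ratr q) : set R).
    by apply: measurableI; [exact: measurable_trace|exact: measurable_ball].
  have := lebesgue_measure_affine t ltr01 mtb; rewrite invr1 mul1e => <-.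
  congr lam; apply/seteqP; split => s /=; rewrite /ball /= sub0r normrN => -[h1 h2]; split => //.
    by rewrite mul1r opprD addrCA subrr addr0 normrN.
  by move: h2; rewrite mul1r opprD addrCA subrr addr0 normrN.
rewrite E in hq.
apply: (@lt_le_trans _ _ (iavg (\1_D : R -> R) (ball t (ratr q)))); last first.
  by apply: ereal_sup_ubound; exists (ratr q) => //; rewrite /= in_itv /= q0.
rewrite /iavg lebesgue_measure_ball ?(ltW q0)//.
have -> : (\int[lam]_(s in ball t (ratr q)) `|(\1_D s : R)%:E| = lam (trace A y `&` ball t (ratr
  q)))%E.
  transitivity (\int[lam]_(s in ball t (ratr q)) (\1_D s : R)%:E)%E.
    by apply: eq_integral => s _; rewrite gee0_abs// lee_fin indicE.
  rewrite integral_indic//; last exact: measurable_ball.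
  congr lam; apply/seteqP; split => s /=; first by move=> [[h1 h2] h3].
  move=> [h1 h2]; split=> //; split=> //.
  move: tN h2; rewrite /ball /= !sub0r !normrN => tN h2.
  have : `|s| <= `|t| + `|t - s| by rewrite -[s in `|s|](subKr t); exact: ler_normB.
  move=> h3; apply: le_lt_trans h3 _.
  by rewrite mulr2n mulrDl mul1r ltr_leD// (le_trans (ltW h2)).
have q2 : (ratr q : R) *+ 2 != 0 by rewrite mulrn_eq0 /= gt_eqF.
rewrite inver (negbTE q2) muleC lte_pdivlMr ?mulrn_wgt0//.
rewrite -EFinM; have -> : c / 2 * (ratr q *+ 2) = c * ratr q; last exact: hq.
by move: (ratr q : R) => z; rewrite -mulr_natr; field.
Qed.

(** Integration over y multiplies the left side of [exceptional_trace] by 2N and the right side by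
    4N, whence 12/c = 2 * 6/c. *)
Lemma exceptional_measure N : (lebesgue_R2m (exceptional N) <= (12 / c)%:E * lebesgue_R2m A)%E.
Proof.
case: N => [|N].
  rewrite /exceptional bigcup0 ?measure0 ?mule_ge0// ?lee_fin ?divr_ge0// 1?ltW//.
  by move=> q _; case: ifP => // /andP[h1 h2]; move: (lt_le_trans h1 h2); rewrite ltxx.
have n0 : 0 < 2 * (N.+1%:R : R) by rewrite mulr_gt0.
have mE := measurable_exceptional N.+1.
rewrite -(@lee_pmul2l _ (2 * N.+1%:R)%:E) ?lte_fin// -integral_strip// ?(ltW n0)//.
rewrite [leRHS](_ : _ = (6 / c)%:E * ((2 * (2 * N.+1%:R))%:E * lebesgue_R2m A))%E; last first.
  by rewrite !muleA -!EFinM; congr (_%:E * _)%E; field; rewrite gt_eqF.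
rewrite -integral_strip ?(ltW n0)//.
have mt := measurable_trace_measure (2 * N.+1%:R) mA.
have c6 : 0 <= 6 / c by rewrite divr_ge0// ltW.
rewrite -(ge0_integralZl_EFin _ _ _ mt c6)//.
apply: ge0_le_integral => //.
- exact: measurable_trace_measure.
- exact: measurable_funeM.
- by move=> y _; exact: exceptional_trace.
Qed.

Lemma nondecreasing_exceptional : nondecreasing_seq exceptional.
Proof.
move=> i j ij; apply/subsetPset => x [q _]; case: ifP => // /andP[q0 qi] hx.
exists q => //; rewrite q0 (le_trans qi) ?ler_nat//.
Qed.

Lemma exceptional_limit : (lebesgue_R2m (\bigcup_N exceptional N) <= (12 / c)%:E * lebesgue_R2m
  A)%E.
Proof.
have mU : measurable (\bigcup_N exceptional N).
  by apply: bigcup_measurable => N _; exact: measurable_exceptional.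
have h := nondecreasing_cvg_mu (mu := lebesgue_R2m) measurable_exceptional mU
  nondecreasing_exceptional.
rewrite -(cvg_lim _ h)//; apply: lime_le; first by apply/cvg_ex; eexists; exact: h.
by apply: nearW => N; exact: exceptional_measure.
Qed.

(** A real radius s is compared with a rational one in (s, 2s), which costs the factor 2. *)
Lemma not_exceptional x s : ~ (\bigcup_N exceptional N) x -> 0 < s ->
  (lam (trace A x `&` B0 s) <= (2 * c * s)%:E)%E.
Proof.
move=> nx s0; have s2 : s < 2 * s by rewrite ltr_pMl// ltr1n.
have [q] := rat_in_itvoo s2.
rewrite in_itv /= => /andP[sq q2].
have q0 : 0 < (ratr q : R) by exact: lt_trans sq.
rewrite leNgt; apply/negP => h; apply: nx.
exists (Num.truncn (ratr q : R)).+1 => //; exists q => //.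
rewrite q0 (ltW (truncnS_gt _)) /large_trace /=.
apply: (@le_lt_trans _ _ (2 * c * s)%:E).
  by rewrite lee_fin [2 * c]mulrC -mulrA ler_wpM2l// ltW.
apply: lt_le_trans h _; apply: le_measure; rewrite ?inE.
- by apply: measurableI; [exact: measurable_trace|exact: measurable_ball].
- by apply: measurableI; [exact: measurable_trace|exact: measurable_ball].
by move=> t [h1 h2]; split=> //; apply: le_ball h2; exact: ltW.
Qed.

End exceptional.
End line_maximal.

(** * Composition of maximal bounds for indicator functions *)

Section maximal_bound.
Context {R : realType} {m : nat}.
Local Notation Rm := 'rV[R]_m.
Local Notation R2m := (Rm * Rm)%type.
Local Notation mR := (measurableTypeR R).
Implicit Types (A : set R2m) (x : R2m).

Record averaging d (W : measurableType d) (nu : {sigma_finite_measure set W -> \bar R})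
    (I : Type) (K : I -> W -> R) : Prop := Averaging {
  avg_measurable : forall i, measurable_fun setT (K i);
  avg_ge0 : forall i w, 0 <= K i w;
  avg_le1 : forall i, (\int[nu]_w (K i w)%:E <= 1)%E }.

(* A weak type estimate at a fixed level, for indicators: it is all that is needed, and
   unlike the weak (1,1) bound it survives products of averages. *)
Definition maximal_bound d (W : measurableType d)
    (nu : {sigma_finite_measure set W -> \bar R}) (iota : W -> R2m)
    (I : Type) (K : I -> W -> R) : Prop :=
  forall eps : R, 0 < eps -> exists2 C : R, 0 < C &
  forall A, measurable A -> exists A' : set R2m,
  [/\ measurable A', (lebesgue_R2m A' <= C%:E * lebesgue_R2m A)%E &
      forall x, ~ A' x -> forall i,
        (\int[nu]_w (K i w * \1_A (x + iota w))%:E <= eps%:E)%E].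

Lemma measurable_indic_shift d (W : measurableType d) (iota : W -> R2m) A x :
  measurable_fun setT iota -> measurable A ->
  measurable_fun setT (fun w => \1_A (x + iota w) : R).
Proof.
move=> mi mA; have mA1 : measurable_fun setT (\1_A : R2m -> R) by exact: measurable_indic.
by apply: (measurableT_comp mA1); apply: measurable_funD_pair.
Qed.

(** The first bound turns A into A1, the second turns A1 into A2. For x off A2, the points x + iota2
    w2 inside A1 have weight at most eps/2, and there the inner average is at most 1; at the other
    points the inner average is at most eps/2. *)
Lemma maximal_bound_prod d1 d2 (W1 : measurableType d1) (W2 : measurableType d2)
    (nu1 : {sigma_finite_measure set W1 -> \bar R})
    (nu2 : {sigma_finite_measure set W2 -> \bar R})
    (iota1 : W1 -> R2m) (iota2 : W2 -> R2m) (I1 I2 : Type)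
    (K1 : I1 -> W1 -> R) (K2 : I2 -> W2 -> R) :
  measurable_fun setT iota1 -> measurable_fun setT iota2 ->
  averaging nu1 K1 -> averaging nu2 K2 ->
  maximal_bound nu1 iota1 K1 -> maximal_bound nu2 iota2 K2 ->
  forall eps : R, 0 < eps -> exists2 C : R, 0 < C &
  forall A, measurable A -> exists A' : set R2m,
  [/\ measurable A', (lebesgue_R2m A' <= C%:E * lebesgue_R2m A)%E &
      forall x, ~ A' x -> forall i1 i2,
        (\int[nu2]_w2 \int[nu1]_w1 (K1 i1 w1 * K2 i2 w2 * \1_A (x + (iota1 w1 + iota2 w2)))%:E
         <= eps%:E)%E].
Proof.
move=> mi1 mi2 [mK1 K10 K11] [mK2 K20 K21] h1 h2 eps e0.
have e2 : 0 < eps / 2 by rewrite divr_gt0.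
have [C1 C10 k1] := h1 _ e2; have [C2 C20 k2] := h2 _ e2.
exists (C2 * C1); first by rewrite mulr_gt0.
move=> A mA; have [A1 [mA1 lA1 hA1]] := k1 A mA; have [A2 [mA2 lA2 hA2]] := k2 A1 mA1.
exists A2; split=> //.
  by apply: le_trans lA2 _; rewrite EFinM -muleA; apply: lee_wpmul2l => //; rewrite lee_fin ltW.
move=> x nx i1 i2.
have mA1i : measurable_fun setT (\1_A1 : R2m -> R) by exact: measurable_indic.
pose H w2 : \bar R := ((K2 i2 w2) * (eps / 2 + \1_A1 (x + iota2 w2)))%:E.
have mKe : measurable_fun setT (fun w2 => (K2 i2 w2)%:E) by exact/measurable_EFinP.
have mKA : measurable_fun setT (fun w2 => (K2 i2 w2 * \1_A1 (x + iota2 w2))%:E).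
  by apply/measurable_EFinP; apply: measurable_funM => //; exact: measurable_indic_shift.
apply: (@le_trans _ _ (\int[nu2]_w2 H w2)%E); last first.
  apply: (@le_trans _ _ (\int[nu2]_w2 ((eps / 2)%:E * (K2 i2 w2)%:E + (K2 i2 w2 * \1_A1 (x + iota2
    w2))%:E))%E).
    rewrite le_eqVlt; apply/orP; left; apply/eqP; apply: eq_integral => w2 _.
    by rewrite /H -EFinM -EFinD; congr EFin; rewrite mulrDr [K2 _ _ * (eps / 2)]mulrC.
  rewrite ge0_integralD//; first last.
  - by move=> w _; rewrite lee_fin mulr_ge0// indicE.
  - exact: measurable_funeM.
  - by move=> w _; rewrite mule_ge0 ?lee_fin// ltW.
  rewrite (ge0_integralZl_EFin _ _ _ mKe (ltW e2))//; last by move=> w _; rewrite lee_fin.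
  rewrite [eps in leRHS]splitr EFinD; apply: leeD; last exact: hA2.
  by rewrite -[leRHS]mule1; apply: lee_wpmul2l => //; rewrite lee_fin ltW.
have mS : measurable_fun setT (fun z : W2 * W1 =>
    (K1 i1 z.2 * K2 i2 z.1 * \1_A (x + (iota1 z.2 + iota2 z.1)))%:E).
  apply/measurable_EFinP; apply: measurable_funM; first apply: measurable_funM.
  - by apply: (measurableT_comp (mK1 i1)); exact: measurable_snd.
  - by apply: (measurableT_comp (mK2 i2)); exact: measurable_fst.
  - have m12 : measurable_fun setT (fun z : W2 * W1 => iota1 z.2 + iota2 z.1).
      apply: measurable_funD_pair.
        by apply: (measurableT_comp mi1); exact: measurable_snd.
      by apply: (measurableT_comp mi2); exact: measurable_fst.
    exact: (measurable_indic_shift x m12 mA).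
have S0 (z : W2 * W1) : (0 <= (K1 i1 z.2 * K2 i2 z.1 * \1_A (x + (iota1 z.2 + iota2 z.1)))%:E)%E.
  by rewrite lee_fin !mulr_ge0// indicE.
apply: ge0_le_integral => //.
- by move=> w2 _; apply: integral_ge0 => w1 _; exact: (S0 (w2, w1)).
- exact: (measurable_fun_fubini_tonelli_F _ mS S0).
- apply/measurable_EFinP; apply: measurable_funM => //; apply: measurable_funD => //.
  exact: measurable_indic_shift.
move=> w2 _.
have mK1A : measurable_fun setT (fun w1 => (K1 i1 w1 * \1_A (x + iota2 w2 + iota1 w1))%:E).
  by apply/measurable_EFinP; apply: measurable_funM => //; exact: measurable_indic_shift.
have -> : (\int[nu1]_w1 (K1 i1 w1 * K2 i2 w2 * \1_A (x + (iota1 w1 + iota2 w2)))%:E =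
    (K2 i2 w2)%:E * \int[nu1]_w1 (K1 i1 w1 * \1_A (x + iota2 w2 + iota1 w1))%:E)%E.
  rewrite -(ge0_integralZl_EFin _ _ _ mK1A (K20 i2 w2))//; last first.
    by move=> w _; rewrite lee_fin mulr_ge0// indicE.
  apply: eq_integral => w1 _; rewrite -EFinM; congr EFin.
  by rewrite -[x + iota2 w2 + _]addrA [iota2 w2 + _]addrC mulrA [K2 _ _ * _]mulrC.
rewrite /H EFinM; apply: lee_wpmul2l; first by rewrite lee_fin.
have [xA1|xA1] := pselect (A1 (x + iota2 w2)).
  rewrite indicE mem_set// EFinD; apply: (@le_trans _ _ 1)%E; last by rewrite leeDr// lee_fin ltW.
  apply: le_trans (K11 i1); apply: ge0_le_integral => //.
  - by move=> w _; rewrite lee_fin mulr_ge0// indicE.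
  - by apply/measurable_EFinP.
  - move=> w _; rewrite lee_fin ler_piMr// indicE.
by rewrite indicE memNset// addr0; exact: hA1.
Qed.

(** For s <= 0 the ball is empty and the kernel zero, so every real number is an acceptable
    index. *)
Definition interval_kernel (s : R) (t : mR) : R := (2 * s)^-1 * \1_(ball (0 : R) s) t.

Lemma averaging_interval : averaging (lebesgue_measure : {sigma_finite_measure set mR -> \bar R})
  interval_kernel.
Proof.
have mb (s : R) : measurable_fun setT (fun t : mR => \1_(ball (0 : R) s) t : R).
  by apply: measurable_indic; exact: measurable_ball.
have nb (s : R) : s <= 0 -> ball (0 : R) s = set0.
  by move=> s0; apply/seteqP; split => t //; rewrite /ball /= => /(le_lt_trans (normr_ge0 _));
    rewrite ltNge s0.
split=> [s|s t|s].
- by apply: measurable_funM.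
- have [s0|s0] := leP s 0; first by rewrite /interval_kernel nb// indic0 mulr0.
  by rewrite /interval_kernel mulr_ge0 ?indicE// invr_ge0 mulr_ge0// ltW.
have [s0|s0] := leP s 0.
  rewrite /interval_kernel nb//; under eq_integral do rewrite indic0 mulr0.
  by rewrite integral0.
have s20 : 0 <= (2 * s)^-1 by rewrite invr_ge0 mulr_ge0// ltW.
rewrite /interval_kernel; under eq_integral do rewrite EFinM.
have mbe : measurable_fun setT (fun t : mR => (\1_(ball (0 : R) s) t : R)%:E) by
  exact/measurable_EFinP.
rewrite (ge0_integralZl_EFin _ _ _ mbe s20)//.
rewrite integral_indic ?setIT//; last exact: measurable_ball.
rewrite [X in (_ * X)%E](_ : _ = (2 * s)%:E); last first.
  transitivity (lebesgue_measure (ball (0%R : R) s)) => //.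
  by rewrite lebesgue_measure_ball ?ltW// mulr_natl.
by rewrite -EFinM mulVf ?lexx// mulf_neq0// gt_eqF.
Qed.

Lemma maximal_bound_line (d : R2m) :
  maximal_bound lebesgue_measure (fun t : mR => (t : R) *: d) interval_kernel.
Proof.
move=> eps e0; exists (12 / eps); first by rewrite divr_gt0.
move=> A mA; exists (\bigcup_N exceptional d A eps N); split.
- by apply: bigcup_measurable => N _; exact: measurable_exceptional.
- exact: exceptional_limit.
move=> x nx s.
have [s0|s0] := leP s 0.
  have -> : (fun w : mR => (interval_kernel s w * \1_A (x + (w : R) *: d))%:E) = cst 0%E.
    apply/funext => t; rewrite /interval_kernel.
    have -> : ball (0 : R) s = set0.
      by apply/seteqP; split => u //; rewrite /ball /= => /(le_lt_trans (normr_ge0 _)); rewrite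
        ltNge s0.
    by rewrite indic0 mulr0 mul0r.
  by rewrite integral_cst// mul0e lee_fin ltW.
have s20 : 0 <= (2 * s)^-1 by rewrite invr_ge0 mulr_ge0// ltW.
have mtb : measurable (trace d A x `&` ball (0%R : R) s).
  by apply: measurableI; [exact: measurable_trace|exact: measurable_ball].
have -> : (\int[lebesgue_measure]_w (interval_kernel s w * \1_A (x + (w : R) *: d))%:E =
    ((2 * s)^-1)%:E * lebesgue_measure (trace d A x `&` ball (0%R : R) s))%E.
  have mi : measurable_fun setT (fun t : mR => (\1_(trace d A x `&` ball (0%R : R) s) t : R)%:E).
    by apply/measurable_EFinP; exact: measurable_indic.
  have -> : lebesgue_measure (trace d A x `&` ball (0%R : R) s) =
      (\int[lebesgue_measure]_t (\1_(trace d A x `&` ball (0%R : R) s) t : R)%:E)%E.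
    by rewrite integral_indic ?setIT.
  rewrite -(ge0_integralZl_EFin _ _ _ mi s20)//.
  apply: eq_integral => t _; rewrite -EFinM /interval_kernel -mulrA; congr (_ * _)%:E.
  rewrite !indicE -natrM mulnb in_setI andbC; congr (nat_of_bool (_ && _))%:R.
have := not_exceptional mA e0 nx s0 => h.
apply: le_trans (lee_wpmul2l _ h) _; first by rewrite lee_fin.
rewrite -EFinM lee_fin; have -> : (2 * s)^-1 * (2 * eps * s) = eps; last by [].
by field; rewrite gt_eqF.
Qed.

End maximal_bound.

Section maximal_cubes.
Context {R : realType} {m : nat}.
Local Notation R2m := ('rV[R]_m * 'rV[R]_m)%type.
Local Notation mR := (measurableTypeR R).

(** The directions form an infinite sequence, so that removing the first coordinate is a shift of
    [d]. *)
Definition lincomb (d : nat -> R2m) n (w : 'rV[R]_n) : R2m := \sum_(i < n) w ord0 i *: d i.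

Definition cube_kernel n (s : R) (w : 'rV[R]_n) : R := ((2 * s) ^+ n)^-1 * \1_(cube s) w.

Lemma lincomb_cons d n (t : R) (w : 'rV[R]_n) :
  lincomb d (cons_rV (t, w)) = lincomb (fun i => d i.+1) w + t *: d 0%N.
Proof.
rewrite /lincomb big_ord_recl addrC; congr (_ + _ *: _).
  by apply: eq_bigr => i _; rewrite mxE liftK.
by rewrite mxE unlift_none.
Qed.

Lemma cube_kernel_cons n s (t : R) (w : 'rV[R]_n) :
  cube_kernel s (cons_rV (t, w)) = cube_kernel s w * interval_kernel s t.
Proof.
rewrite /cube_kernel /interval_kernel exprS invfM.
have -> : \1_(cube s) (cons_rV (t, w)) = \1_(cube s) w * \1_(ball (0 : R) s) t :> R.
  rewrite !indicE -natrM mulnb; congr (nat_of_bool _)%:R; apply/idP/andP.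
  - rewrite inE => h; rewrite !inE; split.
      by move=> i; have := h (lift ord0 i); rewrite mxE liftK.
    by have := h ord0; rewrite mxE unlift_none /ball /= sub0r normrN.
  - rewrite !inE => -[h1 h2]; move=> i; rewrite mxE.
    by case: unliftP => [j _|_] /=; [exact: h1|move: h2; rewrite /ball /= sub0r normrN].
ring.
Qed.

Lemma measurable_multiple (e : R2m) : measurable_fun setT (fun t : mR => (t : R) *: e).
Proof. by apply: measurable_fun_pair => /=; exact: measurable_funZ_rV. Qed.

Lemma measurable_lincomb d n : measurable_fun setT (@lincomb d n).
Proof.
rewrite /lincomb; elim: (index_enum 'I_n) => [|i s IH].
  by under eq_fun do rewrite big_nil; exact: measurable_cst.
under eq_fun do rewrite big_cons; apply: measurable_funD_pair => //.
by apply: (measurableT_comp (measurable_multiple (d i))); exact: measurable_coord_rV.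
Qed.

Lemma measurable_cube_kernel n s : measurable_fun setT (@cube_kernel n s).
Proof. by apply: measurable_funM => //; apply: measurable_indic; exact: measurable_cube. Qed.

Lemma cube_kernel_ge0 n s (w : 'rV[R]_n) : 0 <= cube_kernel s w.
Proof.
elim: n w => [|n IH] w; first by rewrite /cube_kernel expr0 invr1 mul1r indicE.
rewrite -(uncons_rVK w); case: (uncons_rV w) => t v; rewrite cube_kernel_cons mulr_ge0//.
exact: avg_ge0 averaging_interval s t.
Qed.

Lemma averaging_cube n : averaging (lebesgue_rV n) (@cube_kernel n).
Proof.
split=> [s|s w|s]; [exact: measurable_cube_kernel|exact: cube_kernel_ge0|].
have mk k : measurable_fun setT (fun w : 'rV[R]_k => (cube_kernel s w)%:E).
  by apply/measurable_EFinP; exact: measurable_cube_kernel.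
elim: n => [|n IH].
  rewrite /= integral_dirac; [|exact: measurableT|exact: mk].
  rewrite diracE mem_set// mul1e /cube_kernel expr0 invr1 mul1r indicE.
  by case: (_ \in _); rewrite lee_fin.
rewrite (ge0_integral_rVS (mk n.+1)); last by move=> w; rewrite lee_fin cube_kernel_ge0.
apply: le_trans (avg_le1 averaging_interval s).
have [mi i0 _] := @averaging_interval R.
apply: ge0_le_integral => //.
- by move=> t _; apply: integral_ge0 => w _; rewrite lee_fin cube_kernel_ge0.
- have mc := measurableT_comp (mk n.+1) (@measurable_cons_rV R n).
  apply: (measurable_fun_fubini_tonelli_F _ mc) => z.
  by rewrite lee_fin cube_kernel_ge0.
- exact/measurable_EFinP.
move=> t _; under eq_integral do rewrite cube_kernel_cons EFinM.
rewrite (ge0_integralZr _ _ (mk n)); [|exact: measurableT|by move=> w _; rewrite lee_fin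
  cube_kernel_ge0|by rewrite lee_fin].
by rewrite -[leRHS]mul1e; apply: lee_wpmul2r => //; rewrite lee_fin.
Qed.

(** Induction on the dimension: a cube is a product of an interval and a smaller cube. The product
    bound allows independent side lengths, of which only equal ones are retained. *)
Lemma maximal_bound_cube n (d : nat -> R2m) :
  maximal_bound (lebesgue_rV n) (@lincomb d n) (@cube_kernel n).
Proof.
elim: n d => [|n IH] d eps e0.
  exists 1; first exact: ltr01.
  move=> A mA; exists A; split=> //; first by rewrite mul1e.
  move=> x nx s; rewrite /= integral_dirac//; last first.
    apply/measurable_EFinP; apply: measurable_funM; first exact: measurable_cube_kernel.
    by apply: measurable_indic_shift mA; exact: measurable_lincomb.
  rewrite diracE mem_set// mul1e /lincomb big_ord0 addr0 indicE memNset// mulr0 lee_fin ltW//.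
have [C C0 hC] := maximal_bound_prod (@measurable_lincomb (fun i => d i.+1) n)
  (measurable_multiple (d 0%N)) (averaging_cube n) averaging_interval (IH (fun i => d i.+1))
  (maximal_bound_line (d 0%N)) e0.
exists C => // A mA; have [A' [mA' lA' hA']] := hC A mA.
exists A'; split=> // x nx s.
rewrite ge0_integral_rVS; first last.
- by move=> w; rewrite lee_fin mulr_ge0 ?cube_kernel_ge0// indicE.
- apply/measurable_EFinP; apply: measurable_funM; first exact: measurable_cube_kernel.
  by apply: measurable_indic_shift mA; exact: measurable_lincomb.
apply: le_trans (hA' x nx s s); rewrite le_eqVlt; apply/orP; left; apply/eqP.
apply: eq_integral => t _; apply: eq_integral => w _.
by rewrite cube_kernel_cons lincomb_cons.
Qed.

End maximal_cubes.

Section maximal_poisson.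
Context {R : realType} {m : nat}.
Local Notation Rm := 'rV[R]_m.
Local Notation R2m := (Rm * Rm)%type.
Local Notation pc := (@poisson_const R m).

Definition pos_poisson (r : {r : R | 0 < r}) : Rm -> R := poisson (val r).

Lemma averaging_poisson : averaging (lebesgue_rV m) pos_poisson.
Proof.
split=> [r|r w|r]; first exact: measurable_poisson.
- by rewrite ltW// poisson_gt0//; exact: valP r.
- by rewrite integral_poisson1//; exact: valP r.
Qed.

(** The Poisson kernel is dominated by a series of averages over dyadic multiples of a cube, and a
    single exceptional set makes all these averages small at once. *)
Lemma maximal_bound_poisson (d : nat -> R2m) :
  maximal_bound (lebesgue_rV m) (@lincomb _ _ d m) pos_poisson.
Proof.
move=> eps e0.
(* With this [Q] the k-th term of the series is exactly (eps/2) / 2^k, and the terms add up to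
   eps. *)
pose Q : R := 2 * (pc * 2 ^+ m.+1 * 2 ^+ m).
have pc0 := @poisson_const_gt0 R m.
have Q0 : 0 < Q by rewrite !mulr_gt0 ?exprn_gt0.
have eQ0 : 0 < eps / Q by rewrite divr_gt0.
have [C C0 hC] := maximal_bound_cube m d eQ0.
exists C => // A mA; have [A' [mA' lA' hA']] := hC A mA.
exists A'; split=> // x nx r; set a : R := val r.
have a0 : 0 < a := valP r.
have mS := measurable_indic_shift x (@measurable_lincomb _ _ d m) mA.
pose c (k : nat) : R := a ^- m * (pc * (2 ^+ m.+1 / dyad k ^+ m.+1)).
have d0 k : 0 < dyad k :> R by exact: exprn_gt0.
have c0 k : 0 <= c k.
  apply: mulr_ge0; first by rewrite invr_ge0 exprn_ge0// ltW.
  apply: mulr_ge0; first exact: ltW.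
  by rewrite divr_ge0// exprn_ge0// ltW.
have cov w : exists k, cube (dyad k * a) w /\ pos_poisson r w <= c k.
  have [k [hk1 hk2]] := profile_le_dyadic (a^-1 *: w); exists k; split.
    move=> i; have := hk1 i; rewrite mxE normrM normfV (gtr0_norm a0).
    by rewrite ltr_pdivrMl// mulrC.
  rewrite /pos_poisson /poisson /c ler_wpM2l ?invr_ge0 ?exprn_ge0 ?(ltW a0)//.
  by rewrite ler_wpM2l ?(ltW pc0).
have mSe : measurable_fun setT (fun w : Rm => (\1_A (x + lincomb d w) : R)%:E) by
  exact/measurable_EFinP.
have mB k : measurable (cube (dyad k * a) : set Rm) by exact: measurable_cube.
have S0 (w : Rm) : (0 <= (\1_A (x + lincomb d w) : R)%:E)%E by rewrite lee_fin indicE.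
have := ge0_integral_dominated_series (lebesgue_rV m) (measurable_poisson a) mSe
  (fun w => ltW (poisson_gt0 w a0)) S0 c0 mB cov.
under eq_integral do rewrite -EFinM.
move=> h; apply: le_trans h _.
apply: (@le_trans _ _ (\sum_(k <oo) ((eps / 2) / 2 ^+ k)%:E)%E); last first.
  by apply: le_trans (nneseries_half _) _; [rewrite divr_ge0// ltW|rewrite lee_fin mulrC divfK].
apply: lee_nneseries => k _.
  by rewrite mule_ge0 ?lee_fin// integral_ge0.
have ka0 : 0 < dyad k * a by rewrite mulr_gt0// exprn_gt0.
have K0 : 0 < (2 * (dyad k * a)) ^+ m by rewrite exprn_gt0// mulr_gt0.
have -> : (\int[lebesgue_rV m]_(w in cube (dyad k * a)) (\1_A (x + lincomb d w))%:E =
    ((2 * (dyad k * a)) ^+ m)%:E *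
    \int[lebesgue_rV m]_w (cube_kernel (dyad k * a) w * \1_A (x + lincomb d w))%:E)%E.
  have mck : measurable_fun setT (fun w : Rm => (cube_kernel (dyad k * a) w * \1_A (x + lincomb d
    w))%:E).
    by apply/measurable_EFinP; apply: measurable_funM => //; exact: measurable_cube_kernel.
  rewrite -(ge0_integralZl_EFin _ _ _ mck (ltW K0))//; last first.
    by move=> w _; rewrite lee_fin mulr_ge0 ?cube_kernel_ge0// indicE.
  rewrite [LHS]integral_mkcond; apply: eq_integral => w _; rewrite patchE -EFinM /cube_kernel.
  rewrite -mulrA mulVKf ?gt_eqF// !indicE.
  by case: (w \in cube _); rewrite ?mul1r ?mul0r.
apply: (@le_trans _ _ ((c k)%:E * (((2 * (dyad k * a)) ^+ m)%:E * (eps / Q)%:E))%E).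
  apply: lee_wpmul2l; first by rewrite lee_fin.
  by apply: lee_wpmul2l; [rewrite lee_fin ltW|exact: hA'].
rewrite -!EFinM lee_fin /c le_eqVlt; apply/orP; left; apply/eqP.
rewrite /Q /dyad; have k2 : (2 ^+ k : R) != 0 by rewrite expf_neq0.
rewrite !exprMn; move: (2 ^+ k : R) k2 => K k2; rewrite [K ^+ m.+1]exprS.
have Km : K ^+ m != 0 by rewrite expf_neq0.
have am : a ^+ m != 0 by rewrite expf_neq0// gt_eqF.
have m2 : (2 ^+ m : R) != 0 by rewrite expf_neq0.
have pcn : pc != 0 by rewrite gt_eqF.
rewrite [2 ^+ m.+1]exprS; move: (K ^+ m) (a ^+ m) (2 ^+ m : R) pc Km am m2 pcn => X Y Z W hX hY hZ
  hW.
by field; rewrite hX hY hZ hW k2.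
Qed.

End maximal_poisson.

Section maximal_twist.
Context {R : realType} {m : nat}.
Local Notation Rm := 'rV[R]_m.
Local Notation R2m := (Rm * Rm)%type.
Local Notation posR := {r : R | 0 < r}.
Local Notation kap0 := (fun _ : idx3 => @K0 m).

Definition unit_vector (i : nat) : Rm := \row_j (i == j)%:R.

Lemma unit_vector_sum (w : Rm) : \sum_(i < m) w ord0 i *: unit_vector i = w.
Proof.
apply/rowP => l; rewrite summxE (bigD1 l) //= big1 ?addr0.
  by rewrite !mxE eqxx mulr1.
by move=> i il; rewrite !mxE (_ : (i == l :> nat) = false) ?mulr0//; exact: negbTE.
Qed.

Lemma sum_pair n (F : 'I_n -> R2m) :
  \sum_(i < n) F i = (\sum_(i < n) (F i).1, \sum_(i < n) (F i).2).
Proof.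
elim/big_ind3: _ => //; [|by move=> i _; exact: surjective_pairing].
by move=> x1 x2 x3 y1 y2 y3 -> ->.
Qed.

Lemma lincomb_pair (a b : R) (w : Rm) :
  lincomb (fun i => (a *: unit_vector i, b *: unit_vector i)) w = (a *: w, b *: w).
Proof.
rewrite /lincomb sum_pair /=; congr (_, _).
  under eq_bigr do rewrite scalerA mulrC -scalerA.
  by rewrite -scaler_sumr unit_vector_sum.
under eq_bigr do rewrite scalerA mulrC -scalerA.
by rewrite -scaler_sumr unit_vector_sum.
Qed.

(** The three summands of [twist], each a combination of m directions; scalars 0, 1 and -1 are kept
    so that [lincomb_pair] covers all three. *)
Definition span1 (w : Rm) : R2m := lincomb (fun i => (1 *: unit_vector i, 0 *: unit_vector i)) w.
Definition span2 (w : Rm) : R2m := lincomb (fun i => (0 *: unit_vector i, 1 *: unit_vector i)) w.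
Definition span3 (w : Rm) : R2m := lincomb (fun i => (-1 *: unit_vector i, -1 *: unit_vector i)) w.

Lemma twist_span w : twist w = span3 w.2 + (span2 w.1.2 + span1 w.1.1) :> R2m.
Proof.
rewrite /span1 /span2 /span3 !lincomb_pair /twist; apply: pair_ext => /=;
  by rewrite !scale0r !scale1r !scaleN1r ?addr0 ?add0r addrC.
Qed.

Let P2 (r : posR * posR) (u : R2m) : R := pos_poisson r.2 u.2 * pos_poisson r.1 u.1.

Let mP2 r : measurable_fun setT (P2 r).
Proof.
apply: measurable_funM.
  by apply: (measurableT_comp (measurable_poisson _)); exact: measurable_snd.
by apply: (measurableT_comp (measurable_poisson _)); exact: measurable_fst.
Qed.

Let pp0 (r : posR) (w : Rm) : 0 <= pos_poisson r w.
Proof. exact: avg_ge0 averaging_poisson r w. Qed.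

Let averaging2 : averaging lebesgue_R2m P2.
Proof.
split=> [r|r u|r]; [exact: mP2|by rewrite mulr_ge0|].
have mE : measurable_fun setT (fun u => (P2 r u)%:E) by exact/measurable_EFinP.
rewrite [leLHS](fubini_tonelli1 _ mE)/fubini_F; last by move=> u; rewrite lee_fin mulr_ge0.
have [mp _ p1] := @averaging_poisson R m.
apply: le_trans (p1 r.1); apply: ge0_le_integral => //.
- by move=> w1 _; apply: integral_ge0 => w2 _; rewrite lee_fin mulr_ge0.
- by apply: (measurable_fun_fubini_tonelli_F _ mE) => u; rewrite lee_fin mulr_ge0.
- by apply/measurable_EFinP; exact: mp.
move=> w1 _ /=; rewrite /P2 /=; under eq_integral do rewrite EFinM.
have me : measurable_fun setT (fun w : Rm => (pos_poisson r.2 w)%:E) by apply/measurable_EFinP;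
  exact: mp.
rewrite (ge0_integralZr _ _ me); [|exact: measurableT|by move=> w _; rewrite lee_fin|by rewrite
  lee_fin].
by rewrite -[leRHS]mul1e; apply: lee_wpmul2r => //; rewrite lee_fin.
Qed.

Let span12 (u : R2m) : R2m := span2 u.2 + span1 u.1.

Let ms1 : measurable_fun setT span1. Proof. exact: measurable_lincomb. Qed.
Let ms2 : measurable_fun setT span2. Proof. exact: measurable_lincomb. Qed.
Let ms3 : measurable_fun setT span3. Proof. exact: measurable_lincomb. Qed.

Let ms12 : measurable_fun setT span12.
Proof.
apply: measurable_funD_pair.
  by apply: (measurableT_comp ms2); exact: measurable_snd.
by apply: (measurableT_comp ms1); exact: measurable_fst.
Qed.

Let maximal_bound2 : maximal_bound lebesgue_R2m span12 P2.
Proof.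
move=> eps e0.
have [C C0 hC] := maximal_bound_prod ms2 ms1 averaging_poisson averaging_poisson
  (maximal_bound_poisson _) (maximal_bound_poisson _) e0.
exists C => // A mA; have [A' [mA' lA' hA']] := hC A mA; exists A'; split=> // x nx r.
apply: le_trans (hA' x nx r.2 r.1); rewrite le_eqVlt; apply/orP; left; apply/eqP.
have mE : measurable_fun setT (fun u => (P2 r u * \1_A (x + span12 u))%:E).
  by apply/measurable_EFinP; apply: measurable_funM => //; exact: measurable_indic_shift.
rewrite [LHS](fubini_tonelli1 _ mE)// => u.
by rewrite lee_fin; apply: mulr_ge0; [exact: avg_ge0 averaging2 r u|rewrite indicE].
Qed.

Lemma maximal_twist (eps : R) : 0 < eps -> exists2 C : R, 0 < C &
  forall A : set R2m, measurable A -> exists A' : set R2m,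
  [/\ measurable A', (lebesgue_R2m A' <= C%:E * lebesgue_R2m A)%E &
      forall x, ~ A' x -> forall r1 r2 r3 : R, 0 < r1 -> 0 < r2 -> 0 < r3 ->
        (\int[lebesgue_R3m]_w (poisson r1 w.1.1 * poisson r2 w.1.2 * poisson r3 w.2 *
           \1_A (x + twist w))%:E <= eps%:E)%E].
Proof.
move=> e0.
have [C C0 hC] := maximal_bound_prod ms3 ms12 averaging_poisson averaging2
  (maximal_bound_poisson _) maximal_bound2 e0.
exists C => // A mA; have [A' [mA' lA' hA']] := hC A mA; exists A'; split=> // x nx r1 r2 r3 p1 p2
  p3.
pose q1 : posR := exist _ r1 p1; pose q2 : posR := exist _ r2 p2; pose q3 : posR := exist _ r3 p3.
have comm3 (X Y Z : R) : X * Y * Z = Z * (Y * X) by ring.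
apply: le_trans (hA' x nx q3 (q1, q2)); rewrite le_eqVlt; apply/orP; left; apply/eqP.
rewrite ge0_integral_R3m.
- apply: eq_integral => u _; apply: eq_integral => w _; congr EFin.
  rewrite twist_span /P2 /pos_poisson /=; congr (_ * _).
  exact: comm3.
- apply/measurable_EFinP; apply: measurable_funM; last exact: measurable_indic_shift
  measurable_twist mA.
  apply: measurable_funM; first apply: measurable_funM.
  + apply: (measurableT_comp (measurable_poisson _)).
    by apply: (measurableT_comp measurable_fst); exact: measurable_fst.
  + apply: (measurableT_comp (measurable_poisson _)).
    by apply: (measurableT_comp measurable_snd); exact: measurable_fst.
  + by apply: (measurableT_comp (measurable_poisson _)); exact: measurable_snd.
- move=> w; rewrite lee_fin; apply: mulr_ge0; last by rewrite indicE.
  exact: mulr_ge0 (mulr_ge0 (ltW (poisson_gt0 _ p1)) (ltW (poisson_gt0 _ p2))) (ltW (poisson_gt0 _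
    p3)).
Qed.

(* A point of the cone is reached from the vertex by [twist h] with [h] no larger than
   the radii, and such a shift costs a constant factor on the Poisson kernels. *)
Lemma tube0_twist (r : R * R * R) (z : R2m) : positive3 r -> tube0 r z ->
  exists h : Rm * Rm * Rm, [/\ z = twist h, enorm h.1.1 <= r.1.1,
    enorm h.1.2 <= r.1.2 & enorm h.2 <= r.2].
Proof.
have e00 : enorm (0 : Rm) = 0.
  by rewrite /enorm big1 ?sqrtr0// => i _; rewrite mxE expr0n.
case: r => [[r1 r2] r3] [r10 r20 r30]; case: z => z1 z2 /=.
case: ifP => _.
  move=> [/= h1 h2]; exists (z1, z2, 0); split; rewrite /= ?e00 ?ltW//.
  by rewrite /twist /= !subr0.
case: ifP => _ [/= h1 h2].
  exists (z1 - z2, 0, - z2); split; rewrite /= ?e00 ?enormN ?ltW//.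
  by rewrite /twist /= opprK subrK add0r.
exists (0, z2 - z1, - z1); split; rewrite /= ?e00 ?enormN ?ltW//.
by rewrite /twist /= opprK subrK add0r.
Qed.

(** In units of r the shift has length at most 1, so 1 + |w|^2 grows by a factor at most 3. *)
Lemma poisson_shift (r : R) (w h : Rm) : 0 < r -> enorm h <= r ->
  poisson r (w - h) <= 3 `^ (m.+1%:R / 2) * poisson r w.
Proof.
move=> r0 hr; rewrite /poisson [leRHS]mulrCA; apply: ler_wpM2l.
  by rewrite invr_ge0 exprn_ge0// ltW.
rewrite [leRHS]mulrCA; apply: ler_wpM2l; first exact: ltW poisson_const_gt0.
apply: le_profile => //.
rewrite /base scalerBr.
have := enorm_sqD_le (r^-1 *: w - r^-1 *: h) (r^-1 *: h); rewrite subrK.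
have : enorm (r^-1 *: h) ^+ 2 <= 1.
  rewrite exprn_ile1// ?enorm_ge0// enormZ gtr0_norm ?invr_gt0//.
  by rewrite ler_pdivrMl// mulr1.
move: (enorm (r^-1 *: h) ^+ 2) (enorm (r^-1 *: w - r^-1 *: h) ^+ 2) (sqr_ge0 (enorm (r^-1 *: w -
  r^-1 *: h))) => a b b0 a1 h2.
by apply: le_trans (_ : 1 + (2 * b + 2 * a) <= _); [rewrite lerD2l|]; lra.
Qed.

Lemma exceptional_set : exists2 C : R, 0 < C &
  forall A : set R2m, measurable A -> exists A' : set R2m,
  [/\ measurable A', (lebesgue_R2m A' <= C%:E * lebesgue_R2m A)%E &
      forall x, ~ A' x -> forall y r, positive3 r -> tube x r y ->
        ext kap0 (\1_A : R2m -> R) (y, r) <= 4^-1].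
Proof.
pose k : R := 3 `^ (m.+1%:R / 2).
have k0 : 0 < k by rewrite powR_gt0.
(* Moving from the vertex to a point of the cone costs [k] for each of the three kernels, so this
   level at the vertex becomes 1/4 in the cone. *)
have e0 : 0 < (4 * k ^+ 3)^-1 by rewrite invr_gt0 mulr_gt0// exprn_gt0.
have [C C0 hC] := maximal_twist e0; exists C => // A mA.
have [A' [mA' lA' hA']] := hC A mA; exists A'; split=> // x nx y r pr [z hz xzy].
have [h [zh h1 h2 h3]] := tube0_twist pr hz.
have [p1 p2 p3] : [/\ 0 < r.1.1, 0 < r.1.2 & 0 < r.2] by case: r pr {hz h1 h2 h3} => [[r1 r2] r3].
have pos : positive (y, r) by case.
have int1 := integrable_ext_integrand kap0 (measurable_indicR mA) pos (@indic_norm_le1 R m A).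
rewrite -lee_fin fineK; last exact: integrable_fin_num int1.
have mF : measurable_fun setT (fun w => (kprod kap0 (point r w) * \1_A (y + twist w))%:E : \bar R).
  exact: measurable_int int1.
have F0 w : (0 <= (kprod kap0 (point r w) * \1_A (y + twist w))%:E :> \bar R)%E.
  by rewrite lee_fin mulr_ge0 ?indicE// ltW// kprod0_gt0.
rewrite -(ge0_integral_R3m_translation (- h) mF F0) /=.
pose G w : R := poisson r.1.1 w.1.1 * poisson r.1.2 w.1.2 * poisson r.2 w.2 * \1_A (x + twist w).
have G0 w : 0 <= G w.
  apply: mulr_ge0; last by rewrite indicE.
  exact: mulr_ge0 (mulr_ge0 (ltW (poisson_gt0 _ p1)) (ltW (poisson_gt0 _ p2))) (ltW (poisson_gt0 _
    p3)).
have mG : measurable_fun setT (fun w => (G w)%:E).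
  apply/measurable_EFinP; apply: measurable_funM; last exact: measurable_indic_shift
    measurable_twist mA.
  apply: measurable_funM; first apply: measurable_funM.
  + apply: (measurableT_comp (measurable_poisson _)).
    by apply: (measurableT_comp measurable_fst); exact: measurable_fst.
  + apply: (measurableT_comp (measurable_poisson _)).
    by apply: (measurableT_comp measurable_snd); exact: measurable_fst.
  + by apply: (measurableT_comp (measurable_poisson _)); exact: measurable_snd.
apply: (@le_trans _ _ (\int[lebesgue_R3m]_w ((k ^+ 3)%:E * (G w)%:E))%E); last first.
  have k3 : 0 <= k ^+ 3 by rewrite exprn_ge0// ltW.
  rewrite (ge0_integralZl_EFin _ _ _ mG k3)//; last by move=> w _; rewrite lee_fin.
  apply: le_trans (lee_wpmul2l _ (hA' x nx _ _ _ p1 p2 p3)) _; first by rewrite lee_fin.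
  rewrite -EFinM lee_fin invfM mulrCA mulfV ?mulr1//.
  by rewrite expf_neq0// gt_eqF.
apply: ge0_le_integral => //.
- by apply: (measurableT_comp mF); apply: measurable_fun_pair => /=; [apply:
  measurable_funD_pair|apply: measurable_funD_rV].
- exact: measurable_funeM.
move=> w _; rewrite -EFinM lee_fin /G.
have -> : y + twist (w - h) = x + twist w.
  rewrite -xzy zh -addrA; congr (_ + _); rewrite /twist; apply: pair_ext => /=;
  by apply/rowP => i; rewrite !mxE; ring.
rewrite mulrA ler_wpM2r ?indicE//.
rewrite /kprod !kernpE !kern0E//=.
have pN (a : R) (u : Rm) : poisson a (- u) = poisson a u.
  by rewrite /poisson scalerN profileN.
rewrite !pN.
have q1 := poisson_shift w.1.1 p1 h1; have q2 := poisson_shift w.1.2 p2 h2.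
have q3 := poisson_shift w.2 p3 h3.
have -> : k ^+ 3 = k * k * k by rewrite !exprS expr0 mulr1 mulrA.
by apply: ler_pM3 q1 q2 q3; rewrite ltW// poisson_gt0.
Qed.

End maximal_twist.

(** * Twisted extension, tubes and cones *)

Section topology.
Context {R : realType} {m : nat}.
Local Notation Rm := 'rV[R]_m.
Local Notation R2m := (Rm * Rm)%type.
Local Notation P := (R2m * (R * R * R))%type.

Lemma ball_R2m (x y : R2m) (e : R) : 0 < e ->
  (forall i, `|x.1 ord0 i - y.1 ord0 i| < e) -> (forall i, `|x.2 ord0 i - y.2 ord0 i| < e) ->
  ball x e y.
Proof.
by move=> e0 h1 h2; split; split=> // i j; rewrite ord1; [exact: h1|exact: h2].
Qed.

(** Relates the topology to the product sigma-algebra: an open set is the countable union of the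
    rational boxes that it contains. *)
Lemma open_measurable_R2m (A : set R2m) : open A -> measurable A.
Proof.
move=> oA.
pose emb (c : 'rV[rat]_m) : Rm := \row_i ratr (c ord0 i).
pose box (k : 'rV[rat]_m * 'rV[rat]_m * rat) : set R2m :=
  [set y | cube (ratr k.2) (y.1 - emb k.1.1) /\ cube (ratr k.2) (y.2 - emb k.1.2)].
have mbox k : measurable (box k).
  have mc (c : Rm) : measurable_fun setT (fun y : Rm => y - c) by exact: measurable_funB_rV.
  apply: measurableI.
    rewrite -[X in measurable X]setTI.
    exact: (measurableT_comp (mc (emb k.1.1)) measurable_fst measurableT (measurable_cube _)).
  rewrite -[X in measurable X]setTI.
  exact: (measurableT_comp (mc (emb k.1.2)) measurable_snd measurableT (measurable_cube _)).
have -> : A = \bigcup_k (if `[< box k `<=` A >] then box k else set0).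
  apply/seteqP; split => [x Ax|x [k _]]; last by case: ifPn => // /asboolP h /h.
  have /nbhs_ballP[e /= e0 eA] := open_nbhs_nbhs (conj oA Ax).
  have he : 0 < e / 2 by rewrite divr_gt0.
  have [q] := rat_in_itvoo he; rewrite in_itv /= => /andP[q0 qe].
  have approx (z : Rm) : exists c : 'rV[rat]_m, cube (ratr q) (z - emb c).
    have h i : exists c : rat, `|z ord0 i - ratr c| < ratr q.
      have lt : z ord0 i - ratr q < z ord0 i + ratr q by lra.
      have [c] := rat_in_itvoo lt; rewrite in_itv /= => /andP[c1 c2].
      by exists c; rewrite ltr_norml; apply/andP; split; lra.
    have [c hc] := choice h; exists (\row_i c i) => i.
    by rewrite !mxE; exact: hc.
  have [c1 h1] := approx x.1; have [c2 h2] := approx x.2.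
  exists (c1, c2, q) => //; case: ifPn => [_|/asboolP []]; first by split.
  move=> y [/= k1 k2]; apply: eA; apply: ball_R2m => // i.
    have := h1 i; have := k1 i; rewrite !mxE; move: (ratr (c1 ord0 i) : R) => c.
    rewrite !ltr_norml => /andP[? ?] /andP[? ?]; apply/andP; split; lra.
  have := h2 i; have := k2 i; rewrite !mxE; move: (ratr (c2 ord0 i) : R) => c.
  rewrite !ltr_norml => /andP[? ?] /andP[? ?]; apply/andP; split; lra.
apply: countable_bigcupT_measurable; first exact: countableP.
by move=> k; case: ifP.
Qed.

Lemma continuous_measurable_R2m (g : R2m -> R) : continuous g -> measurable_fun setT g.
Proof.
move=> cg; apply: (measurability _ (RGenOInfty.measurableE R)) => _ [_ [x ->] <-].
rewrite setTI; apply: open_measurable_R2m; apply: open_comp => [y _|]; first exact: cg.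
exact: interval_open.
Qed.

Lemma compact_support_bounds (g : R2m -> R) (K : set R2m) : continuous g -> compact K ->
  (forall y, ~ K y -> g y = 0) ->
  exists2 M : R, forall y, `|g y| <= M & (\int[lebesgue_R2m]_y `|g y|%:E < +oo)%E.
Proof.
move=> cg cK gK.
have [M0 [_ hM0]] := compact_bounded (continuous_compact (continuous_subspaceT cg) cK).
pose M := `|M0 + 1|.
have gM y : `|g y| <= M.
  have [Ky|Ky] := pselect (K y); last by rewrite gK// normr0 /M normr_ge0.
  by apply: le_trans (ler_norm _); apply: hM0; [rewrite ltrDl|exists y].
exists M => //.
have [N0 [_ hN0]] := compact_bounded cK.
pose N := `|N0 + 1| + 1.
have hN y : K y -> `|y| < N.
  move=> Ky; rewrite /N ltr_pwDr//; apply: le_trans (ler_norm _).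
  by apply: hN0 => //; rewrite ltrDl.
have N1 : 0 <= N by rewrite addr_ge0.
pose B : set R2m := cube N `*` cube N.
have mB : measurable B by apply: measurableX; exact: measurable_cube.
have KB y : K y -> B y.
  move=> /hN yN; have [[_ h1] [_ h2]] : ball (0 : R2m) N y.
    by rewrite -ball_normE /ball_ /= sub0r normrN.
  split=> i.
    by have := h1 ord0 i; rewrite /ball /= mxE sub0r normrN.
  by have := h2 ord0 i; rewrite /ball /= mxE sub0r normrN.
have mg := continuous_measurable_R2m cg.
apply: (@le_lt_trans _ _ (\int[lebesgue_R2m]_y (M%:E * (\1_B y : R)%:E))%E).
  apply: ge0_le_integral => //.
  - by apply/measurable_EFinP; exact: measurableT_comp.
  - by apply: measurable_funeM; apply/measurable_EFinP; exact: measurable_indic.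
  move=> y _; rewrite -EFinM lee_fin indicE.
  case: (boolP (y \in B)) => yB; first by rewrite mulr1.
  rewrite mulr0 gK ?normr0// => /KB h; move: yB; rewrite notin_setE; exact.
have m1 : measurable_fun setT (fun y : R2m => (\1_B y : R)%:E).
  by apply/measurable_EFinP; exact: measurable_indic.
rewrite (ge0_integralZl_EFin _ _ _ m1 (normr_ge0 _))//.
rewrite integral_indic// setIT.
change (M%:E * lebesgue_R2m B < +oo)%E.
have -> : lebesgue_R2m B = (((2 * N) ^+ m)%:E * ((2 * N) ^+ m)%:E)%E.
  by rewrite -(lebesgue_cube N1); apply: product_measure1E; exact: measurable_cube.
by rewrite -!EFinM ltry.
Qed.

Lemma near_positive (p : P) : positive p -> \forall q \near p, positive q.
Proof.
move=> pos.
have c1 : (fun q : P => q.2.1.1) @ p --> p.2.1.1.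
  apply: (@continuous_comp _ _ _ (fun q : P => q.2) (fun r => r.1.1)); first exact: cvg_snd.
  by apply: continuous_comp; exact: cvg_fst.
have c2 : (fun q : P => q.2.1.2) @ p --> p.2.1.2.
  apply: (@continuous_comp _ _ _ (fun q : P => q.2) (fun r => r.1.2)); first exact: cvg_snd.
  by apply: continuous_comp; [exact: cvg_fst|exact: cvg_snd].
have c3 : (fun q : P => q.2.2) @ p --> p.2.2.
  by apply: (@continuous_comp _ _ _ (fun q : P => q.2) (fun r => r.2)); exact: cvg_snd.
near=> q; case=> /=.
- near: q; exact: (cvgr_gt (p.2.1.1) c1 0 (pos J1)).
- near: q; exact: (cvgr_gt (p.2.1.2) c2 0 (pos J2)).
- near: q; exact: (cvgr_gt (p.2.2) c3 0 (pos J3)).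
Unshelve. all: end_near.
Qed.

Lemma positive_positive3 (p : P) : positive p <-> positive3 p.2.
Proof.
case: p => [y [[r1 r2] r3]]; split=> [h|[h1 h2 h3]]; last by case.
by split; [exact: (h J1)|exact: (h J2)|exact: (h J3)].
Qed.

End topology.

(** * Identification of the twisted convolution with the product extension *)

Section link.
Context {R : realType} {m : nat}.
Local Notation Rm := 'rV[R]_m.
Local Notation R2m := (Rm * Rm)%type.
Local Notation R3m := (Rm * Rm * Rm)%type.
Local Notation P := (R2m * (R * R * R))%type.
Local Notation jet := (@jet m).
Local Notation kap0 := (fun _ : idx3 => @K0 m).

(** Chosen so that [y + twist] becomes the first component while u = w.2 becomes the variable of
    integration in the twisted kernel. For fixed w.2 it is a translation, hence it preserves the
    measure. *)
Definition shear (y : R2m) (w : R3m) : R3m := (w.1 + ((w.2, w.2) - y), w.2).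

Lemma measurable_shear y : measurable_fun setT (shear y).
Proof.
apply: measurable_fun_pair => /=; last exact: measurable_snd.
apply: measurable_funD_pair; first exact: measurable_fst.
apply: measurable_funB_pair; last exact: measurable_cst.
by apply: measurable_fun_pair; exact: measurable_snd.
Qed.

Lemma ge0_integral_shear y (f : R3m -> \bar R) :
  measurable_fun setT f -> (forall w, (0 <= f w)%E) ->
  (\int[lebesgue_R3m]_w f (shear y w) = \int[lebesgue_R3m]_w f w)%E.
Proof.
move=> mf f0; have mg := measurableT_comp mf (measurable_shear y).
have g0 w : (0 <= f (shear y w))%E by exact: f0.
transitivity (\int[lebesgue_rV m]_u \int[lebesgue_R2m]_z f (shear y (z, u)))%E.
  exact: (@fubini_tonelli2 _ _ _ _ _ lebesgue_R2m (lebesgue_rV m) _ mg g0).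
transitivity (\int[lebesgue_rV m]_u \int[lebesgue_R2m]_z f (z, u))%E; last first.
  by rewrite (@fubini_tonelli2 _ _ _ _ _ lebesgue_R2m (lebesgue_rV m) f mf f0).
apply: eq_integral => u _.
have mu : measurable_fun setT (fun z : R2m => f (z, u)).
  by apply: (measurableT_comp mf); exact: pair2_measurable.
exact: (ge0_integral_R2m_translation ((u, u) - y) mu (fun z => f0 (z, u))).
Qed.

Lemma integral_shear y (f : R3m -> \bar R) : measurable_fun setT f ->
  (\int[lebesgue_R3m]_w f (shear y w) = \int[lebesgue_R3m]_w f w)%E.
Proof. exact/integral_invariant/ge0_integral_shear. Qed.

Lemma twist_shear y w : y + twist (shear y w) = w.1.
Proof.
apply: pair_ext => /=; apply/rowP => i; rewrite !mxE.
  by rewrite addrCA addrA; lra.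
by lra.
Qed.

Definition twist_kernel (r : R * R * R) (x : R2m) (u : Rm) : R :=
  poisson r.1.1 (x.1 - u) * poisson r.1.2 (x.2 - u) * poisson r.2 u.

Lemma poisson_twistE r x : poisson_twist r x = \int[lebesgue_rV m]_u twist_kernel r x u.
Proof. by case: r => [[]]. Qed.

Lemma poisson_le (a : R) (v : Rm) : 0 < a -> poisson a v <= a ^- m * @poisson_const R m.
Proof.
move=> a0; have c0 := @poisson_const_gt0 R m.
have i0 : 0 < a ^- m by rewrite invr_gt0 exprn_gt0.
rewrite /poisson (ler_pM2l i0) -[leRHS]mulr1 (ler_pM2l c0).
exact: profile_le1.
Qed.

Lemma integrable_twist_kernel r (x : R2m) : (forall j, 0 < radius r j) ->
  (lebesgue_rV m).-integrable setT (EFin \o twist_kernel r x).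
Proof.
move=> r0; have [[p1 p2] p3] := (r0 J1, r0 J2, r0 J3).
have mp (a : R) (y : Rm) : measurable_fun setT (fun u : Rm => poisson a (y - u)).
  apply: (measurableT_comp (measurable_poisson a)).
  by apply: measurable_funB_rV; [exact: measurable_cst|exact: measurable_id].
pose c := r.1.1 ^- m * @poisson_const R m * (r.1.2 ^- m * @poisson_const R m).
have ip : (lebesgue_rV m).-integrable setT (fun u => (c * poisson r.2 u)%:E).
  have i1 : (lebesgue_rV m).-integrable setT (EFin \o @poisson R m r.2).
    apply/integrableP; split; first by apply/measurable_EFinP; exact: measurable_poisson.
    rewrite (_ : (fun u => _) = (fun u => (poisson r.2 u)%:E)).
      by rewrite integral_poisson1 ?ltry//; exact: p3.
    by apply/funext => u /=; rewrite ger0_norm// ltW// poisson_gt0//; exact: p3.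
  by have := integrableZl measurableT c i1; apply: eq_integrable => // u _.
apply: le_integrable ip => //.
  apply/measurable_EFinP; apply: measurable_funM; last exact: measurable_poisson.
  by apply: measurable_funM; exact: mp.
move=> u _ /=; rewrite lee_fin.
have q1 := poisson_gt0 (x.1 - u) p1; have q2 := poisson_gt0 (x.2 - u) p2.
have q3 := poisson_gt0 u p3.
have l1 := poisson_le (x.1 - u) p1; have l2 := poisson_le (x.2 - u) p2.
have c0 : 0 <= c by apply: mulr_ge0; apply: le_trans (ltW _) _; [exact: q1| |exact: q2|].
rewrite /twist_kernel /= /c in c0 *; move: q1 q2 q3 l1 l2 c0.
move: (poisson _ _) (poisson _ _) (poisson _ _) (_ * _) (_ * _) => X Y Z C D.
move=> X0 Y0 Z0 XC YD CD.
rewrite (ger0_norm (mulr_ge0 (mulr_ge0 (ltW X0) (ltW Y0)) (ltW Z0))).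
rewrite (ger0_norm (mulr_ge0 CD (ltW Z0))).
by rewrite (ler_pM2r Z0); apply: ler_pM => //; exact: ltW.
Qed.

Lemma kprod0_shear (p : P) w : positive p ->
  kprod kap0 (point p.2 (shear p.1 w)) = twist_kernel p.2 (p.1 - w.1) w.2.
Proof.
move=> pos; rewrite /kprod !kernpE /= (kern0E _ (pos J1)) (kern0E _ (pos J2)).
rewrite (kern0E _ (pos J3)) /twist_kernel /=.
have h (a b c : Rm) : - (a + (b - c)) = c - a - b by rewrite opprD opprB addrCA addrA.
by rewrite !h.
Qed.

(** After the shear, Fubini integrates in u first and finds the twisted kernel at p.1 - z. *)
Lemma twisted_convolution (g : R2m -> R) (M : R) (p : P) :
  measurable_fun setT g -> (forall y, `|g y| <= M) -> positive p ->
  \int[lebesgue_R2m]_z (poisson_twist p.2 (p.1 - z) * g z) = ext kap0 g p.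
Proof.
move=> mg gM pos; have := integrable_ext_integrand kap0 mg pos gM.
set E := fun w : R3m => _; move=> iE.
have mE : measurable_fun setT (EFin \o E) := measurable_int _ iE.
pose F (w : R3m) := twist_kernel p.2 (p.1 - w.1) w.2 * g w.1.
have EF w : E (shear p.1 w) = F w.
  by rewrite /E twist_shear (kprod0_shear _ pos).
have mF : measurable_fun setT (EFin \o F).
  have -> : EFin \o F = (EFin \o E) \o shear p.1 by apply/funext => w /=; rewrite EF.
  exact: measurableT_comp mE (measurable_shear p.1).
have iF : lebesgue_R3m.-integrable setT (EFin \o F).
  apply/integrableP; split=> //.
  have /integrableP[_] := iE.
  rewrite -(ge0_integral_shear p.1 (f := fun w => `|(EFin \o E) w|%E))//.
    by under eq_integral do rewrite /= EF.
  exact: measurableT_comp mE.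
rewrite /Rintegral /ext /Rintegral -/E; congr fine.
transitivity (\int[lebesgue_R3m]_w (EFin \o F) w)%E; last first.
  by rewrite -(integral_shear p.1 mE); apply: eq_integral => w _ /=; rewrite EF.
rewrite -(@integral12_prod_meas1 _ _ _ _ _ lebesgue_R2m (lebesgue_rV m) _ iF).
apply: eq_integral => z _; rewrite /fubini_F /F /=.
have ik := integrable_twist_kernel (p.1 - z) pos.
transitivity (\int[lebesgue_rV m]_u ((EFin \o twist_kernel p.2 (p.1 - z)%R) u * (g z)%:E))%E.
  rewrite (integralZr measurableT ik) poisson_twistE EFinM; congr (_ * _)%E.
  by rewrite /Rintegral fineK//; exact: integrable_fin_num.
by apply: eq_integral => u _.
Qed.

(** The identification with [ext] holds for positive radii only; these form an open set, and
    derivatives are local. *)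
Lemma eq_derive_positive (F G : P -> R) (p v : P) : positive p ->
  (forall q, positive q -> F q = G q) -> 'D_v F p = 'D_v G p.
Proof.
move=> pos FG; apply: near_eq_derive.
by apply: filterS (near_positive pos) => q; exact: FG.
Qed.

Variables (f : R2m -> R[i]) (M : R).
Local Notation fr := (fun y => complex.Re (f y)).
Local Notation fi := (fun y => complex.Im (f y)).
Hypotheses (mfr : measurable_fun setT fr) (mfi : measurable_fun setT fi).
Hypotheses (frM : forall y, `|fr y| <= M) (fiM : forall y, `|fi y| <= M).

Let E kap (p : P) : R[i] := Complex (ext kap fr p) (ext kap fi p).

Lemma twisted_extensionE (p : P) : positive p -> twisted_extension f p = E kap0 p.
Proof.
move=> pos; rewrite /E -(twisted_convolution mfr frM pos) -(twisted_convolution mfi fiM pos).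
rewrite /twisted_extension /cintegral; congr Complex; apply: eq_Rintegral => z _.
  by case: (f z) => x y /=; rewrite mul0r subr0.
by case: (f z) => x y /=; rewrite mul0r addr0.
Qed.

Lemma cderiveE kap (F : P -> R[i]) j a (p : P) : kap j = K0 ->
  (forall q, positive q -> F q = E kap q) -> positive p ->
  cderive (dir j a) F p = E (upd kap j (K1 a)) p.
Proof.
move=> kj FE pos; rewrite /cderive /E.
have k1 : (kap j = K0 /\ K1 a = K1 a) \/ (kap j = K1 a /\ K1 a = K2 a :> jet) by left.
congr Complex.
  rewrite (eq_derive_positive (G := ext kap fr) _ pos); last by move=> q /FE ->.
  by have [_] := is_derive_ext mfr pos frM k1.
rewrite (eq_derive_positive (G := ext kap fi) _ pos); last by move=> q /FE ->.
by have [_] := is_derive_ext mfi pos fiM k1.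
Qed.

Lemma nabla3E c (p : P) : positive p ->
  nabla3 c (twisted_extension f) p = E (upd kap0 J3 (K1 c)) p.
Proof.
move=> pos; case: c => [i|]; last exact: (@cderiveE kap0 _ J3 None p erefl twisted_extensionE).
rewrite /nabla3 /nabla1 /nabla2.
rewrite (@cderiveE kap0 _ J1 (Some i) p erefl twisted_extensionE pos).
rewrite (@cderiveE kap0 _ J2 (Some i) p erefl twisted_extensionE pos).
by rewrite /E (ext_sum_rule mfr frM i pos) (ext_sum_rule mfi fiM i pos).
Qed.

Lemma normc_sqr (z : R[i]) : Normc.normc z ^+ 2 = complex.Re z ^+ 2 + complex.Im z ^+ 2.
Proof. by case: z => x y /=; rewrite sqr_sqrtr// addr_ge0// sqr_ge0. Qed.

Lemma nsq_nabla123 (u : R2m -> R) (p : P) :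
  nsq u (nabla J1 (nabla J2 (nabla J3 [:: kap0]))) p =
  \sum_(a : option 'I_m) \sum_(b : option 'I_m) \sum_(c : option 'I_m)
    ext (upd (upd (upd kap0 J3 (K1 c)) J2 (K1 b)) J1 (K1 a)) u p ^+ 2.
Proof.
rewrite nsq_nabla !big_allpairs_dep big_seq1.
rewrite exchange_big /=.
under eq_bigr do rewrite exchange_big /=.
rewrite exchange_big /=; apply: eq_bigr => a _.
by [].
Qed.

Lemma nabla123_sqnormE (p : P) : positive p ->
  nabla123_sqnorm (twisted_extension f) p =
  nsq fr (nabla J1 (nabla J2 (nabla J3 [:: kap0]))) p +
  nsq fi (nabla J1 (nabla J2 (nabla J3 [:: kap0]))) p.
Proof.
move=> pos; rewrite !nsq_nabla123 /nabla123_sqnorm -big_split.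
apply: eq_bigr => a _; rewrite -big_split; apply: eq_bigr => b _.
rewrite -big_split; apply: eq_bigr => c _; rewrite normc_sqr.
have h2 q : positive q -> nabla2 b (nabla3 c (twisted_extension f)) q =
    E (upd (upd kap0 J3 (K1 c)) J2 (K1 b)) q.
  by move=> posq; apply: (@cderiveE _ _ J2 b q erefl _ posq) => q' /nabla3E.
by rewrite /nabla1 (@cderiveE _ _ J1 a p erefl h2 pos).
Qed.

End link.

Section lebesgue_plane.
Context {R : realType}.
Local Notation mR := (measurableTypeR R).

(* A sigma-finite instance on the iterated product, needed to apply Tonelli's theorem. *)
Definition lebesgue_R2 : set (mR * mR) -> \bar R :=
  (lebesgue_measure \x lebesgue_measure)%E.

HB.instance Definition _ := Measure.on lebesgue_R2.

Let lebesgue_R2_sigma_finite : sigma_finite setT lebesgue_R2.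
Proof. by apply: sigma_finite_product_measure1; exact: sigma_finiteT. Qed.

HB.instance Definition _ := Measure_isSigmaFinite.Build _ _ _ lebesgue_R2
  lebesgue_R2_sigma_finite.

Lemma ge0_integral_R3 (f : mR * mR * mR -> \bar R) : measurable_fun setT f ->
  (forall r, (0 <= f r)%E) ->
  (\int[lebesgue_R3]_r f r =
   \int[lebesgue_measure \x lebesgue_measure]_s \int[lebesgue_measure]_t f (s, t))%E.
Proof.
move=> mf f0.
exact: (@fubini_tonelli1 _ _ _ _ _ lebesgue_R2 lebesgue_measure f mf f0).
Qed.

End lebesgue_plane.

(** * Passage from slabs to all positive radii *)

Section energy_limit.
Context {R : realType} {m : nat}.
Local Notation Rm := 'rV[R]_m.
Local Notation R2m := (Rm * Rm)%type.
Local Notation mR := (measurableTypeR R).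
Local Notation mR3 := (mR * mR * mR)%type.
Local Notation P := (R2m * (R * R * R))%type.
Local Notation mP := (R2m * (mR * mR * mR))%type.
Local Notation lebesgue := (fun _ : idx3 => @None R).

Definition vol (r : R * R * R) : R := r.1.1 * r.1.2 * r.2.

Lemma measurable_radius j : measurable_fun setT (fun r : mR3 => radius r j : mR).
Proof.
case: j; [|exact: (measurableT_comp measurable_snd measurable_fst)|exact: measurable_snd].
exact: (measurableT_comp measurable_fst measurable_fst).
Qed.

Lemma measurable_slab (a b : R) : measurable [set r : mR3 | slab a b r].
Proof.
pose S j := [set r : mR3 | `[a, b]%classic (radius r j)].
have mS j : measurable (S j).
  by rewrite -[S j]setTI; exact: (measurable_radius j measurableT (measurable_itv _)).
have -> : [set r : mR3 | slab a b r] = S J1 `&` S J2 `&` S J3.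
  apply/seteqP; split=> r /=.
    by move=> h; rewrite /S /= !in_itv /=; split; [split; [exact: (h J1)|exact: (h J2)]|exact: (h
      J3)].
  by rewrite /S /= !in_itv /= => -[[h1 h2] h3]; case.
by apply: measurableI => //; exact: measurableI.
Qed.

(** On [2a, b/2] one has t - a >= t/2 and b - t >= b/2, while b - a <= b: the parabola is at least
    t/4. *)
Lemma hat_lower (a b t : R) : 0 < a -> a < b -> 2 * a <= t -> 2 * t <= b ->
  t <= 4 * wt a b None t.
Proof.
move=> a0 ab at2 tb; have -> : wt a b None t = hat a b t.
  by rewrite /wt ifT//; apply/andP; split; lra.
rewrite /hat mulrA ler_pdivlMr; last by lra.
nra.
Qed.

Definition positive_set : set mR3 := [set r | positive3 r].

(** Extending r_1 r_2 r_3 by zero encodes the restriction to positive radii, and integrals can run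
    over the whole space. *)
Definition volpos (r : R * R * R) : R := vol r * \1_positive_set r.

(** This is the range [2a, b/2] of [hat_lower] for a = 1/(n + 1) and b = n + 2. *)
Let B (n : nat) : set mR3 := [set r | slab (2 / n.+1%:R) (n.+2%:R / 2) r].

Lemma positive_slabs : positive_set = \bigcup_n B n.
Proof.
apply/seteqP; split => -[[r1 r2] r3] /=.
  move=> [p1 p2 p3].
  pose x := 2 * r1^-1 + 2 * r2^-1 + 2 * r3^-1 + 2 * r1 + 2 * r2 + 2 * r3.
  have [i1 i2 i3] : [/\ 0 < r1^-1, 0 < r2^-1 & 0 < r3^-1] by rewrite !invr_gt0.
  have x0 : 0 <= x by rewrite /x; lra.
  have xn := archi_boundP x0; exists (Num.bound x) => //.
  have n1 : 0 < (Num.bound x).+1%:R :> R by rewrite ltr0n.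
  have h t : 0 < t -> 2 * t^-1 <= x -> 2 * t <= x ->
      2 / (Num.bound x).+1%:R <= t <= (Num.bound x).+2%:R / 2.
    move=> t0 h1 h2; rewrite ler_pdivrMr// ler_pdivlMr ?ltr0n//.
    have e1 : (Num.bound x).+1%:R = (Num.bound x)%:R + 1 :> R by rewrite -natr1.
    have e2 : (Num.bound x).+2%:R = (Num.bound x)%:R + 2 :> R by rewrite -!natr1; lra.
    rewrite e1 e2; apply/andP; split; last by lra.
    have : 2 <= t * (Num.bound x)%:R.
      have : t * (2 * t^-1) <= t * (Num.bound x)%:R by rewrite ler_pM2l//; lra.
      by rewrite mulrCA mulfV ?gt_eqF// mulr1.
    by lra.
  by case=> /=; apply: h => //; rewrite /x; lra.
move=> [n _ h]; have c0 : 0 < 2 / n.+1%:R :> R by rewrite divr_gt0// ltr0n.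
by split; [have := h J1|have := h J2|have := h J3] => /= /andP[h1 _]; exact: lt_le_trans h1.
Qed.

Lemma measurable_positive_set : measurable positive_set.
Proof. by rewrite positive_slabs; apply: bigcupT_measurable => n; exact: measurable_slab. Qed.

Lemma measurable_vol : measurable_fun setT (vol : mR3 -> R).
Proof.
exact: (measurable_funM (measurable_funM (measurable_radius J1) (measurable_radius J2))
  (measurable_radius J3)).
Qed.

Lemma measurable_volpos : measurable_fun setT (volpos : mR3 -> R).
Proof.
apply: measurable_funM; first exact: measurable_vol.
exact: measurable_indic measurable_positive_set.
Qed.

Lemma vol_gt0 r : positive3 r -> 0 < vol r.
Proof. by case: r => [[r1 r2] r3] [p1 p2 p3]; rewrite /vol !mulr_gt0. Qed.

Lemma volpos_ge0 r : 0 <= volpos r.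
Proof.
rewrite /volpos indicE; case: (boolP (r \in positive_set)) => [|_]; last by rewrite mulr0.
by rewrite inE => /vol_gt0/ltW; rewrite mulr1.
Qed.

Lemma homo_B : {homo B : n k / (n <= k)%N >-> (n <= k)%O}.
Proof.
move=> n k nk; apply/subsetPset => r h j; have /andP[h1 h2] := h j; apply/andP; split.
  apply: le_trans h1; rewrite ler_pM2l// lef_pV2 ?posrE ?ltr0n//.
  by rewrite ler_nat.
by apply: (le_trans h2); rewrite ler_pM2r ?invr_gt0// ler_nat.
Qed.

Lemma vol_le_weight n (r : R * R * R) : B n r ->
  vol r <= 64 * weight n.+1%:R^-1 n.+2%:R lebesgue r.
Proof.
move=> Br; have a0 : 0 < n.+1%:R^-1 :> R by rewrite invr_gt0 ltr0n.
have ab : n.+1%:R^-1 < n.+2%:R :> R.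
  apply: (@le_lt_trans _ _ 1); last by rewrite ltr1n.
  by rewrite invf_le1 ?ltr0n// ler1n.
have h j : 0 < radius r j /\ radius r j <= 4 * wt n.+1%:R^-1 n.+2%:R None (radius r j).
  have /andP[] := Br j; move: (n.+1%:R^-1) (n.+2%:R) a0 ab => c d c0 cd h1 h2.
  by split; [lra|apply: hat_lower => //; lra].
have [[p1 h1] [p2 h2] [p3 h3]] := And3 (h J1) (h J2) (h J3); rewrite /= in p1 p2 p3 h1 h2 h3.
have r64 (x y z : R) : 64 * (x * y * z) = (4 * x) * (4 * y) * (4 * z) by ring.
rewrite /vol /weight r64; apply: ler_pM (mulr_ge0 (ltW p1) (ltW p2)) (ltW p3) _ h3.

exact: ler_pM (ltW p1) (ltW p2) h1 h2.
Qed.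

(** On [B n] the weight is at least r_1 r_2 r_3 / 64, where 64 = 4^3. The slabs increase to the
    octant, and monotone convergence transfers a bound that is uniform in a and b. *)
Lemma energy_limit (F : P -> R) (K : \bar R) : good F ->
  (forall a b : R, 0 < a -> a < b -> (Int a b lebesgue F <= K)%E) ->
  (\int[lebesgue_R2m3]_p (volpos p.2 * F p)%:E <= 64%:E * K)%E.
Proof.
move=> [mF F0] FK.
have mS := measurable_slice mF F0.
have S0 r : (0 <= slice F r)%E by exact: slice_ge0.
pose f r := ((vol r)%:E * slice F r)%E.
have mf : measurable_fun setT (f : mR3 -> \bar R).
  by apply: emeasurable_funM => //; apply/measurable_EFinP; exact: measurable_vol.
have mH : measurable_fun setT (fun p : mP => (volpos p.2 * F p)%:E).
  apply/measurable_EFinP; apply: measurable_funM => //.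
  exact: (measurableT_comp measurable_volpos measurable_snd).
have H0 p : (0 <= (volpos p.2 * F p)%:E)%E.
  by rewrite lee_fin; exact: (mulr_ge0 (volpos_ge0 _) (F0 _)).
have f0 n r : B n r -> (0 <= f r)%E.
  move=> Br; apply: mule_ge0 => //; rewrite lee_fin; apply/ltW/vol_gt0.
  by change (positive_set r); rewrite positive_slabs; exists n.
have mB n : measurable (B n) by exact: measurable_slab.
have -> : (\int[lebesgue_R2m3]_p (volpos p.2 * F p)%:E =
    \int[lebesgue_R3]_(r in positive_set) f r)%E.
  rewrite (@fubini_tonelli2 _ _ _ _ _ lebesgue_R2m lebesgue_R3 _ mH H0).
  rewrite [RHS]integral_mkcond; apply: eq_integral => r _.
  rewrite /fubini_G /patch /=.
  have msec : measurable_fun setT (fun y : R2m => (F (y, r))%:E).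
    by apply/measurable_EFinP; apply: (measurableT_comp mF); exact: pair2_measurable.
  have sec0 y : (0 <= (F (y, r))%:E)%E by rewrite lee_fin.
  rewrite /f /slice; under eq_integral do rewrite EFinM.
  rewrite (ge0_integralZl_EFin _ _ _ msec (volpos_ge0 r))//.
  rewrite /volpos indicE; case: (boolP (r \in positive_set)) => _; first by rewrite mulr1.
  by rewrite mulr0 mul0e.
rewrite positive_slabs.
have cv := ge0_nondecreasing_set_cvg_integral (mu := lebesgue_R3) homo_B mB
  (fun n => measurable_funTS mf) f0.
rewrite -(cvg_lim (@ereal_hausdorff R) cv); apply: lime_le; first by apply/cvg_ex; eexists; exact:
  cv.
near=> n; set a : R := n.+1%:R^-1; set b : R := n.+2%:R.
have a0 : 0 < a by rewrite invr_gt0 ltr0n.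
have ab : a < b.
  apply: (@le_lt_trans _ _ 1); last by rewrite ltr1n.
  by rewrite invf_le1 ?ltr0n// ler1n.
pose g (r : mR3) := ((weight a b lebesgue r)%:E * slice F r)%E.
have mg : measurable_fun setT g.
  by apply: emeasurable_funM => //; apply/measurable_EFinP; exact: measurable_weight.
have g0 r : (0 <= g r)%E by apply: mule_ge0 => //; rewrite lee_fin weight_ge0.
have mg64 : measurable_fun setT (fun r => 64%:E * g r)%E by exact: measurable_funeM.
have g640 r : (0 <= 64%:E * g r)%E by apply: mule_ge0.
apply: (@le_trans _ _ (\int[lebesgue_R3]_r (64%:E * g r))%E).
  apply: (@le_trans _ _ (\int[lebesgue_R3]_(r in B n) (64%:E * g r))%E).
    apply: ge0_le_integral; first exact: mB.
    - by move=> r /f0.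
    - exact: measurable_funTS.
    - exact: measurable_funTS.
    move=> r /vol_le_weight h; rewrite /f /g muleA -EFinM.
    by apply: lee_wpmul2r => //; rewrite lee_fin.
  by apply: ge0_subset_integral.
rewrite (ge0_integralZl_EFin _ _ _ mg (ler0n R 64))//.
apply: lee_wpmul2l => //.
apply: le_trans (FK a b a0 ab).
by rewrite (Int_outer a b lebesgue mF F0) (ge0_integral_R3 mg g0).
Unshelve. all: end_near.
Qed.

End energy_limit.

(** * Topology, measurability and volume of tubes *)

Section tubes.
Context {R : realType} {m : nat}.
Local Notation Rm := 'rV[R]_m.
Local Notation R2m := (Rm * Rm)%type.
Local Notation mR := (measurableTypeR R).
Local Notation mR3 := (mR * mR * mR)%type.
Local Notation P := (R2m * (R * R * R))%type.

Lemma continuous_enorm : continuous (@enorm R m).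
Proof.
move=> v; apply: (@continuous_comp _ _ _ (fun v : Rm => \sum_i v ord0 i ^+ 2)).
  apply: continuous_big => [z|i _ w]; first exact: cvgD cvg_fst cvg_snd.
  apply: (@continuous_comp _ _ _ (fun v : Rm => v ord0 i) (fun t : R => t ^+ 2)).
    exact: coord_continuous.
  exact: exprn_continuous.
exact: sqrt_continuous.
Qed.

Lemma open_ball_enorm (e : R) (g : R2m -> Rm) : continuous g ->
  open [set x | enorm (g x) < e].
Proof.
move=> cg; apply: (@open_comp _ _ (fun x => enorm (g x)) [set t | t < e]).
  by move=> x _; apply: continuous_comp; [exact: cg|exact: continuous_enorm].
exact: open_lt.
Qed.

Lemma open_tube0 r : open (@tube0 R m r).
Proof.
case: r => [[r1 r2] r3]; rewrite /tube0.
have c1 : continuous (fun x : R2m => x.1) by move=> x; exact: cvg_fst.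
have c2 : continuous (fun x : R2m => x.2) by move=> x; exact: cvg_snd.
have c12 : continuous (fun x : R2m => x.1 - x.2) by move=> x; exact: cvgB cvg_fst cvg_snd.
have c21 : continuous (fun x : R2m => x.2 - x.1) by move=> x; exact: cvgB cvg_snd cvg_fst.
have h e e' (g g' : R2m -> Rm) : continuous g -> continuous g' ->
    open [set x | enorm (g x) < e /\ enorm (g' x) < e'].
  by move=> cg cg'; apply: openI; exact: open_ball_enorm.
case: ifP => _; first exact: (h _ _ _ _ c1 c2).
by case: ifP => _; [exact: (h _ _ _ _ c12 c2)|exact: (h _ _ _ _ c21 c1)].
Qed.

Lemma tubeE (x : R2m) r y : tube x r y = tube0 r (y - x).
Proof.
apply/propext; split=> [[z tz <-]|h]; first by rewrite addrC addKr.
by exists (y - x) => //; rewrite addrC subrK.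
Qed.

(** The vertices whose tube contains a given point thus form a translate of the tube itself. *)
Lemma tube0N r (z : R2m) : tube0 r (- z) = tube0 r z.
Proof.
have e (a b : Rm) : enorm (- a - - b) = enorm (a - b) by rewrite -opprD enormN.
by case: r => [[r1 r2] r3]; rewrite /tube0; case: ifP => _; [|case: ifP => _];
  rewrite /= ?e ?enormN.
Qed.

Lemma measurable_ltset d (T : measurableType d) (f g : T -> R) : measurable_fun setT f ->
  measurable_fun setT g -> measurable [set t | f t < g t].
Proof.
move=> mf mg; have := measurable_fun_ltr mf mg.
move=> /(_ measurableT [set true] I); rewrite setTI.
by congr measurable; apply/seteqP; split.
Qed.

Lemma measurable_leset d (T : measurableType d) (f g : T -> R) : measurable_fun setT f ->
  measurable_fun setT g -> measurable [set t | f t <= g t].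
Proof.
move=> mf mg; have := measurable_ltset mg mf => /measurableC.
by congr measurable; apply/seteqP; split=> t /=; rewrite leNgt => /negP.
Qed.

Lemma measurable_tube0 : measurable [set q : R2m * mR3 | tube0 q.2 q.1].
Proof.
have mr j : measurable_fun setT (fun q : R2m * mR3 => radius q.2 j : R).
  exact: (measurableT_comp (measurable_radius j) measurable_snd).
have m1 : measurable_fun setT (fun q : R2m * mR3 => q.1.1).
  exact: (measurableT_comp measurable_fst measurable_fst).
have m2 : measurable_fun setT (fun q : R2m * mR3 => q.1.2).
  exact: (measurableT_comp measurable_snd measurable_fst).
have me (g : R2m * mR3 -> Rm) : measurable_fun setT g ->
    measurable_fun setT (fun q => enorm (g q)).
  by move=> mg; exact: (measurableT_comp measurable_enorm mg).
pose D j k l := [set q : R2m * mR3 | radius q.2 j <= radius q.2 k] `&`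
  [set q : R2m * mR3 | radius q.2 j <= radius q.2 l].
have mD j k l : measurable (D j k l).
  by apply: measurableI; apply: measurable_leset; exact: mr.
pose E (g : R2m * mR3 -> Rm) j (h : R2m * mR3 -> Rm) k := [set q : R2m * mR3 | enorm (g q) <
  radius q.2 j] `&`
  [set q : R2m * mR3 | enorm (h q) < radius q.2 k].
have mE (g : R2m * mR3 -> Rm) j (h : R2m * mR3 -> Rm) k : measurable_fun setT g -> measurable_fun
  setT h -> measurable (E g j h k).
  by move=> mg mh; apply: measurableI; apply: measurable_ltset; [exact: me|exact: mr|exact:
    me|exact: mr].
pose E1 := E (fun q => q.1.1) J1 (fun q => q.1.2) J2.
pose E2 := E (fun q => q.1.1 - q.1.2) J1 (fun q => q.1.2) J3.
pose E3 := E (fun q => q.1.2 - q.1.1) J2 (fun q => q.1.1) J3.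
have -> : [set q : R2m * mR3 | tube0 q.2 q.1] =
    (D J3 J1 J2 `&` E1) `|` (~` D J3 J1 J2 `&` ((D J2 J1 J3 `&` E2) `|` (~` D J2 J1 J3 `&` E3))).
  apply/predeqP => -[[z1 z2] [[r1 r2] r3]] /=; rewrite /D /E1 /E2 /E3 /E /=.
  case: ifPn => [/andP[h1 h2]|/negP h].
    by split=> [hz|[[_ hz]//|[[]//]]]; left.
  have {}h : ~ (r3 <= r1 /\ r3 <= r2) by move=> [h1 h2]; apply: h; rewrite h1.
  case: ifPn => [/andP[h1 h2]|/negP h'].
    split=> [hz|[[/h//]|[_ [[_ hz]//|[[]//]]]]].
    by right; split=> //; left.
  have {}h' : ~ (r2 <= r1 /\ r2 <= r3) by move=> [h1 h2]; apply: h'; rewrite h1.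
  split=> [hz|[[/h//]|[_ [[/h'//]|[_ hz]//]]]].
  by right; split=> //; right.
have mB (g h : R2m * mR3 -> Rm) : measurable_fun setT g -> measurable_fun setT h ->
    measurable_fun setT (fun q : R2m * mR3 => (g q - h q : Rm)) by exact: measurable_funB_rV.
have mE1 : measurable E1 by exact: mE.
have mE2 : measurable E2 by apply: mE => //; exact: mB.
have mE3 : measurable E3 by apply: mE => //; exact: mB.
apply: measurableU; first exact: measurableI.
apply: measurableI; first exact: measurableC.
by apply: measurableU; apply: measurableI => //; exact: measurableC.
Qed.

Lemma measurable_tube_volume : measurable_fun setT (fun r : mR3 => @tube_volume R m r : R).
Proof.
have mv := measurable_fun_ysection lebesgue_R2m measurable_tube0.
apply: (measurableT_comp (fine_measurable measurableT)) => /=.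
rewrite (_ : (fun r => _) = lebesgue_R2m \o ysection [set q : R2m * mR3 | tube0 q.2 q.1])//.
apply/funext => r /=; congr lebesgue_R2m; apply/seteqP; split=> z /=; rewrite /ysection /= inE//.
Qed.

Lemma tube_volume_ge0 r : 0 <= @tube_volume R m r.
Proof. by rewrite /tube_volume fine_ge0. Qed.

(** If the volume is zero or infinite, the conventions for [fine] and for the inverse of 0 make the
    left side vanish, so the bound holds for every r. *)
Lemma tube_volumeV_le1 r (y : R2m) :
  (((@tube_volume R m r)^-1)%:E * lebesgue_R2m [set x | tube0 r (y - x)%R] <= 1)%E.
Proof.
have -> : [set x | tube0 r (y - x)] = [set x | tube0 r (x + (- y))].
  by apply/funext => x /=; rewrite -tube0N opprB.
rewrite lebesgue_R2m_translation; last by apply: open_measurable_R2m; exact: open_tube0.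
rewrite /tube_volume; case E : (lebesgue_R2m _) => [c||] /=.
- have c0 : 0 <= c by rewrite -lee_fin -E measure_ge0.
  rewrite -EFinM lee_fin; have [->|cn0] := eqVneq c 0; first by rewrite mulr0.
  by rewrite mulVf.
- by rewrite invr0 mul0e.
- by have : (0 <= -oo :> \bar R)%E by rewrite -E measure_ge0.
Qed.

(** A value above c at (y, r) is seen from every vertex whose tube contains y, and these vertices
    form an open set. Openness of level sets is what makes the maximal function measurable. *)
Lemma open_maximal beta (f : R2m -> R[i]) (c : \bar R) :
  open [set x | (c < twisted_maximal beta f x)%E].
Proof.
have -> : [set x | (c < twisted_maximal beta f x)%E] =
    \bigcup_(p in [set p : P | positive3 p.2 /\ (c < (Normc.normc (twisted_extension f p))%:E)%E])
      [set x | tube0 (scale3 beta p.2) (p.1 - x)].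
  apply/seteqP; split=> x /=.
    move=> /ereal_sup_gt[_ [p [pos tp] <-] cp]; exists p => //=.
    by rewrite -tubeE.
  move=> [p [pos cp]] /= tp; apply: (lt_le_trans cp).
  by apply: ereal_sup_ubound; exists p => //; split=> //; rewrite tubeE.
apply: bigcup_open => p _.
apply: (@open_comp _ _ (fun x : R2m => p.1 - x) (tube0 (scale3 beta p.2))).
  by move=> x _; apply: cvgB; [exact: cvg_cst|exact: cvg_id].
exact: open_tube0.
Qed.

Lemma measurable_maximal beta (f : R2m -> R[i]) :
  measurable_fun setT (twisted_maximal beta f).
Proof.
apply: (measurability _ (ErealGenOInfty.measurableE R)) => _ [_ [c ->] <-].
rewrite setTI; have := open_measurable_R2m (@open_maximal beta f c%:E).
by congr measurable; apply/seteqP; split=> x /=; rewrite in_itv /= andbT.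
Qed.

End tubes.

(** * Points of the half-space where the maximal function controls the extension *)

Section nontangential_points.
Context {R : realType} {m : nat}.
Local Notation Rm := 'rV[R]_m.
Local Notation R2m := (Rm * Rm)%type.
Local Notation R3m := (Rm * Rm * Rm)%type.
Local Notation P := (R2m * (R * R * R))%type.
Local Notation kap0 := (fun _ : idx3 => @K0 m).

Lemma poissonN (a : R) (w : Rm) : poisson a (- w) = poisson a w.
Proof. by rewrite /poisson scalerN profileN. Qed.

Lemma kprod0E r (w : R3m) : (forall j, 0 < radius r j) -> kprod kap0 (point r w) =
  poisson r.1.1 w.1.1 * poisson r.1.2 w.1.2 * poisson r.2 w.2.
Proof.
move=> pos; rewrite /kprod !kernpE /= (kern0E _ (pos J1)) (kern0E _ (pos J2)).
by rewrite (kern0E _ (pos J3)) !poissonN.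
Qed.

Lemma enormB_lt (v w : Rm) (s : R) : enorm v < s -> enorm w < s -> enorm (v - w) < 2 * s.
Proof.
move=> vs ws; have := enorm_sqD_le v (- w); rewrite enormN.
have := enorm_ge0 (v - w); have := enorm_ge0 v; have := enorm_ge0 w.
move: (enorm v) (enorm w) (enorm (v - w)) vs ws => a b c as_ bs b0 a0 c0 h.
by rewrite ltNge; apply/negP => h'; nra.
Qed.

(** The two conditions of a tube bear on differences of the w_i in which the smallest radius is
    paired with each of the two others. Such a difference is at most twice the bound for the larger
    radius. *)
Lemma tube0_of_twist (rho beta : R) r (w : R3m) : 0 < rho -> 2 * rho <= beta ->
  positive3 r -> enorm w.1.1 < rho * r.1.1 -> enorm w.1.2 < rho * r.1.2 ->
  enorm w.2 < rho * r.2 -> tube0 (scale3 beta r) (twist w).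
Proof.
case: r w => [[r1 r2] r3] [[w1 w2] w3] /= rho0 hb [p1 p2 p3] h1 h2 h3.
have b0 : 0 < beta by lra.
have near (v w : Rm) (s t : R) : 0 < t -> s <= t -> enorm v < rho * s -> enorm w < rho * t ->
    enorm (v - w) < beta * t /\ enorm (w - v) < beta * t.
  move=> t0 st hv hw; have hv' : enorm v < rho * t by apply: lt_le_trans hv _; rewrite ler_pM2l.
  have ht : 2 * (rho * t) <= beta * t by rewrite mulrA ler_pM2r.
  by split; apply: lt_le_trans ht; exact: enormB_lt.
have e1 : w1 - w3 - (w2 - w3) = w1 - w2 by rewrite opprB addrA subrK.
have e2 : w2 - w3 - (w1 - w3) = w2 - w1 by rewrite opprB addrA subrK.
rewrite /scale3 /tube0 !ler_pM2l//; case: ifPn => [/andP[l1 l2]|n1].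
  by split; [exact: (near _ _ _ _ p1 l1 h3 h1).2|exact: (near _ _ _ _ p2 l2 h3 h2).2].
case: ifPn => [/andP[l1 l2]|n2]; rewrite /= ?e1 ?e2.
  by split; [exact: (near _ _ _ _ p1 l1 h2 h1).2|exact: (near _ _ _ _ p3 l2 h2 h3).1].
have [l1 l2] : r1 <= r2 /\ r1 <= r3.
  move: n1 n2; rewrite !negb_and -!ltNge.
  by move=> /orP[] ? /orP[] ?; split; lra.
by split; [exact: (near _ _ _ _ p2 l1 h1 h2).2|exact: (near _ _ _ _ p3 l2 h1 h3).1].
Qed.

Lemma cone_self beta (x : R2m) r : 0 < beta -> positive3 r -> cone beta x (x, r).
Proof.
move=> b0 pr; split=> //=; rewrite tubeE subrr.
have e0 : enorm (0 : Rm) = 0.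
  have := enorm_sqE (0 : Rm); rewrite big1 => [/eqP|i _]; last by rewrite mxE expr0n.
  by rewrite sqrf_eq0 => /eqP.
have -> : (0 : R2m) = twist (0 : R3m).
  by apply: pair_ext => /=; rewrite subrr.
apply: (@tube0_of_twist (beta / 2)) => //; first by rewrite divr_gt0.
- by rewrite mulrCA mulfV// mulr1.
- by case: r pr => [[r1 r2] r3] [p1 p2 p3]; rewrite /= e0 !mulr_gt0 ?invr_gt0.
- by case: r pr => [[r1 r2] r3] [p1 p2 p3]; rewrite /= e0 !mulr_gt0 ?invr_gt0.
- by case: r pr => [[r1 r2] r3] [p1 p2 p3]; rewrite /= e0 !mulr_gt0 ?invr_gt0.
Qed.

(* At least (9/10)^3 of the mass of the kernel sits in the tube of aperture 2 rho, and
   (9/10)^3 > 1/2. *)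
Lemma ext_indic_tube (rho beta : R) (A : set R2m) (p : P) : 0 < rho -> 2 * rho <= beta ->
  (forall a : R, 0 < a -> ((9 / 10)%:E <= \int[lebesgue_rV m]_v
     ((poisson a v)%:E * (\1_[set w | (enorm w < rho)%R] (a^-1 *: v))%:E))%E) ->
  measurable A -> positive p -> (forall x, cone beta x p -> A x) ->
  2^-1 <= ext kap0 (\1_A : R2m -> R) p.
Proof.
move=> rho0 hb conc mA pos hA.
have int1 := integrable_ext_integrand kap0 (measurable_indicR mA) pos (@indic_norm_le1 R m A).
rewrite -lee_fin fineK; last exact: integrable_fin_num int1.
have mF := measurable_int _ int1.
pose S := [set w : Rm | enorm w < rho].
have mS : measurable S.
  by have := measurable_ltset (@measurable_enorm R m) (measurable_cst rho).
pose h (a : R) (v : Rm) : R := poisson a v * \1_S (a^-1 *: v).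
have mh a : measurable_fun setT (h a).
  apply: measurable_funM; first exact: measurable_poisson.
  apply: (measurableT_comp (measurable_indic mS)).
  by apply: measurable_funZ_rV; [exact: measurable_cst|exact: measurable_id].
have h0 a v : 0 < a -> 0 <= h a v.
  by move=> a0; apply: mulr_ge0; [exact/ltW/poisson_gt0|rewrite indicE].
have [[p1 p2] p3] := (pos J1, pos J2, pos J3).
have pos3 : positive3 p.2 by exact/positive_positive3.
have hS a v : 0 < a -> S (a^-1 *: v) -> enorm v < rho * a.
  move=> a0; rewrite /S /= enormZ gtr0_norm ?invr_gt0// mulrC ltr_pdivrMr//.
have conc' a : 0 < a -> ((9 / 10)%:E <= \int[lebesgue_rV m]_v (h a v)%:E)%E.
  by move=> a0; under eq_integral do rewrite EFinM; exact: conc.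
pose H (w : R3m) := h p.2.1.1 w.1.1 * h p.2.1.2 w.1.2 * h p.2.2 w.2.
apply: (@le_trans _ _ (\int[lebesgue_R3m]_w (H w)%:E)%E).
  rewrite (ge0_integral_tensor (mh _) (mh _) (mh _) (fun v => h0 _ v p1) (fun v => h0 _ v p2)
    (fun v => h0 _ v p3)).
  apply: (@le_trans _ _ ((9 / 10)%:E * (9 / 10)%:E * (9 / 10)%:E)%E).
    by rewrite -!EFinM lee_fin; lra.
  have c0 : (0 <= (9 / 10)%:E :> \bar R)%E by rewrite lee_fin; lra.
  exact: (lee_pmul (mule_ge0 c0 c0) c0 (lee_pmul c0 c0 (conc' _ p1) (conc' _ p2)) (conc' _ p3)).
have H0 w : 0 <= H w by exact: mulr_ge0 (mulr_ge0 (h0 _ _ p1) (h0 _ _ p2)) (h0 _ _ p3).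
have mH : measurable_fun setT (fun w => (H w)%:E).
  apply/measurable_EFinP; apply: measurable_funM; first apply: measurable_funM.
  - apply: (measurableT_comp (mh _)).
    exact: (measurableT_comp measurable_fst measurable_fst).
  - apply: (measurableT_comp (mh _)).
    exact: (measurableT_comp measurable_snd measurable_fst).
  - exact: (measurableT_comp (mh _) measurable_snd).
apply: ge0_le_integral => //.
- by move=> w _; rewrite lee_fin.
move=> w _; rewrite lee_fin (kprod0E _ pos) /H /h.
move: (poisson_gt0 w.1.1 p1) (poisson_gt0 w.1.2 p2) (poisson_gt0 w.2 p3) => /=.
move: (poisson _ _) (poisson _ _) (poisson _ _) => z y x x0 y0 z0.
have pos0 : 0 <= x * y * z by exact: mulr_ge0 (mulr_ge0 (ltW x0) (ltW y0)) (ltW z0).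
have [s1|s1] := pselect (S (p.2.1.1^-1 *: w.1.1)); last first.
  rewrite [X in x * X](_ : _ = 0) ?mulr0 ?mul0r; last by rewrite indicE memNset.
  by rewrite mulr_ge0// indicE.
have [s2|s2] := pselect (S (p.2.1.2^-1 *: w.1.2)); last first.
  rewrite [X in y * X](_ : _ = 0) ?mulr0 ?mul0r; last by rewrite indicE memNset.
  by rewrite mulr_ge0// indicE.
have [s3|s3] := pselect (S (p.2.2^-1 *: w.2)); last first.
  rewrite [X in z * X](_ : _ = 0) ?mulr0; last by rewrite indicE memNset.
  by rewrite mulr_ge0// indicE.
have Aw : A (p.1 + twist w).
  apply: hA; split=> //; rewrite tubeE opprD addNKr tube0N.
  exact: (tube0_of_twist rho0 hb pos3 (hS _ _ p1 s1) (hS _ _ p2 s2) (hS _ _ p3 s3)).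
by rewrite !indicE !mem_set// !mulr1.
Qed.

End nontangential_points.

(** * The area function *)

Section area_estimate.
Context {R : realType} {m : nat}.
Local Notation Rm := 'rV[R]_m.
Local Notation R2m := (Rm * Rm)%type.
Local Notation mR := (measurableTypeR R).
Local Notation mR3 := (mR * mR * mR)%type.
Local Notation P := (R2m * (R * R * R))%type.
Local Notation mP := (R2m * mR3)%type.
Local Notation kap0 := (fun _ : idx3 => @K0 m).
Local Notation third := (nabla J1 (nabla J2 (nabla J3 [:: kap0]))).

(** The area integral has density (r_1 r_2 r_3)^2 / (r_1 r_2 r_3 V) = r_1 r_2 r_3 / V. Setting it to
    zero off the cone gives one function, jointly measurable in the vertex and the point. *)
Definition cone_weight (x : R2m) (p : P) : R :=
  \1_[set q : R2m * mR3 | tube0 q.2 q.1] (p.1 - x, p.2) *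
  (volpos p.2 * (@tube_volume R m p.2)^-1).

Lemma cone_weight_ge0 x p : 0 <= cone_weight x p.
Proof.
rewrite /cone_weight indicE; apply: mulr_ge0 => //.
by apply: mulr_ge0; [exact: volpos_ge0|rewrite invr_ge0 tube_volume_ge0].
Qed.

Lemma measurable_cone_weight :
  measurable_fun setT (fun z : R2m * mP => cone_weight z.1 z.2).
Proof.
apply: measurable_funM.
  apply: (measurableT_comp (measurable_indic measurable_tube0)).
  apply: measurable_fun_pair => /=.
    apply: measurable_funB_pair; last exact: measurable_fst.
    exact: (measurableT_comp measurable_fst measurable_snd).
  exact: (measurableT_comp measurable_snd measurable_snd).
have mr : measurable_fun setT (fun z : R2m * mP => z.2.2).
  exact: (measurableT_comp measurable_snd measurable_snd).
apply: measurable_funM; first exact: (measurableT_comp measurable_volpos mr).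
have mv : measurable_fun setT (fun z : R2m * mP => @tube_volume R m z.2.2 : R).
  exact: (measurableT_comp measurable_tube_volume mr).
have -> : (fun z : R2m * mP => (@tube_volume R m z.2.2)^-1) =
    (fun z => (@tube_volume R m z.2.2) `^ (-1)).
  by apply/funext => z; rewrite powR_inv1// tube_volume_ge0.
exact: (measurableT_comp (measurable_powR _) mv).
Qed.

Lemma scale31 (r : R * R * R) : scale3 1 r = r.
Proof. by case: r => [[r1 r2] r3]; rewrite /scale3 !mul1r. Qed.

Lemma cone_weight_gt0 x p : cone_weight x p != 0 -> cone 1 x p.
Proof.
rewrite /cone_weight /volpos !mulf_eq0 !negb_or !indicE => /and3P[h1 /andP[_ h2] _].
split; last rewrite tubeE scale31.
  by apply: contrapT => h; move: h2; rewrite memNset ?eqxx.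
by apply: contrapT => h; move: h1; rewrite memNset ?eqxx.
Qed.

Lemma cone_weightE x (p : P) : cone 1 x p ->
  cone_weight x p = vol p.2 * (@tube_volume R m p.2)^-1.
Proof.
move=> [pr]; rewrite tubeE scale31 => tp.
by rewrite /cone_weight /volpos !indicE !mem_set// mul1r mulr1.
Qed.

(** The vertices that see a given point fill a set of measure V, which cancels 1/V. *)
Lemma integral_cone_weight_le (p : P) :
  (\int[lebesgue_R2m]_x (cone_weight x p)%:E <= (volpos p.2)%:E)%E.
Proof.
pose S := [set x | tube0 p.2 (p.1 - x)].
have mS : measurable S.
  apply: open_measurable_R2m.
  apply: (@open_comp _ _ (fun x : R2m => p.1 - x) (tube0 p.2)); last exact: open_tube0.
  by move=> x _; apply: cvgB; [exact: cvg_cst|exact: cvg_id].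
have c0 : 0 <= volpos p.2 * (@tube_volume R m p.2)^-1.
  by apply: mulr_ge0; [exact: volpos_ge0|rewrite invr_ge0 tube_volume_ge0].
have m1 : measurable_fun setT (fun x : R2m => (\1_S x : R)%:E).
  by apply/measurable_EFinP; exact: measurable_indic.
have -> : (\int[lebesgue_R2m]_x (cone_weight x p)%:E =
    \int[lebesgue_R2m]_x ((volpos p.2 * (@tube_volume R m p.2)^-1)%:E * (\1_S x)%:E))%E.
  by apply: eq_integral => x _; rewrite -EFinM mulrC.
rewrite (ge0_integralZl_EFin _ _ _ m1 c0)//.
rewrite integral_indic// setIT EFinM -muleA -[leRHS]mule1.
by apply: lee_wpmul2l; [rewrite lee_fin volpos_ge0|exact: tube_volumeV_le1].
Qed.

Definition cone_integral (F : P -> R) (x : R2m) : \bar R :=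
  (\int[lebesgue_R2m3]_p (cone_weight x p * F p)%:E)%E.

Section cone_integral_facts.
Variable F : P -> R.
Hypothesis gF : good F.

Let mF : measurable_fun setT (fun z : R2m * mP => (cone_weight z.1 z.2 * F z.2)%:E).
Proof.
apply/measurable_EFinP; apply: measurable_funM; first exact: measurable_cone_weight.
exact: (measurableT_comp gF.1 measurable_snd).
Qed.

Let F0 (z : R2m * mP) : (0 <= (cone_weight z.1 z.2 * F z.2)%:E)%E.
Proof. by rewrite lee_fin; exact: mulr_ge0 (cone_weight_ge0 _ _) (gF.2 _). Qed.

Lemma cone_integral_ge0 x : (0 <= cone_integral F x)%E.
Proof. by apply: integral_ge0 => p _; exact: (F0 (x, p)). Qed.

Lemma measurable_cone_integral : measurable_fun setT (cone_integral F).
Proof. exact: (@measurable_fun_fubini_tonelli_F _ _ _ _ _ lebesgue_R2m3 _ mF F0). Qed.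

Lemma measurable_cone_integrand x :
  measurable_fun setT (fun p : mP => (cone_weight x p * F p)%:E).
Proof. exact: (measurableT_comp mF (pair1_measurable x)). Qed.

(** Tonelli: integrating over the vertices first removes the cones and leaves the energy with weight
    r_1 r_2 r_3. *)
Lemma integral_cone_integral_le :
  (\int[lebesgue_R2m]_x cone_integral F x <= \int[lebesgue_R2m3]_p (volpos p.2 * F p)%:E)%E.
Proof.
have := @fubini_tonelli _ _ _ _ _ lebesgue_R2m lebesgue_R2m3 _ mF F0.
rewrite /fubini_F /fubini_G /= => E.
have -> : (\int[lebesgue_R2m]_x cone_integral F x = \int[lebesgue_R2m3]_y
    \int[lebesgue_R2m]_x (cone_weight x y * F y)%:E)%E by exact: E.
have mG := @measurable_fun_fubini_tonelli_G _ _ _ _ _ lebesgue_R2m _ mF F0.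
apply: ge0_le_integral; first exact: measurableT.
- by move=> p _; apply: integral_ge0 => x _; exact: (F0 (x, p)).
- exact: mG.
- apply/measurable_EFinP; apply: measurable_funM gF.1.
  exact: (measurableT_comp measurable_volpos measurable_snd).
move=> p _.
have mw : measurable_fun setT (fun x : R2m => (cone_weight x p)%:E).
  apply/measurable_EFinP.
  exact: (measurableT_comp measurable_cone_weight (pair2_measurable p)).
have -> : (\int[lebesgue_R2m]_x (cone_weight x p * F p)%:E =
    \int[lebesgue_R2m]_x ((F p)%:E * (cone_weight x p)%:E))%E.
  by apply: eq_integral => x _; rewrite -EFinM mulrC.
have w0 x : [set: R2m] x -> (0 <= (cone_weight x p)%:E)%E by move=> _; rewrite lee_fin
  cone_weight_ge0.
rewrite (ge0_integralZl_EFin _ measurableT w0 mw (gF.2 p)).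
rewrite mulrC EFinM; apply: lee_wpmul2l; first by rewrite lee_fin gF.2.
exact: integral_cone_weight_le.
Qed.

End cone_integral_facts.

Variables (f : R2m -> R[i]) (M : R).
Local Notation fr := (fun y => complex.Re (f y)).
Local Notation fi := (fun y => complex.Im (f y)).
Hypotheses (mfr : measurable_fun setT fr) (mfi : measurable_fun setT fi).
Hypotheses (frM : forall y, `|fr y| <= M) (fiM : forall y, `|fi y| <= M).

Definition third_sqnorm (p : P) : R := nsq fr third p + nsq fi third p.

Lemma good_third : good third_sqnorm.
Proof. by apply: good_add; [exact: good_nsq mfr frM _|exact: good_nsq mfi fiM _]. Qed.

Lemma area_cone_integral x : (\int[lebesgue_R2m3]_(p in cone 1 x) (area_integrand f p)%:E)%E =
  cone_integral third_sqnorm x.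
Proof.
rewrite integral_mkcond; apply: eq_integral => p _; rewrite /patch.
case: (boolP (p \in cone 1 x)) => [|h]; last first.
  have [->|/cone_weight_gt0 h'] := eqVneq (cone_weight x p) 0; first by rewrite mul0r.
  by rewrite mem_set in h.
rewrite inE => h; rewrite (cone_weightE h); case: h => pr _.
have pos : positive p by exact/positive_positive3.
rewrite /area_integrand (nabla123_sqnormE mfr mfi frM fiM pos).
rewrite -/(third_sqnorm p) /vol; move: (third_sqnorm p) => N.
case: p pr {pos} => [y [[r1 r2] r3]] /= [p1 p2 p3]; rewrite invfM.
move: (tube_volume _)^-1 => V; congr EFin; field.
by rewrite !gt_eqF.
Qed.

Lemma twisted_area_gt x (lam : R) : 0 < lam -> (lam%:E < twisted_area f x)%E ->
  ((lam ^+ 2)%:E < cone_integral third_sqnorm x)%E.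
Proof.
move=> l0; rewrite /twisted_area area_cone_integral => h; rewrite ltNge; apply/negP => h'.
have J0 := cone_integral_ge0 good_third x.
have : (cone_integral third_sqnorm x `^ 2^-1 <= (lam ^+ 2)%:E `^ 2^-1)%E.
  apply: gt0_ler_poweR => //; first by rewrite in_itv /= J0 leey.
  by rewrite in_itv /= leey lee_fin sqr_ge0.
rewrite poweR_EFin powR12_sqrt ?sqr_ge0// sqrtr_sqr gtr0_norm//.
by rewrite leNgt h.
Qed.

Variables (A A' : set R2m).
Hypotheses (mA : measurable A).
Hypothesis A'le : forall x, ~ A' x -> forall y r, positive3 r -> tube x r y ->
  ext kap0 (\1_A : R2m -> R) (y, r) <= 4^-1.
Local Notation cut := (cutoff (\1_A : R2m -> R) 7).

Lemma good_third_cut : good (fun p => third_sqnorm p * cut p).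
Proof.
apply: good_mul; first exact: good_third.
exact: (good_cutoff (measurable_indicR mA) (@indic_norm_le1 R m A)).
Qed.

(** On the cone v <= 1/4, so 1/2 - v >= 1/4 and 4^7 times the seventh power is at least 1. *)
Lemma cone_integral_cut x : ~ A' x ->
  (cone_integral third_sqnorm x <=
   (4 ^+ 7)%:E * cone_integral (fun p => (third_sqnorm p * cut p)%R) x)%E.
Proof.
move=> nx; have g4 : 0 <= 4 ^+ 7 :> R by rewrite exprn_ge0.
have mc := measurable_cone_integrand good_third_cut x.
have c0 p : [set: mP] p -> (0 <= (cone_weight x p * (third_sqnorm p * cut p))%:E)%E.
  by move=> _; rewrite lee_fin; exact: mulr_ge0 (cone_weight_ge0 _ _) (good_third_cut.2 _).
rewrite -(ge0_integralZl_EFin _ measurableT c0 mc g4).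
apply: ge0_le_integral; first exact: measurableT.
- by move=> p _; rewrite lee_fin; exact: mulr_ge0 (cone_weight_ge0 _ _) (good_third.2 _).
- exact: measurable_cone_integrand good_third x.
- exact: measurable_funeM.
move=> p _; rewrite -EFinM lee_fin.
have N0 := good_third.2 p; move: N0; move: (third_sqnorm p) => N N0.
have w0 := cone_weight_ge0 x p.
have [->|/cone_weight_gt0[pr tp]] := eqVneq (cone_weight x p) 0; first by rewrite !mul0r mulr0.
have := A'le nx pr; rewrite scale31 in tp => /(_ _ tp); rewrite -surjective_pairing => v4.
have cut4 : 1 <= 4 ^+ 7 * cut p.
  rewrite /cutoff -exprMn; apply: exprn_ege1; rewrite /ramp.
  have : 4^-1 <= Num.max 0 (2^-1 - ext kap0 (\1_A : R2m -> R) p).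
    by rewrite le_max; apply/orP; right; lra.
  by move: (Num.max _ _) => t; lra.
move: cut4; move: (cut p) (cone_weight x p) w0 => c w w0 c1.
have -> : 4 ^+ 7 * (w * (N * c)) = w * N * (4 ^+ 7 * c) by ring.
by rewrite -[leLHS]mulr1; apply: ler_wpM2l => //; exact: mulr_ge0.
Qed.

(** Off A', a large area function forces a large cut-off cone integral, and Chebyshev's inequality
    bounds the measure of that set. *)
Lemma area_level_le (lam : R) (E : \bar R) : 0 < lam -> measurable A' ->
  (\int[lebesgue_R2m3]_p (volpos p.2 * (third_sqnorm p * cut p))%:E <= E)%E ->
  (lebesgue_R2m [set x | lam%:E < twisted_area f x] <=
   lebesgue_R2m A' + (4 ^+ 7 / lam ^+ 2)%:E * E)%E.
Proof.
move=> l0 mA' hE.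
pose J x := ((4 ^+ 7)%:E * cone_integral (fun p => (third_sqnorm p * cut p)%R) x)%E.
have g4 : 0 <= 4 ^+ 7 :> R by rewrite exprn_ge0.
have l2 : 0 < lam ^+ 2 by rewrite exprn_gt0.
have mci := measurable_cone_integral good_third_cut.
have mJ : measurable_fun setT J by exact: measurable_funeM.
have J0 x : (0 <= J x)%E.
  by apply: mule_ge0; [rewrite lee_fin|exact: cone_integral_ge0 good_third_cut x].
pose B := [set x | ((lam ^+ 2)%:E < J x)%E].
have mlt (g : R2m -> \bar R) (c : \bar R) : measurable_fun setT g ->
    measurable [set x | (c < g x)%E].
  by move=> mg; rewrite -[X in measurable X]setTI; exact: emeasurable_fun_o_infty.
have mS : measurable [set x | (lam%:E < twisted_area f x)%E].
  apply: (mlt (twisted_area f)); rewrite /twisted_area.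
  under eq_fun do rewrite area_cone_integral.
  exact: (measurableT_comp (measurable_poweR _) (measurable_cone_integral good_third)).
have mB : measurable B by exact: mlt.
apply: (@le_trans _ _ (lebesgue_R2m (A' `|` B))).
  apply: le_measure; rewrite ?inE//; first exact: measurableU.
  move=> x /= /(twisted_area_gt l0) h; have [Ax|nx] := pselect (A' x); first by left.
  by right; apply: lt_le_trans h _; exact: cone_integral_cut.
apply: le_trans (measureU2 _ mA' mB) _; apply: leeD => //.
have : ((lam ^+ 2)%:E * lebesgue_R2m B <= (4 ^+ 7)%:E * E)%E.
  rewrite -integral_cst//; apply: (@le_trans _ _ (\int[lebesgue_R2m]_x J x)%E).
    apply: (@le_trans _ _ (\int[lebesgue_R2m]_(x in B) J x)%E).
      apply: ge0_le_integral => //; first by move=> x _; rewrite lee_fin ltW.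
      - exact: measurable_funTS.
      - by move=> x /ltW.
    exact: ge0_subset_integral.
  have c0 x : [set: R2m] x -> (0 <= cone_integral (fun p => (third_sqnorm p * cut p)%R) x)%E.
    by move=> _; exact: cone_integral_ge0 good_third_cut x.
  rewrite (ge0_integralZl_EFin _ measurableT c0 mci g4).
  apply: lee_wpmul2l => //.
  exact: le_trans (integral_cone_integral_le good_third_cut) hE.
have l2n : lam ^+ 2 != 0 by rewrite gt_eqF.
have i0 : (0 <= ((lam ^+ 2)^-1)%:E)%E by rewrite lee_fin invr_ge0 ltW.
have -> : 4 ^+ 7 / lam ^+ 2 = (lam ^+ 2)^-1 * 4 ^+ 7 :> R by rewrite mulrC.
move=> h; apply: (@le_trans _ _ (((lam ^+ 2)^-1)%:E * ((lam ^+ 2)%:E * lebesgue_R2m B))%E).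
  by rewrite muleA -EFinM (mulVf l2n) mul1e.
by rewrite [in leRHS]EFinM -muleA; exact: lee_wpmul2l.
Qed.

End area_estimate.

(** * The energy bound at a fixed level of the maximal function *)

Section good_lambda.
Context {R : realType} {m : nat}.
Local Notation Rm := 'rV[R]_m.
Local Notation R2m := (Rm * Rm)%type.
Local Notation P := (R2m * (R * R * R))%type.
Local Notation kap0 := (fun _ : idx3 => @K0 m).
Local Notation third := (nabla J1 (nabla J2 (nabla J3 [:: kap0]))).

Lemma smooth_compact_support_bounds (f : R2m -> R[i]) : smooth_compact_support f ->
  exists M : R, (measurable_fun setT (fun y => complex.Re (f y)) /\
    measurable_fun setT (fun y => complex.Im (f y))) /\
    [/\ (forall y, `|complex.Re (f y)| <= M), (forall y, `|complex.Im (f y)| <= M),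
    (\int[lebesgue_R2m]_y `|complex.Re (f y)|%:E < +oo)%E &
    (\int[lebesgue_R2m]_y `|complex.Im (f y)|%:E < +oo)%E].
Proof.
move=> [sr si cK].
have f0 y : ~ closure [set x | f x != 0] y -> f y = 0.
  by move=> ny; apply/eqP; apply: contrapT => /negP fy; apply: ny; exact: subset_closure.
have cr : continuous (fun y => complex.Re (f y)) := sr 0%N.
have ci : continuous (fun y => complex.Im (f y)) := si 0%N.
have r0 y : ~ closure [set x | f x != 0] y -> complex.Re (f y) = 0 by move=> /f0 ->.
have i0 y : ~ closure [set x | f x != 0] y -> complex.Im (f y) = 0 by move=> /f0 ->.
have [M1 h1 h1'] := compact_support_bounds cr cK r0.
have [M2 h2 h2'] := compact_support_bounds ci cK i0.
exists (Num.max M1 M2); split; first by split; exact: continuous_measurable_R2m.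
split=> //.
  by move=> y; rewrite le_max h1.
by move=> y; rewrite le_max h2 orbT.
Qed.

Variables (rho beta lam : R) (f : R2m -> R[i]) (M : R).
Hypotheses (rho0 : 0 < rho) (hb : 2 * rho <= beta) (lam0 : 0 < lam).
Hypothesis conc : forall a : R, 0 < a -> ((9 / 10)%:E <= \int[lebesgue_rV m]_v
  ((poisson a v)%:E * (\1_[set w | (enorm w < rho)%R] (a^-1 *: v))%:E))%E.

Local Notation U := (twisted_extension f).
Local Notation Us := (twisted_maximal beta f).
Local Notation A := [set x | (lam%:E < Us x)%E].
Local Notation E := [set x | (Us x <= lam%:E)%E].
Local Notation v := (ext kap0 (\1_A : R2m -> R)).

Let mA : measurable A.
Proof. exact: open_measurable_R2m (@open_maximal R m beta f lam%:E). Qed.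

Let b0 : 0 < beta.
Proof. by apply: lt_le_trans hb; rewrite mulr_gt0. Qed.

Lemma level_setC : E = ~` A.
Proof. by apply/seteqP; split=> x /=; rewrite leNgt => /negP. Qed.

(** If |U_f| > lambda at p, every vertex whose cone contains p belongs to A, and then v is at least
    1/2 at p. *)
Lemma extension_le_level (p : P) : positive p -> v p < 2^-1 -> Normc.normc (U p) <= lam.
Proof.
move=> pos v2; rewrite leNgt; apply/negP => h.
suff : 2^-1 <= v p by rewrite leNgt v2.
apply: (ext_indic_tube rho0 hb conc mA pos) => x cx /=.
apply: (@lt_le_trans _ _ (Normc.normc (U p))%:E); first by rewrite lte_fin.
by apply: ereal_sup_ubound; exists p.
Qed.

Lemma extension_le_maximal (y : R2m) r : positive3 r ->
  ((Normc.normc (U (y, r)))%:E <= Us y)%E.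
Proof. by move=> pr; apply: ereal_sup_ubound; exists (y, r) => //; exact: cone_self. Qed.

Variables (LA Q1 : R).
Hypothesis hA : lebesgue_R2m A = LA%:E.
Hypothesis hQ : (\int[lebesgue_R2m]_(x in E) (Us x) ^+ 2)%E = Q1%:E.

Let LA0 : 0 <= LA. Proof. by rewrite -lee_fin -hA measure_ge0. Qed.

Let sqe_ge0 (x : \bar R) : (0 <= x ^+ 2)%E.
Proof. by rewrite expe2 sqre_ge0. Qed.

Let Q10 : 0 <= Q1.
Proof. by rewrite -lee_fin -hQ; apply: integral_ge0 => x _. Qed.

Section component.
Variable u : R2m -> R.
Hypotheses (mu : measurable_fun setT u) (uM : forall y, `|u y| <= M)
  (u1 : (\int[lebesgue_R2m]_y `|u y|%:E < +oo)%E)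
  (uU : forall p, positive p -> `|ext kap0 u p| <= Normc.normc (U p)).

(** On A the cut-off is nonzero only where |u| <= lambda; off A the vertical point (y, r) lies in
    the cone of y, so |u| is at most the maximal function. *)
Lemma slice_cutoff_le (r : R * R * R) : (forall j, 0 < radius r j) ->
  (slice (fun p => nsq u [:: kap0] p * cutoff (\1_A : R2m -> R) 1 p)%R r <=
   (lam ^+ 2 * LA + Q1)%:E)%E.
Proof.
move=> r0; have pos y : positive ((y, r) : P) by [].
have pr : positive3 r by exact/(positive_positive3 ((0, r) : P)).
pose F (p : P) := nsq u [:: kap0] p * cutoff (\1_A : R2m -> R) 1 p.
have [mF F0] : good F.
  by apply: good_mul; [exact: good_nsq mu uM _|exact: good_cutoff (measurable_indicR mA)
    (@indic_norm_le1 R m A) _].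
have mFr : measurable_fun setT (fun y : R2m => (F (y, r))%:E).
  by apply/measurable_EFinP; apply: (measurableT_comp mF); exact: pair2_measurable.
have mFU : measurable_fun (A `|` ~` A) (fun y : R2m => (F (y, r))%:E) by rewrite setUv.
have FU0 y : (A `|` ~` A) y -> (0 <= (F (y, r))%:E)%E by move=> _; rewrite lee_fin.
have dj : [disjoint A & ~` A]%classic by apply/disj_setPS; rewrite setICr.
have -> : slice F r = (\int[lebesgue_R2m]_(y in A) (F (y, r))%:E +
    \int[lebesgue_R2m]_(y in ~` A) (F (y, r))%:E)%E.
  by rewrite -(ge0_integral_setU lebesgue_R2m mA (measurableC mA) mFU FU0 dj) setUv.
rewrite EFinD EFinM -hA -hQ level_setC; apply: leeD.
  rewrite -integral_cst//; apply: ge0_le_integral => //.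
  - by move=> y _; rewrite lee_fin.
  - exact: measurable_funTS.
  move=> y _; rewrite lee_fin /F nsq_s0.
  have c0 := @cutoff_ge0 R m (\1_A) 1 (y, r).
  have [c00|cn0] := eqVneq (cutoff (\1_A : R2m -> R) 1 (y, r)) 0.
    by rewrite c00 mulr0 sqr_ge0.
  have v2 : v (y, r) < 2^-1 by apply: (@cutoff_gt0 R m A 0); rewrite lt_neqAle eq_sym cn0.
  have c1 := cutoff_le1 A 1 (pos y).
  have h : ext kap0 u (y, r) ^+ 2 <= lam ^+ 2.
    rewrite -real_normK ?num_real// ler_sqr ?nnegrE ?(ltW lam0)//.
    exact: le_trans (uU (pos y)) (extension_le_level (pos y) v2).
  by rewrite -[leRHS]mulr1; apply: ler_pM => //; exact: sqr_ge0.
have mUs : measurable_fun setT Us := @measurable_maximal R m beta f.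
apply: ge0_le_integral => //.
- exact: measurableC.
- by move=> y _; rewrite lee_fin.
- exact: measurable_funTS.
- apply: measurable_funTS; under eq_fun do rewrite expe2.
  exact: emeasurable_funM.
move=> y _; have c1 := cutoff_le1 A 1 (pos y).
have hU := extension_le_maximal y pr; have hu := uU (pos y).
have N0 : (0 <= (`|ext kap0 u (y, r)|)%:E)%E by rewrite lee_fin.
have hUs : ((`|ext kap0 u (y, r)|)%:E <= Us y)%E by apply: le_trans hU; rewrite lee_fin.
apply: (@le_trans _ _ ((`|ext kap0 u (y, r)|)%:E * (`|ext kap0 u (y, r)|)%:E)%E); last first.
  by rewrite expe2; exact: lee_pmul.
rewrite -EFinM lee_fin /F nsq_s0 -expr2 real_normK ?num_real//.
by rewrite -[leRHS]mulr1; apply: ler_wpM2l => //; exact: sqr_ge0.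
Qed.

Lemma component_energy :
  (\int[lebesgue_R2m3]_p (volpos p.2 * (nsq u third p * cutoff (\1_A : R2m -> R) 7 p))%:E <=
   (64 * c_energy3 * (2 * lam ^+ 2 * LA + Q1))%:E)%E.
Proof.
have Q0 : 0 <= lam ^+ 2 * LA + Q1 by apply: addr_ge0 => //; exact: mulr_ge0 (sqr_ge0 _) LA0.
have ulam p : positive p -> v p < 2^-1 -> `|ext kap0 u p| <= lam.
  by move=> pos v2; apply: le_trans (uU pos) (extension_le_level pos v2).
have gF : good (fun p => nsq u third p * cutoff (\1_A : R2m -> R) 7 p).
  by apply: good_mul; [exact: good_nsq mu uM _|exact: good_cutoff (measurable_indicR mA)
    (@indic_norm_le1 R m A) _].
have -> : (64 * c_energy3 * (2 * lam ^+ 2 * LA + Q1))%:E =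
    (64%:E * (c_energy3 * ((lam ^+ 2 * LA + Q1) + lam ^+ 2 * LA))%:E)%E :> \bar R.
  (* The bound on slices already contains lambda^2 |A|, and the chain adds another copy: hence 2
     lambda^2 |A|. *)
  by rewrite -EFinM; congr EFin; ring.
apply: (energy_limit gF) => a b a0 ab.
have [_ h] := cutoff_energy3 a0 ab mA hA mu uM u1 Q0 ulam slice_cutoff_le.
by apply: (h (fun=> a)) => j; rewrite lexx ltW.
Qed.

End component.

Hypotheses (mfr : measurable_fun setT (fun y => complex.Re (f y)))
  (mfi : measurable_fun setT (fun y => complex.Im (f y)))
  (frM : forall y, `|complex.Re (f y)| <= M) (fiM : forall y, `|complex.Im (f y)| <= M)
  (fr1 : (\int[lebesgue_R2m]_y `|complex.Re (f y)|%:E < +oo)%E)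
  (fi1 : (\int[lebesgue_R2m]_y `|complex.Im (f y)|%:E < +oo)%E).

(** The real and imaginary parts are real extensions, each dominated by |U_f|; their two energies
    add up, 128 = 64 + 64. *)
Lemma total_energy :
  (\int[lebesgue_R2m3]_p (volpos p.2 * (third_sqnorm f p * cutoff (\1_A : R2m -> R) 7 p))%:E <=
   (128 * c_energy3 * (2 * lam ^+ 2 * LA + Q1))%:E)%E.
Proof.
have hr p : positive p -> `|ext kap0 (fun y => complex.Re (f y)) p| <= Normc.normc (U p).
  move=> pos; rewrite (twisted_extensionE mfr mfi frM fiM pos) /= -sqrtr_sqr.
  by rewrite ler_sqrt ?addr_ge0 ?sqr_ge0// lerDl sqr_ge0.
have hi p : positive p -> `|ext kap0 (fun y => complex.Im (f y)) p| <= Normc.normc (U p).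
  move=> pos; rewrite (twisted_extensionE mfr mfi frM fiM pos) /= -sqrtr_sqr.
  by rewrite ler_sqrt ?addr_ge0 ?sqr_ge0// lerDr sqr_ge0.
have er := component_energy mfr frM fr1 hr; have ei := component_energy mfi fiM fi1 hi.
have mv := measurable_volpos (R := R).
have mterm (u : R2m -> R) : measurable_fun setT u -> (forall y, `|u y| <= M) -> good (fun p =>
    volpos p.2 * (nsq u third p * cutoff (\1_A : R2m -> R) 7 p)).
  move=> mu uM; apply: good_mul; last first.
    by apply: good_mul; [exact: good_nsq mu uM _|exact: good_cutoff (measurable_indicR mA)
      (@indic_norm_le1 R m A) _].
  by split=> [|p]; [exact: (measurableT_comp mv measurable_snd)|exact: volpos_ge0].
have [mr r0] := mterm _ mfr frM; have [mi i0] := mterm _ mfi fiM.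
have -> : (128 * c_energy3 * (2 * lam ^+ 2 * LA + Q1))%:E =
   ((64 * c_energy3 * (2 * lam ^+ 2 * LA + Q1))%:E + (64 * c_energy3 * (2 * lam ^+ 2 * LA +
     Q1))%:E)%E :> \bar R.
  by rewrite -EFinD; congr EFin; ring.
apply: le_trans (leeD er ei); rewrite -ge0_integralD//.
- apply: ge0_le_integral => //.
  + move=> p _; rewrite lee_fin /third_sqnorm mulrDl mulrDr.
    by apply: addr_ge0; [exact: r0|exact: i0].
  + apply/measurable_EFinP; rewrite /third_sqnorm; under eq_fun do rewrite mulrDl mulrDr.
    exact: measurable_funD.
  + by apply: emeasurable_funD; exact/measurable_EFinP.
  by move=> p _; rewrite -EFinD lee_fin /third_sqnorm mulrDl mulrDr.
- by move=> p _; rewrite lee_fin.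
- exact/measurable_EFinP.
- by move=> p _; rewrite lee_fin.
- exact/measurable_EFinP.
Qed.

End good_lambda.

Theorem theorem1p4 (R : realType) (m : nat) (m_ge1 : (1 <= m)%N) :
  exists C beta : R, [/\ 0 < C, 1 < beta &
    forall f : 'rV[R]_m * 'rV[R]_m -> R[i], smooth_compact_support f ->
    forall lambda : R, 0 < lambda ->
    (lebesgue_R2m [set x | lambda%:E < twisted_area f x] <=
      C%:E * lebesgue_R2m [set x | lambda%:E < twisted_maximal beta f x] +
      (C / lambda ^+ 2)%:E *
        \int[lebesgue_R2m]_(x in [set x | twisted_maximal beta f x <= lambda%:E])
          (twisted_maximal beta f x) ^+ 2)%E].
Proof.
have [rho rho0 conc] := @poisson_concentration R m.
have [C0 C00 hC0] := @exceptional_set R m.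
pose kappa : R := 4 ^+ 7 * (128 * c_energy3).
have cU30 : 0 < c_energy3 :> R.
  rewrite /c_energy3 /c_remainder3 /c_triple_product /c_product3 /c_energy2 /c_product2 /c_energy1
    /c_indic_triple /c_indic_product3 /c_indic_product2; lra.
have k0 : 0 < kappa by rewrite !mulr_gt0// exprn_gt0.
(* [C0] pays for A', 2 [kappa] for the multiple of lambda^2 |A| in the energy, and [kappa] for the
   integral off A. *)
pose C : R := C0 + 2 * kappa; have Cgt : 0 < C by rewrite /C; lra.
(* The aperture must be at least 2 [rho]; adding 2 also makes it exceed 1. *)
exists C, (2 * rho + 2); split; [by []|lra|move=> f sf lam lam0].
have [M [[mfr mfi] [frM fiM fr1 fi1]]] := smooth_compact_support_bounds sf.
set A := [set x | (lam%:E < twisted_maximal (2 * rho + 2)%R f x)%E].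
set E := [set x | (twisted_maximal (2 * rho + 2)%R f x <= lam%:E)%E].
have mA : measurable A := open_measurable_R2m (@open_maximal R m (2 * rho + 2) f lam%:E).
have l2 : 0 < lam ^+ 2 by rewrite exprn_gt0.
have Cl0 : 0 < C / lam ^+ 2 by rewrite divr_gt0.
have Q0 : (0 <= \int[lebesgue_R2m]_(x in E) (twisted_maximal (2 * rho + 2)%R f x) ^+ 2)%E.
  by apply: integral_ge0 => x _; rewrite expe2 sqre_ge0.
have A0 : (0 <= lebesgue_R2m A)%E by exact: measure_ge0.
(* If |A| or the integral off A is infinite, so is the right-hand side, its coefficients being
   positive; otherwise both are real numbers. *)
case EA : (lebesgue_R2m A) => [LA||]; last 2 first.
- rewrite gt0_muley ?lte_fin// addye ?leey//.
  rewrite -ltNye; apply: (@lt_le_trans _ _ 0%E); first exact: ltNyr.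
  by apply: mule_ge0 => //; rewrite lee_fin ltW.
- by move: A0; rewrite EA.
case EQ : (integral lebesgue_R2m E _) => [Q1||]; last 2 first.
- by rewrite gt0_muley ?lte_fin// addey ?leey.
- by move: Q0; rewrite EQ.
have [A' [mA' lA' hA']] := hC0 A mA.
have hb : 2 * rho <= 2 * rho + 2 by lra.
have en := total_energy rho0 hb lam0 conc EA EQ mfr mfi frM fiM fr1 fi1.
apply: le_trans (area_level_le mfr mfi frM fiM mA hA' lam0 mA' en) _.
apply: le_trans (leeD lA' (lexx _)) _; rewrite EA -!EFinM -!EFinD lee_fin.
have LA0 : 0 <= LA by rewrite -lee_fin -EA.
have Q10 : 0 <= Q1 by rewrite -lee_fin -EQ.
have -> : 4 ^+ 7 / lam ^+ 2 * (128 * c_energy3 * (2 * lam ^+ 2 * LA + Q1)) =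
    2 * kappa * LA + kappa / lam ^+ 2 * Q1.
  by rewrite /kappa; move: c_energy3 => c; field; rewrite gt_eqF.
rewrite addrA -mulrDl lerD2l; apply: ler_wpM2r => //.
by rewrite ler_pM2r ?invr_gt0// /C; lra.
Qed.
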